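(* Let $n \geq 1$, let $T \in \mathscr D_n(\mathbb R^n)$ be a metric current (or a flat chain in the sense of Whitney) and let $d \in \,]n-1,n[$. Consider the following statements: (1) $T \in \mathbf F_{n,d}(\mathbb R^n)$. (2) $T$ has a continuous extension to a Hölder current $\mathrm{Lip}^{\alpha_1}(\mathbb R^n) \times \dots \times \mathrm{Lip}^{\alpha_{n+1}}(\mathbb R^n) \to \mathbb R$ whenever $\alpha_1,\dots,\alpha_{n+1}\in\,]0,1]$ satisfy $\alpha_1 + \dots + \alpha_{n+1} > n$ and $\alpha_2 + \dots + \alpha_{n+1} \geq d$. (3) $\partial T$ has continuous extensions to Hölder currents $\mathrm{Lip}^\alpha(\mathbb R^n)^n \to \mathbb R$ for some $\alpha < 1$, and $\mathrm{Lip}^{d - (n-1)}(\mathbb R^n) \times \mathrm{Lip}(\mathbb R^n)^{n-1} \to \mathbb R$. (4) $T = [\![u]\!]$ for some $u \in \mathrm{BV}^{d - (n - 1)}_c(\mathbb R^n)$. (5) $T = [\![u]\!]$ for some $u \in L_c^1(\mathbb R^n)$ and there is a constant $C > 0$ and a sequence $(u_k)_{k \geq 0}$ in $\mathrm{BV}_c(\mathbb R^n)$ such that: (a) $\sum_{k\geq 0} u_k = u$ in $L^1$ and $\bigcup_k \operatorname{spt}(u_k)$ is bounded; (b) $\|u_k\|_{L^1} \leq C 2^{k(d-n)}$ and $\mathbf V(u_k) \leq C 2^{k(d - (n-1))}$ for all $k$. Then $(1) \Rightarrow (2) \Rightarrow (3) \Rightarrow (4) \Rightarrow (5)$, and $(5)$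 implies that $T \in \bigcap_{d < \delta < n}\mathbf F_{n,\delta}(\mathbb R^n)$. In particular, $\bigcap_{d < \delta < n}\mathrm{BV}^{\delta - (n - 1)}_c(\mathbb R^n) = \bigcap_{d < \delta < n}\mathbf F_{n,\delta}(\mathbb R^n)$ (under the identification of $u$ with $[\![u]\!]$).
   Context: For $\alpha\in[0,1]$, $\mathrm{Lip}^\alpha(g)=\sup_{x\ne y}|g(x)-g(y)|/|x-y|^\alpha$; $\mathrm{Lip}^\alpha(\mathbb R^n)$ is the set of real functions for which this is finite; $\mathrm{Lip}=\mathrm{Lip}^1$. $L^1_c(\mathbb R^n)$: integrable functions with (essentially) compact support. BV. For $u\in L^1_c(\mathbb R^n)$, $\mathbf V^\alpha(u)$ is the smallest $C\in[0,\infty]$ with $\bigl|\int u\det D(f,g^1,\dots,g^{n-1})\,dx\bigr|\le C\,\mathrm{Lip}^\alpha(f)\,\mathrm{Lip}(g^1)\cdots\mathrm{Lip}(g^{n-1})$ for all $f,g^i\in\mathrm{Lip}(\mathbb R^n)$; $\mathrm{BV}^\alpha_c(\mathbb R^n)=\{u\in L^1_c:\mathbf V^\alpha(u)<\infty\}$. $\mathbf V(u)=\sup\{\int u\operatorname{div}\varphi:\varphi\in C_c^1(\mathbb R^n,\mathbb R^n),\|\varphi\|_\infty\le1\}$, $\mathrm{BV}_c(\mathbb R^n)=\{u\in L^1_c:\mathbf V(u)<\infty\}$. Metric currents (with compact support). For a metric space $X$ and $m\ge0$, $\mathscr D_m(X)$ is the space of multilinear maps $T:\mathrm{Lip}(X)^{m+1}\to\mathbb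 R$ such that (i) $T(f,g^1,\dots,g^m)=0$ whenever some $g^i$ is constant in a neighbourhood of $\operatorname{spt}(f)$; (ii) there is a compact $K\subset X$ with $T(f,g)=0$ whenever $\operatorname{spt}(f)\cap K=\emptyset$; (iii) $T(f_k,g_k)\to T(f,g)$ whenever $f_k\to f$, $g^i_k\to g^i$ uniformly with $\sup_{i,k}\{\mathrm{Lip}(f_k),\mathrm{Lip}(g_k^i)\}<\infty$. $\operatorname{spt}(T)$ is the smallest closed set $A$ such that $T(f,g)=0$ whenever $\operatorname{spt}(f)\cap A=\emptyset$. $\partial T(f,g^1,\dots,g^{m-1})=T(1,f,g^1,\dots,g^{m-1})$. $\mathbf M(T)$ is the supremum of $\sum_{\lambda}T(f_\lambda,g^1_\lambda,\dots,g_\lambda^m)$ over finite families with $\sum_\lambda|f_\lambda|\le1$, $\mathrm{Lip}(g^i_\lambda)\le1$. $\mathbf N_m(X)$: those $T$ with $\mathbf M(T)+\mathbf M(\partial T)<\infty$. Weak convergence: supports in one compact set and pointwise convergence. For $u\in L^1_c(\mathbb R^n)$, $[\![u]\!](f,g^1,\dots,g^n)=\int uf\det D(g^1,\dots,g^n)\,dx$ is an element of $\mathscr D_n(\mathbb R^n)$. Hölder currents are multilinear maps $\mathrm{Lip}^{\alpha_1}(X)\times\dots\times\mathrm{Lip}^{\alpha_{m+1}}(X)\to\mathbb R$ satisfying (i)–(iii) with $\mathrm{Lip}$ replaced by $\mathrm{Lip}^{\alpha_i}$ in the $i$th slot; since everything depends only on restrictions to a compact set $K$ containing the support, and $\mathrm{Lip}(K)\subset\mathrm{Lip}^\alpha(K)$,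 ''extension'' is understood after restriction to such a $K$. Fractal currents. For $\gamma\in[m,m+1[$, $\delta\in[m-1,m[$, $T\in\mathscr D_m(X)$ is in $\mathbf F_{\gamma,\delta}(X)$ if there are a compact $K\subset X$, sequences $(R_k)_{k\ge0}$ in $\mathbf N_m(X)$, $(S_k)_{k\ge0}$ in $\mathbf N_{m+1}(X)$ with supports in $K$, and $\sigma,\rho>1$ such that the partial sums of $\sum_k(R_k+\partial S_k)$ converge weakly to $T$ and the series $\sum_k\mathbf M(S_k)\sigma^{k((m+1)-\gamma)}$, $\sum_k\mathbf M(\partial S_k)\sigma^{k(m-\gamma)}$, $\sum_k\mathbf M(R_k)\rho^{k(m-\delta)}$, $\sum_k\mathbf M(\partial R_k)\rho^{k((m-1)-\delta)}$ are finite. For $X=\mathbb R^n$, $m=n$, one has $\mathscr D_{n+1}(\mathbb R^n)=\{0\}$, so $S_k=0$. *)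

(* Defs.v *)
From HB Require Import structures.
From mathcomp Require Import all_boot all_order all_algebra.
From mathcomp Require Import all_classical all_reals all_analysis.

Set Implicit Arguments.
Unset Strict Implicit.
Unset Printing Implicit Defensive.
Import Order.TTheory GRing.Theory Num.Theory.
Import numFieldNormedType.Exports.
Local Open Scope classical_set_scope.
Local Open Scope ring_scope.

(* The product sigma-algebra on R^n, and Lebesgue measure on it as the n-fold
   product of the one-dimensional Lebesgue measure (see lebesgue_rV_box). *)
Definition rV_display : measure_display. Proof. exact. Qed.

Section measurable_rV.
Context {R : realType} {n : nat}.

Definition rV_coord (i : 'I_n) (x : 'rV[R]_n) : measurableTypeR R := x ord0 i.

Let rV_set0 : g_sigma_preimage rV_coord set0.
Proof. exact: sigma_algebra0. Qed.

Let rV_setC A : g_sigma_preimage rV_coord A -> g_sigma_preimage rV_coord (~` A).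
Proof. exact: sigma_algebraC. Qed.

Let rV_bigcup (F : (set 'rV[R]_n)^nat) :
  (forall i, g_sigma_preimage rV_coord (F i)) ->
  g_sigma_preimage rV_coord (\bigcup_i (F i)).
Proof. exact: sigma_algebra_bigcup. Qed.

HB.instance Definition _ := @isMeasurable.Build rV_display
  'rV[R]_n (g_sigma_preimage rV_coord) rV_set0 rV_setC rV_bigcup.

Lemma measurable_rV_coord (i : 'I_n) : measurable_fun [set: 'rV[R]_n] (rV_coord i).
Proof.
move=> _ Y mY; rewrite setTI; apply: sub_sigma_algebra => /=.
rewrite -bigcup_seq/=; exists i => /=; first by rewrite mem_index_enum.
by exists Y => //; rewrite setTI.
Qed.

Lemma measurable_fun_rVP d (T : measurableType d) (f : T -> 'rV[R]_n) :
  (forall i, measurable_fun [set: T] (rV_coord i \o f)) ->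
  measurable_fun [set: T] f.
Proof.
move=> mf _ Y mY; rewrite setTI.
have : g_sigma_preimage (fun i => rV_coord i \o f) (f @^-1` Y).
  by rewrite g_sigma_preimage_comp; exists Y => //; rewrite setTI.
apply: smallest_sub; first exact: sigma_algebra_measurable.
rewrite -bigcup_seq => A [i _ [B mB <-]]; exact: mf.
Qed.

End measurable_rV.

Section lebesgue_rV.
Context {R : realType}.

Definition rV_cons n (p : measurableTypeR R * 'rV[R]_n) : 'rV[R]_n.+1 :=
  \row_(i < n.+1) oapp (fun j => p.2 ord0 j) (p.1 : R) (unlift ord0 i).

Lemma measurable_rV_cons n : measurable_fun setT (@rV_cons n).
Proof.
apply: measurable_fun_rVP => i.
case: (unliftP ord0 i) => [j ->|->].
  rewrite (_ : _ \o _ = rV_coord j \o snd).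
    by apply: measurableT_comp => //; exact: measurable_rV_coord.
  by apply/funext => p /=; rewrite /rV_coord mxE liftK.
rewrite (_ : _ \o _ = fst); first exact: measurable_fst.
by apply/funext => p /=; rewrite /rV_coord mxE unlift_none.
Qed.

Section step.
Variables (n : nat) (m : {sigma_finite_measure set 'rV[R]_n -> \bar R}).

Definition lebesgue_rV_step : set 'rV[R]_n.+1 -> \bar R :=
  pushforward (lebesgue_measure \x m)%E (@rV_cons n).

Let step0 : lebesgue_rV_step set0 = 0%E.
Proof. by rewrite /lebesgue_rV_step /pushforward preimage_set0 measure0. Qed.

Let step_ge0 A : (0 <= lebesgue_rV_step A)%E.
Proof. by rewrite /lebesgue_rV_step /pushforward; exact: measure_ge0. Qed.

Let step_sigma_additive : semi_sigma_additive lebesgue_rV_step.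
Proof.
move=> F mF tF mUF; rewrite /lebesgue_rV_step /pushforward preimage_bigcup.
apply: measure_semi_sigma_additive.
- by move=> k; rewrite -[X in measurable X]setTI; exact: measurable_rV_cons.
- apply/trivIsetP => /= i j _ _ ij; rewrite -preimage_setI.
  by move/trivIsetP : tF => /(_ _ _ _ _ ij) ->//; rewrite preimage_set0.
- rewrite -preimage_bigcup -[X in measurable X]setTI.
  exact: measurable_rV_cons.
Qed.

HB.instance Definition _ := isMeasure.Build _ _ _ lebesgue_rV_step
  step0 step_ge0 step_sigma_additive.

Let step_sigma_finite : sigma_finite setT lebesgue_rV_step.
Proof.
have /sigma_finiteP[F [TF ndF Foo]] := sigma_finiteT (@lebesgue_measure R).
have /sigma_finiteP[G [TG ndG Goo]] := sigma_finiteT m.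
pose unc (x : 'rV[R]_n.+1) : measurableTypeR R * 'rV[R]_n :=
  (x ord0 ord0, \row_j x ord0 (lift ord0 j)).
have consK : cancel (@rV_cons n) unc.
  move=> [a x]; congr pair; first by rewrite mxE unlift_none.
  by apply/rowP => j; rewrite !mxE liftK.
have uncK : cancel unc (@rV_cons n).
  move=> x; apply/rowP => i; rewrite mxE.
  by case: (unliftP ord0 i) => [j ->|->] //=; rewrite mxE.
have munc : measurable_fun setT unc.
  apply: measurable_fun_pair; first exact: measurable_rV_coord.
  apply: measurable_fun_rVP => j.
  rewrite (_ : _ \o _ = rV_coord (lift ord0 j)).
    exact: measurable_rV_coord.
  by apply/funext => x /=; rewrite /rV_coord mxE.
exists (fun k => unc @^-1` (F k `*` G k)).
  rewrite predeqE => x; split => // _.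
  have [i _ Fi] : (\bigcup_i F i) (unc x).1 by rewrite -TF.
  have [j _ Gj] : (\bigcup_i G i) (unc x).2 by rewrite -TG.
  exists (maxn i j) => //; split.
    by move: Fi; exact/subsetPset/ndF/leq_maxl.
  by move: Gj; exact/subsetPset/ndG/leq_maxr.
move=> k; have [mFk Fkoo] := Foo k; have [mGk Gkoo] := Goo k; split.
  by rewrite -[X in measurable X]setTI; apply: munc => //; exact: measurableX.
rewrite /lebesgue_rV_step /pushforward -comp_preimage.
rewrite (_ : _ \o _ = id); last by apply/funext => p /=; rewrite consK.
by rewrite preimage_id product_measure1E// lte_mul_pinfty// ge0_fin_numE.
Qed.

HB.instance Definition _ := Measure_isSigmaFinite.Build _ _ _ lebesgue_rV_step
  step_sigma_finite.

End step.

Fixpoint lebesgue_rV n : {sigma_finite_measure set 'rV[R]_n -> \bar R} :=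
  match n with
  | 0 => @dirac _ 'rV[R]_0 0 R
  | k.+1 => lebesgue_rV_step (lebesgue_rV k)
  end.

Lemma lebesgue_rV_box n (a b : 'rV[R]_n) :
  (forall i, a ord0 i <= b ord0 i) ->
  lebesgue_rV n [set x | forall i, x ord0 i \in `[a ord0 i, b ord0 i]] =
  (\prod_(i < n) (b ord0 i - a ord0 i))%:E.
Proof.
elim: n => [|n IH] in a b * => ab.
  by rewrite /= big_ord0 diracE mem_set//= => -[].
pose t (x : 'rV[R]_n.+1) : 'rV[R]_n := \row_j x ord0 (lift ord0 j).
have E : @rV_cons n @^-1`
    [set x : 'rV[R]_n.+1 | forall i, x ord0 i \in `[a ord0 i, b ord0 i]] =
  `[a ord0 ord0, b ord0 ord0]%classic `*`
    [set x : 'rV[R]_n | forall i, x ord0 i \in `[t a ord0 i, t b ord0 i]].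
  apply/seteqP; split => -[c x] /=.
    move=> h; split; first by have := h ord0; rewrite mxE unlift_none.
    by move=> i; have := h (lift ord0 i); rewrite !mxE liftK.
  move=> [hc hx] i; rewrite mxE; case: (unliftP ord0 i) => [j ->|->] //=.
  by have := hx j; rewrite !mxE.
rewrite [LHS]/= /lebesgue_rV_step /pushforward E.
rewrite product_measure1E//; last first.
  rewrite (_ : [set x | _] = \bigcap_(i in [set: 'I_n])
     (rV_coord i @^-1` `[t a ord0 i, t b ord0 i]%classic)); last first.
    by apply/seteqP; split => x /= h i; [move=> _; exact: h|exact: h].
  apply: fin_bigcap_measurable => // i _.
  by rewrite -[X in measurable X]setTI; apply: measurable_rV_coord.
rewrite IH; last by move=> i; rewrite !mxE.
rewrite big_ord_recl EFinM; congr (_ * _)%E.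
  apply: (etrans (lebesgue_measure_itv _)); rewrite /= lte_fin.
  have := ab ord0; rewrite le_eqVlt => /orP[/eqP ->|->]; last by rewrite EFinB.
  by rewrite ltxx subrr.
by congr EFin; apply: eq_bigr => i _; rewrite !mxE.
Qed.

End lebesgue_rV.

Section derivatives.
Context {R : realType}.

Definition enorm n (x : 'rV[R]_n) : R := Num.sqrt (\sum_i x ord0 i ^+ 2).

Definition partial n (i : 'I_n) (f : 'rV[R]_n -> R) (x : 'rV[R]_n) : R :=
  'D_(delta_mx ord0 i) f x.

(* For Lipschitz g this is meaningful almost everywhere (Rademacher); the
   default value of 'D elsewhere does not affect integrals. *)
Definition detD n (g : 'I_n -> 'rV[R]_n -> R) (x : 'rV[R]_n) : R :=
  \det (\matrix_(i < n, j < n) partial j (g i) x).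

Definition holder_seminorm n (a : R) (f : 'rV[R]_n -> R) : \bar R :=
  ereal_sup [set z | exists x y, x != y /\
    z = (`|f x - f y| / enorm (x - y) `^ a)%:E].

Definition holder n (a : R) (f : 'rV[R]_n -> R) : Prop :=
  (holder_seminorm a f < +oo)%E.

Definition lipschitz n (f : 'rV[R]_n -> R) : Prop := holder 1 f.

Definition fun_spt n (f : 'rV[R]_n -> R) : set 'rV[R]_n :=
  closure [set x | f x != 0].

End derivatives.

Section currents.
Context {R : realType} {n : nat}.
Implicit Types m : nat.

(* A functional on (m+1)-tuples (f, g^1, ..., g^m), with f at index ord0 and
   g^i at index lift ord0 i.  Only its values on tuples of the appropriate
   Lipschitz or Hoelder functions are meaningful, and two functionals are
   identified when they agree on those tuples. *)
Definition functional m := ('I_m.+1 -> 'rV[R]_n -> R) -> R.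

Definition tuple_cons m (f : 'rV[R]_n -> R) (G : 'I_m -> 'rV[R]_n -> R) :
  'I_m.+1 -> 'rV[R]_n -> R := fun i => oapp G f (unlift ord0 i).

Definition tuple_upd m (F : 'I_m -> 'rV[R]_n -> R) (i : 'I_m)
    (h : 'rV[R]_n -> R) : 'I_m -> 'rV[R]_n -> R :=
  fun j => if j == i then h else F j.

Definition holder_tuple m (a : 'I_m -> R) (F : 'I_m -> 'rV[R]_n -> R) : Prop :=
  forall i, holder (a i) (F i).

Definition lip_tuple m (F : 'I_m -> 'rV[R]_n -> R) : Prop :=
  forall i, lipschitz (F i).

Record holder_current m (a : 'I_m.+1 -> R) (T : functional m) : Prop :=
  HolderCurrent {
  hc_multilinear : forall F i c h1 h2, holder_tuple a F ->
    holder (a i) h1 -> holder (a i) h2 ->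
    T (tuple_upd F i (fun x => c * h1 x + h2 x)) =
    c * T (tuple_upd F i h1) + T (tuple_upd F i h2) ;
  hc_local : forall F, holder_tuple a F ->
    (exists (i : 'I_m) (U : set 'rV[R]_n) (c : R),
      [/\ open U, fun_spt (F ord0) `<=` U &
        forall x, U x -> F (lift ord0 i) x = c]) ->
    T F = 0 ;
  hc_compact : exists K : set 'rV[R]_n, compact K /\
    forall F, holder_tuple a F -> fun_spt (F ord0) `&` K = set0 -> T F = 0 ;
  hc_continuous : forall (Fk : nat -> 'I_m.+1 -> 'rV[R]_n -> R) F,
    (forall k, holder_tuple a (Fk k)) -> holder_tuple a F ->
    (forall i, {uniform, (fun k => Fk k i) @ \oo --> F i}) ->
    (exists L : R, forall k i, (holder_seminorm (a i) (Fk k i) <= L%:E)%E) ->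
    T (Fk k) @[k --> \oo] --> T F }.

Definition metric_current m (T : functional m) : Prop :=
  holder_current (fun=> 1) T.

Definition holder_spt m (a : 'I_m.+1 -> R) (T : functional m) :
    set 'rV[R]_n :=
  \bigcap_(A in [set A | closed A /\ forall F, holder_tuple a F ->
    fun_spt (F ord0) `&` A = set0 -> T F = 0]) A.

Definition spt m (T : functional m) : set 'rV[R]_n := holder_spt (fun=> 1) T.

(* Lipschitz functions on R^n need not be globally a-Hoelder, but they are so
   on compact sets.  The extension property is therefore read after
   restriction to a compact K containing the supports: T' takes on a Hoelder
   tuple the value of T on any Lipschitz tuple with the same restriction to K. *)
Definition holder_extension m (a : 'I_m.+1 -> R) (T : functional m) : Prop :=
  exists (T' : functional m) (K : set 'rV[R]_n),
    [/\ holder_current a T', compact K, spt T `<=` K, holder_spt a T' `<=` K &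
      forall F F', lip_tuple F -> holder_tuple a F' ->
        (forall i, {in K, F i =1 F' i}) -> T' F' = T F].

Definition boundary m (T : functional m.+1) : functional m :=
  fun G => T (tuple_cons (fun=> 1) G).

Definition mass m (T : functional m) : \bar R :=
  ereal_sup [set z | exists (N : nat)
      (F : 'I_N -> 'I_m.+1 -> 'rV[R]_n -> R),
    [/\ forall l, lip_tuple (F l),
        forall x, \sum_l `|F l ord0 x| <= 1,
        forall l (i : 'I_m), (holder_seminorm 1 (F l (lift ord0 i)) <= 1%:E)%E &
        z = (\sum_l T (F l))%:E]].

Definition normal_current m (T : functional m.+1) : Prop :=
  metric_current T /\ (mass T + mass (boundary T) < +oo)%E.

Definition weak_cvg m (U : nat -> functional m) (T : functional m) : Prop :=
  (exists K, [/\ compact K, spt T `<=` K & forall k, spt (U k) `<=` K]) /\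
  forall F, lip_tuple F -> U k F @[k --> \oo] --> T F.

(* F_{gamma,delta} in dimension m.+1 *)
Definition fractal m (gamma delta : R) (T : functional m.+1) : Prop :=
  metric_current T /\
  exists (K : set 'rV[R]_n) (Rk : nat -> functional m.+1)
      (Sk : nat -> functional m.+2) (sigma rho : R),
    [/\ compact K,
      forall k, [/\ normal_current (Rk k), normal_current (Sk k),
        spt (Rk k) `<=` K & spt (Sk k) `<=` K],
      1 < sigma /\ 1 < rho,
      weak_cvg (fun N F => \sum_(0 <= k < N) (Rk k F + boundary (Sk k) F)) T &
      [/\ (\sum_(0 <= k <oo) mass (Sk k) *
          (sigma `^ (k%:R * (m.+2%:R - gamma)))%:E < +oo)%E,
        (\sum_(0 <= k <oo) mass (boundary (Sk k)) *
          (sigma `^ (k%:R * (m.+1%:R - gamma)))%:E < +oo)%E,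
        (\sum_(0 <= k <oo) mass (Rk k) *
          (rho `^ (k%:R * (m.+1%:R - delta)))%:E < +oo)%E &
        (\sum_(0 <= k <oo) mass (boundary (Rk k)) *
          (rho `^ (k%:R * (m%:R - delta)))%:E < +oo)%E]].

End currents.
Arguments functional R n m : clear implicits.

Section flat_chains.
Context {R : realType} {n : nat}.
Implicit Types m : nat.

Definition std_simplex m : set 'rV[R]_m :=
  [set y | (forall i, 0 <= y ord0 i) /\ \sum_i y ord0 i <= 1].

(* An oriented m-simplex with vertices v, v + row 0 B, ..., v + row (m-1) B is
   encoded as the pair (v, B); a polyhedral chain is a formal real linear
   combination of nondegenerate oriented simplices. *)
Definition simplex_map m (s : 'rV[R]_n * 'M[R]_(m, n)) (y : 'rV[R]_m) :
  'rV[R]_n := s.1 + y *m s.2.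

Definition poly_chain m := seq (R * ('rV[R]_n * 'M[R]_(m, n))).

Definition nondegenerate m (P : poly_chain m) : bool :=
  all (fun s => row_free s.2.2) P.

Definition chain_within m (K : set 'rV[R]_n) (P : poly_chain m) : Prop :=
  forall s, s \in P -> simplex_map s.2 @` @std_simplex m `<=` K.

(* integration of the pull-back of f dg^1 /\ ... /\ dg^m *)
Definition simplex_current m (s : 'rV[R]_n * 'M[R]_(m, n)) :
    functional R n m := fun F =>
  \int[lebesgue_rV m]_(y in @std_simplex m)
    (F ord0 (simplex_map s y) *
     detD (fun i => F (lift ord0 i) \o simplex_map s) y).

Definition chain_current m (P : poly_chain m) : functional R n m :=
  fun F => \sum_(s <- P) s.1 * simplex_current s.2 F.

Definition flat_norm m (T : functional R n m) : \bar R :=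
  ereal_inf [set z | exists D : poly_chain m.+1, nondegenerate D /\
    z = (mass (fun F => (T F - boundary (chain_current D) F)%R) +
         mass (chain_current D))%E].

(* Flat chains with compact support: the completion of polyhedral chains in
   the flat norm, acting on Lipschitz tuples. *)
Definition flat_chain m (T : functional R n m) : Prop :=
  exists (K : set 'rV[R]_n) (P : nat -> poly_chain m),
    [/\ compact K,
      forall k, nondegenerate (P k) /\ chain_within K (P k),
      forall e : R, 0 < e -> exists N : nat, forall k l, (N <= k)%N ->
        (N <= l)%N ->
        (flat_norm (fun F => (chain_current (P k) F - chain_current (P l) F)%R)
          < e%:E)%E &
      forall F, lip_tuple F -> chain_current (P k) F @[k --> \oo] --> T F].

End flat_chains.

Section bounded_variation.
Context {R : realType}.

Definition ess_spt n (u : 'rV[R]_n -> R) : set 'rV[R]_n :=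
  ~` \bigcup_(U in [set U | open U /\
        {ae lebesgue_rV n, forall x, U x -> u x = 0}]) U.

Definition L1c n (u : 'rV[R]_n -> R) : Prop :=
  (lebesgue_rV n).-integrable setT (EFin \o u) /\ compact (ess_spt u).

Definition L1norm n (u : 'rV[R]_n -> R) : \bar R :=
  (\int[lebesgue_rV n]_x `|u x|%:E)%E.

Definition current_of n (u : 'rV[R]_n -> R) : functional R n n := fun F =>
  \int[lebesgue_rV n]_x (u x * F ord0 x * detD (fun i => F (lift ord0 i)) x).

Definition represents n (u : 'rV[R]_n -> R) (T : functional R n n) : Prop :=
  forall F, lip_tuple F -> T F = current_of u F.

(* The product is that of \bar R, with 0 * +oo = 0.  This convention does not
   matter: it can only affect whether C = 0 is admissible, not the infimum, and
   if some Lip(g^i) = 0 then the determinant vanishes. *)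
Definition fracvar n (a : R) (u : 'rV[R]_n.+1 -> R) : \bar R :=
  ereal_inf [set C | (0 <= C)%E /\
    forall F : 'I_n.+1 -> 'rV[R]_n.+1 -> R, lip_tuple F ->
      (`|\int[lebesgue_rV n.+1]_x (u x * detD F x)|%:E <=
       C * holder_seminorm a (F ord0) *
       \big[mule/1]_(i < n) holder_seminorm 1 (F (lift ord0 i)))%E].

Definition BVfrac n (a : R) (u : 'rV[R]_n.+1 -> R) : Prop :=
  L1c u /\ (fracvar a u < +oo)%E.

Definition divergence n (phi : 'rV[R]_n -> 'rV[R]_n) (x : 'rV[R]_n) : R :=
  \sum_i partial i (fun y => phi y ord0 i) x.

Definition test_field n (phi : 'rV[R]_n -> 'rV[R]_n) : Prop :=
  [/\ forall x, differentiable phi x,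
      forall i : 'I_n, continuous (fun x => 'D_(delta_mx ord0 i) phi x),
      compact (closure [set x | phi x != 0]) &
      forall x, enorm (phi x) <= 1].

Definition div_variation n (u : 'rV[R]_n -> R) : \bar R :=
  ereal_sup [set z | exists phi, test_field phi /\
    z = (\int[lebesgue_rV n]_x (u x * divergence phi x))%:E].

Definition BVc n (u : 'rV[R]_n -> R) : Prop :=
  L1c u /\ (div_variation u < +oo)%E.

End bounded_variation.

(* Main.v *)
(** A current T of top dimension is recovered on dyadic lattices: pairing T with products of
B-splines gives step functions of mesh 2^-k. A bound for the boundary of T on Lip^a controls the
L^1 norms and the variations of the differences of consecutive step functions by geometric
sequences, whose sum is the density u. This gives the implications from (3) on. For (1) => (2),
Hoelder functions are replaced by their spline interpolations at scale q^-j; replacing them one slot at a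
time by the next scale changes a normal current by its mass and boundary mass times powers of
q^-j, and the resulting double series converges under the conditions on the exponents. Conversely a series
as in (5) is fractal because mollification bounds the masses of the currents of the u_k. *)

Require Import Defs.
From mathcomp Require Import all_boot all_order all_algebra all_fingroup.
From mathcomp Require Import all_classical all_reals all_analysis measurable_realfun.
From mathcomp Require Import ring lra zify.
From HB Require Import structures.
Import Order.TTheory GRing.Theory Num.Theory.
Import numFieldNormedType.Exports.
Local Open Scope classical_set_scope.
Local Open Scope ring_scope.
Set Implicit Arguments. Unset Strict Implicit. Unset Printing Implicit Defensive.

Implicit Types (R : realType) (n : nat).

Local Notation lip := (@Defs.lipschitz _ _).
Local Notation via y := (@le_trans _ _ y).
Local Notation mfun := (measurable_fun setT).
Local Notation sc := (lift ord0).
Local Notation upd := tuple_upd.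
Local Notation tcons := tuple_cons.
Local Notation la := (@lebesgue_measure _).
Local Notation mu := (lebesgue_rV _).
Local Notation I f := (\int[lebesgue_rV _]_x f x).

(** Two obstacles shape the proof. The axioms of a metric current know no derivatives, so every
    identity has to come from multilinearity, locality and continuity. Locality concerns constants
    only; replacing a function by two staircases, one of which is constant on each piece of a
    partition of unity, turns it into alternation and the product rule. The chain rule then holds
    for truncated powers, hence for B-splines of a coordinate, and therefore splines take the place
    of smooth functions everywhere. It follows that T is determined by its values T(f, x^1, ...,
    x^n). The second obstacle is to bound sums of absolute values by single values of T: a fine
    spline minus 2^-n times a coarse one is a sum of derivatives of splines of size h, and adding
    these with signs gives one function whose seminorm of exponent a is of order h^(1-a). The same
    signs bound the gradient of a mollified function by its variation. Conversely [[u]] is a metric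
    current because Jacobians of functions with bounded support have integral 0, which is computed
    for splines and passed to the limit. Flat chains of dimension n are limits in mass, since R^n
    contains no simplex of dimension n + 1. *)

Lemma le_normD (K : numDomainType) (W : normedZmodType K) (x y : W) z : `|x| + `|y| <= z -> `|x + y| <= z.
Proof. exact: le_trans (ler_normD _ _). Qed.

Lemma le_normB (K : numDomainType) (W : normedZmodType K) (x y : W) z : `|x| + `|y| <= z -> `|x - y| <= z.
Proof. exact: le_trans (ler_normB _ _). Qed.

Lemma le_norm_sum (K : numDomainType) (W : normedZmodType K) (J : Type) (s : seq J) (P : pred J) (F : J -> W) z :
 \sum_(j <- s | P j) `|F j| <= z -> `|\sum_(j <- s | P j) F j| <= z.
Proof. exact: le_trans (ler_norm_sum _ _ _). Qed.

(** * Sup norm, Hoelder classes, and the topology of R^n by balls *)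

Section norms.
Context {R}.
Lemma coord_le n (x : 'rV[R]_n) i : `|x ord0 i| <= `|x|.
Proof.
rewrite [leRHS]/Num.norm /= mx_normrE; apply/bigmax_geP; right.
by exists (ord0, i).
Qed.

Lemma norm_le n (x : 'rV[R]_n) (r : R) : 0 <= r ->
 (forall i, `|x ord0 i| <= r) -> `|x| <= r.
Proof.
move=> r0 h; rewrite [leLHS]/Num.norm /= mx_normrE.
apply: bigmax_le => // -[i j] _ /=; rewrite (ord1 i); exact: h.
Qed.

Lemma enorm_ge0 n (x : 'rV[R]_n) : 0 <= enorm x.
Proof. exact: sqrtr_ge0. Qed.

Lemma norm_le_enorm n (x : 'rV[R]_n) : `|x| <= enorm x.
Proof.
apply: norm_le; first exact: enorm_ge0.
move=> i; rewrite -sqrtr_sqr ler_wsqrtr// (bigD1 i)//= lerDl.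
apply: sumr_ge0 => j _; exact: sqr_ge0.
Qed.

Lemma enorm_le_norm n (x : 'rV[R]_n) : enorm x <= n%:R * `|x|.
Proof.
have h : \sum_i x ord0 i ^+ 2 <= (n%:R * `|x|) ^+ 2.
 apply: (via (\sum_(i < n) `|x| ^+ 2)).
  apply: ler_sum => i _; rewrite -[leLHS]real_normK ?num_real//. by rewrite ler_sqr ?nnegrE// coord_le.
 rewrite sumr_const card_ord -[leLHS]mulr_natl exprMn. apply: ler_wpM2r; first exact: sqr_ge0.
 by rewrite expr2; case: n x => [|n] x; rewrite ?mul0r// ler_peMl// ler1n.
by rewrite -[leRHS]ger0_norm ?mulr_ge0// -sqrtr_sqr ler_wsqrtr.
Qed.

End norms.

Section holder.
Context {R n}.
Implicit Types f g : 'rV[R]_n -> R.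
(** These classes use the sup norm of row vectors, [holder_seminorm] the Euclidean norm.
    [hol_seminorm] and [seminorm_hol] translate, at the cost of a factor n^a in one direction
    only. *)
Definition hol (a C : R) f := forall x y, `|f x - f y| <= C * `|x - y| `^ a.
Definition lipc (L : R) f := forall x y, `|f x - f y| <= L * `|x - y|.

Lemma lipc_hol L f : lipc L f <-> hol 1 L f.
Proof. by split => h x y; have := h x y; rewrite powRr1. Qed.

Lemma hol_seminorm a C f : 0 <= a -> 0 <= C -> hol a C f ->
 (holder_seminorm a f <= C%:E)%E.
Proof.
move=> a0 C0 h; apply: ge_ereal_sup => _ [x [y [xy ->]]]; rewrite lee_fin.
have exy : 0 < enorm (x - y) by rewrite (lt_le_trans _ (norm_le_enorm _))// normr_gt0 subr_eq0.
rewrite ler_pdivrMr ?powR_gt0//; apply: (le_trans (h x y)).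
by rewrite ler_wpM2l// ge0_ler_powR// ?nnegrE ?enorm_ge0// norm_le_enorm.
Qed.

Lemma seminorm_hol a C f : 0 < a -> (holder_seminorm a f <= C%:E)%E ->
 hol a (C * n%:R `^ a) f.
Proof.
move=> a0 h x y; have [->|xy] := eqVneq x y.
 by rewrite !subrr !normr0 powR0 ?gt_eqF// mulr0.
have exy : 0 < enorm (x - y) by rewrite (lt_le_trans _ (norm_le_enorm _))// normr_gt0 subr_eq0.
have : ((`|f x - f y| / enorm (x - y) `^ a)%:E <= C%:E)%E.
 by apply: le_trans h; apply: ereal_sup_ubound; exists x, y.
rewrite lee_fin ler_pdivrMr ?powR_gt0// => h1.
have C0 : 0 <= C by rewrite -(pmulr_lge0 _ (powR_gt0 a exy)) (le_trans _ h1).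
apply: (le_trans h1); rewrite -mulrA ler_wpM2l// -powRM//.
by rewrite ge0_ler_powR ?nnegrE ?enorm_ge0 ?mulr_ge0 ?(ltW a0)// enorm_le_norm.
Qed.

Lemma holderP a f : 0 < a -> holder a f <-> exists2 C : R, 0 <= C & hol a C f.
Proof.
move=> a0; split; last first.
 by move=> [C C0 h]; apply: (le_lt_trans (hol_seminorm (ltW a0) C0 h)); rewrite ltry.
rewrite /holder => h.
have [M M0 hM] : exists2 M : R, 0 <= M & (holder_seminorm a f <= M%:E)%E.
 move: h; case: (holder_seminorm a f) => [r| |]//= _.
  by exists `|r| => //; rewrite lee_fin ler_norm.
 by exists 0 => //; rewrite leNye.
exists (M * n%:R `^ a); first by rewrite mulr_ge0// powR_ge0.
exact: seminorm_hol.
Qed.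

Lemma lipP f : Defs.lipschitz f <-> exists2 L : R, 0 <= L & lipc L f.
Proof.
have [e1 e2] := @holderP 1 f ltr01; split.
 by move=> h; have [L L0 /lipc_hol h'] := e1 h; exists L.
by move=> [L L0 /lipc_hol h]; apply: e2; exists L.
Qed.

Lemma lipcW L L' f : L <= L' -> lipc L f -> lipc L' f.
Proof. by move=> LL h x y; apply: (le_trans (h x y)); rewrite ler_wpM2r. Qed.

Lemma nbhs_rVP (x : 'rV[R]_n) (P : set 'rV[R]_n) :
 nbhs x P <-> exists2 e : R, 0 < e & forall y, `|x - y| < e -> P y.
Proof.
split; first by move=> /nbhs_normP [e /= e0 h]; exists e.
by move=> [e e0 h]; apply/nbhs_ballP; exists e => //; rewrite -ball_normE.
Qed.

Lemma open_rVP (U : set 'rV[R]_n) : open U <->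
 forall x, U x -> exists2 e : R, 0 < e & forall y, `|x - y| < e -> U y.
Proof.
rewrite openE; split => h x Ux; first by apply/nbhs_rVP; exact: h.
apply/nbhs_rVP; exact: h.
Qed.

Lemma closure_rVP (A : set 'rV[R]_n) x : closure A x <->
 forall e : R, 0 < e -> exists2 y, A y & `|x - y| < e.
Proof.
split=> [h e e0|h B /nbhs_rVP[e e0 hB]].
 have /h [y [Ay xy]] : nbhs x [set y | `|x - y| < e] by apply/nbhs_rVP; exists e. by exists y.
by have [y Ay xy] := h _ e0; exists y; split => //; exact: hB.
Qed.

Lemma fun_spt_neq0 f x : f x != 0 -> fun_spt f x.
Proof. by move=> h; apply: subset_closure. Qed.

Lemma fun_sptN f x : ~ fun_spt f x -> f x = 0.
Proof. by move=> h; apply/eqP/negP => /negP /fun_spt_neq0. Qed.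

Lemma lipc_cont L f : lipc L f -> continuous f.
Proof.
move=> h x; apply/(@cvgrPdist_lt _ _ _ _ (nbhs_filter x)) => e e0.
have L1 : 0 < `|L| + 1 by rewrite ltr_wpDl.
apply/nbhs_rVP; exists (e / (`|L| + 1)); first by rewrite divr_gt0.
move=> y xy; apply: (le_lt_trans (h x y)).
apply: (@le_lt_trans _ _ ((`|L| + 1) * `|x - y|)).
 by rewrite ler_wpM2r// (le_trans (ler_norm _))// lerDl.
by rewrite mulrC -ltr_pdivlMr.
Qed.

Lemma closed_normle (r : R) : closed [set x : 'rV[R]_n | `|x| <= r].
Proof.
rewrite -[X in closed X]setCK; apply: open_closedC; apply/open_rVP => x /= /negP.
rewrite -ltNge => h; exists (`|x| - r); first by rewrite subr_gt0.
move=> y xy; apply/negP; rewrite -ltNge.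
have := ler_dist_dist x y; rewrite ler_norml => /andP[_]; lra.
Qed.

Lemma compact_normle (r : R) : compact [set x : 'rV[R]_n | `|x| <= r].
Proof.
apply: bounded_closed_compact; last exact: closed_normle.
exists r; split; first exact: num_real.
move=> M rM x /= /le_trans; apply; exact: ltW.
Qed.

Lemma compact_cap_ball (A : set 'rV[R]_n) (r : R) : closed A -> compact (A `&` [set x | `|x| <= r]).
Proof.
move=> cA; apply: (subclosed_compact _ (compact_normle (r := r))) => [|x []//].
apply: closedI => //; exact: closed_normle.
Qed.

Lemma open_normlt (r : R) : open [set x : 'rV[R]_n | `|x| < r].
Proof.
apply/open_rVP => x /= xr; exists (r - `|x|); first by rewrite subr_gt0.
by move=> y xy; have := ler_normD (y - x) x; rewrite subrK distrC; lra.
Qed.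

Lemma compact_annulus (r s : R) : compact [set x : 'rV[R]_n | r <= `|x| /\ `|x| <= s].
Proof.
rewrite (_ : [set x | _] = ~` [set x | `|x| < r] `&` [set x | `|x| <= s]).
 by apply/compact_cap_ball/open_closedC/open_normlt.
by apply/seteqP; split => x /= [h1 h2]; split => //; move: h1; rewrite leNgt => /negP.
Qed.

Lemma compact_rV (K : set 'rV[R]_n) : compact K ->
 exists2 r : R, 0 < r & K `<=` [set x | `|x| <= r].
Proof.
move=> /compact_bounded [M [Mr h]]; exists (`|M| + 1); first by rewrite ltr_wpDl.
by move=> x /h; apply; rewrite (le_lt_trans (ler_norm M))// ltrDl.
Qed.


Lemma coord_mf (i : 'I_n) : measurable_fun [set: 'rV[R]_n] (fun x => x ord0 i).
Proof. exact: measurable_rV_coord. Qed.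

Lemma measurable_box (I : 'I_n -> interval R) :
 measurable [set x : 'rV[R]_n | forall i, x ord0 i \in I i].
Proof.
have -> : [set x : 'rV[R]_n | forall i, x ord0 i \in I i] =
  \bigcap_(i in [set: 'I_n]) ((fun x : 'rV[R]_n => x ord0 i) @^-1` [set` I i]).
 by apply/seteqP; split => x /= h i; [move=> _; exact: h|exact: h].
apply: fin_bigcap_measurable => // i _.
by rewrite -[X in measurable X]setTI; apply: coord_mf.
Qed.

(** The sigma-algebra is generated by the coordinates and not by the open sets; an open set is a
    countable union of open cubes with rational centres and sides 2/(k+1). *)
Lemma open_mf (U : set 'rV[R]_n) : open U -> measurable U.
Proof.
move=> oU.
pose B (q : 'rV[rat]_n * nat) : set 'rV[R]_n :=
 [set y | forall i, y ord0 i \in `](ratr (q.1 ord0 i) - q.2.+1%:R^-1), (ratr (q.1 ord0 i) + q.2.+1%:R^-1)[].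
have -> : U = \bigcup_(q in [set q | B q `<=` U]) B q.
 apply/seteqP; split => [x Ux|x [q]]; last exact. have [e e0 he] := (open_rVP U).1 oU x Ux.
 have [k hk] : exists k : nat, k.+1%:R^-1 < e / 2.
  have e2 : 0 < e / 2 by rewrite divr_gt0. by exists (Num.truncn (e / 2)^-1); rewrite invf_plt ?posrE// truncnS_gt.
 have [q hq] : exists q : 'rV[rat]_n, forall i, `|x ord0 i - ratr (q ord0 i)| < k.+1%:R^-1.
  have h i : exists q : rat, `|x ord0 i - ratr q| < k.+1%:R^-1.
   have [|q] := @rat_in_itvoo R (x ord0 i - k.+1%:R^-1) (x ord0 i + k.+1%:R^-1).
    by rewrite ltrD2l gtrN.
   by rewrite in_itv/= => h; exists q; rewrite ltr_distlC.
  exists (\row_i (sval (cid (h i)))) => i; rewrite mxE. exact: (svalP (cid (h i))).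
 exists (q, k) => /=; last by move=> i; rewrite in_itv/= -ltr_distlC distrC.
 move=> y hy; apply: he; apply: (@le_lt_trans _ _ (2 * k.+1%:R^-1)); last first.
  by rewrite mulrC -ltr_pdivlMr.
 apply: norm_le => [|j]; first by rewrite mulr_ge0// invr_ge0.
 have := hy j; rewrite in_itv/= -ltr_distlC => h1; rewrite !mxE.
 have -> : x ord0 j - y ord0 j = (x ord0 j - ratr (q ord0 j)) + (ratr (q ord0 j) - y ord0 j) by ring.
 by rewrite le_normD// mulr_natl mulr2n lerD ?ltW.
rewrite bigcup_mkcond; apply: countable_bigcupT_measurable => [|q].
 exact: countableP.
case: ifP => // _; exact: measurable_box.
Qed.

Lemma continuous_mf (f : 'rV[R]_n -> R) : continuous f -> mfun f.
Proof.
move=> cf; apply: (measurability _ (RGenOpens.measurableE R)) => //.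
move=> _ [_ [a [b ->] <-]]; rewrite setTI.
apply: open_mf; apply: open_comp => //; exact: interval_open.
Qed.

Lemma lipc_mfun L (f : 'rV[R]_n -> R) : lipc L f -> mfun f.
Proof. by move=> /lipc_cont; exact: continuous_mf. Qed.

End holder.

(** * Almost everywhere differentiability of Lipschitz functions of one variable *)

Section lip1.
Context {R}.
Variables (f : R -> R) (L : R).
Hypothesis L0 : 0 <= L.
Hypothesis fL : forall x y, `|f x - f y| <= L * `|x - y|.

Lemma lip1_continuous : continuous f.
Proof.
move=> x; apply/cvgrPdist_lt => e e0.
have L1 : 0 < L + 1 by rewrite ltr_wpDl.
near=> y; apply: (le_lt_trans (fL x y)).
apply: (@le_lt_trans _ _ ((L + 1) * `|x - y|)).
 by rewrite ler_wpM2r// lerDl.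
rewrite mulrC -ltr_pdivlMr//.
by near: y; apply: cvgr_dist_lt => //; rewrite divr_gt0.
Unshelve. all: by end_near. Qed.

(** Adding f to L x and subtracting it from L x gives two nondecreasing functions. Their Stieltjes
    measures add up to 2L times the Lebesgue measure, so each is absolutely continuous, and
    integrating the Radon-Nikodym density of the first recovers f up to an affine function. *)
Definition lip_up (x : R) : R := f x + L * x.
Definition lip_dn (x : R) : R := L * x - f x.

Lemma lip_up_nd : nondecreasing lip_up.
Proof.
move=> x y xy; rewrite /lip_up; have := fL x y.
rewrite ler_norml (distrC x y) (ger0_norm (_ : 0 <= y - x)) ?subr_ge0//; lra.
Qed.

Lemma lip_dn_nd : nondecreasing lip_dn.
Proof.
move=> x y xy; rewrite /lip_dn; have := fL x y.
rewrite ler_norml (distrC x y) (ger0_norm (_ : 0 <= y - x)) ?subr_ge0//; lra.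
Qed.

Lemma lip_up_rc : right_continuous lip_up.
Proof.
apply/right_continuousW => x; apply: cvgD; first exact: lip1_continuous.
by apply: cvgM; [exact: cvg_cst|exact: cvg_id].
Qed.

Lemma lip_dn_rc : right_continuous lip_dn.
Proof.
apply/right_continuousW => x; apply: cvgB; last exact: lip1_continuous.
by apply: cvgM; [exact: cvg_cst|exact: cvg_id].
Qed.

HB.instance Definition _ := isCumulative.Build R _ R lip_up lip_up_nd lip_up_rc.
HB.instance Definition _ := isCumulative.Build R _ R lip_dn lip_dn_nd lip_dn_rc.

Let nu := lebesgue_stieltjes_measure lip_up.
Let nd := lebesgue_stieltjes_measure lip_dn.

Let nuE a b : a <= b -> nu `]a, b] = (lip_up b - lip_up a)%:E.
Proof.
move=> ab; rewrite /nu /lebesgue_stieltjes_measure /measure_extension/=.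
rewrite measurable_mu_extE/=; last exact: is_ocitv.
by rewrite wlength_itv_bnd.
Qed.

Let ndE a b : a <= b -> nd `]a, b] = (lip_dn b - lip_dn a)%:E.
Proof.
move=> ab; rewrite /nd /lebesgue_stieltjes_measure /measure_extension/=.
rewrite measurable_mu_extE/=; last exact: is_ocitv.
by rewrite wlength_itv_bnd.
Qed.

Hypothesis Lp : 0 < L.
Let nu_dominated : nu `<< la.
Proof.
apply/null_content_dominatesP => A mA A0.
have c0 : 0 <= (2 * L)^-1 by rewrite invr_ge0 mulr_ge0.
have sE Y : mscale (NngNum c0) (measure_add nu nd) Y = (((2 * L)^-1)%:E * (nu Y + nd Y))%E.
 congr (_ * _)%E; exact: measure_addE.
have E X : measurable X -> la X = mscale (NngNum c0) (measure_add nu nd) X.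
 apply: lebesgue_measure_unique => _ [[a b] _ <-] /=.
 have [ab|ba] := leP a b; last by rewrite set_itv_ge ?measure0// bnd_simp -leNgt ltW. rewrite sE nuE// ndE//.
 rewrite lebesgue_measure_itv /= lte_fin.
 have -> : ((lip_up b - lip_up a)%:E + (lip_dn b - lip_dn a)%:E)%E = (2 * L * (b - a))%:E.
  by rewrite -EFinD; congr EFin; rewrite /lip_up /lip_dn; ring.
 move: ab; rewrite le_eqVlt => /orP[/eqP ->|ab].
  by rewrite ltxx subrr mulr0 mule0.
 by rewrite ab -EFinB -EFinM; congr EFin; field; rewrite gt_eqF.
have := E _ mA; rewrite [LHS]A0 sE => /esym/eqP.
rewrite mule_eq0 eqe gt_eqF ?invr_gt0 ?mulr_gt0//= => /eqP h.
apply/eqP; rewrite eq_le measure_ge0 andbT -h leeDl//.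
Qed.

(** Restricted to a bounded interval the Stieltjes measure is finite, so that its density is
    integrable. *)
Let D (N : nat) : set (measurableTypeR R) := `](- N%:R), N%:R].
Let mD N : measurable (D N). Proof. exact: measurable_itv. Qed.
Let nuD N : (nu (D N) < +oo)%E.
Proof. by rewrite nuE ?ltry// lerNl (via 0)// lerNl oppr0. Qed.

Lemma lip1_ae_derivable_pos : {ae la, forall x, derivable f x 1}.
Proof.
have key N : {ae la, forall x, - N%:R < x -> x < N%:R -> derivable f x 1}.
 pose nuN : {finite_measure set _ -> \bar R} := mfrestr (mD N) (nuD N). have dN : nuN `<< la.
  apply/null_content_dominatesP => A mA A0. rewrite /nuN /= /mfrestr /mrestr.
  have /null_content_dominatesP h := nu_dominated. apply: h; first exact: measurableI.
  by apply/eqP; rewrite eq_le measure_ge0 andbT -A0 le_measure ?inE//; apply: measurableI.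
 have [w [w0 wfin wint wE]] := radon_nikodym_sigma_finite dN. pose v := fine \o w.
 have vE : EFin \o v = w by apply/funext => x /=; rewrite fineK.
 have intv : la.-integrable setT (EFin \o v) by rewrite vE.
 have := @FTC1 R v (BRight (- N%:R)) _ (open_integrable_locally openT intv).
 move=> /(_ _)/wrap[]; first by move=> y; apply: (integrableS measurableT).
 apply: filterS; first exact: (ae_filter_ringOfSetsType la). move=> x h Nx xN.
 have Nx' : (BRight (- N%:R) < BRight x)%O by rewrite bnd_simp. have [dF _] := h Nx'.
 have FE : \forall y \near x, \int[la]_(t in [set` Interval (BRight (- N%:R)) (BRight y)]) v t = lip_up y - lip_up (- N%:R).
  near=> y. have Ny : - N%:R < y by near: y; exact: lt_nbhsr. have yN : y < N%:R by near: y; exact: lt_nbhsl.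
  rewrite /Rintegral; have := wE _ (measurable_itv `](- N%:R), y]).
  rewrite -vE /= => <-; rewrite /nuN /= /mfrestr /mrestr.
  rewrite setIidl; last by apply: subset_itvl; rewrite bnd_simp ltW. by rewrite [LHS](congr1 fine (nuE (ltW Ny))).
 have d1 : derivable lip_up x 1.
  pose G (y : R) : R := \int[la]_(t in `](- N%:R), y]) v t + lip_up (- N%:R).
  have dG : derivable G x 1 by apply: derivableD. apply: near_eq_derivable dG.
  by near=> y; rewrite /G; have -> // : \int[la]_(t in `](- N%:R), y]) v t = lip_up y - lip_up (- N%:R); [near: y; exact: FE|rewrite subrK].
 have -> : f = lip_up \- (fun x => L * x) by apply/funext => y; rewrite /lip_up /=; ring.
 by apply: derivableB => //; apply: derivableM.
have : {ae la, forall x, forall N : nat, - N%:R < x -> x < N%:R -> derivable f x 1} by apply/ae_foralln.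
apply: filterS; first exact: (ae_filter_ringOfSetsType la).
move=> x h.
have xN : `|x| < (Num.truncn `|x|).+1%:R by rewrite truncnS_gt.
by move: xN; rewrite ltr_norml => /andP[h1 h2]; exact: (h (Num.truncn `|x|).+1).
Unshelve. all: by end_near. Qed.

End lip1.

Lemma lip1_ae_derivable {R : realType} (f : R -> R) (L : R) :
 (forall x y, `|f x - f y| <= L * `|x - y|) ->
 {ae @lebesgue_measure R, forall x, derivable f x 1}.
Proof.
move=> h; have L1 : 0 < `|L| + 1 by rewrite ltr_wpDl.
apply: (@lip1_ae_derivable_pos R f (`|L| + 1) (ltW L1) _ L1) => x y.
by rewrite (le_trans (h x y))// ler_wpM2r// (le_trans (ler_norm _))// lerDl.
Qed.

(** * Calculus of integrable real functions on a measure space *)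

Section functions.
Context d (T : measurableType d) (R : realType) (mu : {measure set T -> \bar R}).
Implicit Types f g : T -> R.
Local Notation I f := (\int[mu]_x f x).
Definition L1 f := mu.-integrable setT (EFin \o f).

Lemma L1_mfun f : L1 f -> mfun f.
Proof. by move=> /integrableP[/measurable_EFinP]. Qed.

Lemma L1_le f g : mfun f -> (forall x, `|f x| <= g x) -> L1 g -> L1 f.
Proof.
move=> mf h; apply: le_integrable => //; first exact/measurable_EFinP.
by move=> x _; rewrite /= lee_fin (le_trans (h x))// ler_norm.
Qed.

Lemma L1D f g : L1 f -> L1 g -> L1 (fun x => f x + g x).
Proof. by move=> h1 h2; have := integrableD measurableT h1 h2. Qed.

Lemma L1B f g : L1 f -> L1 g -> L1 (fun x => f x - g x).
Proof. by move=> h1 h2; have := integrableB measurableT h1 h2. Qed.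

Lemma L1Z c f : L1 f -> L1 (fun x => c * f x).
Proof. by move=> h1; have := integrableZl measurableT c h1. Qed.

Lemma L10 : L1 (fun=> 0).
Proof. exact: integrable0. Qed.

Lemma L1_abs f : L1 f -> L1 (fun x => `|f x|).
Proof.
move=> h; apply: (le_integrable measurableT _ _ h).
 apply/measurable_EFinP; apply: measurableT_comp => //; exact: L1_mfun.
by move=> x _ /=; rewrite normr_id.
Qed.

Lemma L1_sum (J : Type) (s : seq J) (P : pred J) (F : J -> T -> R) :
 (forall j, P j -> L1 (F j)) -> L1 (fun x => \sum_(j <- s | P j) F j x).
Proof.
move=> h; elim: s => [|j s IH].
 by rewrite (_ : (fun _ => _) = fun=> 0); [exact: L10|apply/funext => x; rewrite big_nil].
rewrite (_ : (fun _ => _) = fun x => (if P j then F j x else 0) + \sum_(k <- s | P k) F k x).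
 apply: L1D => //; case Pj: (P j); first exact: h. exact: L10.
by apply/funext => x; rewrite big_cons; case: ifP; rewrite ?add0r.
Qed.

Lemma L1M f g C : L1 f -> mfun g -> (forall x, `|g x| <= C) ->
 L1 (fun x => f x * g x).
Proof.
move=> lf mg gC; apply: (@L1_le _ (fun x => C * `|f x|)).
- apply: measurable_funM => //; exact: L1_mfun.
- by move=> x; rewrite normrM mulrC ler_wpM2r.
- exact/L1Z/L1_abs.
Qed.

Lemma ID f g : L1 f -> L1 g -> I (fun x => f x + g x) = I f + I g.
Proof. exact: RintegralD. Qed.

Lemma IB f g : L1 f -> L1 g -> I (fun x => f x - g x) = I f - I g.
Proof. exact: RintegralB. Qed.

Lemma IZ c f : L1 f -> I (fun x => c * f x) = c * I f.
Proof. by move=> h; rewrite RintegralZl. Qed.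

Lemma I0 : I (fun=> 0 : R) = 0.
Proof. by rewrite Rintegral_cst// mul0r. Qed.

Lemma I_sum (J : Type) (s : seq J) (P : pred J) (F : J -> T -> R) :
 (forall j, P j -> L1 (F j)) ->
 I (fun x => \sum_(j <- s | P j) F j x) = \sum_(j <- s | P j) I (F j).
Proof.
move=> h; elim: s => [|j s IH].
 rewrite big_nil -[RHS]I0; congr Rintegral. by apply/funext => x; rewrite big_nil.
rewrite big_cons -IH; case: ifP => Pj; last first.
 by congr Rintegral; apply/funext => x; rewrite big_cons Pj.
rewrite -ID; [|exact: h|exact: L1_sum].
by congr Rintegral; apply/funext => x; rewrite big_cons Pj.
Qed.

Lemma I_le f g : L1 f -> L1 g -> (forall x, f x <= g x) -> I f <= I g.
Proof. by move=> h1 h2 h; apply: le_Rintegral => // x _; exact: h. Qed.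

Lemma I_ge0 f : (forall x, 0 <= f x) -> 0 <= I f.
Proof. by move=> h; apply: Rintegral_ge0. Qed.

Lemma I_abs f : L1 f -> `|I f| <= I (fun x => `|f x|).
Proof. by move=> h; exact: le_normr_Rintegral. Qed.

Lemma I_abs_le f g : L1 f -> L1 g -> (forall x, `|f x| <= g x) -> `|I f| <= I g.
Proof.
move=> lf lg h; rewrite (le_trans (I_abs lf))// I_le//; exact: L1_abs.
Qed.

Lemma L1_EFin f : L1 f -> (\int[mu]_x (f x)%:E)%E = (I f)%:E.
Proof. by move=> h; rewrite /Rintegral fineK//; apply: integrable_fin_num. Qed.

Lemma I_ae f g : mfun f -> mfun g ->
 {ae mu, forall x, f x = g x} -> I f = I g.
Proof.
move=> mf mg h; rewrite /Rintegral; congr fine.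
apply: ae_eq_integral => //; [exact/measurable_EFinP|exact/measurable_EFinP|].
by move: h; apply: filterS => x e _ /=; rewrite e.
Qed.

Lemma L1_ae f g : mfun g -> {ae mu, forall x, f x = g x} -> L1 f -> L1 g.
Proof.
move=> mg h lf; have mf := L1_mfun lf.
have /integrableP[_ foo] := lf; apply/integrableP; split; first exact/measurable_EFinP.
rewrite (_ : \int[mu]_x `|(EFin \o g) x| = \int[mu]_x `|(EFin \o f) x|)%E//.
apply: ae_eq_integral => //; try (apply: measurableT_comp => //; exact/measurable_EFinP).
by move: h; apply: filterS => x e _ /=; rewrite e.
Qed.

Lemma I_DCT (f_ : nat -> T -> R) f g : (forall k, mfun (f_ k)) ->
 mfun f -> {ae mu, forall x, f_ ^~ x @ \oo --> f x} ->
 L1 g -> {ae mu, forall x, forall k, `|f_ k x| <= g x} ->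
 [/\ L1 f, I (fun x => `|f_ k x - f x|) @[k --> \oo] --> 0 & I (f_ k) @[k --> \oo] --> I f].
Proof.
move=> mf_ mf cf lg fg.
have [|||||h1 h2 h3] := @dominated_convergence _ T R mu setT measurableT
 (fun k => EFin \o f_ k) (EFin \o f) (EFin \o g).
- by move=> k; exact/measurable_EFinP.
- exact/measurable_EFinP.
- by apply: filterS cf => x h _ /=; apply/fine_cvgP; split; [near=> k|].
- exact: lg.
- by apply: filterS fg => x h k _ /=; rewrite lee_fin.
have lf_ k : L1 (f_ k).
 apply: (@L1_ae (fun x => if `|f_ k x| <= g x then f_ k x else 0)) => //.
  apply: filterS fg => x ->//.
 apply: (@L1_le _ (fun x => `|g x|)); last exact: L1_abs.
  apply: measurable_fun_ifT => //; apply: measurable_fun_ler => //.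
   exact: measurableT_comp.
  exact: L1_mfun.
 by move=> x; case: ifP => [h|_]; rewrite ?normr0// (le_trans h)// ler_norm.
split => //.
- exact: (fine_fcvg h2).
- by move: h3; rewrite [X in _ --> X](L1_EFin h1) => h3; exact: (fine_fcvg h3).
Unshelve. all: by end_near. Qed.

End functions.

(** * Boxes, uniqueness of the Lebesgue measure, translations and Fubini *)

Section boxes.
Context {R}.
(** Half-open sides make the boxes a pi-system generating the sigma-algebra and make the cells of a
    lattice disjoint. *)
Definition hbox n (a b : 'rV[R]_n) : set 'rV[R]_n :=
 [set x | forall i, x ord0 i \in `]a ord0 i, b ord0 i]].

Lemma mf_hbox n (a b : 'rV[R]_n) : measurable (hbox a b).
Proof. exact: (measurable_box (fun i => `]a ord0 i, b ord0 i])). Qed.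

Lemma rV_hbox n (a b : 'rV[R]_n) : (forall i, a ord0 i <= b ord0 i) ->
 lebesgue_rV n (hbox a b) = (\prod_(i < n) (b ord0 i - a ord0 i))%:E.
Proof.
elim: n => [|n IH] in a b * => ab.
 by rewrite /= big_ord0 diracE mem_set//= => -[].
pose t (x : 'rV[R]_n.+1) : 'rV[R]_n := \row_j x ord0 (sc j).
have E : @rV_cons R n @^-1` (hbox a b) =
 `]a ord0 ord0, b ord0 ord0]%classic `*` hbox (t a) (t b). apply/seteqP; split => -[c x] /=.
  move=> h; split; first by have := h ord0; rewrite mxE unlift_none.
  by move=> i; have := h (sc i); rewrite !mxE liftK.
 move=> [hc hx] i; rewrite mxE; case: (unliftP ord0 i) => [j ->|->] //=. by have := hx j; rewrite !mxE.
rewrite [LHS]/= /lebesgue_rV_step /pushforward E.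
rewrite product_measure1E//; last exact: mf_hbox.
rewrite IH; last by move=> i; rewrite !mxE.
rewrite big_ord_recl EFinM; congr (_ * _)%E.
 apply: (etrans (lebesgue_measure_itv _)); rewrite /= lte_fin.
 have := ab ord0; rewrite le_eqVlt => /orP[/eqP ->|->]; last by rewrite EFinB. by rewrite ltxx subrr.
by congr EFin; apply: eq_bigr => i _; rewrite !mxE.
Qed.

Lemma hboxI n (a b a' b' : 'rV[R]_n) : hbox a b `&` hbox a' b' =
 hbox (\row_i Num.max (a ord0 i) (a' ord0 i)) (\row_i Num.min (b ord0 i) (b' ord0 i)).
Proof.
apply/seteqP; split => x /=.
 move=> [h1 h2] i; have := h1 i; have := h2 i; rewrite !in_itv/= !mxE.
 by rewrite gt_max le_min => /andP[-> ->] /andP[-> ->].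
move=> h; split => i; have := h i; rewrite !in_itv/= !mxE gt_max le_min.
 by move=> /andP[/andP[-> _] /andP[-> _]].
by move=> /andP[/andP[_ ->] /andP[_ ->]].
Qed.

Definition hboxes n : set (set 'rV[R]_n) := [set A | exists a b, A = hbox a b].

Lemma hboxesI n : setI_closed (@hboxes n).
Proof.
move=> _ _ [a [b ->]] [a' [b' ->]]; rewrite hboxI.
by exists (\row_i Num.max (a ord0 i) (a' ord0 i)), (\row_i Num.min (b ord0 i) (b' ord0 i)).
Qed.

Definition cst_box n (r : R) : set 'rV[R]_n := hbox (const_mx (- r)) (const_mx r).
Local Arguments cst_box : clear implicits.

Lemma cst_box_cover n : \bigcup_k (@cst_box n k%:R) = setT.
Proof.
apply/seteqP; split => // x _.
exists (Num.truncn `|x|).+1 => //= i; rewrite !mxE in_itv/=.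
have : `|x ord0 i| < (Num.truncn `|x|).+1%:R.
 by rewrite (le_lt_trans (coord_le _ _))// truncnS_gt.
by rewrite ltr_norml => /andP[-> /ltW ->].
Qed.

Lemma measurable_hboxes n : @measurable _ 'rV[R]_n = <<s @hboxes n >>.
Proof.
apply/seteqP; split; last first.
 apply: smallest_sub; first exact: sigma_algebra_measurable. by move=> _ [a [b ->]]; exact: mf_hbox.
rewrite /measurable/=; apply: smallest_sub; first exact: smallest_sigma_algebra.
rewrite -bigcup_seq => A [i _ [B mB <-]]; rewrite setTI.
suff : (@ocitv R).-sigma.-measurable `<=` [set Y : set R | <<s @hboxes n >> (rV_coord i @^-1` Y)] by apply.
apply: smallest_sub.
 have [h0 hC hU] := smallest_sigma_algebra setT (@hboxes n); split => /=.
 - by rewrite preimage_set0.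
 - move=> Y hY; rewrite setTD preimage_setC -setTD; exact: hC.
 - move=> F hF; rewrite preimage_bigcup; exact: hU.
move=> _ [[a b] _ <-] /=.
(* The slab is exhausted by boxes that are bounded by k in all the other coordinates. *)
rewrite (_ : _ @^-1` _ = \bigcup_k hbox
  (\row_j if j == i then a else - k%:R) (\row_j if j == i then b else k%:R)).
 have [h0 hC hU] := smallest_sigma_algebra setT (@hboxes n).
 by apply: hU => k; apply: sub_sigma_algebra; eexists; eexists.
apply/seteqP; split => x /=.
 move=> h; have : (\bigcup_k (@cst_box n k%:R)) x by rewrite cst_box_cover.
 move=> [k _ hk]; exists k => // j; rewrite !mxE; have := hk j; rewrite !mxE. by case: eqP => [->|//].
by move=> [k _ /(_ i)]; rewrite !mxE eqxx.
Qed.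

Lemma cst_box_lty n (r : R) : (lebesgue_rV n (cst_box n r) < +oo)%E.
Proof.
have [r0|r0] := leP 0 r.
 rewrite rV_hbox ?ltry// => i; rewrite !mxE. by rewrite lerNl (le_trans _ r0)// lerNl oppr0.
rewrite /cst_box; case: n => [|n].
 by rewrite /= diracE; case: (_ \in _) => //; rewrite ltry.
rewrite (_ : hbox _ _ = set0) ?measure0//.
apply/seteqP; split => // x /(_ ord0); rewrite !mxE in_itv/= => /andP[h1 h2].
by have := lt_le_trans h1 h2; lra.
Qed.

(** Two measures that agree on a pi-system of sets exhausting the space agree; below this is applied
    to the image of the measure under a translation. *)
Lemma lebesgue_rV_unique n (m : {measure set 'rV[R]_n -> \bar R}) :
 (forall a b : 'rV[R]_n, (forall i, a ord0 i <= b ord0 i) ->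
   m (hbox a b) = (\prod_(i < n) (b ord0 i - a ord0 i))%:E) ->
 forall A, measurable A -> lebesgue_rV n A = m A.
Proof.
move=> mE A mA.
apply: (@measure_unique _ _ _ (@hboxes n) (fun k => cst_box n k%:R) _ _ _ _ (lebesgue_rV n) m) => //.
- exact: measurable_hboxes.
- exact: hboxesI.
- by move=> i; eexists; eexists.
- exact: cst_box_cover.
- move=> _ [a [b ->]].
 have [ab|/existsNP[i /negP]] := pselect (forall i, a ord0 i <= b ord0 i).
  exact: etrans (rV_hbox ab) (esym (mE _ _ ab)).
 rewrite -ltNge => ba; rewrite (_ : hbox a b = set0) ?measure0//.
 apply/seteqP; split => // x /(_ i); rewrite in_itv/= => /andP[h1 h2].
 by have := lt_le_trans h1 h2; rewrite ltNge (ltW ba).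
- move=> k; exact: cst_box_lty.
Qed.

Lemma measurable_shift n (v : 'rV[R]_n) : mfun (fun x : 'rV[R]_n => x + v).
Proof.
apply: measurable_fun_rVP => i.
rewrite (_ : _ \o _ = fun x : 'rV[R]_n => (x ord0 i + v ord0 i)%R).
 apply: measurable_funD => //; exact: coord_mf.
by apply/funext => x; rewrite /rV_coord/= mxE.
Qed.

Lemma lebesgue_rV_shift n (v : 'rV[R]_n) A : measurable A ->
 lebesgue_rV n A = pushforward (lebesgue_rV n) (fun x => x + v) A.
Proof.
move=> mA.
have mv := measurable_shift v.
pose m : {measure set 'rV[R]_n -> \bar R} :=
 measure_function_pushforward__canonical__measure_function_Measure (lebesgue_rV n) mv.
rewrite -[RHS]/(m A).
apply: lebesgue_rV_unique => // a b ab; rewrite /m/= /pushforward.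
rewrite (_ : _ @^-1` _ = hbox (a - v) (b - v)).
 rewrite rV_hbox; last by move=> i; rewrite !mxE lerD2r. by congr EFin; apply: eq_bigr => i _; rewrite !mxE; ring.
by apply/seteqP; split => x h i; have := h i; rewrite !in_itv/= !mxE ltrBlDr lerBrDr.
Qed.

End boxes.
Arguments cst_box {R} n r.

Section integrals.
Context {R}.
Lemma L1_shift n (f : 'rV[R]_n -> R) v : L1 mu f ->
 L1 mu (fun x => f (x + v)) /\ I (fun x => f (x + v)) = I f.
Proof.
move=> lf; have mv := measurable_shift v.
have mf := L1_mfun lf.
have E : (\int[mu]_x `|(f (x + v))%:E| = \int[mu]_x `|(f x)%:E|)%E.
 transitivity (\int[pushforward (lebesgue_rV n) (fun x => (x + v)%R)]_x `|(f x)%:E|)%E.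
  rewrite ge0_integral_pushforward//. by apply/measurable_EFinP; apply: measurableT_comp.
 by apply: eq_measure_integral => A mA _; exact/esym/lebesgue_rV_shift.
have l2 : L1 mu (fun x => f (x + v)).
 have /integrableP[_ foo] := lf; apply/integrableP; split; last by rewrite E.
 by apply/measurable_EFinP; apply: measurableT_comp => //.
split => //; rewrite /Rintegral; congr fine.
transitivity (\int[pushforward (lebesgue_rV n) (fun x => (x + v)%R)]_x (f x)%:E)%E.
 rewrite integral_pushforward//; exact/measurable_EFinP.
by apply: eq_measure_integral => A mA _; exact/esym/lebesgue_rV_shift.
Qed.

Lemma L1_bounded n (f : 'rV[R]_n -> R) (C r : R) : mfun f ->
 (forall x, `|f x| <= C) -> (forall x, r < `|x| -> f x = 0) -> L1 mu f.
Proof.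
move=> mf fC f0.
apply: (@L1_le _ _ _ _ _ (fun x => C * \1_(cst_box n (`|r| + 1)) x)) => //.
 move=> x; rewrite indicE; case: (boolP (x \in _)) => [_|]; first by rewrite mulr1.
 rewrite notin_setE mulr0 => h; rewrite f0 ?normr0//.
 rewrite ltNge; apply/negP => xr; apply: h => i; rewrite !mxE in_itv/=.
 have : `|x ord0 i| <= r by rewrite (le_trans (coord_le _ _)).
 by rewrite ler_norml => /andP[h1 h2]; have := ler_norm r; lra.
apply: L1Z; apply/integrableP; split.
 apply/measurable_EFinP; apply: measurable_indic; exact: mf_hbox.
rewrite (eq_integral (fun x => (\1_(cst_box n (`|r| + 1)) x)%:E)) => [|x _].
 rewrite integral_indic// ?setIT; first exact: cst_box_lty. exact: mf_hbox.
by rewrite /= ger0_norm.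
Qed.

Lemma lebesgue_rV_Fubini n (f : 'rV[R]_n.+1 -> R) : L1 (lebesgue_rV n.+1) f ->
 (\int[lebesgue_rV n.+1]_x (f x)%:E =
  \int[la]_t \int[mu]_y (f (rV_cons (t, y)))%:E)%E.
Proof.
move=> lf; have mf := L1_mfun lf.
have mc := @measurable_rV_cons R n.
have lc : (la \x lebesgue_rV n)%E.-integrable setT (EFin \o (f \o @rV_cons R n)).
 have /integrableP[_ foo] := lf; apply/integrableP; split.
  by apply/measurable_EFinP; apply: measurableT_comp.
 move: foo; rewrite /= ge0_integral_pushforward//. apply/measurable_EFinP; exact: measurableT_comp.
rewrite -[RHS]/(\int[la]_t (fubini_F (lebesgue_rV n) (EFin \o (f \o @rV_cons R n))) t)%E.
rewrite integral12_prod_meas1//.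
rewrite /= integral_pushforward//; exact/measurable_EFinP.
Qed.

Lemma lebesgue_rV_Tonelli n (f : 'rV[R]_n.+1 -> \bar R) : mfun f ->
 (forall x, 0 <= f x)%E ->
 (\int[lebesgue_rV n.+1]_x f x =
  \int[la]_t \int[mu]_y f (rV_cons (t, y)))%E.
Proof.
move=> mf f0; have mc := @measurable_rV_cons R n.
rewrite /= ge0_integral_pushforward//=.
rewrite (fubini_tonelli1 (f \o @rV_cons R n))//=.
exact: measurableT_comp.
Qed.


(** Cauchy criterion with countably many conditions: continuity away from 0 allows any increment to
    be replaced by a rational one. It makes the set of points of differentiability measurable. *)
Lemma cvg_dnbhs0_ratP (g : R -> R) : (forall h, h != 0 -> {for h, continuous g}) ->
 cvg (g @ 0^') <->
 forall m : nat, exists k : nat, forall q q' : rat, q != 0 -> q' != 0 ->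
  `|ratr q : R| < k.+1%:R^-1 -> `|ratr q' : R| < k.+1%:R^-1 ->
  `|g (ratr q) - g (ratr q')| <= m.+1%:R^-1.
Proof.
move=> gc; split.
 move=> /cvg_ex[l] /cvgrPdist_lt gl m. have m2 : 0 < m.+1%:R^-1 / 2 :> R by rewrite divr_gt0.
 have /gl [e /= e0 he] := m2.
 have [k hk] : exists k : nat, k.+1%:R^-1 < e by exists (Num.truncn e^-1); rewrite invf_plt ?posrE// truncnS_gt.
 exists k => q q' q0 q'0 qk q'k.
 have h1 : `|l - g (ratr q)| < m.+1%:R^-1 / 2 by apply: he; rewrite /= ?sub0r ?normrN ?(lt_trans qk)// fmorph_eq0.
 have h2 : `|l - g (ratr q')| < m.+1%:R^-1 / 2 by apply: he; rewrite /= ?sub0r ?normrN ?(lt_trans q'k)// fmorph_eq0.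
 have -> : g (ratr q) - g (ratr q') = (l - g (ratr q')) - (l - g (ratr q)) by ring.
 by rewrite le_normB// [leRHS]splitr lerD// ltW.
move=> H; apply: cauchy_cvg; apply/cauchy_exP => e e0.
have [m hm] : exists m : nat, m.+1%:R^-1 < e / 2.
 have e2 : 0 < e / 2 by rewrite divr_gt0. by exists (Num.truncn (e / 2)^-1); rewrite invf_plt ?posrE// truncnS_gt.
have [k hk] := H m.
have approx h d : h != 0 -> `|h| < k.+1%:R^-1 -> 0 < d ->
  exists q : rat, [/\ q != 0, `|ratr q : R| < k.+1%:R^-1 & `|g h - g (ratr q)| < d].
 move=> h0 hh d0. have /cvgrPdist_lt/(_ _ d0) [r /= r0 hr] := gc _ h0.
 pose s := Num.min r (Num.min `|h| (k.+1%:R^-1 - `|h|)). have s0 : 0 < s by rewrite !lt_min r0 normr_gt0 h0 subr_gt0.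
 have [|q] := @rat_in_itvoo R (h - s) (h + s); first by rewrite ltrD2l gtrN. rewrite in_itv/= -ltr_distlC => hq.
 have [sr sh sk] : [/\ s <= r, s <= `|h| & s <= k.+1%:R^-1 - `|h|] by rewrite /s !ge_min !lexx !orbT.
 have dq := ler_dist_dist h (ratr q); have dq' := ler_dist_dist (ratr q) h. rewrite distrC in dq'. exists q; split.
 - rewrite -(fmorph_eq0 (ratr : rat -> R)); apply/eqP => q0.
  by move: hq; rewrite q0 subr0 => hq; have := lt_le_trans hq sh; rewrite ltxx.
 - have : `|ratr q : R| <= `|h| + `|h - ratr q| by rewrite -[X in `|X| <= _](subKr h) le_normB.
  move=> h7; apply: (le_lt_trans h7). by rewrite -ltrBrDl (lt_le_trans hq).
 - apply: hr => /=; exact: lt_le_trans sr.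
pose q0 : rat := (k.+2%:R)^-1.
have q0n : q0 != 0 by rewrite invr_eq0.
have q0k : `|ratr q0 : R| < k.+1%:R^-1 by rewrite fmorphV /= ratr_nat ger0_norm// ltf_pV2 ?posrE// ltr_nat.
exists (g (ratr q0)); exists k.+1%:R^-1 => //= h; rewrite /ball/= sub0r normrN => hh h0.
have e4 : 0 < e / 2 by rewrite divr_gt0.
have [q [qn qk gq]] := approx h _ h0 hh e4.
have := hk q0 q q0n qn q0k qk => h1.
have -> : g (ratr q0) - g h = (g (ratr q0) - g (ratr q)) - (g h - g (ratr q)) by ring.
by rewrite (le_lt_trans (ler_normB _ _))// [ltRHS]splitr ler_ltD// (le_trans h1)// ltW.
Qed.

End integrals.

(** * Difference quotients and measurability of partial derivatives *)

Section partials.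
Context {R n}.
Implicit Types (f g : 'rV[R]_n -> R) (i : 'I_n).
Local Notation e_ i := (delta_mx ord0 i : 'rV[R]_n).
Definition dquot i f (h : R) x := h^-1 * (f (h *: e_ i + x) - f x).

Lemma norm_delta i : `|e_ i| = 1.
Proof.
apply/eqP; rewrite eq_le; apply/andP; split.
 apply: norm_le => // j; rewrite mxE eqxx /=. by case: (j == i); rewrite ?normr1 ?normr0.
by have := coord_le (e_ i) i; rewrite mxE !eqxx normr1.
Qed.

Lemma derivable_dquot i f x : derivable f x (e_ i) <-> cvg (dquot i f ^~ x @ 0^').
Proof. by []. Qed.

Lemma partial_dquot i f x : partial i f x = lim (dquot i f ^~ x @ 0^').
Proof. by []. Qed.

Lemma dquot_bound i f L h x : 0 <= L -> lipc L f -> `|dquot i f h x| <= L.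
Proof.
move=> L0 fL; rewrite /dquot normrM.
have [->|h0] := eqVneq h 0; first by rewrite invr0 normr0 mul0r.
rewrite normfV ler_pdivrMl ?normr_gt0// mulrC (le_trans (fL _ _))//.
by rewrite addrK normrZ norm_delta mulr1.
Qed.

Lemma dquot_continuous i f x h : continuous f -> h != 0 ->
 {for h, continuous (dquot i f ^~ x)}.
Proof.
move=> cf h0; apply: (@cvgM _ _ (nbhs h)); first exact: (cvgV h0 cvg_id).
apply: cvgB; last exact: cvg_cst.
have c : (fun k : R => k *: e_ i + x) @ h --> h *: e_ i + x.
 move=> A /nbhs_rVP [e e0 he]; exists e => //= k hk; apply: he.
 by rewrite opprD addrACA subrr addr0 -scalerBl normrZ norm_delta mulr1.
exact: (cvg_comp _ _ c (cf _)).
Qed.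

Lemma partial_bound i f L x : 0 <= L -> lipc L f -> `|partial i f x| <= L.
Proof.
move=> L0 fL; rewrite partial_dquot.
(* A limit that does not exist takes the default value 0, so the bound holds at every point. *)
have [c|nc] := pselect (cvg (dquot i f ^~ x @ 0^')); last first.
 by rewrite (dvgP nc) /= normr0.
have cl : dquot i f ^~ x @ 0^' --> lim (dquot i f ^~ x @ 0^') by [].
have cn := cvg_norm (FF := dnbhs_filter _) cl.
apply: (closed_cvg (fun y : R => y <= L) _ _ _ cn).
 exact: closed_le.
near=> h; exact: dquot_bound.
Unshelve. all: by end_near. Qed.

Lemma dquot_measurable i f h : continuous f -> mfun (dquot i f h).
Proof.
move=> cf; have mf := continuous_mf cf.
apply: measurable_funM => //; apply: measurable_funB => //.
apply: (measurableT_comp mf).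
rewrite (_ : +%R _ = fun x => x + h *: e_ i); first exact: measurable_shift.
by apply/funext => x; rewrite addrC.
Qed.

Definition dset i f : set 'rV[R]_n := [set x | derivable f x (e_ i)].

(** By the rational criterion the set is a countable combination of sets on which two given
    difference quotients are close. *)
Lemma derivable_mf i f : continuous f -> measurable (dset i f).
Proof.
move=> cf.
pose P (m k : nat) (q : rat * rat) : set 'rV[R]_n :=
 if [&& q.1 != 0, q.2 != 0, `|ratr q.1 : R| < k.+1%:R^-1 & `|ratr q.2 : R| < k.+1%:R^-1]
 then [set x | `|dquot i f (ratr q.1) x - dquot i f (ratr q.2) x| <= m.+1%:R^-1]
 else setT.
have -> : dset i f = \bigcap_m \bigcup_k \bigcap_q P m k q.
 apply/seteqP; split => x.
  move=> /derivable_dquot/cvg_dnbhs0_ratP => /(_ (fun h => @dquot_continuous i f x h cf)) H m _.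
  have [k hk] := H m; exists k => // -[q q'] _; rewrite /P /=. by case: ifP => // /and4P[h1 h2 h3 h4]; exact: hk.
 move=> H; apply/derivable_dquot/cvg_dnbhs0_ratP.
  move=> h h0; exact: dquot_continuous.
 move=> m; have [k _ hk] := H m Logic.I; exists k => q q' h1 h2 h3 h4.
 by have := hk (q, q') Logic.I; rewrite /P /= h1 h2 h3 h4.
apply: bigcapT_measurable => m; apply: bigcupT_measurable => k.
rewrite -[X in measurable X]setCK setC_bigcap; apply: measurableC.
apply: countable_bigcupT_measurable => [|q]; first exact: countableP.
apply: measurableC; rewrite /P; case: ifP => // _.
rewrite -[X in measurable X]setTI.
have m1 : mfun (fun x => `|dquot i f (ratr q.1) x - dquot i f (ratr q.2) x|).
 apply: measurableT_comp => //; apply: measurable_funB; exact: dquot_measurable.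
have := m1 measurableT _ (measurable_itv `]-oo, m.+1%:R^-1]).
by congr (measurable _); apply/seteqP; split => x /=; rewrite in_itv/=.
Qed.

Lemma cvg_dquot_seq i f x : derivable f x (e_ i) ->
 dquot i f (k.+1%:R^-1) x @[k --> \oo] --> partial i f x.
Proof.
move=> /derivable_dquot c; rewrite partial_dquot.
have cl : dquot i f ^~ x @ 0^' --> lim (dquot i f ^~ x @ 0^') by [].
apply: (cvg_comp (fun k : nat => k.+1%:R^-1 : R) (dquot i f ^~ x) _ cl).
move=> A [e /= e0 he]; near=> k; apply: he => /=; last by rewrite invr_neq0.
rewrite sub0r normrN.
near: k; have := @cvg_harmonic R; move=> /cvgr0Pnorm_lt/(_ _ e0); exact.
Unshelve. all: by end_near. Qed.

(** Multiplied by the indicator of [dset], the quotients for the increments 1/(k+1) converge at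
    every point, also where [partial] has its default value 0. *)
Lemma partial_mf i f : continuous f -> mfun (partial i f).
Proof.
move=> cf; have mD := derivable_mf i cf.
have -> : partial i f = (fun x => limn (fun k => (dquot i f (k.+1%:R^-1) x) * \1_(dset i f) x)).
 apply/funext => x; apply/esym/cvg_lim => //; rewrite indicE. have [/set_mem/= h|] := boolP (x \in dset i f).
  under eq_fun do rewrite mulr1; exact: cvg_dquot_seq.
 rewrite notin_setE => nc; under eq_fun do rewrite mulr0. rewrite partial_dquot dvgP; first exact: cvg_cst. exact: nc.
apply: (measurable_fun_cvg (h := fun k x => (dquot i f (k.+1%:R^-1) x) * \1_(dset i f) x)).
 by move=> k; apply: measurable_funM; [exact: dquot_measurable|exact: measurable_indic].
move=> x _; rewrite indicE.
have [/set_mem/= h|_] := boolP (x \in dset i f).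
 under eq_fun do rewrite mulr1; apply: cvgP; exact: cvg_dquot_seq h.
by under eq_fun do rewrite mulr0; apply: is_cvg_cst.
Qed.

End partials.

(** * Existence of partial derivatives of Lipschitz functions almost everywhere *)

Section ae.
Context {R}.
Lemma lebesgue_rV_Tonelli2 n (f : 'rV[R]_n.+1 -> \bar R) : mfun f ->
 (forall x, 0 <= f x)%E ->
 (\int[lebesgue_rV n.+1]_x f x =
  \int[mu]_y \int[la]_t f (rV_cons (t, y)))%E.
Proof.
move=> mf f0; have mc := @measurable_rV_cons R n.
rewrite lebesgue_rV_Tonelli//.
rewrite (fubini_tonelli (f \o @rV_cons R n))//=.
exact: measurableT_comp.
Qed.

Lemma rV_cons_norm n (p q : R * 'rV[R]_n) :
 `|rV_cons p - rV_cons q| <= Num.max `|p.1 - q.1| `|p.2 - q.2|.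
Proof.
apply: norm_le; first by rewrite le_max normr_ge0.
move=> i; rewrite !mxE; case: (unliftP ord0 i) => [j _|_] /=; rewrite le_max.
 by have := coord_le (p.2 - q.2) j; rewrite !mxE => ->; rewrite orbT.
by rewrite lexx.
Qed.

Lemma ae0_integral d (T : measurableType d) (mu : {measure set T -> \bar R})
 (f : T -> \bar R) : mfun f -> {ae mu, forall x, f x = 0%E} ->
 (\int[mu]_x f x = 0)%E.
Proof.
move=> mf h; rewrite -[RHS](integral0 mu setT); apply: ae_eq_integral => //.
by apply: filterS h => x /= -> _.
Qed.

Lemma measurable_rV_cons1 n (y : 'rV[R]_n) :
 mfun (fun t : measurableTypeR R => rV_cons (t, y)).
Proof. by apply: measurableT_comp => //; exact: measurable_rV_cons. Qed.

Lemma measurable_rV_cons2 n (t : R) :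
 mfun (fun y : 'rV[R]_n => rV_cons (t, y)).
Proof. by apply: measurableT_comp => //; exact: measurable_rV_cons. Qed.

Lemma derivable_rV_cons2 n (f : 'rV[R]_n.+1 -> R) (j : 'I_n) t y :
 derivable f (rV_cons (t, y)) (delta_mx ord0 (sc j)) =
 derivable (fun z => f (rV_cons (t, z))) y (delta_mx ord0 j).
Proof.
change (cvg (dquot (sc j) f ^~ (rV_cons (t, y)) @ 0^') =
 cvg (dquot j (fun z => f (rV_cons (t, z))) ^~ y @ 0^')).
suff -> : dquot (sc j) f ^~ (rV_cons (t, y)) =
 dquot j (fun z => f (rV_cons (t, z))) ^~ y by [].
apply/funext => h; rewrite /dquot; congr (_ * (f _ - _)).
apply/rowP => k; rewrite !mxE eqxx /=.
case: (unliftP ord0 k) => [l ->|->] /=.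
 by rewrite !mxE eqxx /= (inj_eq (@lift_inj _ _)).
by rewrite mulr0 add0r.
Qed.

Lemma derivable_rV_cons1 n (f : 'rV[R]_n.+1 -> R) t y :
 derivable f (rV_cons (t, y)) (delta_mx ord0 ord0) =
 derivable (fun z : R => f (rV_cons (z, y))) t 1.
Proof.
change (cvg (dquot ord0 f ^~ (rV_cons (t, y)) @ 0^') =
 cvg ((fun h : R => h^-1 * (f (rV_cons (h * 1 + t, y)) - f (rV_cons (t, y)))) @ 0^')).
suff -> : dquot ord0 f ^~ (rV_cons (t, y)) =
 (fun h : R => h^-1 * (f (rV_cons (h * 1 + t, y)) - f (rV_cons (t, y)))) by [].
apply/funext => h; rewrite /dquot; congr (_ * (f _ - _)).
apply/rowP => k; rewrite !mxE eqxx /=.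
case: (unliftP ord0 k) => [l ->|->] /=; first by rewrite !mulr0 add0r.
by [].
Qed.

(** The exceptional set is measurable, so its measure can be computed on slices: lines for the first
    coordinate, where the one-dimensional case applies, and hyperplanes for any other coordinate,
    where induction applies. *)
Lemma lip_ae_derivable n (f : 'rV[R]_n -> R) L (i : 'I_n) : lipc L f ->
 {ae mu, forall x, derivable f x (delta_mx ord0 i)}.
Proof.
elim: n f L i => [|n IH] f L i fL; first by case: i.
have cf := lipc_cont fL.
have mD := derivable_mf i cf.
exists (~` dset i f); split => //; first exact: measurableC.
have mC := measurableC mD.
rewrite -[X in _ X = _]setIT -[LHS](integral_indic (lebesgue_rV n.+1) measurableT mC).
have mi : mfun (fun x => (\1_(~` dset i f) x)%:E : \bar R).
 apply/measurable_EFinP; exact: measurable_indic.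
have i0 x : (0 <= (\1_(~` dset i f) x)%:E :> \bar R)%E by rewrite lee_fin.
have i01 x : derivable f x (delta_mx ord0 i) -> (\1_(~` dset i f) x)%:E = 0%E :> \bar R.
 move=> h; rewrite indicE memNset//; apply; exact: h.
have [j ij|j0] := unliftP ord0 i.
 rewrite lebesgue_rV_Tonelli//. rewrite (eq_integral (fun=> 0%E)) ?integral0// => t _ /=. apply: ae0_integral.
  apply: (measurableT_comp mi); exact: measurable_rV_cons2.
 have ftL : lipc `|L| (fun y => f (rV_cons (t, y))).
  move=> y z; rewrite (le_trans (fL _ _))// (le_trans (ler_wpM2r _ (ler_norm L)))//.
  by rewrite ler_wpM2l// (le_trans (rV_cons_norm _ _))//= subrr normr0 ge_max normr_ge0 lexx.
 have := IH _ _ (j : 'I_n) ftL; apply: filterS => y dy; apply: i01. by rewrite ij derivable_rV_cons2.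
rewrite lebesgue_rV_Tonelli2//.
rewrite (eq_integral (fun=> 0%E)) ?integral0// => y _ /=.
apply: ae0_integral.
 apply: (measurableT_comp mi); exact: measurable_rV_cons1.
have ftL t s : `|f (rV_cons (t, y)) - f (rV_cons (s, y))| <= `|L| * `|t - s|.
 rewrite (le_trans (fL _ _))// (le_trans (ler_wpM2r _ (ler_norm L)))//.
 by rewrite ler_wpM2l// (le_trans (rV_cons_norm _ _))//= subrr normr0 ge_max normr_ge0 lexx.
have := lip1_ae_derivable ftL; apply: filterS; first exact: (ae_filter_ringOfSetsType la).
move=> t dt; apply: i01.
by rewrite j0 derivable_rV_cons1.
Qed.

End ae.

(** * Rules for partial derivatives; Lipschitz functions with bounded support *)

Section calculus.
Context {R n}.
Implicit Types (f g : 'rV[R]_n -> R) (i : 'I_n).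
Lemma partial_lin_ae i f g c L M : lipc L f -> lipc M g ->
 {ae mu, forall x, partial i (fun y => c * f y + g y) x =
   c * partial i f x + partial i g x}.
Proof.
move=> fL gM; apply: filterS2 (lip_ae_derivable i fL) (lip_ae_derivable i gM) => x df dg.
rewrite /partial (_ : (fun y => _) = c *: f + g)//.
rewrite deriveD ?deriveZ//; exact: derivableZ.
Qed.

Lemma partial_mul_ae i f g L M : lipc L f -> lipc M g ->
 {ae mu, forall x, partial i (fun y => f y * g y) x =
   f x * partial i g x + g x * partial i f x}.
Proof.
move=> fL gM; apply: filterS2 (lip_ae_derivable i fL) (lip_ae_derivable i gM) => x df dg.
by rewrite /partial (_ : (fun y => _) = f * g)// deriveM.
Qed.

Lemma partial_local i f (U : set 'rV[R]_n) c : open U -> (forall x, U x -> f x = c) ->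
 forall x, U x -> partial i f x = 0.
Proof.
move=> oU h x Ux; rewrite /partial -(derive_cst c x (delta_mx ord0 i)).
apply: near_eq_derive; apply/nbhs_rVP.
by have [e e0 he] := (open_rVP U).1 oU x Ux; exists e => // y /he /h.
Qed.

Lemma lipc_bounded f L r : lipc L f -> (forall x, r < `|x| -> f x = 0) ->
 forall x, `|f x| <= `|f 0| + `|L| * `|r|.
Proof.
move=> fL f0 x; have [xr|xr] := leP `|x| `|r|; last first.
 by rewrite f0 ?normr0 ?addr_ge0 ?mulr_ge0// (le_lt_trans (ler_norm r)).
rewrite -[X in `|X| <= _](subrK (f 0)) addrC le_normD// lerD2l.
rewrite (le_trans (fL _ _))// subr0 (le_trans (ler_wpM2r _ (ler_norm L)))//.
by rewrite ler_wpM2l.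
Qed.

Lemma L1_lipc f L r : lipc L f -> (forall x, r < `|x| -> f x = 0) ->
 L1 mu f.
Proof.
move=> fL f0; apply: (L1_bounded _ (lipc_bounded fL f0) f0).
exact: lipc_mfun fL.
Qed.


(** Vanishing at every point outside a ball stands for compact support throughout; densities are
    brought to this form by changing them on null sets. *)
Definition bsupp (r : R) f := forall x, r < `|x| -> f x = 0.
Definition lipb f := exists L r : R, [/\ 0 <= L, lipc L f & bsupp r f].

Lemma lipc_cst (c : R) : lipc 0 (fun _ : 'rV[R]_n => c).
Proof. by move=> x y; rewrite subrr normr0 mul0r. Qed.

Lemma lipcD L M f g : lipc L f -> lipc M g -> lipc (L + M) (fun x => f x + g x).
Proof.
move=> h1 h2 x y; rewrite opprD addrACA le_normD// mulrDl.
by rewrite lerD.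
Qed.

Lemma lipcZ L c f : lipc L f -> lipc (`|c| * L) (fun x => c * f x).
Proof. by move=> h x y; rewrite -mulrBr normrM -mulrA ler_wpM2l. Qed.

Lemma lipcN L f : lipc L f -> lipc L (fun x => - f x).
Proof. by move=> h x y; rewrite -opprD normrN. Qed.

Lemma lipcB L M f g : lipc L f -> lipc M g -> lipc (L + M) (fun x => f x - g x).
Proof. by move=> h1 h2; apply: lipcD => //; exact: lipcN. Qed.

Lemma lipc_sum (J : Type) (s : seq J) (P : pred J) (L : J -> R) (F : J -> 'rV[R]_n -> R) :
 (forall j, P j -> lipc (L j) (F j)) ->
 lipc (\sum_(j <- s | P j) L j) (fun x => \sum_(j <- s | P j) F j x).
Proof.
move=> h x y; rewrite -sumrB mulr_suml le_norm_sum//.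
apply: ler_sum => j Pj; exact: h.
Qed.

Lemma lipcM L M A B f g : 0 <= A -> 0 <= B -> lipc L f -> lipc M g ->
 (forall x, `|f x| <= A) -> (forall x, `|g x| <= B) ->
 lipc (A * M + B * L) (fun x => f x * g x).
Proof.
move=> A0 B0 h1 h2 fA gB x y.
have -> : f x * g x - f y * g y = f x * (g x - g y) + g y * (f x - f y) by ring.
rewrite le_normD// !normrM mulrDl -!mulrA.
by rewrite lerD// ler_pM.
Qed.

Lemma lipc_comp1 (phi : R -> R) L M f : 0 <= M ->
 (forall s t, `|phi s - phi t| <= M * `|s - t|) ->
 lipc L f -> lipc (M * L) (fun x => phi (f x)).
Proof. by move=> M0 hp hf x y; rewrite (le_trans (hp _ _))// -mulrA ler_wpM2l. Qed.

Lemma lipc_coord (i : 'I_n) : lipc 1 (fun x : 'rV[R]_n => x ord0 i).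
Proof. by move=> x y; rewrite mul1r; have := coord_le (x - y) i; rewrite !mxE. Qed.

Definition clamp (t : R) : R := Num.max 0 (Num.min 1 t).
Lemma clamp_ge0 t : 0 <= clamp t. Proof. by rewrite /clamp le_max lexx. Qed.
Lemma clamp_le1 t : clamp t <= 1.
Proof. by rewrite /clamp ge_max ler01 ge_min lexx. Qed.
Lemma clamp_0 t : t <= 0 -> clamp t = 0.
Proof.
move=> t0; apply/eqP; rewrite eq_le clamp_ge0 andbT /clamp ge_max lexx /=.
by rewrite ge_min t0 orbT.
Qed.
Lemma clamp_1 t : 1 <= t -> clamp t = 1.
Proof. by move=> t1; rewrite /clamp (min_l t1) (max_r ler01). Qed.
Lemma clamp_id t : 0 <= t -> t <= 1 -> clamp t = t.
Proof. by move=> t0 t1; rewrite /clamp (min_r t1) (max_r t0). Qed.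
Lemma clamp_norm t : `|clamp t| <= 1.
Proof. by rewrite ger0_norm ?clamp_ge0 ?clamp_le1. Qed.
Lemma clamp_nd s t : s <= t -> clamp s <= clamp t.
Proof.
move=> st; rewrite /clamp ge_max !le_max lexx /= ge_min !le_min.
by case: (lerP 1 s) => s1; [rewrite (le_trans s1 st) lexx !orbT|
 rewrite (ltW s1) st !orbT].
Qed.

Lemma clamp_lip s t : `|clamp s - clamp t| <= 1 * `|s - t|.
Proof.
rewrite mul1r; wlog st : s t / s <= t => [H|].
 by have [/H//|/ltW/H] := leP s t; rewrite distrC (distrC s).
have h := clamp_nd st.
rewrite distrC ger0_norm ?subr_ge0// distrC ger0_norm ?subr_ge0//.
have [t1|t1] := leP t 1; last first.
 have [s0|s0] := leP s 0; first by rewrite (clamp_0 s0); have := clamp_le1 t; lra.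
 have [s1|s1] := leP s 1; last by rewrite (clamp_1 (ltW t1)) (clamp_1 (ltW s1)) subrr subr_ge0.
 by rewrite (clamp_id (ltW s0) s1); have := clamp_le1 t; lra.
have [s0|s0] := leP s 0.
 rewrite (clamp_0 s0); have [t0|t0] := leP t 0; first by rewrite clamp_0//; lra.
 by rewrite (clamp_id (ltW t0) t1); lra.
by rewrite !clamp_id//; lra.
Qed.

Definition cutoff (r : R) (x : 'rV[R]_n) : R := clamp (r + 1 - `|x|).

Lemma cutoff_lip r : lipc 1 (cutoff r).
Proof.
move=> x y; rewrite (le_trans (clamp_lip _ _))// !mul1r.
by have -> : r + 1 - `|x| - (r + 1 - `|y|) = `|y| - `|x|; [ring|rewrite distrC ler_dist_dist].
Qed.

Lemma cutoff1 r x : `|x| <= r -> cutoff r x = 1.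
Proof. by move=> h; rewrite /cutoff clamp_1//; lra. Qed.

Lemma cutoff0 r x : r + 1 <= `|x| -> cutoff r x = 0.
Proof. by move=> h; rewrite /cutoff clamp_0//; lra. Qed.

Lemma cutoff_bsupp r : bsupp (r + 1) (cutoff r).
Proof. by move=> x /ltW; exact: cutoff0. Qed.

Lemma cutoff_norm r x : `|cutoff r x| <= 1. Proof. exact: clamp_norm. Qed.

Lemma bsuppW r s f : r <= s -> bsupp r f -> bsupp s f.
Proof. by move=> rs h x sx; apply: h; exact: le_lt_trans sx. Qed.

Lemma lipbP f : lipb f -> exists L r A : R,
 [/\ 0 <= L /\ 0 <= A, 0 < r, lipc L f, bsupp r f & forall x, `|f x| <= A].
Proof.
move=> [L [r [L0 fL fr]]]; exists L, (`|r| + 1), (`|f 0| + `|L| * `|r|); split.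
- by split => //; rewrite addr_ge0// mulr_ge0.
- by rewrite ltr_wpDl.
- by [].
- by apply: bsuppW fr; rewrite (le_trans (ler_norm r))// lerDl.
- exact: lipc_bounded fL fr.
Qed.

Lemma lipbL1 f : lipb f -> L1 mu f.
Proof. by move=> [L [r [_ fL fr]]]; exact: L1_lipc fL fr. Qed.

Lemma lipb0 : lipb (fun=> 0 : R).
Proof. by exists 0, 0; split => //; exact: lipc_cst. Qed.

Lemma lipbD f g : lipb f -> lipb g -> lipb (fun x => f x + g x).
Proof.
move=> [L [r [L0 fL fr]]] [M [s [M0 gM gs]]].
exists (L + M), (Num.max r s); split; first exact: addr_ge0.
 exact: lipcD.
by move=> x; rewrite gt_max => /andP[h1 h2]; rewrite fr// gs// addr0.
Qed.

Lemma lipbZ c f : lipb f -> lipb (fun x => c * f x).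
Proof.
move=> [L [r [L0 fL fr]]]; exists (`|c| * L), r; split; first exact: mulr_ge0.
 exact: lipcZ.
by move=> x /fr ->; rewrite mulr0.
Qed.

Lemma lipb_sum (J : Type) (s : seq J) (P : pred J) (F : J -> 'rV[R]_n -> R) :
 (forall j, P j -> lipb (F j)) -> lipb (fun x => \sum_(j <- s | P j) F j x).
Proof.
move=> h; elim: s => [|j s IH].
 by rewrite (_ : (fun _ => _) = fun=> 0); [exact: lipb0|apply/funext => x; rewrite big_nil].
rewrite (_ : (fun _ => _) = fun x => (if P j then F j x else 0) + \sum_(k <- s | P k) F k x).
 apply: lipbD => //; case Pj: (P j); [exact: h|exact: lipb0].
by apply/funext => x; rewrite big_cons; case: ifP; rewrite ?add0r.
Qed.

(** The factor g may be unbounded. The difference of the products is split so that g is evaluated at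
    a point of the ball and f is the factor of the increment of g. *)
Lemma lipbMl f g L : lipb f -> lipc L g -> lipb (fun x => g x * f x).
Proof.
move=> /lipbP[M [r [A [[M0 A0] r0 fM fr fA]]]] gL.
pose B := `|g 0| + `|L| * (r + 1).
have B0 : 0 <= B by rewrite addr_ge0// mulr_ge0// addr_ge0// ltW.
exists (`|L| * A + B * M), r; split; last by move=> x /fr ->; rewrite mulr0.
 by rewrite addr_ge0// mulr_ge0.
have gb x : `|x| <= r -> `|g x| <= B.
 move=> xr; rewrite -[X in `|X| <= _](subrK (g 0)) addrC le_normD// lerD2l.
 rewrite (le_trans (gL _ _))// subr0 (le_trans (ler_wpM2r _ (ler_norm L)))//.
 by rewrite ler_wpM2l// (le_trans xr)// lerDl.
have key x y : `|x| <= r -> `|g x * f x - g y * f y| <= (`|L| * A + B * M) * `|x - y|.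
 move=> xr; have -> : g x * f x - g y * f y = g x * (f x - f y) + f y * (g x - g y) by ring.
 rewrite le_normD// !normrM mulrDl addrC lerD//.
  rewrite mulrC mulrAC ler_pM// (le_trans (gL _ _))//. by rewrite ler_wpM2r// ler_norm.
 by rewrite -mulrA ler_pM// gb.
move=> x y; have [xr|xr] := leP `|x| r; first exact: key.
have [yr|yr] := leP `|y| r; first by rewrite distrC (distrC x); exact: key.
by rewrite (fr _ xr) (fr _ yr) !mulr0 subrr normr0 mulr_ge0// addr_ge0// mulr_ge0.
Qed.

Lemma lipb_cutoff r : lipb (cutoff r).
Proof. by exists 1, (r + 1); split => //; [exact: cutoff_lip|exact: cutoff_bsupp]. Qed.

Lemma lipb_cut L g r : lipc L g -> lipb (fun x => g x * cutoff r x).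
Proof. by move=> gL; exact: lipbMl (lipb_cutoff r) gL. Qed.

End calculus.

(** * Density of Lipschitz functions with bounded support in L^1 *)

Section density.
Context {R n}.
Implicit Types (u v : 'rV[R]_n -> R).
(** The approximable functions form a subspace closed in L^1. It contains the indicators of boxes,
    by a Dynkin argument those of bounded measurable sets, hence the simple functions with bounded
    support and finally all of L^1. *)
Definition apxable u := L1 mu u /\
 forall e : R, 0 < e -> exists2 v, lipb v & I (fun x => `|u x - v x|) < e.

Lemma apxable_lim u : L1 mu u ->
 (forall e : R, 0 < e -> exists2 v, apxable v & I (fun x => `|u x - v x|) < e) ->
 apxable u.
Proof.
move=> lu h; split => // e e0; have e2 : 0 < e / 2 by rewrite divr_gt0.
have [v [lv hv] uv] := h _ e2; have [w bw vw] := hv _ e2; exists w => //.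
have lw := lipbL1 bw.
rewrite (le_lt_trans _ (_ : I (fun x => `|u x - v x|) + I (fun x => `|v x - w x|) < e))//.
 rewrite -ID; [|exact/L1_abs/L1B|exact/L1_abs/L1B]. apply: I_le; [exact/L1_abs/L1B|by apply: L1D; exact/L1_abs/L1B|].
 move=> x; exact: ler_distD.
by rewrite [ltRHS]splitr ltrD.
Qed.

Lemma apxableD u v : apxable u -> apxable v ->
 apxable (fun x => u x + v x).
Proof.
move=> [lu hu] [lv hv]; split; first exact: L1D.
move=> e e0; have e2 : 0 < e / 2 by rewrite divr_gt0.
have [u' bu hu'] := hu _ e2; have [v' bv hv'] := hv _ e2.
exists (fun x => u' x + v' x); first exact: lipbD.
have lu' := lipbL1 bu; have lv' := lipbL1 bv.
rewrite (le_lt_trans _ (_ : I (fun x => `|u x - u' x|) + I (fun x => `|v x - v' x|) < e))//.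
 rewrite -ID; [|exact/L1_abs/L1B|exact/L1_abs/L1B].
 apply: I_le; [by apply/L1_abs/L1B; apply: L1D|by apply: L1D; exact/L1_abs/L1B|].
 by move=> x; rewrite opprD addrACA ler_normD.
by rewrite [ltRHS]splitr ltrD.
Qed.

Lemma apxableZ c u : apxable u -> apxable (fun x => c * u x).
Proof.
move=> [lu hu]; split; first exact: L1Z.
move=> e e0; have c1 : 0 < `|c| + 1 by rewrite ltr_wpDl.
have [u' bu hu'] := hu _ (divr_gt0 e0 c1).
exists (fun x => c * u' x); first exact: lipbZ.
have lu' := lipbL1 bu.
rewrite (_ : (fun x => _) = fun x => `|c| * `|u x - u' x|); last first.
 by apply/funext => x; rewrite -mulrBr normrM.
rewrite IZ; last exact/L1_abs/L1B.
have : (`|c| + 1) * I (fun x => `|u x - u' x|) < e by rewrite mulrC -ltr_pdivlMr.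
by apply: le_lt_trans; rewrite ler_wpM2r ?I_ge0// lerDl.
Qed.

Lemma apxable_sum (J : Type) (s : seq J) (F : J -> 'rV[R]_n -> R) :
 (forall j, apxable (F j)) -> apxable (fun x => \sum_(j <- s) F j x).
Proof.
move=> h; elim: s => [|j s IH].
 rewrite (_ : (fun _ => _) = fun x => 0 * 0).
  apply: apxableZ; split; first exact: L10. move=> e e0; exists (fun=> 0); first exact: lipb0.
  by under eq_Rintegral do rewrite subrr normr0; rewrite I0.
 by apply/funext => x; rewrite big_nil mul0r.
rewrite (_ : (fun _ => _) = fun x => F j x + \sum_(k <- s) F k x).
 exact: apxableD.
by apply/funext => x; rewrite big_cons.
Qed.

Lemma L1_indic_sub (A : set 'rV[R]_n) (r : R) : measurable A ->
 L1 mu (\1_(A `&` cst_box n r)).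
Proof.
move=> mA; apply: (@L1_bounded _ _ _ 1 (`|r|)).
- apply: measurable_indic; apply: measurableI => //; exact: mf_hbox.
- by move=> x; rewrite indicE; case: (_ \in _); rewrite ?normr0 ?normr1.
- move=> x xr; rewrite indicE memNset// => -[_ hb].
 move: xr; apply/negP; rewrite -leNgt; apply: norm_le => // k.
 have := hb k; rewrite in_itv/= !mxE ler_norml; have := ler_norm r => h /andP[h1 h2].
 by rewrite (le_trans _ (ltW h1)) ?lerN2// (le_trans h2).
Qed.

(** Equal to 1 on the product of the intervals [a + 1/(k+1), b] and decreasing to 0 within 1/(k+1)
    of it. The shift of the left ends makes the limit the indicator of a box that is open on the
    left. *)
Definition box_bump (a b : 'rV[R]_n) (k : nat) (x : 'rV[R]_n) : R :=
 clamp (1 - k.+1%:R * \sum_i (Num.max 0 (a ord0 i + k.+1%:R^-1 - x ord0 i) +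
  Num.max 0 (x ord0 i - b ord0 i))).

Lemma max0_lip (s t : R) : `|Num.max 0 s - Num.max 0 t| <= 1 * `|s - t|.
Proof.
rewrite mul1r; case: (leP 0 s) => s0; case: (leP 0 t) => t0 //.
- by rewrite subr0 !ger0_norm//; lra.
- by rewrite sub0r normrN distrC !ger0_norm//; lra.
- by rewrite subrr normr0.
Qed.

Lemma box_bump_lip a b k : exists2 L, 0 <= L & lipc L (box_bump a b k).
Proof.
have h : lipc (1 * (0 + `|k.+1%:R| * \sum_(i < n) (1 * (0 + 1) + 1 * (1 + 0)))) (box_bump a b k).
 apply: lipc_comp1 => //; first exact: clamp_lip. apply: lipcB; first exact: lipc_cst.
 apply: lipcZ; apply: lipc_sum => i _; apply: lipcD.
  apply: lipc_comp1 => //; first exact: max0_lip. by apply: lipcB; [exact: lipc_cst|exact: lipc_coord].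
 apply: lipc_comp1 => //; first exact: max0_lip. by apply: lipcB; [exact: lipc_coord|exact: lipc_cst].
eexists; last exact: h.
by rewrite mul1r add0r mulr_ge0// sumr_ge0// => i _; rewrite !mul1r add0r addr0 addr_ge0.
Qed.

Lemma box_bump_term_ge0 (a b : 'rV[R]_n) k (x : 'rV[R]_n) i :
 0 <= Num.max 0 (a ord0 i + k.+1%:R^-1 - x ord0 i) + Num.max 0 (x ord0 i - b ord0 i).
Proof. by rewrite addr_ge0// le_max lexx. Qed.

Lemma box_bump0 (a b : 'rV[R]_n) k (x : 'rV[R]_n) i :
 1 <= k.+1%:R * (Num.max 0 (a ord0 i + k.+1%:R^-1 - x ord0 i) +
         Num.max 0 (x ord0 i - b ord0 i)) -> box_bump a b k x = 0.
Proof.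
move=> h; rewrite /box_bump clamp_0// subr_le0 (le_trans h)// ler_wpM2l//.
rewrite (bigD1 i)//= lerDl sumr_ge0// => j _; exact: box_bump_term_ge0.
Qed.

Lemma box_bump_cvg a b x : box_bump a b k x @[k --> \oo] --> (\1_(hbox a b) x : R).
Proof.
have harm (e : R) : 0 < e -> \forall k \near \oo, k.+1%:R^-1 < e.
 move=> e0; have /cvgr0Pnorm_lt/(_ _ e0) := @cvg_harmonic R. by apply: filterS => k; rewrite /harmonic /= ger0_norm.
rewrite indicE; case: (boolP (x \in hbox a b)) => [/set_mem/= hx|].
 suff [N hN] : exists N, forall k, (N <= k)%N -> box_bump a b k x = 1.
  apply: (@cvg_trans _ ((fun=> 1 : R) @ \oo)); last exact: cvg_cst. by apply: near_eq_cvg; exists N => // k /= /hN ->.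
 have : \forall k \near \oo, forall i, k.+1%:R^-1 < x ord0 i - a ord0 i.
  apply: filter_forall => i; apply: harm; rewrite subr_gt0. by have := hx i; rewrite in_itv/= => /andP[].
 move=> [N _ hN]; exists N => k /hN hk. rewrite /box_bump big1 ?mulr0 ?subr0 ?clamp_1// => i _.
 have := hx i; rewrite in_itv/= => /andP[h1 h2]; have := hk i => h3.
 have e2 : x ord0 i - b ord0 i <= 0 by rewrite subr_le0.
 rewrite (max_l e2); move: h3; move: (k.+1%:R^-1) => kv h3; rewrite max_l ?addr0//; lra.
rewrite notin_setE => hx.
suff [N hN] : exists N, forall k, (N <= k)%N -> box_bump a b k x = 0.
 apply: (@cvg_trans _ ((fun=> 0 : R) @ \oo)); last exact: cvg_cst. by apply: near_eq_cvg; exists N => // k /= /hN ->.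
have /existsNP[i /negP hi] : ~ forall i, x ord0 i \in `]a ord0 i, b ord0 i] by exact: hx.
move: hi; rewrite in_itv/= negb_and -!leNgt -ltNge => /orP[hi|hi].
 exists 0 => k _; apply: (@box_bump0 _ _ _ _ i). rewrite mulrC -ler_pdivrMr// mul1r.
 have m : a ord0 i + k.+1%:R^-1 - x ord0 i <= Num.max 0 (a ord0 i + k.+1%:R^-1 - x ord0 i).
  by rewrite le_max lexx orbT.
 have m0 : 0 <= Num.max 0 (x ord0 i - b ord0 i) by rewrite le_max lexx.
 by move: m; move: (k.+1%:R^-1) => kv m; apply: (le_trans _ (lerD m m0)); lra.
have : 0 < x ord0 i - b ord0 i by rewrite subr_gt0.
move=> /harm [N _ hN]; exists N => k /hN hk; apply: (@box_bump0 _ _ _ _ i).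
rewrite mulrC -ler_pdivrMr// mul1r.
have m : x ord0 i - b ord0 i <= Num.max 0 (x ord0 i - b ord0 i) by rewrite le_max lexx orbT.
have m0 : 0 <= Num.max 0 (a ord0 i + k.+1%:R^-1 - x ord0 i) by rewrite le_max lexx.
by apply: (le_trans _ (lerD m0 m)); rewrite add0r ltW.
Qed.

Lemma box_bump_DCT u a b : L1 mu u ->
 I (fun x => `|u x * box_bump a b k x - u x * \1_(hbox a b) x|) @[k --> \oo] --> 0 /\
 I (fun x => u x * box_bump a b k x) @[k --> \oo] --> I (fun x => u x * \1_(hbox a b) x).
Proof.
move=> lu; have mu_ := L1_mfun lu.
have [|||||_ h1 h2] := @I_DCT _ _ R mu (fun k x => u x * box_bump a b k x)
 (fun x => u x * \1_(hbox a b) x) (fun x => `|u x|).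
- move=> k; apply: measurable_funM => //.
 by have [L _] := box_bump_lip a b k; exact: lipc_mfun.
- apply: measurable_funM => //; apply: measurable_indic; exact: mf_hbox.
- by apply: nearW => x; apply: cvgM; [exact: cvg_cst|exact: box_bump_cvg].
- exact: L1_abs.
- apply: nearW => x k; rewrite normrM -[leRHS]mulr1 ler_wpM2l//; exact: clamp_norm.
by split.
Qed.

Lemma apxable_hbox a b : apxable (\1_(hbox a b)).
Proof.
pose r := `|a| + `|b|.
have sub x : hbox a b x -> `|x| <= r.
 move=> hx; apply: norm_le => [|i]; first exact: addr_ge0. have := hx i; rewrite !in_itv/= /r => /andP[h1 h2].
 have := coord_le a i; have := coord_le b i. rewrite !ler_norml => /andP[b1 b2] /andP[a1 a2].
 have a0 := normr_ge0 a; have b0 := normr_ge0 b. by apply/andP; split; lra.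
have l2 : L1 mu (@cutoff R n r) by apply/lipbL1/lipb_cutoff.
have E : (fun x => cutoff r x * \1_(hbox a b) x) = \1_(hbox a b).
 apply/funext => x; rewrite indicE; case: (boolP (x \in _)) => [/set_mem/sub h|_].
  by rewrite cutoff1// mulr1.
 by rewrite mulr0.
have l1 : L1 mu (\1_(hbox a b)).
 rewrite -E; apply: (L1M (C := 1) l2); first by apply: measurable_indic; exact: mf_hbox.
 by move=> x; rewrite indicE; case: (_ \in _); rewrite ?normr0 ?normr1.
split => // e e0.
have [/cvgr0Pnorm_lt/(_ _ e0)[N _ hN] _] := box_bump_DCT a b l2.
have [L _ hL] := box_bump_lip a b N.
exists (fun x => box_bump a b N x * cutoff r x); first exact: lipbMl (lipb_cutoff r) hL.
have := hN N (leqnn N); rewrite ger0_norm; last by apply: I_ge0.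
rewrite (_ : (fun x => _) = fun x => `|\1_(hbox a b) x - box_bump a b N x * cutoff r x|)//.
apply/funext => x; have /= Ex := congr1 (fun g => g x) E.
by rewrite Ex distrC (mulrC (cutoff r x)).
Qed.

(** The intersection with a fixed box keeps all sets of the Dynkin class of finite measure;
    complements are taken within that box, and disjoint unions pass to the limit by dominated
    convergence. *)
Lemma apxable_indic (A : set 'rV[R]_n) N : measurable A ->
 apxable (\1_(A `&` cst_box n N%:R)).
Proof.
move=> mA; have mG := @measurable_hboxes R n; move: (mA); rewrite mG => sA.
apply: (dynkin_induction mG (@hboxesI R n)
 (P := fun A => apxable (\1_(A `&` cst_box n N%:R))) _ _ _ _ sA).
- rewrite setTI; exact: apxable_hbox.
- by move=> _ [a [b ->]]; rewrite hboxI; exact: apxable_hbox.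
- move=> S mS hS.
 rewrite (_ : \1_(~` S `&` _) = fun x => \1_(cst_box n N%:R) x + -1 * \1_(S `&` cst_box n N%:R) x).
  by apply: apxableD; [exact: apxable_hbox|exact: apxableZ].
 apply/funext => x; rewrite !indicE !in_setI in_setC. by case: (x \in S); case: (x \in cst_box _ _) => /=; ring.
- move=> F mF tF hF; set B := cst_box n N%:R.
 have lU := @L1_indic_sub (\bigcup_k F k) N%:R (bigcupT_measurable _ mF). apply: apxable_lim => // e e0.
 pose g K x : R := \sum_(0 <= k < K) \1_(F k `&` B) x. have gx K x : g K x = \1_((\bigcup_(k < K) F k) `&` B) x.
  rewrite indicE; case: (boolP (x \in _)) => [/set_mem[[k /= kK Fk] Bx]|].
   rewrite /g (bigD1_seq k) ?mem_index_iota ?iota_uniq//= indicE mem_set; last by split.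
   rewrite big1 ?addr0// => j jk; rewrite indicE memNset// => -[Fj _].
   move/trivIsetP : tF => /(_ j k Logic.I Logic.I jk) /seteqP[+ _]. by move=> /(_ x); apply.
  rewrite notin_setE => h; rewrite /g big_seq big1// => k; rewrite mem_index_iota => kK.
  by rewrite indicE memNset// => -[Fk Bx]; apply: h; split => //; exists k.
 have mB : measurable B by exact: mf_hbox.
 have [|||||_ h1 _] := @I_DCT _ _ R mu g (\1_((\bigcup_k F k) `&` B)) (\1_((\bigcup_k F k) `&` B)).
 + move=> K; apply: measurable_sum => k; apply: measurable_indic.
  exact: measurableI.
 + apply: measurable_indic; apply: measurableI => //; exact: bigcupT_measurable.
 + apply: nearW => x.
  rewrite indicE; case: (boolP (x \in _)) => [/set_mem[[k _ Fk] Bx]|].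
   apply: (@cvg_trans _ ((fun=> 1 : R) @ \oo)); last exact: cvg_cst.
   apply: near_eq_cvg; exists k.+1 => // K /= kK; rewrite gx indicE mem_set//. by split => //; exists k.
  rewrite notin_setE => h. rewrite (_ : (fun K => g K x) = fun=> 0); first exact: cvg_cst.
  apply/funext => K; rewrite gx indicE memNset// => -[[k _ Fk] Bx]. by apply: h; split => //; exists k.
 + exact: lU.
 + apply: nearW => x K; rewrite gx !indicE.
  case: (boolP (x \in _)) => [/set_mem[[k _ Fk] Bx]|_]; last by rewrite normr0.
  by rewrite normr1 mem_set//; split => //; exists k.
 have /cvgr0Pnorm_lt/(_ _ e0)[K _ hK] := h1. exists (g K).
  rewrite (_ : g K = fun x => \sum_(k <- index_iota 0 K) \1_(F k `&` B) x)//. apply: apxable_sum => k; exact: hF.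
 have := hK K (leqnn K); rewrite ger0_norm; last exact: I_ge0. by under eq_Rintegral do rewrite distrC.
Qed.

Import HBSimple.

Lemma apxable_L1 u : L1 mu u -> apxable u.
Proof.
move=> lu; have mu_ := L1_mfun lu.
apply: apxable_lim => // e e0; have e2 : 0 < e / 2 by rewrite divr_gt0.
have mB N : measurable (cst_box n N%:R : set 'rV[R]_n) by exact: mf_hbox.
have l01 (A : set 'rV[R]_n) x : `|\1_A x : R| <= 1 by rewrite indicE; case: (_ \in _); rewrite ?normr0 ?normr1.
pose uN N x : R := u x * \1_(cst_box n N%:R) x.
have luN N : L1 mu (uN N) by apply: (L1M lu) => //; exact: measurable_indic.
have [|||||_ h1 _] := @I_DCT _ _ R mu uN u (fun x => `|u x|).
- move=> N; exact: L1_mfun.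
- by [].
- apply: nearW => x; rewrite -[X in _ --> X]mulr1; apply: cvgM; first exact: cvg_cst.
 apply: (@cvg_trans _ ((fun=> 1 : R) @ \oo)); last exact: cvg_cst.
 apply: near_eq_cvg; exists (Num.truncn `|x|).+1 => // N /= hN. rewrite indicE mem_set// => i; rewrite in_itv/= !mxE.
 have : `|x ord0 i| < N%:R.
  rewrite (le_lt_trans (coord_le _ _))// (lt_le_trans (truncnS_gt _))//. by rewrite ler_nat.
 by rewrite ltr_norml => /andP[-> /ltW ->].
- exact: L1_abs.
- apply: nearW => x N; rewrite /uN normrM -[leRHS]mulr1 ler_wpM2l//.
have /cvgr0Pnorm_lt/(_ _ e2)[N _ /(_ N (leqnn N))] := h1.
rewrite ger0_norm; last exact: I_ge0.
move=> hN.
have [g [lg _ g0]] := approximation_sfun_integrable measurableT (luN N).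
have /fine_fcvg/cvgr0Pnorm_lt/(_ _ e2)[K _ /(_ K (leqnn K))] := g0.
rewrite /= ger0_norm; last by apply: fine_ge0; apply: integral_ge0.
rewrite -/(I (fun x => `|uN N x - g K x|)) => hK.
have lgK : L1 mu (g K) by exact: lg.
pose v x : R := g K x * \1_(cst_box n N%:R) x.
have lv : L1 mu v by apply: (L1M lgK) => //; exact: measurable_indic.
exists v.
 rewrite (_ : v = fun x => \sum_(r <- finmap.enum_fset (fset_set (range (g K)))) r * \1_(g K @^-1` [set r] `&` cst_box n N%:R) x).
  apply: apxable_sum => r; apply: apxableZ; apply: apxable_indic. exact: measurable_sfunP.
 apply/funext => x; rewrite /v {1}(fimfunE (g K)) fsbig_finite//= mulr_suml.
 apply: eq_bigr => r _; rewrite -mulrA; congr (_ * _). by rewrite indicI.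
have l3 : L1 mu (fun x => `|u x - uN N x|) by exact/L1_abs/L1B.
have l4 : L1 mu (fun x => `|uN N x - g K x|) by exact/L1_abs/L1B.
rewrite (le_lt_trans _ (_ : I (fun x => `|u x - uN N x|) + I (fun x => `|uN N x - g K x|) < e))//.
 rewrite -ID//; apply: I_le; [exact/L1_abs/L1B|exact: L1D|].
 move=> x; rewrite (le_trans (ler_distD (uN N x) _ _))// lerD2l /uN /v.
 rewrite indicE; case: (_ \in _); first by rewrite !mulr1. by rewrite !mulr0 subrr normr0.
rewrite [ltRHS]splitr ltrD//.
by under eq_Rintegral do rewrite distrC.
Qed.

Lemma lipb_dense u : L1 mu u -> forall e : R, 0 < e ->
 exists2 v, lipb v & I (fun x => `|u x - v x|) < e.
Proof. by move=> /apxable_L1[]. Qed.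

(** Multiplying an approximation by the cutoff does not increase the error, since u vanishes
    wherever the cutoff differs from 1. *)
Lemma lipb_dense_supp (r e : R) u : L1 mu u -> bsupp r u -> 0 < e ->
 exists v, [/\ lipb v, bsupp (r + 1) v & I (fun x => `|u x - v x|) < e].
Proof.
move=> lu ur e0; have [v0 bv0 hv0] := lipb_dense lu e0.
have bv : lipb (fun x => cutoff r x * v0 x) by apply: lipbMl bv0 _; exact: cutoff_lip.
exists (fun x => cutoff r x * v0 x); split => // [x hx|]; first by rewrite cutoff_bsupp ?mul0r.
apply: le_lt_trans hv0; apply: I_le => [||x].
- apply/L1_abs/L1B => //; exact: lipbL1.
- apply/L1_abs/L1B => //; exact: lipbL1.
rewrite (_ : u x - _ = cutoff r x * (u x - v0 x)); first by rewrite normrM ler_piMl// cutoff_norm.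
rewrite mulrBr; congr (_ - _); have [xr|xr] := leP `|x| r; first by rewrite cutoff1// mul1r.
by rewrite ur// mulr0.
Qed.


End density.

(** * B-splines of one variable and sums over a lattice *)

Section spline1.
Context {R}.
Implicit Types s t : R.
Definition pp (t : R) : R := Num.max 0 t.
Lemma pp_pos t : 0 <= t -> pp t = t. Proof. by move=> h; rewrite /pp max_r. Qed.
Lemma pp_neg t : t <= 0 -> pp t = 0. Proof. by move=> h; rewrite /pp max_l. Qed.
Lemma pp_ge0 t : 0 <= pp t. Proof. by rewrite /pp le_max lexx. Qed.
Lemma pp_lip s t : `|pp s - pp t| <= 1 * `|s - t|. Proof. exact: max0_lip. Qed.

Lemma derive_congr (f g : R -> R) (t a b : R) : is_derive t (1 : R) f a ->
 (forall s, g s = f s) -> b = a -> is_derive t (1 : R) g b.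
Proof. by move=> h /funext -> ->. Qed.

Lemma is_derive_pp k t : is_derive t 1 (fun t => pp t ^+ k.+2) (k.+2%:R * pp t ^+ k.+1).
Proof.
have [t0|t0|->] := ltgtP t 0.
- have d0 : is_derive t 1 (cst 0 : R -> R) (k.+2%:R * pp t ^+ k.+1).
  rewrite (pp_neg (ltW t0)) expr0n mulr0; exact: is_derive_cst.
 apply: near_eq_is_derive d0; near=> s; rewrite /= pp_neg ?expr0n//. apply: ltW; near: s; exact: lt_nbhsl.
- have d0 : is_derive t 1 (fun t : R => t ^+ k.+2) (k.+2%:R * pp t ^+ k.+1).
  apply: (derive_congr (is_deriveX k.+2 (@is_derive_id R R^o t 1))) => [s|].
   by rewrite exprfctE.
  by rewrite (pp_pos (ltW t0)) /GRing.scale/= mulr1.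
 apply: near_eq_is_derive d0; near=> s; rewrite /= pp_pos//. apply: ltW; near: s; exact: lt_nbhsr.
- rewrite (pp_pos (lexx 0)) expr0n mulr0.
 have c : (fun h : R => h^-1 *: (((fun t => pp t ^+ k.+2) \o shift 0) (h *: 1) - pp 0 ^+ k.+2)) @ 0^' --> (0 : R).
  apply/cvgrPdist_lt => e e0; near=> h. have h0 : h != 0 by near: h; exact: nbhs_dnbhs_neq.
  have he : `|h| < Num.min 1 e.
   near: h; apply: (@dnbhs0_lt R R^o); by rewrite lt_min ltr01.
  rewrite /= addr0 /GRing.scale/= mulr1 (pp_pos (lexx 0)) expr0n/= subr0 sub0r normrN.
  rewrite normrM normfV ltr_pdivrMl ?normr_gt0// normrX.
  have ph : `|pp h| <= `|h| by rewrite -[h in leRHS]subr0 -{1}(subr0 (pp h)) -{1}(pp_pos (lexx 0)) -[leRHS]mul1r pp_lip.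
  move: he; rewrite lt_min => /andP[h1 h2].
  apply: (@le_lt_trans _ _ (`|h| ^+ k.+2)); first by rewrite lerXn2r ?nnegrE.
  rewrite exprS ltr_pM2l ?normr_gt0// (le_lt_trans _ h2)//. by rewrite exprS ler_piMr// exprn_ile1// ltW.
 by split; [apply/cvg_ex; exists 0|exact/cvg_lim].
Unshelve. all: by end_near. Qed.

Definition mono1 (f : R -> R) := forall s t, s <= t -> 0 <= f t - f s <= t - s.

Lemma mono1_derive (f f' : R -> R) : (forall t, is_derive t 1 f (f' t)) ->
 (forall t, 0 <= f' t <= 1) -> mono1 f.
Proof.
move=> df f'01 s t; rewrite le_eqVlt => /orP[/eqP ->|st]; first by rewrite !subrr lexx.
have [|c _ ->] := @MVT _ f f' s t st (fun x _ => df x).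
 by apply: continuous_subspaceT => x; apply: differentiable_continuous; apply/derivable1_diffP.
have /andP[c0 c1] := f'01 c.
by rewrite mulr_ge0// ?subr_ge0 ?(ltW st)//= ler_piMl// subr_ge0 ltW.
Qed.

(** [hat] and [bsp] are the linear and the quadratic B-spline on [0,2] and [0,3]; [th] and [Bsp] are
    their primitives, [ramp2] and [th3] the primitives of [clamp] and [th]. Each of [hat], [th],
    [bsp], [Bsp] is the difference of one of [clamp], [ramp2], [th], [th3] and its unit translate,
    so that sums over a lattice telescope. *)
Definition hat t := pp t - 2 * pp (t - 1) + pp (t - 2).
Definition th t := (pp t ^+ 2 - 2 * pp (t - 1) ^+ 2 + pp (t - 2) ^+ 2) / 2.
Definition bsp t := th t - th (t - 1).
Definition dbsp t := hat t - hat (t - 1).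
Definition ramp2 t := (pp t ^+ 2 - pp (t - 1) ^+ 2) / 2.
Definition th3 t := (pp t ^+ 3 - 2 * pp (t - 1) ^+ 3 + pp (t - 2) ^+ 3) / 6.
Definition Bsp t := th3 t - th3 (t - 1).

Lemma thE t : th t = ramp2 t - ramp2 (t - 1).
Proof. by rewrite /th /ramp2 (_ : t - 1 - 1 = t - 2); [field|ring]. Qed.

Lemma clampE t : clamp t = pp t - pp (t - 1).
Proof.
have [t0|t0] := leP t 0.
 by rewrite clamp_0// !pp_neg ?subr0//; lra.
have [t1|t1] := leP t 1.
 by rewrite (clamp_id (ltW t0) t1) (pp_pos (ltW t0)) pp_neg ?subr0//; lra.
by rewrite (clamp_1 (ltW t1)) (pp_pos (ltW t0)) pp_pos//; lra.
Qed.

Lemma hatE t : hat t = clamp t - clamp (t - 1).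
Proof. by rewrite /hat !clampE (_ : t - 1 - 1 = t - 2); ring. Qed.

Lemma hat_ge0 t : 0 <= hat t.
Proof. by rewrite hatE subr_ge0 clamp_nd// gerBl. Qed.
Lemma hat_le1 t : hat t <= 1.
Proof. by rewrite hatE; have := clamp_ge0 (t - 1); have := clamp_le1 t; lra. Qed.
Lemma hat_0 t : (t <= 0) || (2 <= t) -> hat t = 0.
Proof.
rewrite hatE => /orP[h|h]; first by rewrite !clamp_0 ?subrr//; lra.
by rewrite !clamp_1 ?subrr//; lra.
Qed.
Lemma hat_lip s t : `|hat s - hat t| <= 2 * `|s - t|.
Proof.
rewrite !hatE.
have -> : clamp s - clamp (s - 1) - (clamp t - clamp (t - 1)) =
 (clamp s - clamp t) - (clamp (s - 1) - clamp (t - 1)) by ring.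
rewrite le_normB// mulr_natl mulr2n lerD//.
 by rewrite -[leRHS]mul1r clamp_lip.
have := clamp_lip (s - 1) (t - 1); rewrite mul1r.
by have -> : s - 1 - (t - 1) = s - t by ring.
Qed.

Lemma derive_pps k c t :
 is_derive t 1 (fun t => pp (t - c) ^+ k.+2) (k.+2%:R * pp (t - c) ^+ k.+1).
Proof.
have d1 : is_derive t 1 (fun t : R => t - c) 1.
 have := is_deriveB (@is_derive_id R R^o t 1) (is_derive_cst c t 1). rewrite subr0; exact.
have := @is_derive1_comp R (fun t => pp t ^+ k.+2) (fun t : R => t - c) t _ _ (is_derive_pp k (t - c)) d1.
by rewrite mulr1.
Qed.

Lemma is_derive_ramp2 t : is_derive t 1 ramp2 (clamp t).
Proof.
have h0 := derive_pps 0 0 t; have h1 := derive_pps 0 1 t.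
apply: (derive_congr (is_deriveZ 2^-1 (is_deriveB h0 h1))).
 by move=> s; rewrite /ramp2 /= !fctE subr0 /GRing.scale/= mulrC.
by rewrite clampE /GRing.scale/= subr0; field.
Qed.

Lemma is_derive_th c t : is_derive t 1 (fun t => th (t - c)) (hat (t - c)).
Proof.
have h0 := derive_pps 0 c t; have h1 := derive_pps 0 (c + 1) t.
have h2 := derive_pps 0 (c + 2) t.
apply: (derive_congr (is_deriveZ 2^-1 (is_deriveD (is_deriveB h0 (is_deriveZ 2 h1)) h2))).
 by move=> s; rewrite /th /= !fctE /GRing.scale/= mulrC !opprD !addrA.
by rewrite /hat /GRing.scale/= !opprD !addrA; field.
Qed.

Lemma is_derive_bsp c t : is_derive t 1 (fun t => bsp (t - c)) (dbsp (t - c)).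
Proof.
apply: (derive_congr (is_deriveB (is_derive_th c t) (is_derive_th (c + 1) t))).
 by move=> s; rewrite /bsp !fctE opprD addrA.
by rewrite /dbsp; congr (_ - hat _); ring.
Qed.

Lemma is_derive_th3 c t : is_derive t 1 (fun t => th3 (t - c)) (th (t - c)).
Proof.
have h0 := derive_pps 1 c t; have h1 := derive_pps 1 (c + 1) t.
have h2 := derive_pps 1 (c + 2) t.
apply: (derive_congr (is_deriveZ 6^-1 (is_deriveD (is_deriveB h0 (is_deriveZ 2 h1)) h2))).
 by move=> s; rewrite /th3 /= !fctE /GRing.scale/= mulrC !opprD !addrA.
by rewrite /th /GRing.scale/= !opprD !addrA; field.
Qed.

Lemma ramp2_mono1 : mono1 ramp2.
Proof.
by apply: mono1_derive is_derive_ramp2 _ => t; rewrite clamp_ge0 clamp_le1.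
Qed.

Lemma th_mono1 : mono1 th.
Proof.
have d (t : R) : is_derive t (1 : R) th (hat t) by apply: (derive_congr (is_derive_th 0 t)) => [s|]; rewrite subr0.
by apply: mono1_derive d _ => t; rewrite hat_ge0 hat_le1.
Qed.

Lemma th_ge0 t : 0 <= th t.
Proof.
rewrite thE; have := ramp2_mono1 (_ : t - 1 <= t); rewrite gerBl => /(_ ler01).
by case/andP.
Qed.
Lemma th_le1 t : th t <= 1.
Proof.
rewrite thE; have := ramp2_mono1 (_ : t - 1 <= t); rewrite gerBl => /(_ ler01).
by case/andP => _; rewrite subKr.
Qed.
Lemma th_0 t : t <= 0 -> th t = 0.
Proof. by move=> h; rewrite /th !pp_neg ?expr0n/=; lra. Qed.
Lemma th_1 t : 2 <= t -> th t = 1.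
Proof. by move=> h; rewrite /th !pp_pos; [field|lra..]. Qed.

Lemma th3_mono1 : mono1 th3.
Proof.
have d (t : R) : is_derive t (1 : R) th3 (th t).
 by apply: (derive_congr (is_derive_th3 0 t)) => [s|]; rewrite subr0.
by apply: mono1_derive d _ => t; rewrite th_ge0 th_le1.
Qed.

Lemma Bsp_mono s t : s <= t -> Bsp s <= Bsp t.
Proof.
have d (r : R) : is_derive r (1 : R) Bsp (bsp r).
 by apply: (derive_congr (is_deriveB (is_derive_th3 0 r) (is_derive_th3 1 r))) => [x|];
  rewrite /Bsp /bsp ?fctE subr0.
have e01 r : 0 <= bsp r <= 1.
 rewrite /bsp; have := th_mono1 (_ : r - 1 <= r); rewrite gerBl => /(_ ler01).
 by case/andP => -> h /=; rewrite (le_trans h)// subKr.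
by move=> st; have /andP[+ _] := mono1_derive d e01 st; rewrite subr_ge0.
Qed.

Lemma Bsp_0 t : t <= 0 -> Bsp t = 0.
Proof. by move=> h; rewrite /Bsp /th3 !pp_neg ?expr0n/=; lra. Qed.
Lemma Bsp_1 t : 3 <= t -> Bsp t = 1.
Proof. by move=> h; rewrite /Bsp /th3 !pp_pos; [field|lra..]. Qed.

Lemma bsp_ge0 t : 0 <= bsp t.
Proof.
by rewrite /bsp; have := th_mono1 (_ : t - 1 <= t); rewrite gerBl => /(_ ler01)/andP[].
Qed.
Lemma bsp_0 t : (t <= 0) || (3 <= t) -> bsp t = 0.
Proof.
rewrite /bsp => /orP[h|h]; first by rewrite !th_0 ?subrr//; lra.
by rewrite !th_1 ?subrr//; lra.
Qed.
Lemma bsp_le1 t : bsp t <= 1.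
Proof. by rewrite /bsp; have := th_ge0 (t - 1); have := th_le1 t; lra. Qed.

Lemma sum_shift (A B : R -> R) N t : (forall t, A t = B t - B (t - 1)) ->
 \sum_(j < N) A (t - j%:R) = B t - B (t - N%:R).
Proof.
move=> AB; elim: N => [|N IH]; first by rewrite big_ord0 subr0 subrr.
rewrite big_ord_recr/= IH AB; have -> : t - N%:R - 1 = t - N.+1%:R by rewrite -natr1; ring.
ring.
Qed.

Lemma sum_bsp N t : \sum_(j < N) bsp (t - j%:R) = th t - th (t - N%:R).
Proof. exact: sum_shift. Qed.
Lemma sum_hat N t : \sum_(j < N) hat (t - j%:R) = clamp t - clamp (t - N%:R).
Proof. by apply: sum_shift => s; exact: hatE. Qed.

Lemma sum_bsp_abs N t : \sum_(j < N) `|bsp (t - j%:R)| <= 1.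
Proof.
rewrite (eq_bigr (fun j : 'I_N => bsp (t - j%:R))) => [|j _]; last by rewrite ger0_norm ?bsp_ge0.
by rewrite sum_bsp; have := th_ge0 (t - N%:R); have := th_le1 t; lra.
Qed.

Lemma sum_bsp1 N t : 2 <= t -> t <= N%:R -> \sum_(j < N) bsp (t - j%:R) = 1.
Proof. by move=> h1 h2; rewrite sum_bsp th_1// th_0 ?subr0// subr_le0. Qed.
Lemma sum_hat1 N t : 2 <= t -> t <= N%:R -> \sum_(j < N) hat (t - j%:R) = 1.
Proof. by move=> h1 h2; rewrite sum_hat clamp_1 ?clamp_0 ?subr0 ?subr_le0//; lra. Qed.

(** As A is nondecreasing all the differences have the same sign, so their absolute values telescope
    to increments of B, which is 1-Lipschitz. The bound is the same for every number of nodes. *)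
Lemma sum_shift_diff (A B : R -> R) N s t : (forall t, A t = B t - B (t - 1)) ->
 {homo A : s t / s <= t} -> mono1 B ->
 \sum_(j < N) `|A (s - j%:R) - A (t - j%:R)| <= `|s - t|.
Proof.
move=> AB ndA mB; wlog st : s t / t <= s => [H|].
 have [/H//|/ltW/H] := leP t s; rewrite (distrC s); apply: le_trans. by apply: ler_sum => j _; rewrite distrC.
rewrite (eq_bigr (fun j : 'I_N => A (s - j%:R) - A (t - j%:R))) => [|j _]; last first.
 by rewrite ger0_norm// subr_ge0 ndA// lerD2r.
rewrite sumrB !(sum_shift _ _ AB).
have /andP[_ h1] := mB _ _ st.
have /andP[h2 _] := mB (t - N%:R) (s - N%:R) (ltac:(by rewrite lerD2r)).
rewrite (ger0_norm (_ : 0 <= s - t)) ?subr_ge0//; lra.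
Qed.

Lemma sum_bsp_diff N s t : \sum_(j < N) `|bsp (s - j%:R) - bsp (t - j%:R)| <= 2 * `|s - t|.
Proof.
have ndth : {homo th : s t / s <= t} by move=> x y xy; have /andP[+ _] := th_mono1 xy; rewrite subr_ge0.
have h1 := @sum_shift_diff th ramp2 N s t thE ndth ramp2_mono1.
have h2 := @sum_shift_diff th ramp2 N (s - 1) (t - 1) thE ndth ramp2_mono1.
rewrite mulr_natl mulr2n; apply: le_trans (lerD h1 _); last first.
 by apply: (le_trans h2); have -> : s - 1 - (t - 1) = s - t by ring.
rewrite -big_split /=; apply: ler_sum => j _; rewrite /bsp.
have -> : th (s - j%:R) - th (s - j%:R - 1) - (th (t - j%:R) - th (t - j%:R - 1)) =
  (th (s - j%:R) - th (t - j%:R)) - (th (s - 1 - j%:R) - th (t - 1 - j%:R)).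
 by rewrite (addrAC s) (addrAC t); ring.
exact: ler_normB.
Qed.

Lemma sum_Bsp_diff N s t : \sum_(j < N) `|Bsp (s - j%:R) - Bsp (t - j%:R)| <= `|s - t|.
Proof. by apply: (@sum_shift_diff Bsp th3) => //; [exact: Bsp_mono|exact: th3_mono1]. Qed.


Lemma prod_diff n (b c : 'I_n -> R) : \prod_i b i - \prod_i c i =
 \sum_(m < n) \prod_(i < n) (if (i < m)%N then c i else if i == m then b i - c i else b i).
Proof.
elim: n b c => [|n IH] b c; first by rewrite !big_ord0 subrr.
rewrite !big_ord_recr /=.
rewrite [X in _ = _ + X * _](_ : _ = \prod_(i < n) c (widen_ord (leqnSn n) i)); last first.
 by apply: eq_bigr => i _; rewrite ltn_ord.
rewrite ltnn eqxx [X in _ = X + _](eq_bigr (fun m : 'I_n =>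
 (\prod_(i < n) (if (i < m)%N then c (widen_ord (leqnSn n) i) else
  if i == m then b (widen_ord (leqnSn n) i) - c (widen_ord (leqnSn n) i)
  else b (widen_ord (leqnSn n) i))) * b ord_max)); last first.
 move=> m _; rewrite big_ord_recr /=; congr (_ * _). by rewrite ltnNge ltnW//= -val_eqE /= gtn_eqF.
rewrite -mulr_suml -IH; ring.
Qed.

Lemma sum_tensor n N (a : 'I_n -> 'I_N -> R) :
 \sum_(q : {ffun 'I_n -> 'I_N}) \prod_i a i (q i) = \prod_i \sum_j a i j.
Proof. by rewrite bigA_distr_bigA. Qed.

(** A sum over multi-indices factors into one-dimensional sums; no constant for product splines
    depends on the number of nodes. *)
Lemma sum_tensor_bound n N (a : 'I_n -> 'I_N -> R) (A : 'I_n -> R) :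
 (forall i, \sum_j `|a i j| <= A i) ->
 \sum_(q : {ffun 'I_n -> 'I_N}) `|\prod_i a i (q i)| <= \prod_i A i.
Proof.
move=> h; rewrite (eq_bigr (fun q : {ffun 'I_n -> 'I_N} => \prod_i `|a i (q i)|)); last first.
 by move=> q _; rewrite normr_prod.
rewrite (sum_tensor (fun i j => `|a i j|)); apply: ler_prod => i _.
by rewrite h sumr_ge0.
Qed.

Lemma sum_tensor_diff n N (a b : 'I_n -> 'I_N -> R) (A D : 'I_n -> R) :
 (forall i, \sum_j `|a i j| <= A i) -> (forall i, \sum_j `|b i j| <= A i) ->
 (forall i, \sum_j `|a i j - b i j| <= D i) ->
 \sum_(q : {ffun 'I_n -> 'I_N}) `|\prod_i a i (q i) - \prod_i b i (q i)| <=
 \sum_m D m * \prod_(i | i != m) A i.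
Proof.
move=> ha hb hd.
pose t (m : 'I_n) (i : 'I_n) (j : 'I_N) :=
 if (i < m)%N then b i j else if i == m then a i j - b i j else a i j.
apply: (via (\sum_(q : {ffun 'I_n -> 'I_N}) \sum_m `|\prod_i t m i (q i)|)).
 by apply: ler_sum => q _; rewrite prod_diff ler_norm_sum.
rewrite exchange_big /=; apply: ler_sum => m _.
have -> : D m * \prod_(i | i != m) A i = \prod_i (if i == m then D i else A i).
 rewrite [RHS](bigD1 m)//= eqxx; congr (_ * _). by apply: eq_bigr => i /negbTE ->.
apply: sum_tensor_bound => i; rewrite /t.
have [im|im|/val_inj ->] := ltngtP i m.
- by rewrite -val_eqE ltn_eqF.
- by rewrite -val_eqE gtn_eqF.
- by rewrite eqxx.
Qed.

End spline1.

(** * Product splines on a lattice in R^n *)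

Section tensors.
Context {R n}.
Implicit Types (g : 'I_n -> R -> R).
Definition tensor g (x : 'rV[R]_n) : R := \prod_i g i (x ord0 i).

Lemma partial_tensor g (x : 'rV[R]_n) j d :
 is_derive (x ord0 j) (1 : R) (g j) d ->
 derivable (tensor g) x (delta_mx ord0 j) /\
 partial j (tensor g) x = d * \prod_(i | i != j) g i (x ord0 i).
Proof.
move=> [dg dgE]; set P := \prod_(i | _) _.
have E : dquot j (tensor g) ^~ x =
  fun h => (h^-1 *: ((g j \o shift (x ord0 j)) (h *: (1 : R)) - g j (x ord0 j))) * P.
 apply/funext => h; rewrite /dquot /tensor (bigD1 j)//= [X in _ - X](bigD1 j)//=. rewrite !mxE !eqxx /=.
 rewrite (eq_bigr (fun i => g i (x ord0 i))) => [|i ij]; last first.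
  by rewrite !mxE eqxx /= (negbTE ij) mulr0 add0r.
 by rewrite -/P /GRing.scale/=; ring.
have c : dquot j (tensor g) ^~ x @ 0^' --> d * P by rewrite E; apply: cvgM; [rewrite -dgE; exact: dg|exact: cvg_cst].
split; first by apply/derivable_dquot; apply/cvg_ex; eexists; exact: c.
by rewrite partial_dquot; exact/cvg_lim.
Qed.

End tensors.

Section splines.
Context {R n}.
Variables (r0 h : R) (N : nat).
Hypothesis h0 : 0 < h.
Local Notation idx := {ffun 'I_n -> 'I_N}.
Implicit Types (q : idx) (x y : 'rV[R]_n).
Definition crd (t : R) : R := (t + r0) / h.

Lemma is_derive_crd (f : R -> R) (t df : R) : is_derive (crd t) 1 f df ->
 is_derive t (1 : R) (fun t => f (crd t)) (h^-1 * df).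
Proof.
have h2 := is_deriveD (@is_derive_id R R^o t 1) (is_derive_cst r0 t (1 : R)).
have d1 : is_derive t (1 : R) crd h^-1.
 by apply: (derive_congr (is_deriveZ h^-1 h2)) => [s|]; rewrite /crd /GRing.scale/= ?addr0 ?mulr1// mulrC.
by move=> d2; apply: (derive_congr (@is_derive1_comp R f crd t _ _ d2 d1)) => //; rewrite mulrC.
Qed.

(** The product spline supported in the cube of side 3h with lower corner [node q]. The lattice
    starts at -r0 in every coordinate, so that finitely many indices, counted from 0, cover a
    ball. *)
Definition om q : 'rV[R]_n -> R := tensor (fun i t => bsp (crd t - (q i)%:R)).
Definition spl (c : idx -> R) x : R := \sum_q c q * om q x.
Definition node q : 'rV[R]_n := \row_i (h * (q i)%:R - r0).

Lemma crdB s t : crd s - crd t = (s - t) / h.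
Proof. by rewrite /crd; field; rewrite gt_eqF. Qed.

Lemma om_ge0 q x : 0 <= om q x.
Proof. by apply: prodr_ge0 => i _; exact: bsp_ge0. Qed.

Lemma om_supp q x i : om q x != 0 -> 0 <= x ord0 i - node q ord0 i <= 3 * h.
Proof.
rewrite /om /tensor prodf_seq_neq0 => /allP/(_ i); rewrite mem_index_enum => /(_ isT) /=.
move=> h1; have : ~~ ((crd (x ord0 i) - (q i)%:R <= 0) || (3 <= crd (x ord0 i) - (q i)%:R)).
 by apply: contra h1 => /bsp_0 ->.
have e : x ord0 i - node q ord0 i = (crd (x ord0 i) - (q i)%:R) * h by rewrite mxE /crd mulrBl divfK ?gt_eqF//; ring.
rewrite negb_or -!ltNge e => /andP[/ltW h2 /ltW h3].
by rewrite pmulr_lge0// h2 /= ler_pM2r.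
Qed.

Lemma om_dist q x y : om q x != 0 -> (forall i, 0 <= y ord0 i - node q ord0 i <= 3 * h) ->
 `|x - y| <= 3 * h.
Proof.
move=> hx hy; apply: norm_le => [|i]; first by rewrite mulr_ge0// ltW.
rewrite !mxE; have := om_supp i hx; have := hy i; rewrite ler_norml; lra.
Qed.

Lemma sum_om_abs x : \sum_q `|om q x| <= 1.
Proof.
have := @sum_tensor_bound R n N (fun i j => bsp (crd (x ord0 i) - j%:R)) (fun=> 1).
rewrite big1_eq; apply => i; exact: sum_bsp_abs.
Qed.

Lemma sum_om1 x : (forall i, 2 * h <= x ord0 i + r0 <= N%:R * h) -> \sum_q om q x = 1.
Proof.
move=> hx; rewrite (sum_tensor (fun i j => bsp (crd (x ord0 i) - j%:R))) big1// => i _.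
have /andP[h1 h2] := hx i.
by rewrite sum_bsp1 // /crd ?ler_pdivlMr// ler_pdivrMr.
Qed.

Lemma sum_om_diff x y : \sum_q `|om q x - om q y| <= n%:R * (2 / h) * `|x - y|.
Proof.
have := @sum_tensor_diff R n N (fun i j => bsp (crd (x ord0 i) - j%:R))
 (fun i j => bsp (crd (y ord0 i) - j%:R)) (fun=> 1) (fun=> 2 / h * `|x - y|).
have -> : \sum_(m < n) (2 / h * `|x - y| * \prod_(i < n | i != m) (1 : R)) =
  n%:R * (2 / h) * `|x - y|.
 rewrite (eq_bigr (fun=> 2 / h * `|x - y|)) => [|m _]; last by rewrite big1_eq mulr1.
 by rewrite sumr_const card_ord -[LHS]mulr_natl mulrA.
apply.
- move=> i; exact: sum_bsp_abs.
- move=> i; exact: sum_bsp_abs.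
- move=> i; apply: (le_trans (sum_bsp_diff _ _ _)).
 rewrite crdB normrM (gtr0_norm (_ : 0 < h^-1)) ?invr_gt0// mulrA mulrAC. rewrite ler_wpM2l ?divr_ge0 ?(ltW h0)//.
 by have := coord_le (x - y) i; rewrite !mxE.
Qed.

Lemma om_lip q : lipc (n%:R * (2 / h)) (om q).
Proof.
move=> x y; apply: le_trans (sum_om_diff x y).
by rewrite (bigD1 q)//= lerDl sumr_ge0.
Qed.

Lemma om_bsupp q : exists r, bsupp r (om q).
Proof.
exists (`|node q| + 3 * h) => x hx; apply/eqP; apply: contraTT hx => /om_supp hs.
rewrite -leNgt; apply: norm_le => [|i]; first by rewrite addr_ge0// mulr_ge0// ltW.
have := hs i; have := coord_le (node q) i; rewrite !ler_norml => /andP[h1 h2] /andP[h3 h4].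
have := h0; lra.
Qed.

Lemma om_lipb q : lipb (om q).
Proof.
have [r hr] := om_bsupp q; exists (n%:R * (2 / h)), r; split => //; last exact: om_lip.
by rewrite mulr_ge0// divr_ge0// ltW.
Qed.

Lemma spl_lipb c : lipb (spl c).
Proof. by apply: lipb_sum => q _; apply: lipbZ; exact: om_lipb. Qed.

(* c approximates f near the support of each om q *)
Section quasi.
Variables (f : 'rV[R]_n -> R) (c : idx -> R) (r E : R).
Hypothesis r0E : r + 1 + 2 * h <= r0.
Hypothesis NE : r + 1 + r0 <= N%:R * h.
Hypothesis f0 : bsupp r f.
Hypothesis c0 : forall q x, om q x != 0 -> r < `|x| -> c q = 0.
Hypothesis cE : forall q x, om q x != 0 -> `|c q - f x| <= E.
Hypothesis E0 : 0 <= E.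

Lemma spl_out x : r < `|x| -> spl c x = 0.
Proof.
move=> hx; rewrite /spl big1// => q _.
by have [->|/c0 ->] := eqVneq (om q x) 0; rewrite ?mulr0 ?mul0r.
Qed.

Lemma sum_om_in x : `|x| <= r + 1 -> \sum_q om q x = 1.
Proof.
move=> hx; apply: sum_om1 => i.
have := coord_le x i; rewrite ler_norml => /andP[h1 h2].
by apply/andP; split; have := r0E; have := NE; lra.
Qed.

Lemma spl_close x : `|spl c x - f x| <= E.
Proof.
have [hx|hx] := leP `|x| r; last by rewrite spl_out// f0// subrr normr0.
have -> : f x = \sum_q f x * om q x by rewrite -mulr_sumr sum_om_in ?mulr1// (le_trans hx)// lerDl.
rewrite -sumrB; apply: le_norm_sum.
apply: (via (\sum_q E * `|om q x|)); last first.
 by rewrite -mulr_sumr ler_piMr// sum_om_abs.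
apply: ler_sum => q _; rewrite -mulrBl normrM.
by have [->|/cE hq] := eqVneq (om q x) 0; rewrite ?normr0 ?mulr0// ler_wpM2r.
Qed.

(** Near the ball the splines sum to 1 at both points, so the number f x may be subtracted from
    every coefficient. The coefficients that contribute then have size at most E + |f x - f y|. *)
Lemma spl_diff x y : `|x - y| <= 1 ->
 `|spl c x - spl c y| <= (E + `|f x - f y|) * (n%:R * (2 / h)) * `|x - y|.
Proof.
wlog xy : x y / `|y| <= `|x| => [H|] d1.
 have [/H|/ltW/H] := leP `|y| `|x|; first exact.
 by rewrite (distrC (spl c x)) (distrC (f x)) (distrC x); apply; rewrite distrC.
have hr : 0 <= (E + `|f x - f y|) * (n%:R * (2 / h)) * `|x - y|.
 by rewrite !mulr_ge0 ?addr_ge0 ?divr_ge0// ?ltW// invr_gt0.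
have [hx|hx] := leP `|x| (r + 1); last first.
 rewrite !spl_out ?subrr ?normr0//; last by rewrite (lt_trans _ hx)// ltrDl.
 have := ler_dist_dist x y; rewrite ler_norml => /andP[_]; lra.
have -> : spl c x - spl c y = \sum_q (c q - f x) * (om q x - om q y).
 rewrite (eq_bigr (fun q => (c q * om q x - c q * om q y) - f x * (om q x - om q y))); last first.
  by move=> q _; ring.
 rewrite sumrB sumrB -mulr_sumr sumrB !sum_om_in ?subrr ?mulr0 ?subr0//. exact: le_trans xy hx.
apply: le_norm_sum; rewrite -mulrA.
apply: (via ((E + `|f x - f y|) * \sum_q `|om q x - om q y|)); last first.
 by rewrite ler_wpM2l ?addr_ge0// sum_om_diff.
rewrite mulr_sumr; apply: ler_sum => q _; rewrite normrM.
have [ox|/cE ox] := eqVneq (om q x) 0; last by rewrite ler_wpM2r// (le_trans ox)// lerDl.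
have [oy|/cE oy] := eqVneq (om q y) 0; first by rewrite ox oy subrr normr0 !mulr0.
rewrite ler_wpM2r//; have -> : c q - f x = (c q - f y) - (f x - f y) by ring.
by rewrite le_normB// lerD2r.
Qed.

End quasi.

End splines.

(** * Spline interpolation of Hoelder functions *)

Section interpolation.
Context {R n}.
Implicit Types (f g : 'rV[R]_n -> R) (r h : R).

(* number of nodes per coordinate on a lattice of step h covering the ball of radius r + 4 *)
Definition Nh r h : nat := (Num.truncn ((2 * r + 10) / h)).+1.

Lemma Nh_ge r h : 0 < h -> 2 * r + 10 <= (Nh r h)%:R * h.
Proof. by move=> h0; rewrite -ler_pdivrMr// ltW// truncnS_gt. Qed.

(** The number of nodes is left free because nested dyadic lattices will need it to double from one
    scale to the next; [Ih] is the instance with [Nh] nodes per coordinate. *)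
Definition IhN r h N f : 'rV[R]_n -> R :=
 spl (r + 6) h (fun q : {ffun 'I_n -> 'I_N} => f (node (r + 6) h q)).

Definition Ih r h f : 'rV[R]_n -> R :=
 spl (r + 6) h (fun q : {ffun 'I_n -> 'I_(Nh r h)} => f (node (r + 6) h q)).

Section bounds.
Variables (r h : R) (N : nat).
Hypotheses (h0 : 0 < h) (h1 : h <= 1) (Nge : 2 * r + 10 <= N%:R * h).
Local Notation idx := {ffun 'I_n -> 'I_N}.
Lemma node_dist (q : idx) x : om (r + 6) h q x != 0 -> `|x - node (r + 6) h q| <= 3 * h.
Proof. by move=> hq; apply: (om_dist h0 hq) => i; rewrite subrr lexx mulr_ge0// ltW. Qed.

Variables (f : 'rV[R]_n -> R) (a C : R).
Hypotheses (fr : bsupp r f) (a0 : 0 < a) (a1 : a <= 1) (C0 : 0 <= C) (fC : hol a C f).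

Lemma IhN_node0 (q : idx) x : om (r + 6) h q x != 0 -> r + 3 < `|x| -> f (node (r + 6) h q) = 0.
Proof.
move=> /node_dist hq hx; apply: fr.
have := ler_normD (x - node (r + 6) h q) (node (r + 6) h q); rewrite subrK; have := h1; lra.
Qed.

Lemma pow3h : (3 * h) `^ a <= 3 * h `^ a.
Proof.
rewrite powRM ?(ltW h0)// ler_wpM2r ?powR_ge0//.
by rewrite -[leRHS]powRr1// ler_powR// ler1n.
Qed.

Lemma IhN_nodeE (q : idx) x : om (r + 6) h q x != 0 ->
 `|f (node (r + 6) h q) - f x| <= C * (3 * h `^ a).
Proof.
move=> /node_dist hq; apply: (le_trans (fC _ _)); rewrite ler_wpM2l//.
apply: le_trans pow3h; rewrite distrC ge0_ler_powR ?nnegrE ?(ltW a0)//.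
by rewrite mulr_ge0// ltW.
Qed.

Let r0E : r + 3 + 1 + 2 * h <= r + 6. Proof. by have := h1; lra. Qed.
Let NE : r + 3 + 1 + (r + 6) <= N%:R * h.
Proof. by have := Nge; lra. Qed.
Let fr3 : bsupp (r + 3) f. Proof. by apply: bsuppW fr; rewrite lerDl. Qed.
Let E0 : 0 <= C * (3 * h `^ a). Proof. by rewrite !mulr_ge0// powR_ge0. Qed.

Lemma IhN_close x : `|IhN r h N f x - f x| <= C * (3 * h `^ a).
Proof. exact: (spl_close h0 r0E NE fr3 IhN_node0 IhN_nodeE E0). Qed.

Lemma IhN_bsupp : bsupp (r + 3) (IhN r h N f).
Proof. move=> x; exact: (spl_out IhN_node0). Qed.

(** For |x - y| <= h the coefficients vary by 4 C h^a and the splines have slope 2n/h, which gives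
    8n. For |x - y| > h the interpolation errors at the two points and the increment of f, at most
    3, 3 and 1 times C h^(a-1) |x - y|, give 7; here a <= 1 enters. *)
Lemma IhN_lip : lipc ((8 * n%:R + 7) * C * h `^ (a - 1)) (IhN r h N f).
Proof.
move=> x y.
have hpow : h `^ a = h `^ (a - 1) * h by rewrite -[X in _ * X](powRr1 (ltW h0)) -powRD ?subrK// (gt_eqF h0) implybT.
have hp0 : 0 <= h `^ (a - 1) by exact: powR_ge0.
have [xy|xy] := leP `|x - y| h.
 have d1 : `|x - y| <= 1 by exact: le_trans h1. apply: (le_trans (spl_diff h0 r0E NE IhN_node0 IhN_nodeE E0 d1)).
 rewrite ler_wpM2r//. have fE : `|f x - f y| <= C * h `^ a.
  by rewrite (le_trans (fC _ _))// ler_wpM2l// ge0_ler_powR ?nnegrE ?(ltW a0) ?(ltW h0).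
 apply: (via ((4 * C * h `^ a) * (n%:R * (2 / h)))).
  rewrite ler_wpM2r ?mulr_ge0 ?invr_ge0 ?(ltW h0)//.
  have := lerD (lexx (C * (3 * h `^ a))) fE; move: (h `^ a) => u; lra.
 rewrite hpow.
 have -> : 4 * C * (h `^ (a - 1) * h) * (n%:R * (2 / h)) = 8 * n%:R * C * h `^ (a - 1) by field; rewrite gt_eqF.
 by rewrite !ler_wpM2r// lerDl.
apply: (via (7 * C * h `^ (a - 1) * `|x - y|)); last first.
 by rewrite !ler_wpM2r// lerDr mulr_ge0.
have -> : IhN r h N f x - IhN r h N f y = (IhN r h N f x - f x) - (IhN r h N f y - f y) + (f x - f y) by ring.
have xh : h `^ a <= h `^ (a - 1) * `|x - y| by rewrite hpow ler_wpM2l// ltW.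
have fE : `|f x - f y| <= C * (h `^ (a - 1) * `|x - y|).
 rewrite (le_trans (fC _ _))// ler_wpM2l//. have xy0 : 0 < `|x - y| by rewrite (lt_trans h0).
 have -> : `|x - y| `^ a = `|x - y| `^ (a - 1) * `|x - y|.
  by rewrite -[X in _ * X](powRr1 (ltW xy0)) -powRD ?subrK// (gt_eqF xy0) implybT.
 rewrite ler_wpM2r//. have := @ge0_ler_powR R (1 - a) _ h `|x - y|; rewrite subr_ge0 => /(_ a1).
 rewrite !nnegrE (ltW h0) normr_ge0 => /(_ isT isT (ltW xy)) hh.
 have e1 (t : R) : 0 < t -> t `^ (a - 1) = (t `^ (1 - a))^-1 by move=> t0; rewrite -powRN opprB.
 by rewrite !e1// lef_pV2 ?posrE ?powR_gt0.
have := IhN_close x; have := IhN_close y => c1 c2.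
apply: le_normD; apply: (le_trans (lerD (ler_normB _ _) fE)).
have C3 : C * (3 * h `^ a) <= 3 * C * h `^ (a - 1) * `|x - y| by rewrite mulrCA -2!mulrA ler_wpM2l// ler_wpM2l.
apply: (le_trans (lerD (lerD (le_trans c2 C3) (le_trans c1 C3)) (lexx _))).
have -> : 3 * C * h `^ (a - 1) * `|x - y| + 3 * C * h `^ (a - 1) * `|x - y| +
  C * (h `^ (a - 1) * `|x - y|) = 7 * C * h `^ (a - 1) * `|x - y| by ring.
exact: lexx.
Qed.

End bounds.

Section standard.
Variables (r h : R) (f : 'rV[R]_n -> R) (a C : R).
Hypotheses (h0 : 0 < h) (h1 : h <= 1).
Hypotheses (fr : bsupp r f) (a0 : 0 < a) (a1 : a <= 1) (C0 : 0 <= C) (fC : hol a C f).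

Lemma Ih_close x : `|Ih r h f x - f x| <= C * (3 * h `^ a).
Proof. exact: (IhN_close h0 h1 (Nh_ge r h0) fr a0 a1 C0 fC). Qed.

Lemma Ih_bsupp : bsupp (r + 3) (Ih r h f).
Proof. move=> x; exact: (@IhN_bsupp r h (Nh r h) h0 h1 f fr x). Qed.

Lemma Ih_lip : lipc ((8 * n%:R + 7) * C * h `^ (a - 1)) (Ih r h f).
Proof. exact: (IhN_lip h0 h1 (Nh_ge r h0) fr a0 a1 C0 fC). Qed.

End standard.

Lemma Ih_lipb r h f : 0 < h -> lipb (Ih r h f).
Proof. by move=> h0; exact: spl_lipb. Qed.

Lemma IhL r h c f g x : Ih r h (fun y => c * f y + g y) x = c * Ih r h f x + Ih r h g x.
Proof.
rewrite /Ih /spl mulr_sumr -big_split /=; apply: eq_bigr => q _.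
by rewrite mulrDl mulrA.
Qed.

End interpolation.

(** * Means over cubes and convergence of difference quotients in L^1 *)

Section steklov.
Context {R n}.
Implicit Types (f u v : 'rV[R]_n -> R) (z : 'rV[R]_n).
Definition cube (h : R) z : set 'rV[R]_n := hbox z (z + const_mx h).

Lemma cubeP h z x : cube h z x <-> forall i, 0 < x ord0 i - z ord0 i <= h.
Proof.
split => hx i; have := hx i; rewrite in_itv/= !mxE subr_gt0 lerBlDl//.
Qed.

Lemma mf_cube h z : measurable (cube h z). Proof. exact: mf_hbox. Qed.

Lemma I_indic (A : set 'rV[R]_n) : measurable A -> I (\1_A) = fine (mu A).
Proof. by move=> mA; rewrite /Rintegral integral_indic// setIT. Qed.

Lemma I_cube h z : 0 <= h -> I (\1_(cube h z)) = h ^+ n.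
Proof.
move=> h0; rewrite I_indic; last exact: mf_cube.
rewrite rV_hbox => [|i]; last by rewrite !mxE lerDl.
rewrite /= (eq_bigr (fun=> h)) => [|i _]; last by rewrite !mxE addrAC subrr add0r.
by rewrite prodr_const card_ord.
Qed.

Lemma indic01 (A : set 'rV[R]_n) x : `|\1_A x : R| <= 1.
Proof. by rewrite indicE; case: (_ \in _); rewrite ?normr0 ?normr1. Qed.

Lemma L1_indic u (A : set 'rV[R]_n) : L1 mu u -> measurable A -> L1 mu (fun x => u x * \1_A x).
Proof.
move=> lu mA; apply: (L1M (C := 1) lu); first exact: measurable_indic.
move=> x; exact: indic01.
Qed.

Lemma L1_cube h z : L1 mu (\1_(cube h z)).
Proof.
apply: (@L1_bounded _ _ _ 1 (`|z| + `|h|)).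
- apply: measurable_indic; exact: mf_cube.
- move=> x; exact: indic01.
- move=> x hx; rewrite indicE memNset// => /cubeP hb.
 move: hx; apply/negP; rewrite -leNgt; apply: norm_le => [|i]; first exact: addr_ge0.
 have /andP[h1 h2] := hb i; have := coord_le z i; have := ler_norm h.
 rewrite !ler_norml => h3 /andP[h4 h5]; apply/andP; split; have := normr_ge0 h; lra.
Qed.

(** Steklov mean over the cube with lower corner z. Interpolating means instead of point values
    makes the gradients of the interpolations converge in L^1. *)
Definition avg (h : R) u z : R := h ^- n * I (fun x => u x * \1_(cube h z) x).

Lemma avgL h z c u v : L1 mu u -> L1 mu v ->
 avg h (fun x => c * u x + v x) z = c * avg h u z + avg h v z.
Proof.
move=> lu lv; have mc := mf_cube h z.
rewrite /avg (_ : (fun x => _) = fun x => c * (u x * \1_(cube h z) x) + v x * \1_(cube h z) x).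
 by rewrite ID ?IZ; [ring|exact: L1_indic|apply: L1Z; exact: L1_indic|exact: L1_indic].
by apply/funext => x; ring.
Qed.

Lemma avg_dist h u z c E : 0 < h -> L1 mu u ->
 (forall y, cube h z y -> `|u y - c| <= E) -> `|avg h u z - c| <= E.
Proof.
move=> h0 lu hE; have hn : h ^+ n != 0 by rewrite expf_neq0// gt_eqF.
have lc := L1_cube h z; have mc := mf_cube h z.
have lu' := L1_indic lu mc.
have -> : avg h u z - c = h ^- n * I (fun x => (u x - c) * \1_(cube h z) x).
 rewrite (_ : (fun x => (u x - c) * _) = fun x => u x * \1_(cube h z) x - c * \1_(cube h z) x).
  rewrite IB//; last exact: L1Z. by rewrite IZ// I_cube ?(ltW h0)// /avg mulrBr [_ * (c * _)]mulrCA mulVf// mulr1.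
 by apply/funext => x; ring.
have E' : I (fun x => E * \1_(cube h z) x) = E * h ^+ n by rewrite IZ// I_cube// ltW.
rewrite normrM gtr0_norm ?invr_gt0 ?exprn_gt0// ler_pdivrMl ?exprn_gt0// mulrC -E'.
apply: I_abs_le; last first.
- move=> x; rewrite indicE; case: (boolP (x \in _)) => [/set_mem/hE|_]; first by rewrite !mulr1.
 by rewrite !mulr0 normr0.
- exact: L1Z.
- rewrite (_ : (fun x => _) = fun x => u x * \1_(cube h z) x - c * \1_(cube h z) x).
  apply: L1B => //; exact: L1Z.
 by apply/funext => x; ring.
Qed.

Lemma cube_norm h z y : 0 <= h -> cube h z y -> `|y - z| <= h.
Proof.
move=> h0 /cubeP hy; apply: norm_le => // i; rewrite !mxE.
have := hy i; rewrite ler_norml; lra.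
Qed.

Lemma avg_shift h u z (v : 'rV[R]_n) : L1 mu u -> avg h u (z + v) = avg h (fun x => u (x + v)) z.
Proof.
move=> lu; rewrite /avg; congr (_ * _).
have lu' := L1_indic lu (mf_cube h (z + v)).
have [_ <-] := L1_shift v lu'.
congr Rintegral; apply/funext => x; congr (_ * _); rewrite !indicE; congr ((nat_of_bool _)%:R).
apply/idP/idP; rewrite !inE => /cubeP hx; apply/cubeP => i; have := hx i; rewrite !mxE;
 by rewrite opprD addrACA subrr addr0.
Qed.

(** A difference of two means is the mean of the difference of u and a translate. *)
Lemma avg_lip h u L : 0 < h -> lipb u -> lipc L u -> lipc L (avg h u).
Proof.
move=> h0 bu uL x y; have lu := lipbL1 bu.
have [ls _] := L1_shift (x - y) lu.
have -> : avg h u x = avg h (fun t => u (t + (x - y))) y by rewrite -avg_shift// addrC subrK.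
have -> : avg h (fun t => u (t + (x - y))) y - avg h u y =
  avg h (fun t => -1 * u t + u (t + (x - y))) y - 0 by rewrite avgL//; ring.
apply: avg_dist => //; first by apply: L1D => //; exact: L1Z.
move=> t _; rewrite subr0 mulN1r addrC (le_trans (uL _ _))//.
by rewrite addrAC subrr add0r.
Qed.

Lemma avg_bsupp h u r : 0 < h -> h <= 1 -> bsupp r u -> bsupp (r + 1) (avg h u).
Proof.
move=> h0 h1 ur z hz; rewrite /avg (_ : (fun x => _) = fun=> 0) ?I0 ?mulr0//.
apply/funext => x; rewrite indicE; case: (boolP (x \in _)) => [/set_mem hx|]; last by rewrite mulr0.
have := cube_norm (ltW h0) hx => hd; rewrite ur ?mul0r//.
have := ler_normD (z - x) x; rewrite subrK distrC.
by have := h1; lra.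
Qed.


Implicit Types (g : 'rV[R]_n -> R).
Lemma partial_sum (J : Type) (s : seq J) (c : J -> R) (g : J -> 'rV[R]_n -> R) j x :
 (forall k, derivable (g k) x (delta_mx ord0 j)) ->
 derivable (fun y => \sum_(k <- s) c k * g k y) x (delta_mx ord0 j) /\
 partial j (fun y => \sum_(k <- s) c k * g k y) x = \sum_(k <- s) c k * partial j (g k) x.
Proof.
move=> dg; elim: s => [|k s [IH1 IH2]].
 rewrite (_ : (fun y => _) = cst 0); last by apply/funext => y; rewrite big_nil.
 by split; [exact: derivable_cst|rewrite big_nil /partial derive_cst].
rewrite (_ : (fun y => _) = c k *: g k + (fun y => \sum_(k <- s) c k * g k y)); last first.
 by apply/funext => y; rewrite big_cons.
have dZ : derivable (c k *: g k) x (delta_mx ord0 j) by apply: derivableZ; exact: dg.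
split; first exact: derivableD dZ IH1.
by rewrite big_cons -IH2 /partial (deriveD dZ IH1) (deriveZ _ (dg k)).
Qed.

Lemma cvg_dquot_seq' i f x (u : nat -> R) : (forall k, u k != 0) -> u k @[k --> \oo] --> 0 ->
 derivable f x (delta_mx ord0 i) -> dquot i f (u k) x @[k --> \oo] --> partial i f x.
Proof.
move=> u0 ul /derivable_dquot c; rewrite partial_dquot.
have cl : dquot i f ^~ x @ 0^' --> lim (dquot i f ^~ x @ 0^') by [].
apply: (cvg_comp u (dquot i f ^~ x) _ cl).
move=> A [e /= e0 he]; near=> k; apply: he => //=.
by rewrite sub0r normrN; near: k; move/cvgr0Pnorm_lt : ul => /(_ _ e0).
Unshelve. all: by end_near. Qed.

Lemma partial_bsupp i f r : bsupp r f -> bsupp r (partial i f).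
Proof.
move=> fr x xr; apply: (@partial_local _ _ i f [set y | r < `|y|] 0) => //.
by rewrite (_ : [set y | _] = ~` [set y | `|y| <= r]);
 [apply: closed_openC; exact: closed_normle|
  apply/seteqP; split => y /=; [move=> h; apply/negP; rewrite -ltNge|move/negP; rewrite -ltNge]].
Qed.

Lemma partial_L1 i f : lipb f -> L1 mu (partial i f).
Proof.
move=> [L [r [L0 fL fr]]]; apply: (@L1_bounded _ _ _ L r).
- exact: (partial_mf i (lipc_cont fL)).
- move=> x; exact: partial_bound.
- exact: partial_bsupp.
Qed.

(** The quotients converge almost everywhere, are bounded by L, and live in one ball because the
    increments are at most 1, so that convergence is dominated. *)
Lemma dquot_L1_cvg i f (u : nat -> R) : lipb f -> (forall k, u k != 0) ->
 (forall k, `|u k| <= 1) -> u k @[k --> \oo] --> 0 ->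
 I (fun x => `|dquot i f (u k) x - partial i f x|) @[k --> \oo] --> 0.
Proof.
move=> [L [r [L0 fL fr]]] u0 u1 ul; have cf := lipc_cont fL.
have [|||||_ h _] := @I_DCT _ _ R mu (fun k => dquot i f (u k)) (partial i f)
  (fun x => L * cutoff (`|r| + 1) x).
- move=> k; exact: dquot_measurable.
- exact: partial_mf.
- apply: filterS (lip_ae_derivable i fL) => x; exact: cvg_dquot_seq'.
- by apply: L1Z; apply/lipbL1/lipb_cutoff.
- apply: nearW => x k; have [xr|xr] := leP `|x| (`|r| + 1).
  rewrite cutoff1// mulr1; exact: dquot_bound.
 have rr := ler_norm r. rewrite /dquot !fr ?subrr ?mulr0 ?normr0 ?mulr_ge0//; first exact: clamp_ge0.
  by rewrite (le_lt_trans rr)// (lt_trans _ xr)// ltrDl.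
 have h2 : `|x| <= `|u k| + `|u k *: delta_mx ord0 i + x|.
  rewrite -{1}(addKr (u k *: delta_mx ord0 i) x) le_normD//. by rewrite normrN normrZ norm_delta mulr1.
 by rewrite (le_lt_trans rr)// -(ltrD2l 1) (addrC 1) (lt_le_trans xr)// (le_trans h2)// lerD2r.
- exact: h.
Qed.

End steklov.

(** * Gradients of interpolated means and their convergence in L^1 *)

Section gradient.
Context {R n}.
Implicit Types (f u v : 'rV[R]_n -> R).
Lemma cube_disjoint (r0 h : R) N (q q' : {ffun 'I_n -> 'I_N}) x : 0 < h ->
 cube h (node r0 h q) x -> cube h (node r0 h q') x -> q = q'.
Proof.
move=> h0 /cubeP hq /cubeP hq'; apply/ffunP => i; apply/val_inj/eqP => /=.
have := hq i; have := hq' i; rewrite !mxE => /andP[a1 a2] /andP[b1 b2].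
have K (a b : nat) : h * a%:R < h * b%:R + h -> (a <= b)%N.
 have -> : h * b%:R + h = h * b.+1%:R by rewrite -natr1 mulrDr mulr1. by rewrite (ltr_pM2l h0) ltr_nat ltnS.
by rewrite eqn_leq; apply/andP; split; apply: K; lra.
Qed.

Lemma sum_cube_le1 (r0 h : R) N x : 0 < h ->
 \sum_(q : {ffun 'I_n -> 'I_N}) \1_(cube h (node r0 h q)) x <= 1 :> R.
Proof.
move=> h0; have [[q hq]|nq] := pselect (exists q : {ffun 'I_n -> 'I_N}, cube h (node r0 h q) x).
 rewrite (bigD1 q)//= indicE mem_set// big1 ?addr0// => q' q'q.
 rewrite indicE memNset// => hq'; move/eqP: q'q; apply; exact: cube_disjoint hq' hq.
by rewrite big1// => q _; rewrite indicE memNset// => hq; apply: nq; exists q.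
Qed.

Variables (j : 'I_n) (r h : R).
Hypotheses (h0 : 0 < h) (h1 : h <= 1).
Local Notation rho := (r + 1).
Local Notation N := (Nh rho h).
Local Notation idx := {ffun 'I_n -> 'I_N}.
Local Notation nd := (node (rho + 6) h).
Local Notation cr := (crd (rho + 6) h).
(** The quadratic spline in the coordinate j is replaced by the linear one: the derivative of [om]
    in direction j is the difference of two neighbouring functions of this kind divided by h. *)
Definition omj (q : idx) : 'rV[R]_n -> R :=
 tensor (fun i t => (if i == j then hat else bsp) (cr t - (q i)%:R)).

Lemma kern_ge0 i t : 0 <= (if i == j then hat else bsp) t :> R.
Proof. by case: ifP => _; [exact: hat_ge0|exact: bsp_ge0]. Qed.
Lemma kern_le1 i t : (if i == j then hat else bsp) t <= 1 :> R.
Proof. by case: ifP => _; [exact: hat_le1|exact: bsp_le1]. Qed.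

Lemma omj_ge0 q x : 0 <= omj q x.
Proof. by apply: prodr_ge0 => i _; exact: kern_ge0. Qed.
Lemma omj_le1 q x : omj q x <= 1.
Proof. by apply: prodr_ile1 => i _; rewrite kern_ge0 kern_le1. Qed.

Lemma omj_supp q x : omj q x != 0 -> cube (3 * h) (nd q) x.
Proof.
rewrite /omj /tensor prodf_seq_neq0 => /allP hx; apply/cubeP => i.
have := hx i; rewrite mem_index_enum => /(_ isT) /= h2.
have e : x ord0 i - nd q ord0 i = (cr (x ord0 i) - (q i)%:R) * h by rewrite mxE /crd mulrBl divfK ?gt_eqF//; ring.
rewrite e pmulr_lgt0// ler_pM2r// !ltNge.
apply/andP; split; [apply/negP => h3|rewrite leNgt; apply/negP => /ltW h3]; move: h2; case: ifP => _.
- by rewrite hat_0 ?h3 ?eqxx.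
- by rewrite bsp_0 ?h3 ?eqxx.
- rewrite hat_0 ?eqxx//; apply/orP; right; apply: le_trans h3; lra.
- by rewrite bsp_0 ?h3 ?orbT ?eqxx.
Qed.

Lemma sum_omj1 x : `|x| <= rho + 4 -> \sum_q omj q x = 1.
Proof.
move=> hx; rewrite (sum_tensor (fun i k => (if i == j then hat else bsp) (cr (x ord0 i) - k%:R))).
rewrite big1// => i _.
have := coord_le x i; rewrite ler_norml => /andP[h2 h3].
have hN := Nh_ge rho h0.
have c1 : 2 <= cr (x ord0 i) by rewrite /crd ler_pdivlMr//; have := h1; lra.
have c2 : cr (x ord0 i) <= N%:R by rewrite /crd ler_pdivrMr//; lra.
by case: ifP => _; [exact: sum_hat1|exact: sum_bsp1].
Qed.

Lemma omj_measurable q : mfun (omj q).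
Proof.
rewrite /omj /tensor; apply: measurable_prod => i _.
have mc : mfun (fun x : 'rV[R]_n => cr (x ord0 i) - (q i)%:R).
 apply: measurable_funB => //; apply: measurable_funM => //. apply: measurable_funD => //; exact: coord_mf.
suff [L L0 hL] : exists2 L : R, 0 <= L & forall s t, `|(if i == j then hat else bsp) s - (if i == j then hat else bsp) t| <= L * `|s - t|.
 apply: (measurableT_comp _ mc); apply: continuous_measurable_fun => s. exact: (lip1_continuous L0 hL).
case: (i == j); first by exists 2 => // s t; exact: hat_lip.
exists 2 => // s t; have := @sum_bsp_diff R 1 s t; rewrite big_ord1.
by rewrite !subr0.
Qed.

(** Quasi-interpolation with the kernels [omj], bounded on L^1 uniformly in h ([Aj_norm]) and close
    to the identity on Lipschitz functions ([Aj_close]). *)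
Definition Aj u x := \sum_q avg h u (nd q) * omj q x.

Lemma AjL c u v x : L1 mu u -> L1 mu v ->
 Aj (fun y => c * u y + v y) x = c * Aj u x + Aj v x.
Proof.
move=> lu lv; rewrite /Aj mulr_sumr -big_split /=; apply: eq_bigr => q _.
by rewrite avgL// mulrDl mulrA.
Qed.

Lemma L1_omj q : L1 mu (omj q) /\ I (omj q) <= (3 * h) ^+ n.
Proof.
have b x : `|omj q x| <= \1_(cube (3 * h) (nd q)) x.
 rewrite ger0_norm ?omj_ge0// indicE; case: (boolP (x \in _)) => [_|]; first exact: omj_le1.
 by rewrite notin_setE => hx; have [->//|/omj_supp] := eqVneq (omj q x) 0.
have lc := @L1_cube R n (3 * h) (nd q).
have l1 : L1 mu (omj q) by apply: (L1_le _ b) => //; exact: omj_measurable.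
split => //; rewrite -(@I_cube R n (3 * h) (nd q)) ?mulr_ge0 ?(ltW h0)//.
apply: I_le => // x; exact: le_trans (ler_norm _) (b x).
Qed.

Lemma L1_Aj u : L1 mu (Aj u).
Proof. by apply: L1_sum => q _; apply: L1Z; have [] := L1_omj q. Qed.

(** Each kernel has integral at most (3h)^n, each mean carries the factor h^-n, and the cubes of the
    means are disjoint. *)
Lemma Aj_norm u : L1 mu u -> I (fun x => `|Aj u x|) <= 3 ^+ n * I (fun x => `|u x|).
Proof.
move=> lu; have lau := L1_abs lu.
apply: (via (\sum_q `|avg h u (nd q)| * (3 * h) ^+ n)).
 apply: (via (I (fun x => \sum_q `|avg h u (nd q)| * omj q x))).
  apply: I_le; [exact/L1_abs/L1_Aj| |].
   by apply: L1_sum => q _; apply: L1Z; have [] := L1_omj q.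
  move=> x; apply: le_norm_sum; apply: ler_sum => q _. by rewrite normrM (ger0_norm (omj_ge0 _ _)).
 rewrite I_sum; last by move=> q _; apply: L1Z; have [] := L1_omj q.
 apply: ler_sum => q _; have [l1 hl] := L1_omj q; rewrite IZ//. by rewrite ler_wpM2l.
apply: (via (3 ^+ n * \sum_(q : idx) I (fun x => `|u x| * \1_(cube h (nd q)) x))).
 rewrite mulr_sumr; apply: ler_sum => q _. rewrite /avg normrM gtr0_norm ?invr_gt0 ?exprn_gt0// exprMn.
 rewrite mulrC -mulrA ler_wpM2l ?exprn_ge0// mulrA mulfV ?expf_neq0 ?gt_eqF// mul1r.
 apply: I_abs_le; [apply: L1_indic => //; exact: mf_cube| |].
  apply: L1_indic => //; exact: mf_cube.
 by move=> x; rewrite normrM indicE; case: (_ \in _); rewrite ?normr1 ?normr0.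
rewrite ler_wpM2l ?exprn_ge0// -I_sum; last first.
 move=> q _; apply: L1_indic => //; exact: mf_cube.
apply: I_le => //.
 apply: L1_sum => q _; apply: L1_indic => //; exact: mf_cube.
by move=> x; rewrite -mulr_sumr ler_piMr// sum_cube_le1.
Qed.

Lemma Aj_close v M x : lipb v -> 0 <= M -> lipc M v -> bsupp rho v ->
 `|Aj v x - v x| <= 3 * h * M * cutoff (rho + 4) x.
Proof.
move=> bv M0 vM vr; have lv := lipbL1 bv.
have hM : 0 <= 3 * h * M by rewrite !mulr_ge0// ltW.
have nodeD q y : omj q x != 0 -> cube h (nd q) y -> `|y - x| <= 3 * h.
 move=> /omj_supp/cubeP hx /cubeP hy; apply: norm_le => [|i]; first by rewrite mulr_ge0// ltW.
 have := hx i; have := hy i; rewrite !mxE ler_norml => /andP[a1 a2] /andP[b1 b2].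
 by apply/andP; split; have := h0; lra.
have [hx|hx] := leP `|x| (rho + 4); last first.
 have -> : v x = 0 by apply: vr; rewrite (lt_trans _ hx)// ltrDl.
 rewrite /Aj big1 ?subrr ?normr0 ?mulr_ge0 ?clamp_ge0 ?(ltW h0)// => q _.
 have [->|hq] := eqVneq (omj q x) 0; first by rewrite mulr0. rewrite (avg_bsupp h0 h1 vr) ?mul0r//.
 have h3 : 0 <= 3 * h by rewrite mulr_ge0// ltW. have hd := cube_norm h3 (omj_supp hq).
 have := ler_normD (x - nd q) (nd q); rewrite subrK; have := h1; lra.
rewrite cutoff1// mulr1.
have -> : v x = \sum_q v x * omj q x by rewrite -mulr_sumr sum_omj1// mulr1.
rewrite -sumrB le_norm_sum//.
apply: (via (\sum_q 3 * h * M * omj q x)); last by rewrite -mulr_sumr sum_omj1// mulr1.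
apply: ler_sum => q _; rewrite -mulrBl normrM (ger0_norm (omj_ge0 _ _)).
have [->|hq] := eqVneq (omj q x) 0; first by rewrite !mulr0.
rewrite ler_wpM2r ?omj_ge0//; apply: avg_dist => // y hy.
by rewrite (le_trans (vM _ _))// mulrC ler_wpM2r// (nodeD q).
Qed.

(** Summation by parts in the index q j. The shift [sg] is taken cyclic so as to be a bijection; the
    terms that wrap around vanish because their nodes lie outside the support of c. *)
Lemma partial_Ih c x : bsupp rho c -> partial j (Ih rho h c) x =
 \sum_q h^-1 * (c (nd q) - c (nd q - h *: delta_mx ord0 j)) * omj q x.
Proof.
move=> cut0.
pose s := cr (x ord0 j).
pose P (q : idx) := \prod_(i | i != j) bsp (cr (x ord0 i) - (q i)%:R).
pose e : 'rV[R]_n := delta_mx ord0 j.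
have dom q : derivable (om (rho + 6) h q) x e /\
  partial j (om (rho + 6) h q) x = h^-1 * dbsp (s - (q j)%:R) * P q.
 apply: partial_tensor. apply: (is_derive_crd (f := fun t => bsp (t - (q j)%:R))); exact: is_derive_bsp.
have [_ ->] := @partial_sum R n idx (index_enum _) (fun q => c (nd q)) (fun q => om (rho + 6) h q) j x (fun q => (dom q).1).
rewrite (eq_bigr (fun q => h^-1 * (c (nd q) * (hat (s - (q j)%:R) * P q)) -
  h^-1 * (c (nd q) * (hat (s - (q j)%:R - 1) * P q)))); last first.
 by move=> q _; rewrite (dom q).2 /dbsp; ring.
rewrite sumrB.
have omjE q : omj q x = hat (s - (q j)%:R) * P q.
 rewrite /omj /tensor (bigD1 j)//= eqxx; congr (_ * _). by apply: eq_bigr => i /negbTE ->.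
pose sg (q : idx) : idx := [ffun i => if i == j then ordS (q i) else q i].
have sgK : bijective sg.
 exists (fun q : idx => [ffun i => if i == j then ord_pred (q i) else q i] : idx) => q; apply/ffunP => i.
  by rewrite /sg !ffunE; case: (i == j) => //; rewrite ordSK.
 by rewrite /sg !ffunE; case: (i == j) => //; rewrite ord_predK.
have -> : \sum_q h^-1 * (c (nd q) * (hat (s - (q j)%:R - 1) * P q)) =
  \sum_q h^-1 * (c (nd q - h *: e) * (hat (s - (q j)%:R) * P q)).
 rewrite [RHS](reindex sg); last exact: onW_bij. apply: eq_bigr => q _.
 have -> : P (sg q) = P q by apply: eq_bigr => i /negbTE ij; rewrite ffunE ij. have hN := Nh_ge rho h0.
 have [qN|qN] := eqVneq (q j).+1 N.
  have sq0 : (sg q j : nat) = 0%N by rewrite ffunE eqxx /= qN modnn.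
  rewrite (cut0 (nd q)) ?(cut0 (nd (sg q) - _)) ?mul0r//.
   apply: lt_le_trans (coord_le _ j); rewrite !mxE !eqxx sq0 /= mulr0 mulr1.
   rewrite -normrN; apply: lt_le_trans (ler_norm _); have := h0; lra.
  apply: lt_le_trans (coord_le _ j); rewrite !mxE.
  have qE : (q j)%:R = N%:R - 1 :> R by move/(congr1 (fun m => m%:R : R)): qN; rewrite -natr1 => <-; rewrite addrK.
  apply: lt_le_trans (ler_norm _); rewrite qE mulrBr mulr1 mulrC; have := h1; have := h0; lra.
 have sqE : (sg q j : nat) = (q j).+1 by rewrite ffunE eqxx /= modn_small// ltn_neqAle qN ltn_ord.
 have -> : nd (sg q) - h *: e = nd q.
  apply/rowP => i; rewrite !mxE eqxx /=; have [->|ij] := eqVneq i j.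
   by rewrite sqE -natr1 /=; ring.
  by rewrite ffunE (negbTE ij) mulr0 subr0.
 have -> // : s - (sg q j)%:R = s - (q j)%:R - 1 by rewrite sqE -natr1; ring.
by rewrite -sumrB; apply: eq_bigr => q _; rewrite omjE; ring.
Qed.

(** Taking means commutes with translations, so the backward difference of the means is the mean of
    the difference quotient with increment -h. *)
Lemma partial_Ih_avg f x : lipb f -> bsupp r f ->
 partial j (Ih rho h (avg h f)) x = Aj (dquot j f (- h)) x.
Proof.
move=> bf fr; have lf := lipbL1 bf; pose e : 'rV[R]_n := delta_mx ord0 j.
rewrite partial_Ih; last exact: (avg_bsupp h0 h1 fr).
rewrite /Aj; apply: eq_bigr => q _.
have -> : dquot j f (- h) = fun y => h^-1 * f y + (fun y => - h^-1 * f (y + - (h *: e))) y.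
 by apply/funext => y; rewrite /dquot invrN scaleNr (addrC (- (h *: _))); ring.
have [ls _] := L1_shift (- (h *: e)) lf.
have lz : L1 mu (fun y => - h^-1 * f (y - h *: e)) by exact: L1Z.
rewrite avgL//.
have -> : avg h (fun y => - h^-1 * f (y - h *: e)) (nd q) = - h^-1 * avg h f (nd q - h *: e).
 rewrite avg_shift//; have := avgL h (nd q) (- h^-1) ls (L10 mu).
 rewrite (_ : (fun x0 => _) = fun y => - h^-1 * f (y - h *: e)); last by apply/funext => y; rewrite addr0.
 by move=> ->; rewrite /avg (_ : (fun x0 => 0 * _) = fun=> 0) ?I0 ?mulr0 ?addr0//; apply/funext => y; rewrite mul0r. rewrite -/e; ring.
Qed.

End gradient.

Section gradient_cvg.
Context {R n}.
Implicit Types (f u v : 'rV[R]_n -> R).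
Definition hk (k : nat) : R := k.+1%:R^-1.
Lemma hk_gt0 k : 0 < hk k. Proof. by rewrite invr_gt0. Qed.
Lemma hk_le1 k : hk k <= 1. Proof. by rewrite invf_le1// ler1n. Qed.
Lemma hk_cvg : hk k @[k --> \oo] --> 0. Proof. exact: cvg_harmonic. Qed.
Definition smoothing r f k : 'rV[R]_n -> R := Ih (r + 1) (hk k) (avg (hk k) f).

(** With a Lipschitz v close to the partial derivative in L^1 the error splits into [Aj] of the
    quotient minus v, controlled by the L^1 bound of [Aj], the error of [Aj] on v, and the distance
    from v to the derivative. *)
Lemma partial_smoothing_cvg (j : 'I_n) r f : lipb f -> bsupp r f ->
 I (fun x => `|partial j (smoothing r f k) x - partial j f x|) @[k --> \oo] --> 0.
Proof.
move=> bf fr; apply/cvgr0Pnorm_lt => e e0.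
pose P := partial j f; have lP : L1 mu P by exact: partial_L1.
have c0 : 0 < (3 ^+ n + 1 : R) by rewrite ltr_pwDr// exprn_ge0.
pose e1 := e / 4 / (3 ^+ n + 1).
have e10 : 0 < e1 by rewrite !divr_gt0.
have Pr : bsupp r P by exact: partial_bsupp.
have [v [bv vr hv]] := lipb_dense_supp lP Pr e10; have lv := lipbL1 bv.
have [M [_ [M0 vM _]]] := bv.
pose K := M * I (fun x : 'rV[R]_n => cutoff (r + 1 + 4) x).
have K0 : 0 <= K by rewrite mulr_ge0// I_ge0// => x; exact: clamp_ge0.
have dc : I (fun x => `|dquot j f (- hk k) x - P x|) @[k --> \oo] --> 0.
 apply: dquot_L1_cvg => // [k|k|]; rewrite ?normrN ?oppr_eq0 ?gt_eqF ?hk_gt0//.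
  by rewrite gtr0_norm ?hk_gt0 ?hk_le1.
 rewrite -oppr0; apply: cvgN; exact: hk_cvg.
have /cvgr0Pnorm_lt /(_ _ e10) nd := dc.
have e20 : 0 < e / 4 / (3 * K + 1) by rewrite !divr_gt0// ltr_pwDr// mulr_ge0.
have /cvgr0Pnorm_lt /(_ _ e20) nh := hk_cvg.
near=> k.
have hdk : I (fun x => `|dquot j f (- hk k) x - P x|) < e1 by apply: le_lt_trans (ler_norm _) _; near: k; exact: nd.
have hhk : hk k < e / 4 / (3 * K + 1) by apply: le_lt_trans (ler_norm _) _; near: k; exact: nh.
have h0 := hk_gt0 k; have h1 := hk_le1 k.
have ld : L1 mu (dquot j f (- hk k)).
 have [ls _] := L1_shift (- hk k *: delta_mx ord0 j) (lipbL1 bf).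
 by apply/L1Z/L1B; [under eq_fun do rewrite addrC|exact: lipbL1].
pose A := @Aj R n j r (hk k).
have lA u : L1 mu (A u) by exact: L1_Aj.
have ldv : L1 mu (fun x => -1 * v x + dquot j f (- hk k) x) by apply: L1D => //; exact: L1Z.
have lc : L1 mu (fun x : 'rV[R]_n => 3 * hk k * M * cutoff (r + 1 + 4) x) by apply/L1Z/lipbL1/lipb_cutoff.
have lPv : L1 mu (fun x => `|P x - v x|) by exact/L1_abs/L1B.
rewrite ger0_norm ?I_ge0//.
apply: (@le_lt_trans _ _ (I (fun x => `|A (fun y => -1 * v y + dquot j f (- hk k) y) x| +
  3 * hk k * M * cutoff (r + 1 + 4) x + `|P x - v x|))).
 apply: I_le.
 - apply/L1_abs/L1B => //; rewrite /smoothing.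
  rewrite (_ : partial j _ = A (dquot j f (- hk k)))//. apply/funext => x; exact: partial_Ih_avg.
 - apply: L1D => //; apply: L1D => //; exact: L1_abs.
 move=> x; rewrite /smoothing partial_Ih_avg// -/A. have e3 := Aj_close j h0 h1 x bv M0 vM vr; rewrite -/A in e3.
 have -> : A (dquot j f (- hk k)) x - partial j f x =
  (A (fun y => -1 * v y + dquot j f (- hk k) y) x + (A v x - v x)) - (P x - v x).
  by rewrite /A AjL// /P; ring.
 apply: le_normB; rewrite lerD2r. by apply: le_normD; rewrite lerD2l.
rewrite ID//; last by apply: L1D => //; exact: L1_abs.
rewrite ID//; last exact: L1_abs.
have lvP : L1 mu (fun x => `|dquot j f (- hk k) x - P x|) by exact/L1_abs/L1B.
have t1 : I (fun x => `|A (fun y => -1 * v y + dquot j f (- hk k) y) x|) <= 3 ^+ n * (e1 + e1).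
 apply: (le_trans (Aj_norm j r h0 ldv)); rewrite ler_wpM2l ?exprn_ge0//.
 apply: (via (I (fun x => `|dquot j f (- hk k) x - P x| + `|P x - v x|))).
  apply: I_le => [||x]; [exact: L1_abs|exact: L1D|].
  have -> : -1 * v x + dquot j f (- hk k) x = (dquot j f (- hk k) x - P x) + (P x - v x) by ring. exact: ler_normD.
 by rewrite ID// ltW// ltrD.
have t2 : I (fun x : 'rV[R]_n => 3 * hk k * M * cutoff (r + 1 + 4) x) <= e / 4.
 rewrite IZ; last exact/lipbL1/lipb_cutoff.
 rewrite -mulrA -/K; have K1 : 0 < 3 * K + 1 by rewrite ltr_pwDr// mulr_ge0.
 move: hhk; rewrite ltr_pdivlMr// mulrDr mulr1 => /ltW; apply: le_trans.
 by rewrite -[3 * _ * _]mulrA mulrCA lerDl ltW.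
have e1E : 3 ^+ n * e1 + e1 = e / 4 by rewrite -{2}(mul1r e1) -mulrDl /e1 mulrC divfK// gt_eqF.
have hh : 0 <= 3 ^+ n * e1 by rewrite mulr_ge0 ?exprn_ge0// ltW.
move: t1; rewrite mulrDr => t1; lra.
Unshelve. all: by end_near. Qed.

Lemma smoothing_lip r f L k : lipb f -> 0 <= L -> lipc L f -> bsupp r f ->
 lipc ((8 * n%:R + 7) * L) (smoothing r f k).
Proof.
move=> bf L0 fL fr; have h0 := hk_gt0 k; have h1 := hk_le1 k.
have h2 : hol 1 L (avg (hk k) f) by apply/lipc_hol; exact: avg_lip.
have := Ih_lip h0 h1 (avg_bsupp h0 h1 fr) ltr01 (lexx 1) L0 h2.
by rewrite subrr powRr0 mulr1.
Qed.

End gradient_cvg.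

(** * Integrals of products of functions of one variable *)

Section one_dim.
Context {R}.
Definition testfun (g : R -> R) := continuous g /\
 exists B r : R, (forall t, `|g t| <= B) /\ (forall t, r < `|t| -> g t = 0).

Lemma testfunM f g : testfun f -> testfun g -> testfun (fun t => f t * g t).
Proof.
move=> [cf [B [r [fB fr]]]] [cg [C [s [gC gs]]]]; split.
 by move=> t; apply: cvgM; [exact: cf|exact: cg].
exists (B * C), r; split => [t|t /fr ->]; last by rewrite mul0r.
by rewrite normrM ler_pM.
Qed.

Lemma testfun_prod (J : Type) (s : seq J) (P : pred J) (g : J -> R -> R) j0 : j0 \in [:: true] ->
 (forall j, testfun (g j)) -> forall f, testfun f -> testfun (fun t => f t * \prod_(j <- s | P j) g j t).
Proof.
move=> _ tg; elim: s => [|j s IH] f tf.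
 by rewrite (_ : (fun t => _) = f)//; apply/funext => t; rewrite big_nil mulr1.
case Pj: (P j); last first.
 by rewrite (_ : (fun t => _) = (fun t => f t * \prod_(j <- s | P j) g j t)); [exact: IH|apply/funext => t; rewrite big_cons Pj].
rewrite (_ : (fun t => _) = (fun t => (f t * g j t) * \prod_(j <- s | P j) g j t)).
 exact/IH/testfunM.
by apply/funext => t; rewrite big_cons Pj mulrA.
Qed.

Lemma testfun_L1 g : testfun g -> L1 la g.
Proof.
move=> [cg [B [r [gB gr]]]].
have B0 : 0 <= B by exact: le_trans (normr_ge0 _) (gB 0).
apply: (@L1_le _ _ _ _ _ (fun t => B * \1_(`[- r, r]%classic : set (measurableTypeR R)) t)).
- exact: continuous_measurable_fun.
- move=> t; rewrite indicE; case: (boolP (_ \in _)) => [_|]; first by rewrite mulr1.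
 rewrite notin_setE /= in_itv/= -ler_norml => /negP; rewrite -ltNge => h. by rewrite gr// normr0 mulr0.
- apply: L1Z; exact: (integrable_indic_itv (- r) r true false).
Qed.

Lemma testfun_FTC f g : testfun f -> testfun g -> (forall t, is_derive t (1 : R) f (g t)) ->
 \int[la]_t g t = 0.
Proof.
move=> [cf [_ [rf [_ hf]]]] [cg [_ [rg [_ hg]]]] d.
pose r := `|rf| + `|rg| + 1.
have r0 : 0 < r by rewrite ltr_wpDl// addr_ge0.
have hr : rf < r by rewrite (le_lt_trans (ler_norm rf))// /r -addrA ltrDl ltr_wpDl.
have fr t : rf < `|t| -> f t = 0 by exact: hf.
have e : (\int[la]_(t in `[(- r)%R, r]) (g t)%:E = (f r)%:E - (f (- r)%R)%:E)%E.
 apply: continuous_FTC2.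
 - by rewrite gtrN.
 - apply: continuous_subspaceT => t; exact: cg.
 - split => [t _||].
  + by case: (d t).
  + apply: cvg_at_right_filter; exact: cf.
  + apply: cvg_at_left_filter; exact: cf.
 - by move=> t _; rewrite derive1E; case: (d t).
rewrite (_ : Rintegral _ _ _ = \int[la]_(t in `[- r, r]) g t).
 by rewrite /Rintegral e !hf ?normrN ?gtr0_norm ?subee.
rewrite [RHS]Rintegral_mkcond; congr Rintegral; apply/funext => t.
rewrite patchE; case: ifPn => //; rewrite notin_setE /= in_itv/= -ler_norml => /negP.
rewrite -ltNge => h; apply: hg; apply: le_lt_trans h.
by rewrite (le_trans (ler_norm rg))// /r -addrA addrCA lerDl addr_ge0.
Qed.

Lemma is_derive_prod n (g g' : 'I_n -> R -> R) t : (forall i, is_derive t (1 : R) (g i) (g' i t)) ->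
 is_derive t (1 : R) (fun s => \prod_i g i s) (\sum_i g' i t * \prod_(j | j != i) g j t).
Proof.
elim: n g g' => [|n IH] g g' d.
 apply: (derive_congr (is_derive_cst (1 : R) t (1 : R))) => [s|]; first by rewrite big_ord0. by rewrite big_ord0.
have d1 := IH (fun i => g (sc i)) (fun i => g' (sc i)) (fun i => d (sc i)).
apply: (derive_congr (is_deriveM (d ord0) d1)) => [s|]; first by rewrite big_ord_recl.
rewrite big_ord_recl [LHS]addrC; congr (_ + _).
 rewrite scaler_sumr; apply: eq_bigr => i _; rewrite [in LHS]big_mkcond big_ord_recl /=.
 rewrite [in RHS]big_mkcond /GRing.scale/= mulrCA; congr (_ * (_ * _)).
rewrite /GRing.scale/= mulrC; congr (_ * _).
by rewrite big_mkcond big_ord_recl eqxx /= mul1r; apply: eq_bigr => i _.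
Qed.


Lemma tensor_measurable n (g : 'I_n -> R -> R) : (forall i, continuous (g i)) ->
 mfun (tensor g).
Proof.
move=> cg; apply: measurable_prod => i _.
apply: (measurableT_comp (f := g i)); last exact: coord_mf.
exact: continuous_measurable_fun.
Qed.

Lemma L1_tensor n (g : 'I_n -> R -> R) : (forall i, testfun (g i)) -> L1 mu (tensor g).
Proof.
move=> tg; pose B i := projT1 (cid (tg i).2); pose r i := projT1 (cid (projT2 (cid (tg i).2))).
have hB i : (forall t, `|g i t| <= B i) /\ (forall t, r i < `|t| -> g i t = 0).
 by exact: (projT2 (cid (projT2 (cid (tg i).2)))).
apply: (@L1_bounded _ _ _ (\prod_i B i) (\sum_i `|r i|)).
- by apply: tensor_measurable => i; have [] := tg i.
- by move=> x; rewrite normr_prod; apply: ler_prod => i _; rewrite normr_ge0 (hB i).1.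
- move=> x hx; have [i hi] : exists i, `|r i| < `|x ord0 i|.
  apply/not_existsP => h; move: hx; apply/negP; rewrite -leNgt. apply: norm_le => [|i]; first exact: sumr_ge0.
  have /negP := h i; rewrite -leNgt => /le_trans; apply. by rewrite (bigD1 i)//= lerDl sumr_ge0.
 by rewrite /tensor (bigD1 i)//= (hB i).2 ?mul0r// (le_lt_trans (ler_norm _)).
Qed.

Lemma I_tensor n (g : 'I_n -> R -> R) : (forall i, testfun (g i)) ->
 \int[mu]_x tensor g x = \prod_i \int[la]_t g i t.
Proof.
elim: n g => [|n IH] g tg.
 rewrite big_ord0 (_ : tensor g = cst 1); last by apply/funext => x; rewrite /tensor big_ord0.
 have d1 : lebesgue_rV 0 [set: 'rV[R]_0] = 1%:E by rewrite /= diracE mem_set.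
 apply: (etrans (@Rintegral_cst _ _ R (lebesgue_rV 0) setT measurableT 1)). rewrite mul1r; exact: (congr1 fine d1).
rewrite big_ord_recl -(IH (fun i => g (sc i)))//.
have lt := L1_tensor tg; have lt' := L1_tensor (fun i => tg (sc i)).
apply: (@EFin_inj R); rewrite -(L1_EFin lt) lebesgue_rV_Fubini//.
transitivity (\int[la]_t ((\int[mu]_y tensor (fun i => g (sc i)) y) * g ord0 t)%:E)%E.
 apply: eq_integral => t _; rewrite [in RHS]mulrC EFinM -(L1_EFin lt') -integralZl//.
 apply: eq_integral => y _; rewrite /tensor big_ord_recl EFinM mxE unlift_none /=.
 by congr (_ * _)%E; congr EFin; apply: eq_bigr => i _; rewrite mxE liftK.
rewrite L1_EFin; last exact/L1Z/testfun_L1.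
rewrite IZ 1?mulrC//; exact: testfun_L1.
Qed.

End one_dim.

(** * Jacobian determinants: bounds, measurability, continuity, linearity *)

Section detD.
Context {R n}.

(* Expanding the determinant, the integral is the determinant of the matrix of the integrals of
  [g' i l * \prod_(k != i) g k l], whose columns sum to the integral of a derivative. *)
Lemma I_detD_tensor (g g' : 'I_n.+1 -> 'I_n.+1 -> R -> R) :
 (forall i l, testfun (g i l)) -> (forall i l, testfun (g' i l)) ->
 (forall i l t, is_derive t (1 : R) (g i l) (g' i l t)) ->
 \int[mu]_x detD (fun i => tensor (g i)) x = 0.
Proof.
move=> tg tg' d.
pose gm i l t := g' i l t * \prod_(k | k != i) g k l t.
have tgm i l : testfun (gm i l) by apply: (@testfun_prod _ _ _ _ _ true).
pose M : 'M[R]_n.+1 := \matrix_(i, l) \int[la]_t gm i l t.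
have E x : detD (fun i => tensor (g i)) x =
  \sum_(s : 'S_n.+1) (-1) ^+ s * tensor (fun l => gm (s^-1 l)%g l) x.
 apply: eq_bigr => s _; congr (_ * _).
 transitivity (\prod_i (g' i (s i) (x ord0 (s i)) * \prod_(l | l != s i) g i l (x ord0 l))).
  by apply: eq_bigr => i _; rewrite mxE; have [_ ->] := partial_tensor (d i (s i) (x ord0 (s i))).
 rewrite big_split /= /tensor /gm [RHS]big_split /=; congr (_ * _).
  rewrite [RHS](reindex_inj (@perm_inj _ s)) /=. by apply: eq_bigr => i _; rewrite permK.
 rewrite (exchange_big_dep predT)//=; apply: eq_bigr => l _.
 by apply: eq_bigl => i; rewrite eq_sym (can2_eq (permK s) (permKV s)).
have -> : (fun x => detD (fun i => tensor (g i)) x) = fun x => \sum_(s : 'S_n.+1) (-1) ^+ s * tensor (fun l => gm (s^-1 l)%g l) x.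
 exact/funext.
have lt (s : 'S_n.+1) : L1 mu (tensor (fun l => gm (s^-1 l)%g l)) by apply: L1_tensor.
rewrite I_sum; last by move=> s _; exact: L1Z.
transitivity (\det M).
 apply: eq_bigr => s _; rewrite IZ// I_tensor//; congr (_ * _).
 rewrite (reindex_inj (@perm_inj _ s)) /=; apply: eq_bigr => i _; by rewrite permK mxE.
apply/eqP/det0P; exists (const_mx 1).
 by apply/eqP => /rowP /(_ ord0) /eqP; rewrite !mxE oner_eq0.
apply/rowP => l; rewrite !mxE.
transitivity (\sum_i \int[la]_t gm i l t); first by apply: eq_bigr => i _; rewrite !mxE mul1r.
rewrite -I_sum; last by move=> i _; exact: testfun_L1.
apply: (@testfun_FTC _ (fun t => \prod_i g i l t)).
- rewrite (_ : (fun t => _) = fun t => g ord0 l t * \prod_(i | i != ord0) g i l t); last first.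
  by apply/funext => t; rewrite (bigD1 ord0).
 exact: (@testfun_prod _ _ _ _ _ true).
- split.
  elim: (index_enum _) => [|i e IH] t.
   by rewrite (_ : (fun t => _) = cst 0); [exact: cvg_cst|apply/funext => s; rewrite big_nil].
  rewrite (_ : (fun t => _) = (fun t => gm i l t + \sum_(j <- e) gm j l t)); last first.
   by apply/funext => s; rewrite big_cons.
  by apply: cvgD; [exact: (tgm i l).1|exact: IH].
 pose B i := projT1 (cid (tgm i l).2); pose r i := projT1 (cid (projT2 (cid (tgm i l).2))).
 have hB i : (forall t, `|gm i l t| <= B i) /\ (forall t, r i < `|t| -> gm i l t = 0).
  by exact: (projT2 (cid (projT2 (cid (tgm i l).2)))).
 exists (\sum_i B i), (\sum_i `|r i|); split => t.
  apply: le_norm_sum; apply: ler_sum => i _; exact: (hB i).1.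
 move=> ht; rewrite big1// => i _; apply: (hB i).2; apply: le_lt_trans ht.
 by rewrite (le_trans (ler_norm _))// (bigD1 i)//= lerDl sumr_ge0.
- move=> t; exact: (@is_derive_prod R _ (fun i t => g i l t) (fun i t => g' i l t) t (fun i => d i l t)).
Qed.

Lemma testfun_bsp (r0 h c : R) : 0 < h -> testfun (fun t => bsp (crd r0 h t - c)) /\
 testfun (fun t => h^-1 * dbsp (crd r0 h t - c)) /\
 forall t, is_derive t (1 : R) (fun t => bsp (crd r0 h t - c)) (h^-1 * dbsp (crd r0 h t - c)).
Proof.
move=> h0.
have d2 (t : R) : is_derive t (1 : R) (fun t => bsp (crd r0 h t - c)) (h^-1 * dbsp (crd r0 h t - c)).
 apply: (is_derive_crd (f := fun t => bsp (t - c))); exact: is_derive_bsp.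
have big t : `|r0| + h * (`|c| + 3) < `|t| -> (crd r0 h t - c <= 0) || (3 <= crd r0 h t - c).
 move=> ht; have [t0|t0] := leP 0 t; apply/orP; [right|left].
  rewrite lerBrDr /crd ler_pdivlMr//; move: ht; rewrite (ger0_norm t0) => ht.
  have : (3 + c) * h <= h * (`|c| + 3) by rewrite mulrC ler_pM2l// addrC lerD2r ler_norm.
  have := ler_norm (- r0); rewrite normrN; lra.
 rewrite subr_le0 /crd ler_pdivrMr//; move: ht; rewrite (ltr0_norm t0) => ht. have : - c * h <= h * (`|c| + 3).
  by rewrite mulrC ler_pM2l// (le_trans (ler_norm _))// normrN lerDl.
 have := ler_norm r0; lra.
have cd : continuous (fun t : R => crd r0 h t - c).
 move=> t; apply: cvgB; last exact: cvg_cst.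
 by apply: cvgM; [apply: cvgD; [exact: cvg_id|exact: cvg_cst]|exact: cvg_cst].
have ch : continuous (@hat R) by move=> t; exact: (lip1_continuous _ hat_lip).
split; [split|split; [split|exact: d2]].
- move=> t; apply: differentiable_continuous; apply/derivable1_diffP; by case: (d2 t).
- exists 1, (`|r0| + h * (`|c| + 3)); split => t; last by move/big/bsp_0.
 by rewrite ger0_norm ?bsp_ge0// bsp_le1.
- move=> t; apply: cvgM; first exact: cvg_cst.
 apply: cvgB; first by apply: (cvg_comp (fun t => crd r0 h t - c) hat (cd t)); exact: ch.
 apply: (cvg_comp (fun t => crd r0 h t - c - 1) hat); last exact: ch. by apply: cvgB; [exact: cd|exact: cvg_cst].
- exists (h^-1 * 1), (`|r0| + h * (`|c| + 3)); split => t.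
  rewrite normrM gtr0_norm ?invr_gt0// ler_wpM2l ?invr_ge0 ?(ltW h0)// /dbsp ler_norml.
  have := hat_ge0 (crd r0 h t - c); have := hat_le1 (crd r0 h t - c).
  have := hat_ge0 (crd r0 h t - c - 1); have := hat_le1 (crd r0 h t - c - 1); lra.
 move/big => hb; rewrite /dbsp !hat_0 ?subr0 ?mulr0//; move: hb => /orP[hb|hb]; apply/orP; [left|right|left|right]; lra.
Qed.


Implicit Types (G H : 'I_n -> 'rV[R]_n -> R) (f g h : 'rV[R]_n -> R).
Lemma partial_eq_open i f g (U : set 'rV[R]_n) : open U -> (forall x, U x -> f x = g x) ->
 forall x, U x -> partial i f x = partial i g x.
Proof.
move=> oU h x Ux; rewrite /partial; apply: near_eq_derive; apply/nbhs_rVP.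
by have [e e0 he] := (open_rVP U).1 oU x Ux; exists e => // y /he /h.
Qed.

Lemma detD_row0 G i x : (forall j, partial j (G i) x = 0) -> detD G x = 0.
Proof. by move=> h; apply: big1 => s _; rewrite (bigD1 i)//= mxE h mul0r mulr0. Qed.

Lemma detD_const G i (U : set 'rV[R]_n) c x : open U -> (forall y, U y -> G i y = c) -> U x ->
 detD G x = 0.
Proof. by move=> oU h Ux; apply: (@detD_row0 _ i) => j; exact: partial_local h x Ux. Qed.

Lemma detD_eq_open G H (U : set 'rV[R]_n) : open U -> (forall i x, U x -> G i x = H i x) ->
 forall x, U x -> detD G x = detD H x.
Proof.
move=> oU h x Ux; congr (\det _); apply/matrixP => i j; rewrite !mxE.
apply: (partial_eq_open j oU) => // y; exact: h.
Qed.

Lemma detD_bsupp G i r : bsupp r (G i) -> bsupp r (detD G).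
Proof. by move=> h x hx; apply: (@detD_row0 _ i) => j; exact: partial_bsupp h x hx. Qed.

Lemma det_bound (A : 'M[R]_n) (L : 'I_n -> R) : (forall i j, `|A i j| <= L i) ->
 `|\det A| <= n`!%:R * \prod_i L i.
Proof.
move=> h; apply: le_norm_sum.
apply: (via (\sum_(s : 'S_n) \prod_i L i)).
 apply: ler_sum => s _; rewrite normrM normrX normrN1 expr1n mul1r normr_prod.
 by apply: ler_prod => i _; rewrite normr_ge0 h.
by rewrite sumr_const card_Sn mulr_natl.
Qed.

Lemma detD_bound G (L : 'I_n -> R) x : (forall i, 0 <= L i) -> (forall i, lipc (L i) (G i)) ->
 `|detD G x| <= n`!%:R * \prod_i L i.
Proof. by move=> L0 h; apply: det_bound => i j; rewrite mxE; exact: partial_bound. Qed.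

Lemma detD_mf G : (forall i, continuous (G i)) -> mfun (detD G).
Proof.
move=> h; apply: measurable_sum => s; apply: measurable_funM => //.
apply: measurable_prod => i _.
rewrite (_ : (fun x => _) = partial (s i) (G i)); first exact: partial_mf.
by apply/funext => x; rewrite mxE.
Qed.

Lemma prod_dist (a b : 'I_n -> R) K : 1 <= K -> (forall i, `|a i| <= K) -> (forall i, `|b i| <= K) ->
 `|\prod_i a i - \prod_i b i| <= K ^+ n * \sum_i `|a i - b i|.
Proof.
move=> K1 ha hb; rewrite prod_diff mulr_sumr le_norm_sum//.
have K0 : 0 <= K by exact: le_trans K1.
apply: ler_sum => m _; rewrite (bigD1 m)//= ltnn eqxx normrM mulrC ler_wpM2r//.
rewrite normr_prod; apply: (via (\prod_(i < n | i != m) K)).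
 apply: ler_prod => i im; rewrite normr_ge0 (negbTE im). by case: ifP => _; [exact: hb|exact: ha].
rewrite prodr_const; apply: ler_weXn2l => //.
by rewrite -[X in (_ <= X)%N]card_ord max_card.
Qed.

Lemma det_dist (A B : 'M[R]_n) K : 1 <= K -> (forall i j, `|A i j| <= K) -> (forall i j, `|B i j| <= K) ->
 `|\det A - \det B| <= n`!%:R * K ^+ n * \sum_i \sum_j `|A i j - B i j|.
Proof.
move=> K1 hA hB; rewrite -sumrB le_norm_sum//.
apply: (via (\sum_(s : 'S_n) K ^+ n * \sum_i \sum_j `|A i j - B i j|)).
 apply: ler_sum => s _; rewrite -mulrBr normrM normrX normrN1 expr1n mul1r.
 apply: (le_trans (@prod_dist (fun i => A i (s i)) (fun i => B i (s i)) K K1 _ _)) => //.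
 rewrite ler_wpM2l ?exprn_ge0 ?(le_trans _ K1)//. by apply: ler_sum => i _; rewrite (bigD1 (s i))//= lerDl sumr_ge0.
by rewrite sumr_const card_Sn -mulrA mulr_natl.
Qed.

Lemma L1_detD G i0 : (forall i, exists L, 0 <= L /\ lipc L (G i)) -> lipb (G i0) -> L1 mu (detD G).
Proof.
move=> /choice[L hL] [_ [r [_ _ hr]]].
apply: (@L1_bounded _ _ _ (n`!%:R * \prod_i L i) r).
- apply: detD_mf => i; exact: lipc_cont (hL i).2.
- by move=> x; apply: detD_bound => i; [exact: (hL i).1|exact: (hL i).2].
- exact: detD_bsupp hr.
Qed.

(** On matrices with entries bounded by K the determinant is Lipschitz, so convergence of the
    entries in L^1 suffices. *)
Lemma detD_L1_cvg (Gk : nat -> 'I_n -> 'rV[R]_n -> R) G K :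
 (forall i, lipc K (G i)) -> (forall k i, lipc K (Gk k i)) ->
 (forall i, lipb (G i)) -> (forall k i, lipb (Gk k i)) -> 1 <= K ->
 (forall i j, I (fun x => `|partial j (Gk k i) x - partial j (G i) x|) @[k --> \oo] --> 0) ->
 (0 < n)%N -> I (detD (Gk k)) @[k --> \oo] --> I (detD G).
Proof.
move=> lG lGk bG bGk K1 cv n0; have K0 : 0 <= K by exact: le_trans K1.
have i0 : 'I_n by exact: Ordinal n0.
have l1 : L1 mu (detD G) by apply: (@L1_detD _ i0) => // i; exists K.
have l1k k : L1 mu (detD (Gk k)) by apply: (@L1_detD _ i0) => // i; exists K.
pose D k i j x := `|partial j (Gk k i) x - partial j (G i) x|.
have lD k i j : L1 mu (D k i j) by apply/L1_abs/L1B; exact: partial_L1.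
have cs : \sum_i \sum_j I (D k i j) @[k --> \oo] --> \sum_(i < n) \sum_(j < n) 0.
 apply: cvg_big => [|i _]; first exact: add_continuous.
 by apply: cvg_big => [|j _]; [exact: add_continuous|exact: cv].
rewrite big1 in cs; last by move=> i _; rewrite big1.
have cz : n`!%:R * K ^+ n * \sum_i \sum_j I (D k i j) @[k --> \oo] --> 0.
 by rewrite -[X in _ --> X](mulr0 (n`!%:R * K ^+ n)); apply: cvgM; [exact: cvg_cst|exact: cs].
apply/cvgrPdist_le => e e0.
have /cvgr0Pnorm_le /(_ _ e0) := cz; apply: filterS => k hk.
rewrite distrC -IB//; apply: le_trans (le_trans (ler_norm _) hk).
apply: (via (I (fun x => n`!%:R * K ^+ n * \sum_i \sum_j D k i j x))).
 have lS : L1 mu (fun x => \sum_i \sum_j D k i j x) by apply: L1_sum => i _; exact: L1_sum.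
 apply: I_abs_le; [exact: L1B|exact: L1Z|move=> x].
 apply: (le_trans (@det_dist _ _ K K1 _ _)) => [i j|i j|]; rewrite ?mxE; try exact: partial_bound.
 rewrite ler_wpM2l ?mulr_ge0 ?exprn_ge0//. by apply: ler_sum => i _; apply: ler_sum => j _; rewrite !mxE.
rewrite IZ; last by apply: L1_sum => i _; exact: L1_sum.
rewrite I_sum; last by move=> i _; exact: L1_sum.
by under eq_bigr do rewrite I_sum//.
Qed.

Lemma detD_lin_ae G i c h1 h2 L M : lipc L h1 -> lipc M h2 ->
 {ae mu, forall x, detD (upd G i (fun y => c * h1 y + h2 y)) x =
  c * detD (upd G i h1) x + detD (upd G i h2) x}.
Proof.
move=> l1 l2.
have : {ae mu, forall x, forall j, partial j (fun y => c * h1 y + h2 y) x = c * partial j h1 x + partial j h2 x}.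
 apply: filter_forall => j; exact: partial_lin_ae l1 l2.
apply: filterS => x hx; rewrite -[X in _ + X]mul1r; apply: (determinant_multilinear (i0 := i)).
 by apply/rowP => j; rewrite !mxE /tuple_upd eqxx hx mul1r.
all: by apply/matrixP => k j; rewrite !mxE /tuple_upd eq_sym (negbTE (neq_lift _ _)).
Qed.

Lemma detD_mul_ae G i h1 h2 L M : lipc L h1 -> lipc M h2 ->
 {ae mu, forall x, detD (upd G i (fun y => h1 y * h2 y)) x =
  h1 x * detD (upd G i h2) x + h2 x * detD (upd G i h1) x}.
Proof.
move=> l1 l2.
have : {ae mu, forall x, forall j, partial j (fun y => h1 y * h2 y) x = h1 x * partial j h2 x + h2 x * partial j h1 x}.
 apply: filter_forall => j; exact: partial_mul_ae l1 l2.
apply: filterS => x hx; apply: (determinant_multilinear (i0 := i)).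
 by apply/rowP => j; rewrite !mxE /tuple_upd eqxx hx.
all: by apply/matrixP => k j; rewrite !mxE /tuple_upd eq_sym (negbTE (neq_lift _ _)).
Qed.

End detD.

(** * Vanishing integrals of Jacobians and integration by parts *)

Section integral.
Context {R} {p : nat}.
Local Notation n := p.+1.
Implicit Types (G H : 'I_n -> 'rV[R]_n -> R) (f g h : 'rV[R]_n -> R).
Lemma om_derivable (r0 h : R) N (q : {ffun 'I_n -> 'I_N}) x j : 0 < h ->
 derivable (om r0 h q) x (delta_mx ord0 j).
Proof.
move=> h0; have [_ [_ d]] := @testfun_bsp R r0 h (q j)%:R h0.
by have [] := @partial_tensor R n (fun i t => bsp (crd r0 h t - (q i)%:R)) x j _ (d (x ord0 j)).
Qed.

Lemma I_detD_om (r0 h : R) N (q : 'I_n -> {ffun 'I_n -> 'I_N}) : 0 < h ->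
 I (detD (fun i => om r0 h (q i))) = 0.
Proof.
move=> h0; apply: (@I_detD_tensor R p (fun i l t => bsp (crd r0 h t - (q i l)%:R))
  (fun i l t => h^-1 * dbsp (crd r0 h t - (q i l)%:R))) => i l.
- by have [] := @testfun_bsp R r0 h (q i l)%:R h0.
- by have [_ []] := @testfun_bsp R r0 h (q i l)%:R h0.
- by have [_ [_]] := @testfun_bsp R r0 h (q i l)%:R h0.
Qed.

Lemma I_detD_spl (r0 h : R) N (c : 'I_n -> {ffun 'I_n -> 'I_N} -> R) : 0 < h ->
 I (detD (fun i => spl r0 h (c i))) = 0.
Proof.
move=> h0.
have E x : detD (fun i => spl r0 h (c i)) x =
  \sum_(q : {ffun 'I_n -> {ffun 'I_n -> 'I_N}}) (\prod_i c i (q i)) * detD (fun i => om r0 h (q i)) x.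
 rewrite /detD /determinant.
 transitivity (\sum_(s : 'S_n) (-1) ^+ s * \sum_(q : {ffun 'I_n -> {ffun 'I_n -> 'I_N}}) \prod_i (c i (q i) * partial (s i) (om r0 h (q i)) x)).
  apply: eq_bigr => s _; congr (_ * _); rewrite -(bigA_distr_bigA (fun i q => c i q * partial (s i) (om r0 h q) x)).
  apply: eq_bigr => i _; rewrite mxE.
  by have [_] := @partial_sum R n _ (index_enum _) (c i) (fun q => om r0 h q) (s i) x (fun k => @om_derivable r0 h N k x (s i) h0).
 under [RHS]eq_bigr do rewrite mulr_sumr.
 rewrite exchange_big /=; apply: eq_bigr => s _; rewrite mulr_sumr; apply: eq_bigr => q _.
 rewrite big_split /= mulrCA; congr (_ * (_ * _)); apply: eq_bigr => i _; by rewrite mxE.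
have lq (q : 'I_n -> {ffun 'I_n -> 'I_N}) : L1 mu (detD (fun i => om r0 h (q i))).
 have bo i : lipb (om r0 h (q i)) by exact: om_lipb.
 by apply: (@L1_detD _ _ _ ord0) => // i; have [L [r [L0 fL _]]] := bo i; exists L.
rewrite (_ : detD _ = fun x => \sum_(q : {ffun 'I_n -> {ffun 'I_n -> 'I_N}}) (\prod_i c i (q i)) * detD (fun i => om r0 h (q i)) x).
 rewrite I_sum; last by move=> q _; exact: L1Z. by rewrite big1// => q _; rewrite IZ// I_detD_om// mulr0.
exact/funext.
Qed.

(** The smoothings are combinations of product splines, for which the integral vanishes. Their
    Lipschitz constants are bounded and their gradients converge in L^1. *)
Lemma I_detD0_lipb G : (forall i, lipb (G i)) -> I (detD G) = 0.
Proof.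
move=> bG; have /choice[L /choice[r hr]] := bG.
pose r1 := \sum_i `|r i|; pose K := \sum_i L i.
have L0 i : 0 <= L i by have [] := hr i.
have K0 : 0 <= K by exact: sumr_ge0.
have rG i : bsupp r1 (G i).
 have [_ _] := hr i; apply: bsuppW; rewrite (le_trans (ler_norm _))//. by rewrite /r1 (bigD1 i)//= lerDl sumr_ge0.
have KG i : lipc K (G i).
 have [_ h _] := hr i; apply: lipcW h; by rewrite /K (bigD1 i)//= lerDl sumr_ge0.
pose K' := (8 * n%:R + 7) * K + 1.
have C0 : 1 <= 8 * n%:R + 7 :> R by have : 0 <= 8 * n%:R :> R by [rewrite mulr_ge0]; lra.
have KK : K <= K' by rewrite /K' (le_trans (ler_peMl K0 C0))// lerDl.
have := @detD_L1_cvg R n (fun k i => smoothing r1 (G i) k) G K' _ _ bG.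
have -> : (fun k => I (detD (fun i => smoothing r1 (G i) k))) = fun=> 0.
 apply/funext => k; apply: I_detD_spl; exact: hk_gt0.
move=> hc; suff c : (fun _ : nat => 0 : R) k @[k --> \oo] --> I (detD G).
 by have := cvg_unique _ (cvg_cst (0 : R)) c => <-.
apply: hc => //.
- move=> i; exact: lipcW (KG i).
- move=> k i; apply: (@lipcW _ _ ((8 * n%:R + 7) * K)); first by rewrite lerDl.
 exact: smoothing_lip.
- move=> k i; apply: Ih_lipb; exact: hk_gt0.
- by rewrite /K' lerDr mulr_ge0// (le_trans _ C0).
- move=> i j; exact: partial_smoothing_cvg.
Qed.

(** The determinant vanishes outside the support of [G i0], so all the functions may be cut off
    there. *)
Lemma I_detD0 G i0 : (forall i, exists L, 0 <= L /\ lipc L (G i)) -> lipb (G i0) -> I (detD G) = 0.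
Proof.
move=> lG [L0 [r [L00 gL gr]]].
have <- : I (detD (fun i => fun x => G i x * cutoff (`|r| + 1) x)) = I (detD G).
 congr Rintegral; apply/funext => x; have [xr|xr] := ltP `|x| (`|r| + 1).
  apply: (@detD_eq_open _ _ _ _ [set y | `|y| < `|r| + 1]) => //.
   exact: open_normlt.
  by move=> i y /= hy; rewrite cutoff1 ?mulr1// ltW.
 have rx : r < `|x| by rewrite (lt_le_trans _ xr)// (le_lt_trans (ler_norm r))// ltrDl.
 rewrite (detD_bsupp gr)// (@detD_bsupp _ _ _ i0 r)// => y hy; by rewrite gr// mul0r.
apply: I_detD0_lipb => i; have [L [_ h]] := lG i; exact: lipb_cut h.
Qed.

(** The Jacobian with the product u h in slot i has integral 0, and the Leibniz rule splits it into
    the two sides. *)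
Lemma I_detD_parts G i u h : (forall j, exists L, 0 <= L /\ lipc L (G j)) -> lipb u ->
 (exists L, 0 <= L /\ lipc L h) ->
 I (fun x => u x * detD (upd G i h) x) = - I (fun x => h x * detD (upd G i u) x).
Proof.
move=> lG bu [M [M0 hM]]; have [L [r [L0 uL ur]]] := bu.
have lU w : (exists L, 0 <= L /\ lipc L w) -> forall j, exists L, 0 <= L /\ lipc L (upd G i w j).
 by move=> lw j; rewrite /tuple_upd; case: (j == i).
have cU w : (exists L, 0 <= L /\ lipc L w) -> mfun (detD (upd G i w)).
 by move=> lw; apply: detD_mf => j; have [K [_ h']] := lU w lw j; exact: lipc_cont h'.
have eU w : lipb w -> lipb (upd G i w i) by rewrite /tuple_upd eqxx.
have lu : exists L, 0 <= L /\ lipc L u by exists L.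
have lh : exists L, 0 <= L /\ lipc L h by exists M.
have buh : lipb (fun x => u x * h x).
 by rewrite (_ : (fun x => _) = fun x => h x * u x); [exact: lipbMl hM|apply/funext => x; rewrite mulrC].
have luh : exists L, 0 <= L /\ lipc L (fun x => u x * h x) by have [K [s [? ? _]]] := buh; exists K.
have z := @I_detD0 (upd G i (fun x => u x * h x)) i (lU _ luh) (eU _ buh).
have /choice[LG hLG] := lU h lh.
have l1 : L1 mu (fun x => u x * detD (upd G i h) x).
 apply: (L1M (lipbL1 bu) (cU h lh) (C := n`!%:R * \prod_j LG j)) => x. by apply: detD_bound => j; have [] := hLG j.
have l2 : L1 mu (fun x => h x * detD (upd G i u) x).
 have [LU hLU] := choice (lU u lu).
 have e : (fun x => h x * detD (upd G i u) x) = fun x => (h x * cutoff r x) * detD (upd G i u) x.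
  apply/funext => x; have [xr|xr] := leP `|x| r; first by rewrite cutoff1// mulr1.
  by rewrite (@detD_bsupp _ _ _ i r) ?mulr0// /tuple_upd eqxx.
 rewrite e; apply: (L1M (lipbL1 (lipb_cut r hM)) (cU u lu) (C := n`!%:R * \prod_j LU j)) => x.
 by apply: detD_bound => j; have [] := hLU j.
apply/eqP; rewrite -addr_eq0 -ID//; apply/eqP; rewrite -[RHS]z; apply: I_ae.
- exact: L1_mfun (L1D l1 l2).
- exact: cU.
- by apply: filterS (detD_mul_ae G i uL hM) => x ->.
Qed.

End integral.

(** * Multilinear functionals on tuples of functions *)

Section multilinear.
Context {R n} {m : nat}.
Local Notation V := ('rV[R]_n -> R).
Implicit Types (F A B : 'I_m -> V) (P : 'I_m -> V -> Prop) (T : ('I_m -> V) -> R).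
Definition lin_closed (Q : V -> Prop) := forall c h1 h2, Q h1 -> Q h2 -> Q (fun x => c * h1 x + h2 x).

Lemma lin_closed_sum (Q : V -> Prop) J (s : seq J) (c : J -> R) (h : J -> V) : lin_closed Q -> Q (fun=> 0) -> (forall j, Q (h j)) ->
 Q (fun x => \sum_(j <- s) c j * h j x).
Proof.
move=> hQ Q0 QF; elim: s => [|j s IH].
 by rewrite (_ : (fun x => _) = fun=> 0)//; apply/funext => x; rewrite big_nil.
rewrite (_ : (fun x => _) = fun x => c j * h j x + \sum_(j <- s) c j * h j x); first exact: hQ.
by apply/funext => x; rewrite big_cons.
Qed.

(** A class P i for each slot lets metric and Hoelder currents be treated alike. *)
Definition mlin P T := forall F i c h1 h2, (forall j, P j (F j)) -> P i h1 -> P i h2 ->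
 T (upd F i (fun x => c * h1 x + h2 x)) = c * T (upd F i h1) + T (upd F i h2).

Lemma updE F i h : upd F i h i = h.
Proof. by rewrite /tuple_upd eqxx. Qed.

Lemma updN F i j h : j != i -> upd F i h j = F j.
Proof. by move=> /negbTE h1; rewrite /tuple_upd h1. Qed.

Lemma upd_id F i : upd F i (F i) = F.
Proof. by apply/funext => j; rewrite /tuple_upd; case: eqP => [->|]. Qed.

Lemma upd_P P F i h : (forall j, P j (F j)) -> P i h -> forall j, P j (upd F i h j).
Proof. by move=> hF hh j; rewrite /tuple_upd; case: eqP => [->|]. Qed.

Lemma mlin0 P T F i : mlin P T -> (forall j, P j (F j)) -> P i (fun=> 0) ->
 T (upd F i (fun=> 0)) = 0.
Proof.
move=> ml hF h0; have := ml F i 1 (fun=> 0) (fun=> 0) hF h0 h0.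
rewrite (_ : (fun x : 'rV[R]_n => 1 * 0 + 0) = fun=> 0 :> R); last by apply/funext => x; ring.
lra.
Qed.

Lemma mlinD P T F i h1 h2 : mlin P T -> (forall j, P j (F j)) -> P i h1 -> P i h2 ->
 T (upd F i (fun x => h1 x + h2 x)) = T (upd F i h1) + T (upd F i h2).
Proof.
move=> ml hF p1 p2; have := ml F i 1 h1 h2 hF p1 p2; rewrite mul1r => <-.
by congr (T (upd _ _ _)); apply/funext => x; rewrite mul1r.
Qed.

Lemma mlinZ P T F i c h : mlin P T -> (forall j, P j (F j)) -> P i (fun=> 0) -> P i h ->
 T (upd F i (fun x => c * h x)) = c * T (upd F i h).
Proof.
move=> ml hF p0 p1; have := ml F i c h _ hF p1 p0; rewrite (mlin0 ml hF p0) addr0 => <-.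
by congr (T (upd _ _ _)); apply/funext => x; rewrite addr0.
Qed.

Lemma mlinB P T F i h1 h2 : mlin P T -> (forall j, P j (F j)) -> P i h1 -> P i h2 ->
 T (upd F i (fun x => h1 x - h2 x)) = T (upd F i h1) - T (upd F i h2).
Proof.
move=> ml hF p1 p2; have := ml F i (-1) h2 h1 hF p2 p1; rewrite mulN1r addrC => <-.
by congr (T (upd _ _ _)); apply/funext => x; rewrite mulN1r addrC.
Qed.

Lemma mlin_sum P T F i (J : Type) (s : seq J) (c : J -> R) (h : J -> V) :
 lin_closed (P i) -> mlin P T -> (forall j, P j (F j)) -> P i (fun=> 0) -> (forall k, P i (h k)) ->
 P i (fun x => \sum_(k <- s) c k * h k x) /\
 T (upd F i (fun x => \sum_(k <- s) c k * h k x)) = \sum_(k <- s) c k * T (upd F i (h k)).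
Proof.
move=> lP ml hF p0 ph; elim: s => [|k s [IH1 IH2]].
 rewrite big_nil (_ : (fun x => _) = fun=> 0); last by apply/funext => x; rewrite big_nil.
 split => //; exact: mlin0 ml hF p0.
rewrite big_cons (_ : (fun x => _) = fun x => c k * h k x + (fun x => \sum_(k <- s) c k * h k x) x); last first.
 by apply/funext => x; rewrite big_cons.
by split; [exact: lP|rewrite ml// IH2].
Qed.

Definition hyb A B (k : nat) : 'I_m -> V := fun i => if (i < k)%N then A i else B i.

Lemma hyb_P P A B k : (forall j, P j (A j)) -> (forall j, P j (B j)) -> forall j, P j (hyb A B k j).
Proof. by move=> hA hB j; rewrite /hyb; case: ifP. Qed.

(** Slots are exchanged in increasing order: in the i-th term the slots before i already carry A,
    those after i still carry B. Later estimates rely on this order. *)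
Lemma mlin_telescope P T A B : mlin P T -> (forall j, P j (A j)) -> (forall j, P j (B j)) ->
 T A - T B = \sum_(i < m) T (upd (hyb A B i) i (fun x => A i x - B i x)).
Proof.
move=> ml hA hB.
have -> : T A = T (hyb A B m) by congr T; apply/funext => i; rewrite /hyb ltn_ord.
have -> : T B = T (hyb A B 0) by congr T; apply/funext => i.
rewrite -(telescope_sumr (fun k => T (hyb A B k)) (leq0n m)) big_mkord; apply: eq_bigr => i _.
rewrite (mlinB ml (hyb_P i hA hB)) //; congr (_ - _).
 congr T; apply/funext => j; rewrite /hyb /tuple_upd ltnS.
 by have [->|ij] := eqVneq j i; [rewrite leqnn|rewrite leq_eqVlt val_eqE (negbTE ij)].
congr T; apply/funext => j; rewrite /hyb /tuple_upd.
by have [->|ij] := eqVneq j i; [rewrite ltnn|].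
Qed.

End multilinear.

(** * Uniform convergence and criteria for Hoelder currents *)

Section hoelder_currents.
Context {R n}.
Implicit Types (f : 'rV[R]_n -> R).
Definition ucvg (fk : nat -> 'rV[R]_n -> R) f :=
 forall e : R, 0 < e -> \forall k \near \oo, forall x, `|fk k x - f x| <= e.

Lemma ucvgP fk f : {uniform, fk @ \oo --> f} <-> ucvg fk f.
Proof.
split => h.
 move=> e e0. have : nbhs (f : uniform_fun setT R) [set g | forall x, ball (f x) e (g x)].
  apply/uniform_nbhs; exists [set xy | ball xy.1 e xy.2]; split; first by rewrite -entourage_ballE; exists e.
  move=> g /= hg x; exact: hg.
 move=> /h hn; have {}hn : \forall k \near \oo, forall x, ball (f x) e (fk k x) := hn.
 apply: filterS hn => k hk x; have := hk x. by rewrite -ball_normE /= distrC => /ltW.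
move=> P /uniform_nbhs[E [+ hE]]; rewrite -entourage_ballE => -[e /= e0 he].
have e2 : 0 < e / 2 by rewrite divr_gt0.
apply: (filterS _ (h _ e2)) => k hk; apply: hE => x _; apply: he => /=.
by rewrite -ball_normE /= distrC (le_lt_trans (hk x))// ltr_pdivrMr// ltr_pMr// ltr1n.
Qed.

Lemma ucvg_cst f : ucvg (fun=> f) f.
Proof. by move=> e e0; apply: nearW => k x; rewrite subrr normr0 ltW. Qed.

Lemma ucvg_le (fk : nat -> 'rV[R]_n -> R) f (ek : nat -> R) :
 (forall k x, `|fk k x - f x| <= ek k) -> ek k @[k --> \oo] --> 0 -> ucvg fk f.
Proof.
move=> h /cvgr0Pnorm_le he e /he; apply: filterS => k hk x.
exact: le_trans (h k x) (le_trans (ler_norm _) hk).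
Qed.

Section holder.
Variables (m : nat) (a : 'I_m.+1 -> R) (T : functional R n m).
Hypothesis a0 : forall i, 0 < a i.

Lemma holder_tupleP (F : 'I_m.+1 -> 'rV[R]_n -> R) : holder_tuple a F <-> forall i, exists2 C, 0 <= C & hol (a i) C (F i).
Proof. by split => h i; apply/holderP => //; exact: h. Qed.

Lemma hc_mlin : holder_current a T -> mlin (fun i => holder (a i)) T.
Proof. by move=> hT F i c h1 h2 hF p1 p2; exact: hc_multilinear hF p1 p2. Qed.

Lemma holder_lin i : lin_closed (@holder R n (a i)).
Proof.
move=> c f g /holderP -/(_ (a0 i))[C C0 hC] /holderP -/(_ (a0 i))[D D0 hD]; apply/holderP => //.
exists (`|c| * C + D); first by rewrite addr_ge0// mulr_ge0.
move=> x y; rewrite opprD addrACA -mulrBr le_normD// mulrDl lerD//.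
by rewrite normrM -mulrA ler_wpM2l.
Qed.

Lemma holder_cst i (c : R) : @holder R n (a i) (fun=> c).
Proof.
by apply/holderP => //; exists 0 => // x y; rewrite subrr normr0 mul0r.
Qed.

Lemma hc_cvg Fk F L : holder_current a T -> 0 <= L -> (forall k i, hol (a i) L (Fk k i)) ->
 (forall i, hol (a i) L (F i)) -> (forall i, ucvg (fun k => Fk k i) (F i)) ->
 T (Fk k) @[k --> \oo] --> T F.
Proof.
move=> hT L0 hFk hF hu; apply: (hc_continuous hT).
- by move=> k i; apply/holderP => //; exists L.
- by move=> i; apply/holderP => //; exists L.
- move=> i; apply/ucvgP; exact: hu.
- exists L => k i; apply: hol_seminorm => //; exact: ltW.
Qed.

(** The axioms in the form in which they are checked below: the first function vanishes on a ball
    instead of having its support off a compact set, and one Hoelder constant serves all slots and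
    all terms of a sequence. *)
Lemma hc_build r : mlin (fun i => holder (a i)) T ->
 (forall F, holder_tuple a F -> (exists (i : 'I_m) (U : set 'rV[R]_n) (c : R),
   [/\ open U, fun_spt (F ord0) `<=` U & forall x, U x -> F (sc i) x = c]) -> T F = 0) ->
 (forall F, holder_tuple a F -> (forall x, `|x| <= r -> F ord0 x = 0) -> T F = 0) ->
 (forall Fk F L, 0 <= L -> (forall k i, hol (a i) L (Fk k i)) ->
  (forall i, hol (a i) L (F i)) -> (forall i, ucvg (fun k => Fk k i) (F i)) ->
  T (Fk k) @[k --> \oo] --> T F) ->
 holder_current a T.
Proof.
move=> h1 h2 h3 h4; split => //.
- exists [set x | `|x| <= r]; split; first exact: compact_normle.
 move=> F hF e; apply: h3 => // x xr; apply: fun_sptN => hx. by have : set0 x by rewrite -e.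
- move=> Fk F hFk hF hu [L hL].
 have nL k i : hol (a i) (`|L| * n%:R `^ a i) (Fk k i).
  apply: seminorm_hol => //; apply: le_trans (hL k i) _; by rewrite lee_fin ler_norm.
 have /choice[LF hLF] : forall i, exists C, 0 <= C /\ hol (a i) C (F i).
  by move=> i; have /holderP := hF i => /(_ (a0 i))[C C0 hC]; exists C.
 pose K := \sum_i `|L| * n%:R `^ a i + \sum_i LF i.
 have P0 i : 0 <= `|L| * n%:R `^ a i :> R by rewrite mulr_ge0 ?powR_ge0. have LF0 i : 0 <= LF i by have [] := hLF i.
 have hw i C f : C <= K -> hol (a i) C f -> hol (a i) K f.
  by move=> CK h x y; apply: (le_trans (h x y)); rewrite ler_wpM2r ?powR_ge0.
 have K0 : 0 <= K by rewrite addr_ge0 ?sumr_ge0. apply: (h4 _ _ K) => //.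
 - move=> k i; apply: hw (nL k i); rewrite /K (bigD1 i)//= -addrA lerDl addr_ge0 ?sumr_ge0//.
 - move=> i; apply: (hw i (LF i)); last by have [] := hLF i.
  by rewrite /K addrC (bigD1 i)//= -addrA lerDl addr_ge0 ?sumr_ge0.
 - move=> i; apply/ucvgP; exact: hu.
Qed.

Lemma hc_ext T' : (forall F, holder_tuple a F -> T' F = T F) ->
 holder_current a T -> holder_current a T'.
Proof.
move=> e [h1 h2 h3 h4]; split.
- move=> F i c f g hF hf hg.
 have hu h : holder (a i) h -> holder_tuple a (upd F i h).
  by move=> hh; apply: (upd_P (P := fun i => holder (a i))).
 by rewrite !e//; [exact: h1|exact: hu|exact: hu|apply/hu/holder_lin].
- by move=> F hF h; rewrite e// h2.
- by have [K [cK hK]] := h3; exists K; split => // F hF h; rewrite e// hK.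
- move=> Fk F hFk hF hu hL; rewrite e// (_ : (fun k => _) = fun k => T (Fk k)).
  exact: h4.
 by apply/funext => k; rewrite e.
Qed.

Lemma holder_spt_ext T' : (forall F, holder_tuple a F -> T' F = T F) -> holder_spt a T' = holder_spt a T.
Proof.
move=> e; rewrite /holder_spt; congr (\bigcap_(A in _) A).
apply/seteqP; split => A /= [cA h]; split => // F hF hA; by [rewrite -e// h|rewrite e// h].
Qed.

Lemma hspt_sub (A : set 'rV[R]_n) : closed A ->
 (forall F, holder_tuple a F -> (forall x, A x -> F ord0 x = 0) -> T F = 0) ->
 holder_spt a T `<=` A.
Proof.
move=> cA h x; apply; split => // F hF e; apply: h => // y yA; apply: fun_sptN => hy.
by have : set0 y by rewrite -e.
Qed.

End holder.

Lemma lip_tupleP m (F : 'I_m -> 'rV[R]_n -> R) : lip_tuple F <-> forall i, exists L, 0 <= L /\ lipc L (F i).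
Proof.
split => h i; first by have /lipP[L L0 hL] := h i; exists L.
by apply/lipP; have [L [L0 hL]] := h i; exists L.
Qed.

Lemma lip_tuple_max m (F : 'I_m -> 'rV[R]_n -> R) : lip_tuple F ->
 exists L, 0 <= L /\ forall i, lipc L (F i).
Proof.
move=> /lip_tupleP/choice[L hL]; exists (\sum_i L i); have L0 i : 0 <= L i by have [] := hL i.
split; first exact: sumr_ge0.
by move=> i; apply: lipcW (hL i).2; rewrite (bigD1 i)//= lerDl sumr_ge0.
Qed.

End hoelder_currents.

(** * Essential supports and representatives with bounded support *)

Section supports.
Context {R n}.
Implicit Types (u v : 'rV[R]_n -> R) (r : R).
Definition aesupp r u := {ae mu, forall x, r < `|x| -> u x = 0}.

Lemma open_normgt r : open [set x : 'rV[R]_n | r < `|x|].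
Proof.
rewrite (_ : [set x | _] = ~` [set x | `|x| <= r]); first exact/closed_openC/closed_normle.
by apply/seteqP; split => y /=; [move=> h; apply/negP; rewrite -ltNge|move/negP; rewrite -ltNge].
Qed.

Lemma ess_spt_sub r u : aesupp r u -> ess_spt u `<=` [set x | `|x| <= r].
Proof.
move=> h x /= hx; rewrite leNgt; apply/negP => rx; apply: hx.
by exists [set y | r < `|y|] => //; split => //; exact: open_normgt.
Qed.

Lemma closed_ess_spt u : closed (ess_spt u).
Proof. by apply: open_closedC; apply: bigcup_open => U []. Qed.

Lemma aesupp_L1c r u : L1 mu u -> aesupp r u -> L1c u.
Proof.
move=> lu h; split => //; apply: (subclosed_compact _ (@compact_normle R n r)).
 exact: closed_ess_spt.
exact: ess_spt_sub.
Qed.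

(** The open sets whose union is the complement of the essential support need not be countable in
    number; on a compact set finitely many of them suffice. *)
Lemma negligible_compact (A : set 'rV[R]_n) u : compact A -> A `&` ess_spt u = set0 ->
 {ae mu, forall x, A x -> u x = 0}.
Proof.
rewrite compact_cover => cA e.
pose D := [set U : set 'rV[R]_n | open U /\ {ae mu, forall x, U x -> u x = 0}].
have [||D' sD hD] := cA (set 'rV[R]_n) D id.
- by move=> U [].
- move=> x Ax; have : ~ ess_spt u x by move=> hx; have : set0 x by rewrite -e.
 by move=> /contrapT [U DU Ux]; exists U.
have : forall s : seq (set 'rV[R]_n), (forall U, U \in s -> {ae mu, forall x, U x -> u x = 0}) ->
  {ae mu, forall x, forall U, U \in s -> U x -> u x = 0}.
 elim=> [|U s IH] h; first by apply: nearW => x U; rewrite in_nil. have h1 := h U (mem_head _ _).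
 have h2 := IH (fun W hW => h W (mem_behead (s := U :: s) hW)).
 apply: filterS2 h1 h2 => x e1 e2 W; rewrite in_cons => /orP[/eqP ->//|]; exact: e2.
move=> /(_ (finmap.enum_fset D')) hs.
have {}hs := hs (fun U UD => let: conj _ h := set_mem (sD U UD) in h).
apply: filterS hs => x hx /hD [U UD Ux]; exact: hx Ux.
Qed.

(** The exterior of a ball around the essential support is covered by countably many compact annuli,
    on each of which u vanishes almost everywhere. *)
Lemma L1c_aesupp u : L1c u -> exists r, 0 <= r /\ aesupp r u.
Proof.
move=> [_ cu]; have [r r0 hr] := compact_rV cu; exists (`|r| + 1); split; first by rewrite addr_ge0.
have ann (k : nat) : {ae mu, forall x, [set x | `|r| + 1 <= `|x| /\ `|x| <= k%:R] x -> u x = 0}.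
 apply: negligible_compact; first exact: compact_annulus. apply/seteqP; split => x //= [[h1 _] /hr h2].
 have := le_trans h1 h2; have := ler_norm r; lra.
have : {ae mu, forall x, forall k, [set x | `|r| + 1 <= `|x| /\ `|x| <= k%:R] x -> u x = 0}.
 exact/ae_foralln.
apply: filterS => x h hx; apply: (h (Num.truncn `|x|).+1); split; first exact: ltW.
exact/ltW/truncnS_gt.
Qed.

Definition bcut r u x : R := u x * \1_[set y : 'rV[R]_n | `|y| <= r] x.

Lemma cut_bsupp r u : bsupp r (bcut r u).
Proof. by move=> x hx; rewrite /bcut indicE memNset ?mulr0//=; apply/negP; rewrite -ltNge. Qed.

Lemma cut_ae r u : aesupp r u -> {ae mu, forall x, u x = bcut r u x}.
Proof.
apply: filterS => x h; have [hx|hx] := leP `|x| r; last by rewrite h// /bcut h// mul0r.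
by rewrite /bcut indicE mem_set// mulr1.
Qed.

Lemma cut_L1 r u : L1 mu u -> L1 mu (bcut r u).
Proof. by move=> lu; apply: L1_indic => //; apply: closed_measurable_rV || (rewrite -[X in measurable X]setCK; apply: measurableC; apply: open_mf; apply: closed_openC; exact: closed_normle). Qed.

End supports.

(** * Tuples with a distinguished first function *)

Section tails.
Context {R n} {m : nat}.
Local Notation V := ('rV[R]_n -> R).
Definition tl (F : 'I_m.+1 -> V) : 'I_m -> V := fun i => F (sc i).

Lemma tl_upd0 F h : tl (upd F ord0 h) = tl F.
Proof. by apply/funext => i; rewrite /tl updN// eq_sym neq_lift. Qed.

Lemma tl_updS F i h : tl (upd F (sc i) h) = upd (tl F) i h.
Proof. by apply/funext => j; rewrite /tl /tuple_upd (inj_eq lift_inj). Qed.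

Lemma tl_cons f (G : 'I_m -> V) : tl (tcons f G) = G.
Proof. by apply/funext => i; rewrite /tl /tuple_cons liftK. Qed.

Lemma tcons0 f (G : 'I_m -> V) : tcons f G ord0 = f.
Proof. by rewrite /tuple_cons unlift_none. Qed.

Lemma tconsS f (G : 'I_m -> V) i : tcons f G (sc i) = G i.
Proof. by rewrite /tuple_cons liftK. Qed.

Lemma tconsE (F : 'I_m.+1 -> V) : tcons (F ord0) (tl F) = F.
Proof.
apply/funext => i; case: (unliftP ord0 i) => [j ->|->]; by rewrite ?tconsS ?tcons0.
Qed.

Lemma tcons_upd f (G : 'I_m -> V) i h : tcons f (upd G i h) = upd (tcons f G) (sc i) h.
Proof.
apply/funext => j; case: (unliftP ord0 j) => [k ->|->].
 by rewrite tconsS /tuple_upd (inj_eq lift_inj) tconsS.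
by rewrite tcons0 updN ?neq_lift// tcons0.
Qed.

Lemma tcons_upd0 f (G : 'I_m -> V) h : upd (tcons f G) ord0 h = tcons h G.
Proof.
apply/funext => j; case: (unliftP ord0 j) => [k ->|->].
 by rewrite updN ?tconsS// eq_sym neq_lift.
by rewrite updE tcons0.
Qed.

Lemma tcons_P (P : V -> Prop) f (G : 'I_m -> V) : P f -> (forall i, P (G i)) ->
 forall i, P (tcons f G i).
Proof. by move=> hf hG i; case: (unliftP ord0 i) => [k ->|->]; rewrite ?tconsS ?tcons0. Qed.

Lemma lip_upd k (F : 'I_k -> V) i h : lip_tuple F -> Defs.lipschitz h -> lip_tuple (upd F i h).
Proof. by move=> hF hh j; rewrite /tuple_upd; case: eqP => // _; exact: hF. Qed.

End tails.

(** * The current of an integrable density is metric *)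

Section currents.
Context {R} {p : nat}.
Local Notation n := p.+1.
Implicit Types (u v w f : 'rV[R]_n -> R) (F : 'I_n.+1 -> 'rV[R]_n -> R).
Lemma three_eps (a b c d e : R) : `|a - c| <= e / 3 -> `|c - d| <= e / 3 -> `|b - d| <= e / 3 -> `|a - b| <= e.
Proof. rewrite !ler_norml; lra. Qed.

Lemma L1_weight r u w C : L1 mu u -> bsupp r u -> mfun w ->
 (forall x, `|x| <= r -> `|w x| <= C) -> L1 mu (fun x => u x * w x) /\
 `|I (fun x => u x * w x)| <= C * I (fun x => `|u x|).
Proof.
move=> lu ur mw hw.
have b x : `|u x * w x| <= C * `|u x|.
 have [xr|xr] := leP `|x| r; first by rewrite normrM mulrC ler_wpM2r// hw. by rewrite ur// mul0r normr0 mulr0.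
have lw : L1 mu (fun x => u x * w x).
 apply: (L1_le _ b); last exact/L1Z/L1_abs. apply: measurable_funM => //; exact: L1_mfun lu.
split => //; rewrite -IZ; last exact: L1_abs.
by apply: I_abs_le => //; exact/L1Z/L1_abs.
Qed.

Definition cD : R := n`!%:R.

Lemma weight_mf F : lip_tuple F -> mfun (fun x => F ord0 x * detD (tl F) x).
Proof.
move=> /lip_tupleP h; apply: measurable_funM.
 by have [L [_ hL]] := h ord0; exact: lipc_mfun hL.
by apply: detD_mf => i; have [L [_ hL]] := h (sc i); exact: lipc_cont hL.
Qed.

Lemma current_ofE u F : current_of u F = I (fun x => u x * (F ord0 x * detD (tl F) x)).
Proof. by congr Rintegral; apply/funext => x; rewrite mulrA. Qed.

Section fixed.
Variables (u : 'rV[R]_n -> R) (r : R).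
Hypotheses (lu : L1 mu u) (ur : bsupp r u).

Lemma lip_bound_ball f L x : 0 <= L -> lipc L f -> `|x| <= r -> `|f x| <= `|f 0| + L * `|r|.
Proof.
move=> L0 fL xr; rewrite -(subrK (f 0) (f x)) addrC le_normD// lerD2l.
by apply: (le_trans (fL _ _)); rewrite subr0 ler_wpM2l// (le_trans xr)// ler_norm.
Qed.

Lemma current_bound F A L : lip_tuple F -> 0 <= A -> (forall x, `|x| <= r -> `|F ord0 x| <= A) ->
 (forall i, 0 <= L i) -> (forall i, lipc (L i) (tl F i)) ->
 `|current_of u F| <= A * (cD * \prod_i L i) * I (fun x => `|u x|).
Proof.
move=> hF A0 hA L0 hL; rewrite current_ofE.
apply: (L1_weight lu ur (weight_mf hF) _).2 => x xr.
rewrite normrM ler_pM// ?hA//; exact: detD_bound.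
Qed.

Lemma current_L1 F : lip_tuple F -> L1 mu (fun x => u x * (F ord0 x * detD (tl F) x)).
Proof.
move=> hF; have [L [L0 hL]] := lip_tuple_max hF.
apply: (L1_weight (C := (`|F ord0 0| + L * `|r|) * (cD * \prod_(i < n) L)) lu ur (weight_mf hF) _).1 => x xr.
rewrite normrM ler_pM//; first exact: lip_bound_ball.
apply: (detD_bound (L := fun=> L)) => // i; exact: hL.
Qed.

Lemma current_mlin : mlin (fun=> @Defs.lipschitz R n) (current_of u).
Proof.
move=> F i c h1 h2 hF l1 l2.
have hU h : Defs.lipschitz h -> lip_tuple (upd F i h) by exact: lip_upd.
have lc : Defs.lipschitz (fun x => c * h1 x + h2 x).
 exact: (@holder_lin R n 0 (fun=> 1) (fun=> ltr01) ord0).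
rewrite !current_ofE -IZ; last exact/current_L1/hU.
rewrite -ID; [|exact/L1Z/current_L1/hU|exact/current_L1/hU].
have m1 := L1_mfun (current_L1 (hU _ l1)); have m2 := L1_mfun (current_L1 (hU _ l2)).
have m3 := L1_mfun (current_L1 (hU _ lc)).
apply: I_ae => //.
 apply: measurable_funD => //; exact: measurable_funM.
case: (unliftP ord0 i) => [j ->|->].
 have /lipP[L1 _ hL1] := l1; have /lipP[L2 _ hL2] := l2. apply: filterS (detD_lin_ae (tl F) j c hL1 hL2) => x.
 rewrite !tl_updS => ->; rewrite !updN ?neq_lift//; ring.
by apply: nearW => x; rewrite !tl_upd0 !updE; ring.
Qed.

End fixed.

Lemma currentB u v F r : L1 mu u -> bsupp r u -> L1 mu v -> bsupp r v -> lip_tuple F ->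
 current_of (fun x => u x - v x) F = current_of u F - current_of v F.
Proof.
move=> lu ur lv vr hF; rewrite !current_ofE -IB; [|exact: current_L1 ur _ _|exact: current_L1 vr _ _].
by congr Rintegral; apply/funext => x; ring.
Qed.

Lemma current_of_ae u v F : mfun u -> mfun v ->
 {ae mu, forall x, u x = v x} -> lip_tuple F -> current_of u F = current_of v F.
Proof.
move=> mu_ mv e hF; rewrite !current_ofE; have mw := weight_mf hF.
apply: I_ae; [exact: measurable_funM|exact: measurable_funM|].
by apply: filterS e => x ->.
Qed.

(** Slots are exchanged one at a time. A small difference w in a slot of the determinant trades
    places, by integration by parts, with v times the first function; as v is Lipschitz with bounded
    support, w then enters only through its sup norm. *)
Lemma current_cvg_lipb v Fk F L : lipb v -> 0 <= L ->
 (forall k i, lipc L (Fk k i)) -> (forall i, lipc L (F i)) -> (forall i, ucvg (fun k => Fk k i) (F i)) ->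
 current_of v (Fk k) @[k --> \oo] --> current_of v F.
Proof.
move=> bv L0 hFk hF hu; have [Lv [r [Lv0 vL vr]]] := bv; have lv := lipbL1 bv.
have bw : lipb (fun x => v x * F ord0 x).
 by rewrite (_ : (fun x => _) = fun x => F ord0 x * v x); [exact: lipbMl (hF ord0)|apply/funext => x; rewrite mulrC].
have [M [_ [M0 wM _]]] := bw.
have lF : lip_tuple F by apply/lip_tupleP => i; exists L.
have lFk k : lip_tuple (Fk k) by apply/lip_tupleP => i; exists L.
pose K := L + L + M.
have LK : L <= K by rewrite /K -addrA lerDl addr_ge0.
have K0 : 0 <= K by exact: le_trans LK.
pose J := I (fun x : 'rV[R]_n => cutoff r x).
have J0 : 0 <= J by apply: I_ge0 => x; exact: clamp_ge0.
pose C := cD * K ^+ n * (I (fun x => `|v x|) + J).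
have C0 : 0 <= C by rewrite !mulr_ge0 ?exprn_ge0// addr_ge0// I_ge0.
have est k e : 0 <= e -> (forall i x, `|Fk k i x - F i x| <= e) ->
  `|current_of v F - current_of v (Fk k)| <= n.+1%:R * (e * C).
 move=> e0 he; rewrite (mlin_telescope (current_mlin lv vr) lF (lFk k)). apply: le_norm_sum;
 apply: (via (\sum_(i < n.+1) e * C)); last by rewrite sumr_const card_ord mulr_natl.
 apply: ler_sum => i _; set H := hyb _ _ _; pose w x := F i x - Fk k i x. have hw x : `|w x| <= e by rewrite distrC.
 have wL : lipc (L + L) w by exact: lipcB. have HL j : lipc L (H j) by rewrite /H /hyb; case: ifP.
 have lw : exists L, 0 <= L /\ lipc L w by exists (L + L); rewrite addr_ge0. have lU : lip_tuple (upd H i w).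
  apply: lip_upd; first by move=> j; apply/lipP; exists L. by have [Lw [? ?]] := lw; apply/lipP; exists Lw.
 have KL f : lipc (L + L) f \/ lipc L f \/ lipc M f -> lipc K f.
  case => [|[]]; apply: lipcW; rewrite /K; first by rewrite lerDl.
   by rewrite -addrA lerDl addr_ge0.
  by rewrite lerDr addr_ge0.
 have [j ij|i0] := unliftP ord0 i.
  rewrite -/w current_ofE; move: w hw wL lw lU => w hw wL lw lU. rewrite ij tl_updS updN ?neq_lift//.
  (* The slots before i carry the limit already, so the product with v is a fixed function, and its
     Lipschitz constant M does not depend on k. *)
  have -> : H ord0 = F ord0 by rewrite /H /hyb ij. under eq_Rintegral do rewrite mulrA.
  rewrite (@I_detD_parts R p (tl H) j (fun x => v x * F ord0 x) w)//; last first.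
   move=> l; exists L; split => //; exact: HL.
  rewrite normrN. apply: (via (I (fun x : 'rV[R]_n => e * (cD * K ^+ n) * cutoff r x))); last first.
   rewrite IZ; last exact/lipbL1/lipb_cutoff.
   rewrite -/J -mulrA /C ler_wpM2l// ler_wpM2l ?mulr_ge0 ?exprn_ge0// lerDr. by apply: I_ge0.
  have dr : bsupp r (detD (upd (tl H) j (fun x => v x * F ord0 x))).
   by apply: (@detD_bsupp _ _ _ j); rewrite updE => x hx; rewrite vr ?mul0r.
  have b x : `|w x * detD (upd (tl H) j (fun x => v x * F ord0 x)) x| <= e * (cD * K ^+ n) * cutoff r x.
   have [xr|xr] := leP `|x| r; last by rewrite dr// mulr0 normr0 !mulr_ge0 ?exprn_ge0 ?clamp_ge0.
   rewrite cutoff1// mulr1 normrM ler_pM//. rewrite -[n in K ^+ n](card_ord n) -prodr_const.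
   apply: (detD_bound (L := fun=> K)) => // l; rewrite /tuple_upd; case: eqP => _.
    by apply: KL; right; right.
   apply: KL; right; left; exact: HL.
  have lc : L1 mu (fun x : 'rV[R]_n => e * (cD * K ^+ n) * cutoff r x) by apply/L1Z/lipbL1/lipb_cutoff.
  apply: (I_abs_le _ _ b) => //; apply: (L1_le _ b) => //. apply: measurable_funM; first exact: lipc_mfun wL.
  apply: detD_mf => l; rewrite /tuple_upd; case: eqP => _; first exact: lipc_cont wM. exact: lipc_cont (HL _).
 apply: (le_trans (current_bound (A := e) (L := fun=> L) lv vr lU _ _ _ _)) => //.
 - by move=> x _; rewrite {1}i0 updE.
 - move=> l; rewrite {1}i0 tl_upd0; exact: HL.
 rewrite /C -!mulrA ler_wpM2l// ler_wpM2l// prodr_const card_ord ler_pM ?exprn_ge0 ?I_ge0//.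
  by rewrite lerXn2r ?nnegrE.
 by rewrite lerDl.
apply/cvgrPdist_le => e e0.
pose e1 := e / (n.+1%:R * (C + 1)).
have D0 : 0 < n.+1%:R * (C + 1) by rewrite mulr_gt0// ltr_pwDr.
have e10 : 0 < e1 by rewrite divr_gt0.
have : \forall k \near \oo, forall i x, `|Fk k i x - F i x| <= e1.
 apply: filter_forall => i; exact: (hu i _ e10).
apply: filterS => k hk; apply: (le_trans (est k e1 (ltW e10) hk)).
by rewrite mulrCA /e1 mulrAC ler_pdivrMr// ler_wpM2l ?(ltW e0)// ler_wpM2l// lerDl.
Qed.

(** The density is approximated in L^1 by a Lipschitz one. By [current_bound] the error is uniform
    over tuples with Lipschitz constant L whose first function stays within 1 of that of the
    limit. *)
Lemma current_cvg u r Fk F L : L1 mu u -> bsupp r u -> 0 <= L ->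
 (forall k i, lipc L (Fk k i)) -> (forall i, lipc L (F i)) -> (forall i, ucvg (fun k => Fk k i) (F i)) ->
 current_of u (Fk k) @[k --> \oo] --> current_of u F.
Proof.
move=> lu ur L0 hFk hF hu.
have lF : lip_tuple F by apply/lip_tupleP => i; exists L.
have lFk k : lip_tuple (Fk k) by apply/lip_tupleP => i; exists L.
pose A := `|F ord0 0| + L * `|r + 1| + 1.
have A0 : 0 <= A by rewrite !addr_ge0// mulr_ge0.
pose C := A * (cD * L ^+ n).
have C0 : 0 <= C by rewrite !mulr_ge0// exprn_ge0.
apply/cvgrPdist_le => e e0.
have e30 : 0 < e / 3 by rewrite divr_gt0.
have C1 : 0 < C + 1 by rewrite ltr_pwDr.
have [v [bv vr /ltW huv]] := lipb_dense_supp lu ur (divr_gt0 e30 C1); have lv := lipbL1 bv.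
have ur1 : bsupp (r + 1) u by apply: bsuppW ur; rewrite lerDl.
have luv : L1 mu (fun x => u x - v x) by exact: L1B.
have uvr : bsupp (r + 1) (fun x => u x - v x) by move=> x hx; rewrite ur1// vr// subrr.
have est G : (forall i, lipc L (G i)) -> (forall x, `|G ord0 x - F ord0 x| <= 1) ->
  `|current_of u G - current_of v G| <= e / 3.
 move=> hG hG0; have lG : lip_tuple G by apply/lip_tupleP => i; exists L. rewrite -(currentB lu ur1 lv vr lG).
 apply: (le_trans (current_bound (A := A) (L := fun=> L) luv uvr lG A0 _ _ _)) => //.
  move=> x xr; rewrite -(subrK (F ord0 x) (G ord0 x)) le_normD// addrC.
  by rewrite lerD// (lip_bound_ball L0 (hF ord0) xr).
 - move=> i; exact: hG.
 rewrite prodr_const card_ord -/C (le_trans (ler_wpM2l C0 huv))//.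
 by rewrite mulrA ler_pdivrMr// mulrC ler_wpM2l ?(ltW e30)// lerDl.
have /cvgrPdist_le /(_ _ e30) hv := current_cvg_lipb bv L0 hFk hF hu.
near=> k.
have h1 : `|current_of v F - current_of v (Fk k)| <= e / 3 by near: k; exact: hv.
have h2 : `|current_of u (Fk k) - current_of v (Fk k)| <= e / 3.
 apply: est => //; near: k; exact: (hu ord0 1 ltr01).
have h3 : `|current_of u F - current_of v F| <= e / 3 by apply: est => // x; rewrite subrr normr0.
exact: three_eps h3 h1 h2.
Unshelve. all: by end_near. Qed.

Lemma current_off u r F : bsupp r u -> (forall x, `|x| <= r -> F ord0 x = 0) -> current_of u F = 0.
Proof.
move=> ur hF; rewrite current_ofE (_ : (fun x => _) = fun=> 0) ?I0//.
apply/funext => x; have [xr|xr] := leP `|x| r; first by rewrite hF// mul0r mulr0.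
by rewrite ur// mul0r.
Qed.

Lemma current_metric_bsupp u r : L1 mu u -> bsupp r u -> metric_current (current_of u).
Proof.
move=> lu ur; apply: (@hc_build _ _ _ _ _ (fun=> ltr01) r).
- exact: current_mlin ur.
- move=> F hF [i [U [c [oU hU hc]]]].
 rewrite current_ofE (_ : (fun x => _) = fun=> 0) ?I0//; apply/funext => x.
 have [->|Fx] := eqVneq (F ord0 x) 0; first by rewrite mul0r mulr0.
 rewrite (@detD_const _ _ (tl F) i U c) ?mulr0//; exact/hU/fun_spt_neq0.
- move=> F _; exact: current_off.
- move=> Fk F L L0 hFk hF hu; apply: (current_cvg lu ur L0) => //.
  move=> k i; apply/lipc_hol; exact: hFk.
 move=> i; apply/lipc_hol; exact: hF.
Qed.

Lemma current_metric u : L1c u -> metric_current (current_of u).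
Proof.
move=> cu; have [r [_ hr]] := L1c_aesupp cu; have lu := cu.1.
apply: (hc_ext (fun=> ltr01) _ (current_metric_bsupp (cut_L1 r lu) (@cut_bsupp _ _ r u))).
move=> F hF; apply: current_of_ae => //; [exact: L1_mfun lu|exact: L1_mfun (cut_L1 r lu)|].
exact: cut_ae.
Qed.

End currents.

(** * Staircases with flat parts that cover the line *)

Section staircases.
Context {R}.
Implicit Types s t : R.

(* Nondecreasing, within distance 8 of the identity on [0, M], and increasing only on the
  intervals [b, b + 1] with b an integer congruent to - o modulo 8. *)
Definition stair (o M : nat) s : R := \sum_(j < M) clamp (s - j%:R + ((j + o) %% 8)%:R).

Lemma sum_clamp M s : \sum_(j < M) clamp (s - j%:R) = pp s - pp (s - M%:R) :> R.
Proof. by rewrite (sum_shift (B := pp)) // => t; exact: clampE. Qed.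

Lemma pp_mono1 : mono1 (@pp R).
Proof.
move=> s t st; have h := pp_lip t s; rewrite mul1r [`|t - s|]ger0_norm ?subr_ge0// in h.
have h2 : pp s <= pp t by rewrite /pp ge_max !le_max lexx st orbT.
by move: h; rewrite ger0_norm ?subr_ge0// => ->; rewrite andbT.
Qed.

Lemma stair_mono o M s t : s <= t -> 0 <= stair o M t - stair o M s <= 8 * (t - s).
Proof.
move=> st; rewrite /stair -sumrB; apply/andP; split.
 by apply: sumr_ge0 => j _; rewrite subr_ge0; apply: clamp_nd; lra.
apply: (via (\sum_(j < M) \sum_(e < 8) (clamp (t + e%:R - j%:R) - clamp (s + e%:R - j%:R)))).
 apply: ler_sum => j _. have he : ((j + o) %% 8 < 8)%N by rewrite ltn_mod.
 rewrite (bigD1 (Ordinal he))//= [t + _ - _]addrAC [s + _ - _]addrAC lerDl.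
 by apply: sumr_ge0 => e _; rewrite subr_ge0; apply: clamp_nd; lra.
rewrite exchange_big /=.
apply: (via (\sum_(e < 8) (t - s))); last by rewrite sumr_const card_ord mulr_natl.
apply: ler_sum => e _; rewrite sumrB !sum_clamp.
have := @pp_mono1 (s + e%:R) (t + e%:R); have := @pp_mono1 (s + e%:R - M%:R) (t + e%:R - M%:R).
rewrite !lerD2r => /(_ st) /andP[h1 _] /(_ st) /andP[_ h2]; lra.
Qed.

Lemma stair_lip o M s t : `|stair o M s - stair o M t| <= 8 * `|s - t|.
Proof.
wlog st : s t / s <= t.
 by move=> h; have [/h//|/ltW /h] := leP s t; rewrite distrC [`|t - s|]distrC.
have /andP[h1 h2] := stair_mono o M st.
by rewrite distrC ger0_norm// distrC ger0_norm ?subr_ge0.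
Qed.

Lemma stair_close o M s : 0 <= s -> s <= M%:R -> `|stair o M s - s| <= 8.
Proof.
move=> s0 sM.
have sE : s = \sum_(j < M) clamp (s - j%:R) by rewrite sum_clamp pp_pos// pp_neg ?subr0// subr_le0.
rewrite {2}sE /stair -sumrB ger0_norm; last first.
 by apply: sumr_ge0 => j _; rewrite subr_ge0; apply: clamp_nd; rewrite lerDl.
apply: (via (\sum_(j < M) (clamp (s + 8 - j%:R) - clamp (s - j%:R)))).
 apply: ler_sum => j _; rewrite lerD2r; apply: clamp_nd.
 by rewrite addrAC lerD2r lerD2l (ler_nat _ _ 8) ltnW// ltn_mod.
rewrite sumrB !sum_clamp pp_pos ?addr_ge0//.
have h1 := pp_ge0 (s + 8 - M%:R); have h2 : pp s = s by rewrite pp_pos.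
have h3 : pp (s - M%:R) = 0 by rewrite pp_neg// subr_le0.
rewrite h2 h3; lra.
Qed.

(** One riser ends at j0 - 1 or earlier and the next one begins at j0 + 3 or later. The residues 2,
    ..., 5 are half of all residues modulo 8, so the offsets 0 and 4 together serve every j0. *)
Lemma stair_const o M (j0 : nat) s t : (2 <= (j0 + o) %% 8 <= 5)%N ->
 j0%:R - 2^-1 < s < j0%:R + 2 + 2^-1 -> j0%:R - 2^-1 < t < j0%:R + 2 + 2^-1 ->
 stair o M s = stair o M t.
Proof.
move=> ho hs ht; apply: eq_bigr => j _.
have [h|h] : (j0 + 3 + ((j + o) %% 8) <= j \/ j + 2 <= j0 + ((j + o) %% 8))%N by lia.
 have : (j0 + 3 + ((j + o) %% 8))%:R <= j%:R :> R by rewrite ler_nat. rewrite !natrD; set e := (_ %% 8)%:R => h'.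
 rewrite !clamp_0//; lra.
have : (j + 2)%:R <= (j0 + ((j + o) %% 8))%:R :> R by rewrite ler_nat.
rewrite !natrD; set e := (_ %% 8)%:R => h'.
rewrite !clamp_1//; lra.
Qed.

End staircases.

(** * Bounded Lipschitz functions and staircases of functions *)

Section bounded.
Context {R n}.
Implicit Types f g : 'rV[R]_n -> R.
Definition lipbd f := exists L A : R, [/\ 0 <= L, 0 <= A, lipc L f & forall x, `|f x| <= A].

Lemma bd_lip f : lipbd f -> Defs.lipschitz f.
Proof. by move=> [L [A [L0 _ fL _]]]; apply/lipP; exists L. Qed.

Lemma lipb_lipbd f : lipb f -> lipbd f.
Proof. by move=> /lipbP[L [r [A [[L0 A0] _ fL _ fA]]]]; exists L, A. Qed.

Lemma lipb_lip f : lipb f -> Defs.lipschitz f. Proof. by move=> /lipb_lipbd/bd_lip. Qed.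

Lemma lipbdM f g : lipbd f -> lipbd g -> lipbd (fun x => f x * g x).
Proof.
move=> [L [A [L0 A0 fL fA]]] [M [B [M0 B0 gM gB]]]; exists (A * M + B * L), (A * B); split.
- by rewrite addr_ge0// mulr_ge0.
- exact: mulr_ge0.
- exact: lipcM.
- by move=> x; rewrite normrM ler_pM.
Qed.

Lemma lipbdD f g : lipbd f -> lipbd g -> lipbd (fun x => f x + g x).
Proof.
move=> [L [A [L0 A0 fL fA]]] [M [B [M0 B0 gM gB]]]; exists (L + M), (A + B); split.
- exact: addr_ge0.
- exact: addr_ge0.
- exact: lipcD.
- by move=> x; rewrite le_normD// lerD.
Qed.

Lemma lipbd_cst c : lipbd (fun=> c).
Proof. by exists 0, `|c|; split => // x y; rewrite subrr normr0 mul0r. Qed.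

Lemma lipbd_comp (phi : R -> R) (K B : R) f : 0 <= K ->
 (forall s t, `|phi s - phi t| <= K * `|s - t|) -> (forall s, `|phi s| <= B) ->
 Defs.lipschitz f -> lipbd (fun x => phi (f x)).
Proof.
move=> K0 hK hB /lipP[L L0 fL]; exists (K * L), B; split.
- exact: mulr_ge0.
- exact: le_trans (hB 0).
- exact: lipc_comp1 fL.
- by move=> x.
Qed.

Definition cst_near (phi a : 'rV[R]_n -> R) := exists (c d : R), 0 < d /\
 forall x y, phi x != 0 -> `|y - x| < d -> a y = c.

(** A single staircase is not constant on the pieces above its risers; the second one has its risers
    where the first is flat. Two copies of g, in two slots or in a product, are replaced by one
    staircase each, and on every piece locality applies to one of them. *)
Lemma staircases g L A (e : R) : 0 <= L -> lipc L g -> (forall x, `|g x| <= A) -> 0 < e ->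
 exists (N : nat) (phi : 'I_N -> 'rV[R]_n -> R) (a b : 'rV[R]_n -> R),
 [/\ (forall q, lipbd (phi q)) /\ (forall x, \sum_q phi q x = 1), lipc (8 * L) a /\ lipc (8 * L) b,
   forall x, `|a x - g x| <= 8 * e, forall x, `|b x - g x| <= 8 * e &
   forall q, cst_near (phi q) a \/ cst_near (phi q) b].
Proof.
move=> L0 gL gA e0.
(* The summand 2 is there because the hats sum to 1 only from 2 on. *)
pose s x := (g x + A) / e + 2.
pose M := (Num.truncn (2 * A / e)).+4.
have sb x : 2 <= s x <= M%:R.
 have := gA x; rewrite ler_norml => /andP[h1 h2]; rewrite /s; apply/andP; split.
  by rewrite lerDr divr_ge0 ?(ltW e0)//; lra.
 rewrite /M -[in leRHS]addn2 natrD lerD2r; apply: (via (2 * A / e)).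
  by rewrite ler_wpM2r ?invr_ge0 ?(ltW e0)//; lra.
 by apply: (le_trans (ltW (truncnS_gt _))); rewrite ler_nat.
have sd x y : s x - s y = (g x - g y) / e by rewrite /s; field; rewrite gt_eqF.
pose st o x := e * (stair o M (s x) - 2) - A.
exists M, (fun j x => hat (s x - j%:R)), (st 0%N), (st 4%N).
have sL : Defs.lipschitz s.
 apply/lipP; exists (e^-1 * L); first by rewrite mulr_ge0// invr_ge0 ltW.
 by move=> x y; rewrite sd normrM mulrC -mulrA gtr0_norm ?invr_gt0// ler_wpM2l ?invr_ge0 ?(ltW e0).
have stL o : lipc (8 * L) (st o).
 move=> x y; rewrite /st (_ : _ - _ = e * (stair o M (s x) - stair o M (s y))); last by ring.
 rewrite normrM gtr0_norm// (le_trans (ler_wpM2l (ltW e0) (stair_lip _ _ _ _)))//.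
 rewrite sd normrM (gtr0_norm (x := e^-1)) ?invr_gt0// mulrCA -mulrA ler_wpM2l//.
 by rewrite mulrCA divff ?gt_eqF// mulr1.
have stc o x : `|st o x - g x| <= 8 * e.
 have gE : g x = e * (s x - 2) - A by rewrite /s; field; rewrite gt_eqF.
 rewrite gE /st (_ : _ - _ = e * (stair o M (s x) - s x)); last by ring. have /andP[h1 h2] := sb x.
 by rewrite normrM gtr0_norm// mulrC ler_wpM2r ?(ltW e0)// stair_close// (le_trans _ h1).
split => //.
- split => [q|x]; last by have /andP[h1 h2] := sb x; exact: sum_hat1.
 apply: (@lipbd_comp (fun t => hat (t - q%:R)) 2 1 s) => // [u v|u].
  by rewrite (le_trans (hat_lip _ _))// opprD addrACA opprK addNr addr0.
 by rewrite ger0_norm ?hat_ge0 ?hat_le1.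
- move=> q; have hq : (2 <= (q + 0) %% 8 <= 5 \/ 2 <= (q + 4) %% 8 <= 5)%N by lia.
 have key o : (2 <= (q + o) %% 8 <= 5)%N -> cst_near (fun x => hat (s x - q%:R)) (st o).
  (* Within distance d the function s moves by less than 1/2, which keeps it in the range of
     [stair_const] around a hat supported in [q, q + 2]. *)
  move=> ho; pose d := e / (2 * (L + 1)). have L1 : 0 < L + 1 by rewrite ltr_pwDr.
  exists (e * (stair o M (q%:R + 1) - 2) - A), d; split; first by rewrite divr_gt0// mulr_gt0.
  move=> x y hx hy; rewrite /st; suff -> : stair o M (s y) = stair o M (q%:R + 1) by [].
  apply: (@stair_const R o M q (s y) (q%:R + 1) ho); last first.
   by apply/andP; split; lra.
  have hs : 0 < s x - q%:R < 2.
   by apply/andP; split; rewrite ltNge; apply/negP => h; move: hx; rewrite hat_0 ?eqxx ?h ?orbT.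
  have : `|s y - s x| < 2^-1.
   rewrite sd normrM (gtr0_norm (x := e^-1)) ?invr_gt0// ltr_pdivrMr//.
   apply: (@le_lt_trans _ _ ((L + 1) * `|y - x|)).
    by rewrite (le_trans (gL _ _))// ler_wpM2r// lerDl.
   move: hy; rewrite /d ltr_pdivlMr ?mulr_gt0// => hy; lra.
  rewrite ltr_norml; lra.
 by case: hq => [/key|/key]; [left|right].
Qed.

End bounded.

(** * Uniform convergence with bounded Lipschitz constants *)

Section lip_cvg.
Context {R n} {m : nat}.
Local Notation V := ('rV[R]_n -> R).
Implicit Types (f g : V) (fk gk : nat -> V).
Definition lcvg fk f := (exists2 L : R, 0 <= L & lipc L f /\ forall k, lipc L (fk k)) /\ ucvg fk f.

Lemma lcvg_cst f : Defs.lipschitz f -> lcvg (fun=> f) f.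
Proof. by move=> /lipP[L L0 fL]; split; [exists L|exact: ucvg_cst]. Qed.

Lemma lcvg_le fk f (L c : R) (e : nat -> R) : 0 <= L -> lipc L f -> (forall k, lipc L (fk k)) ->
 (forall k x, `|fk k x - f x| <= c * e k) -> e k @[k --> \oo] --> 0 -> lcvg fk f.
Proof.
move=> L0 fL fkL h e0; split; first by exists L.
by apply: (ucvg_le h); rewrite -[X in _ --> X](mulr0 c); apply: cvgM; [exact: cvg_cst|].
Qed.

Lemma lcvg_cons fk f (Gk : nat -> 'I_m -> V) G : lcvg fk f -> (forall i, lcvg (Gk^~ i) (G i)) ->
 forall i, lcvg (fun k => tcons (fk k) (Gk k) i) (tcons f G i).
Proof. by move=> hf hG i; rewrite /tuple_cons; case: (unlift ord0 i) => [j|] /=. Qed.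

Lemma lcvg_upd fk f (Gk : nat -> 'I_m -> V) G i : lcvg fk f -> (forall i, lcvg (Gk^~ i) (G i)) ->
 forall j, lcvg (fun k => upd (Gk k) i (fk k) j) (upd G i f j).
Proof. by move=> hf hG j; rewrite /tuple_upd; case: eqP. Qed.

Lemma lcvgM fk f gk g (A : R) : lcvg fk f -> lcvg gk g -> 0 <= A ->
 (forall k x, `|fk k x| <= A) -> (forall x, `|f x| <= A) ->
 (forall k x, `|gk k x| <= A) -> (forall x, `|g x| <= A) -> lcvg (fun k x => fk k x * gk k x) (fun x => f x * g x).
Proof.
move=> [[L L0 [fL fkL]] fu] [[M M0 [gM gkM]] gu] A0 fkA fA gkA gA; split.
 exists (A * M + A * L); first by rewrite addr_ge0// mulr_ge0. by split => [|k]; exact: lipcM.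
move=> e e0; have A1 : 0 < 2 * A + 1 by rewrite ltr_wpDl// mulr_ge0.
have e1 : 0 < e / (2 * A + 1) by rewrite divr_gt0.
apply: filterS2 (fu _ e1) (gu _ e1) => k hf hg x.
have -> : fk k x * gk k x - f x * g x = (fk k x - f x) * gk k x + f x * (gk k x - g x) by ring.
have t1 := ler_pM (normr_ge0 _) (normr_ge0 _) (hf x) (gkA k x).
have t2 := ler_pM (normr_ge0 _) (normr_ge0 _) (fA x) (hg x); rewrite -!normrM in t1 t2.
apply: le_normD; apply: (le_trans (lerD t1 t2)).
rewrite [A * _]mulrC -mulrDr -mulr2n -[A *+ 2]mulr_natl mulrAC ler_pdivrMr// ler_wpM2l ?(ltW e0)//.
by rewrite lerDl.
Qed.

(** Staircases of step 1/(k+1) with bounds uniform in k. The relation P stands for the identity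
    proved for staircases, so that alternation and the product rule share the passage to the
    limit. *)
Lemma stair_seq g (P : V -> V -> Prop) : lipbd g ->
 (forall N (phi : 'I_N -> V) a b, (forall q, lipbd (phi q)) -> (forall x, \sum_q phi q x = 1) ->
  lipbd a -> lipbd b -> (forall q, cst_near (phi q) a \/ cst_near (phi q) b) -> P a b) ->
 exists (A : R) (a b : nat -> V), [/\ 0 <= A, forall k, P (a k) (b k), lcvg a g, lcvg b g &
  forall k x, [/\ `|a k x| <= A, `|b k x| <= A & `|g x| <= A]].
Proof.
move=> [L [A [L0 A0 gL gA]]] hP; have L8 : 0 <= 8 * L by rewrite mulr_ge0.
have bd k w : (forall x, `|w x - g x| <= 8 * hk k) -> forall x, `|w x| <= A + 8.
 move=> hw x; rewrite -(subrK (g x) (w x)) le_normD// addrC lerD//. by rewrite (le_trans (hw x))// ler_piMr// hk_le1.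
have /choice[ab hab] k : exists ab : V * V, [/\ lipc (8 * L) ab.1 /\ lipc (8 * L) ab.2,
  forall x, `|ab.1 x - g x| <= 8 * hk k, forall x, `|ab.2 x - g x| <= 8 * hk k & P ab.1 ab.2].
 have [N [phi [a [b [[bphi s1] [aL bL] ag bg hq]]]]] := staircases L0 gL gA (@hk_gt0 R k).
 have bw w : lipc (8 * L) w -> (forall x, `|w x - g x| <= 8 * hk k) -> lipbd w.
  by move=> wL /bd wA; exists (8 * L), (A + 8); split => //; rewrite addr_ge0.
 exists (a, b); split => //=; apply: (hP N phi) => //; exact: bw.
have g8 : lipc (8 * L) g by apply: lipcW gL; rewrite ler_peMl// ler1n.
exists (A + 8), (fun k => (ab k).1), (fun k => (ab k).2); split => [|k|||k x].
- by rewrite addr_ge0.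
- by case: (hab k).
- by apply: (lcvg_le L8 g8 _ _ hk_cvg) => k; case: (hab k) => -[].
- by apply: (lcvg_le L8 g8 _ _ hk_cvg) => k; case: (hab k) => -[].
- case: (hab k) => _ h1 h2 _; split; [exact: (bd k)|exact: (bd k)|].
 by rewrite (le_trans (gA x))// lerDl.
Qed.

End lip_cvg.

(** * Locality, alternation and the product rule for metric currents *)

Section current.
Context {R n} {m : nat}.
Local Notation V := ('rV[R]_n -> R).
Implicit Types (f g h : V) (G : 'I_m -> V) (F : 'I_m.+1 -> V).
Variable T : functional R n m.
Hypothesis hT : metric_current T.

Lemma mc_mlin : mlin (fun=> lip) T.
Proof. exact: (@hc_mlin _ _ _ (fun=> 1)). Qed.

Lemma lipbd_lin : lin_closed (@lipbd R n).
Proof. by move=> c f g bf bg; apply: lipbdD => //; apply: lipbdM => //; exact: lipbd_cst. Qed.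

Lemma lip_lin : lin_closed (@Defs.lipschitz R n).
Proof. exact: (@holder_lin R n 0 (fun=> 1) (fun=> ltr01) ord0). Qed.

Lemma lip_cst (c : R) : @Defs.lipschitz R n (fun=> c).
Proof. exact: (@holder_cst R n 0 (fun=> 1) (fun=> ltr01) ord0). Qed.

Lemma lip_sub f g : lip f -> lip g -> lip (fun x => f x - g x).
Proof.
move=> hf hg; rewrite (_ : (fun x => _) = fun x => -1 * g x + f x); first exact: lip_lin.
by apply/funext => x; rewrite mulN1r addrC.
Qed.

Lemma lip_cons f G : lip f -> lip_tuple G -> lip_tuple (tcons f G).
Proof. by move=> hf hG; exact: (tcons_P (P := lip)). Qed.

Lemma lip_tl F : lip_tuple F -> lip_tuple (tl F). Proof. by move=> h i; exact: h. Qed.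

Lemma mc_cvg Fk F L : 0 <= L -> (forall k i, lipc L (Fk k i)) -> (forall i, lipc L (F i)) ->
 (forall i, ucvg (fun k => Fk k i) (F i)) -> T (Fk k) @[k --> \oo] --> T F.
Proof.
move=> L0 hFk hF hu; apply: (hc_cvg _ hT L0) => //.
 move=> k i; apply/lipc_hol; exact: hFk.
move=> i; apply/lipc_hol; exact: hF.
Qed.

Lemma mc_lcvg (Fk : nat -> 'I_m.+1 -> V) F : (forall i, lcvg (Fk^~ i) (F i)) -> T (Fk k) @[k --> \oo] --> T F.
Proof.
move=> h; have /choice[L hL] i : exists L, 0 <= L /\ (lipc L (F i) /\ forall k, lipc L (Fk k i)).
 by have [[L L0 FL] _] := h i; exists L.
have LS i : L i <= \sum_j L j by rewrite (bigD1 i)//= lerDl sumr_ge0// => j _; case: (hL j).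
apply: (mc_cvg (L := \sum_j L j)) => [|k i|i|i].
- by apply: sumr_ge0 => i _; case: (hL i).
- by apply: lipcW (LS i) _; case: (hL i) => _ [].
- by apply: lipcW (LS i) _; case: (hL i) => _ [].
- by case: (h i).
Qed.

Lemma mc_lcvg0 (Fk : nat -> 'I_m.+1 -> V) F : (forall i, lcvg (Fk^~ i) (F i)) -> (forall k, T (Fk k) = 0) -> T F = 0.
Proof.
move=> /mc_lcvg hc h0; have := hc; rewrite (_ : (fun k => _) = fun=> 0); last by apply/funext.
by move=> /(cvg_unique _ (cvg_cst (0 : R))) <-.
Qed.

Lemma mc_lin0 c h1 h2 G : lip h1 -> lip h2 -> lip_tuple G ->
 T (tcons (fun x => c * h1 x + h2 x) G) = c * T (tcons h1 G) + T (tcons h2 G).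
Proof.
move=> l1 l2 lG; have lF : lip_tuple (tcons h1 G) by exact: lip_cons.
by rewrite -(tcons_upd0 h1) (mc_mlin c lF l1 l2) !tcons_upd0.
Qed.

Lemma mc_linS c h f1 f2 G i : lip h -> lip f1 -> lip f2 -> lip_tuple G ->
 T (tcons h (upd G i (fun x => c * f1 x + f2 x))) =
 c * T (tcons h (upd G i f1)) + T (tcons h (upd G i f2)).
Proof.
move=> lh l1 l2 lG; have lF : lip_tuple (tcons h G) by exact: lip_cons.
by rewrite !tcons_upd (mc_mlin c lF l1 l2).
Qed.

Lemma mc_sum0 (J : Type) (s : seq J) (c : J -> R) (f : J -> V) G :
 (forall k, lip (f k)) -> lip_tuple G ->
 T (tcons (fun x => \sum_(k <- s) c k * f k x) G) = \sum_(k <- s) c k * T (tcons (f k) G).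
Proof.
move=> lf lG; have lF : lip_tuple (tcons (fun=> 0) G) by apply: lip_cons => //; exact: lip_cst.
rewrite -(tcons_upd0 (fun=> 0)).
have [_ ->] := @mlin_sum _ _ _ _ _ _ ord0 _ s c f lip_lin mc_mlin lF (lip_cst 0) lf.
by apply: eq_bigr => k _; rewrite tcons_upd0.
Qed.

Lemma mc_sumS (J : Type) (s : seq J) (c : J -> R) (f : J -> V) h G i :
 (forall k, lip (f k)) -> lip h -> lip_tuple G ->
 T (tcons h (upd G i (fun x => \sum_(k <- s) c k * f k x))) =
 \sum_(k <- s) c k * T (tcons h (upd G i (f k))).
Proof.
move=> lf lh lG; have lF : lip_tuple (tcons h G) by exact: lip_cons.
rewrite tcons_upd.
have [_ ->] := @mlin_sum _ _ _ _ _ _ (sc i) _ s c f lip_lin mc_mlin lF (lip_cst 0) lf.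
by apply: eq_bigr => k _; rewrite tcons_upd.
Qed.

Lemma mc_zero0 G : lip_tuple G -> T (tcons (fun=> 0) G) = 0.
Proof.
move=> lG; have lF : lip_tuple (tcons (fun=> 0) G) by apply: lip_cons => //; exact: lip_cst.
rewrite -(tcons_upd0 (fun=> 0)); exact: (mlin0 mc_mlin lF (lip_cst 0)).
Qed.

Lemma mc_zeroS h G i : lip h -> lip_tuple G -> T (tcons h (upd G i (fun=> 0))) = 0.
Proof.
move=> lh lG; have lF : lip_tuple (tcons h G) by exact: lip_cons.
rewrite tcons_upd; exact: (mlin0 mc_mlin lF (lip_cst 0)).
Qed.

Lemma mc_local h G i (c d : R) : lip h -> lip_tuple G -> 0 < d ->
 (forall x y, h x != 0 -> `|y - x| < d -> G i y = c) -> T (tcons h G) = 0.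
Proof.
move=> lh lG d0 hc; apply: (hc_local hT); first exact: lip_cons.
exists i, [set y | exists x, h x != 0 /\ `|y - x| < d], c; split.
- apply/open_rVP => y [x [hx yx]]; exists (d - `|y - x|); first by rewrite subr_gt0.
 move=> z hz; exists x; split => //; have := ler_normD (z - y) (y - x); rewrite addrA subrK.
 by move=> h1; apply: (le_lt_trans h1); rewrite -ltrBrDr distrC.
- move=> y; rewrite tcons0 /fun_spt => /closure_rVP /(_ _ d0)[x hx xy].
 by exists x; split => //; rewrite ?(distrC y).
- by move=> y [x [hx xy]]; rewrite tconsS; exact: hc hx xy.
Qed.

Lemma mc_local_eq h G i f g (d : R) : lip h -> lip_tuple G -> lip f -> lip g -> 0 < d ->
 (forall x y, h x != 0 -> `|y - x| < d -> f y = g y) ->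
 T (tcons h (upd G i f)) = T (tcons h (upd G i g)).
Proof.
move=> lh lG lf lg d0 e; apply/eqP; rewrite -subr_eq0; apply/eqP.
have := mc_linS (-1) i lh lg lf lG; rewrite mulN1r addrC => <-.
have l1 : lip (fun x => -1 * g x + f x) by exact: lip_lin.
apply: (@mc_local _ _ i 0 d) => //; first exact: lip_upd.
by move=> x y hx xy; rewrite updE mulN1r (e x y hx xy) addNr.
Qed.

(** For the first function this is the compactness axiom. In another slot the first function is
    multiplied by a cutoff, and locality applies to the difference of the tuples, which vanishes
    near the support of the product; the margins add up to r + 3. *)
Lemma mc_ball : exists r, 0 <= r /\ forall F F', lip_tuple F -> lip_tuple F' ->
 (forall i x, `|x| <= r -> F i x = F' i x) -> T F = T F'.
Proof.
have [K [cK hK]] := hc_compact hT; have [r r0 hr] := compact_rV cK.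
have B1 f G : lip f -> lip_tuple G -> (forall x, `|x| <= r + 1 -> f x = 0) -> T (tcons f G) = 0.
 move=> lf lG hf; apply: hK; first exact: lip_cons. rewrite tcons0; apply/seteqP; split => x //= [+ /hr /= xr].
 move=> /closure_rVP /(_ 1 ltr01)[y fy xy]; move/eqP: fy; apply; apply: hf.
 have := ler_normD (y - x) x; rewrite subrK => /le_trans; apply. by rewrite addrC lerD// ltW// distrC.
exists (r + 3); split; first by rewrite addr_ge0// ltW.
move=> F F' lF lF' e; apply/eqP; rewrite -subr_eq0; apply/eqP.
rewrite (mlin_telescope mc_mlin lF lF') big1// => i _; set H := hyb _ _ _.
have lH : lip_tuple H by move=> j; rewrite /H /hyb; case: ifP.
have lw : lip (fun x => F i x - F' i x) by exact: lip_sub.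
rewrite -(tconsE H); case: (unliftP ord0 i) => [j ij|i0].
 rewrite ij -tcons_upd -ij; set w := fun x => F i x - F' i x. have l1 : lip (fun x => H ord0 x * cutoff (r + 1) x).
  by apply/lipb_lipbd/bd_lip || apply: lipb_lip; have /lipP[L _ hL] := lH ord0; exact: lipb_cut hL.
 have lG : lip_tuple (upd (tl H) j w) by apply: lip_upd => //; exact: lip_tl.
 have l2 : lip (fun x => H ord0 x - H ord0 x * cutoff (r + 1) x) by exact: lip_sub.
 have -> : H ord0 = fun x => 1 * (H ord0 x * cutoff (r + 1) x) + (H ord0 x - H ord0 x * cutoff (r + 1) x).
  by apply/funext => x; rewrite mul1r addrC subrK.
 rewrite mc_lin0// (B1 (fun x => _ - _))//; last first.
  by move=> x xr; rewrite cutoff1// mulr1 subrr.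
 rewrite addr0 mul1r; apply: (@mc_local _ _ j 0 1) => // x y hx xy. rewrite updE /w e ?subrr//.
 have xr : `|x| <= r + 2.
  rewrite leNgt; apply/negP => h; move: hx; rewrite cutoff0 ?mulr0 ?eqxx//. by rewrite -addrA ltW.
 have := ler_normD (y - x) x; rewrite subrK; lra.
rewrite i0 tcons_upd0; apply: B1 => //; first by rewrite -i0.
 exact: lip_tl.
by move=> x xr; rewrite e ?subrr// (le_trans xr)// lerD2l (ler_nat _ 1 3).
Qed.

(* Truncating all the functions outside a large ball does not change T, so that
  they may be assumed to be bounded. *)
Lemma mc_bounded : exists r, 0 <= r /\ forall F, lip_tuple F ->
 T F = T (fun i x => F i x * cutoff r x).
Proof.
have [r [r0 hr]] := mc_ball; exists r; split => // F lF; apply: hr => //.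
 move=> i; apply: lipb_lip; have /lipP[L _ hL] := lF i; exact: lipb_cut hL.
by move=> i x xr; rewrite cutoff1// mulr1.
Qed.

Lemma mc_stair_split h G (N : nat) (phi : 'I_N -> V) : lipbd h -> lip_tuple G ->
 (forall q, lipbd (phi q)) -> (forall x, \sum_q phi q x = 1) ->
 T (tcons h G) = \sum_q T (tcons (fun x => phi q x * h x) G).
Proof.
move=> bh lG bphi s1.
have -> : h = fun x => \sum_(q <- index_enum 'I_N) 1 * (phi q x * h x).
 by apply/funext => x; under eq_bigr do rewrite mul1r; rewrite -mulr_suml s1 mul1r.
rewrite mc_sum0//; last by move=> q; apply: bd_lip; exact: lipbdM.
apply: eq_bigr => q _; rewrite mul1r; congr (T (tcons _ _)).
by apply/funext => x; congr (_ * _); under eq_bigr do rewrite mul1r; rewrite -mulr_suml s1 mul1r.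
Qed.

(** The two copies of the function are replaced by the two staircases. On each piece of the
    partition one of them is locally constant, so every term is 0 by locality, and continuity passes
    to the limit. *)
Lemma mc_alt F i1 i2 : lip_tuple F -> i1 != i2 -> F (sc i1) = F (sc i2) -> T F = 0.
Proof.
move=> lF i12; have [r [_ ->]] := mc_bounded => // e.
pose g x := F (sc i1) x * cutoff r x.
pose h x := F ord0 x * cutoff r x.
pose G i x := F (sc i) x * cutoff r x.
have bF i : lipbd (fun x => F i x * cutoff r x).
 by apply: lipb_lipbd; have /lipP[L _ hL] := lF i; exact: lipb_cut hL.
have lG : lip_tuple G by move=> i; apply: bd_lip; exact: bF.
rewrite (_ : (fun i x => _) = tcons h (upd (upd G i1 g) i2 g)); last first.
 apply/funext => i; case: (unliftP ord0 i) => [j ->|->]; last by rewrite tcons0.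
 rewrite tconsS /tuple_upd; case: eqP => [->|_]; first by rewrite /g e. by case: eqP => [->|].
have [|A [a [b [_ hab ca cb _]]]] := @stair_seq _ _ g (fun a b => T (tcons h (upd (upd G i1 a) i2 b)) = 0) (bF _).
 move=> N phi a b bphi s1 /bd_lip la /bd_lip lb hq.
 have lU : lip_tuple (upd (upd G i1 a) i2 b) by do 2 apply: lip_upd => //.
 rewrite (mc_stair_split (bF ord0) lU bphi s1) big1// => q _.
 have lq : lip (fun x => phi q x * (F ord0 x * cutoff r x)) by apply: bd_lip; exact: lipbdM.
 have [[c [d [d0 hcd]]]|[c [d [d0 hcd]]]] := hq q.
  apply: (@mc_local _ _ i1 c d) => // x y; rewrite mulf_eq0 negb_or => /andP[hx _] xy.
  rewrite updN// updE; exact: hcd hx xy.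
 apply: (@mc_local _ _ i2 c d) => // x y; rewrite mulf_eq0 negb_or => /andP[hx _] xy. rewrite updE; exact: hcd hx xy.
apply: mc_lcvg0 hab; apply: lcvg_cons; first exact/lcvg_cst/bd_lip/bF.
do 2 apply: lcvg_upd => //; move=> j; exact: lcvg_cst.
Qed.

(** The square is approximated by the product of the two staircases. On each piece one factor is a
    constant, which linearity takes out of the slot and puts into the first function, while the term
    with that factor in the slot is 0. *)
Lemma mc_sq h g G i : lipbd h -> lipbd g -> lip_tuple G ->
 T (tcons h (upd G i (fun x => g x * g x))) =
 2 * T (tcons (fun x => g x * h x) (upd G i g)).
Proof.
move=> bh bg lG; have [Lh [B [_ B0 _ hB]]] := bh; have lh := bd_lip bh.
have [|A [a [b [A0 hab ca cb abA]]]] := @stair_seq _ _ g (fun a b => T (tcons h (upd G i (fun x => a x * b x))) =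
  T (tcons (fun x => a x * h x) (upd G i b)) +
  T (tcons (fun x => b x * h x) (upd G i a))) bg.
 move=> N phi a b bphi s1 ba bb hq. have la := bd_lip ba; have lb := bd_lip bb; have lab := bd_lip (lipbdM ba bb).
 have lba := bd_lip (lipbdM bb ba). have key w w' q : lipbd w -> lipbd w' -> cst_near (phi q) w ->
   T (tcons (fun x => phi q x * h x) (upd G i (fun x => w x * w' x))) =
   T (tcons (fun x => phi q x * (w x * h x)) (upd G i w')) +
   T (tcons (fun x => phi q x * (w' x * h x)) (upd G i w)).
  move=> bw bw' [c [d [d0 hcd]]]. have lw := bd_lip bw; have lw' := bd_lip bw'.
  have lq : lip (fun x => phi q x * h x) by apply: bd_lip; exact: lipbdM.
  have lcw : lip (fun x => c * w' x + 0) by apply: lip_lin => //; exact: lip_cst.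
  have nz x k' : phi q x * k' != 0 -> phi q x != 0 by rewrite mulf_eq0 negb_or => /andP[].
  rewrite (@mc_local_eq _ G i _ (fun x => c * w' x + 0) d)//; first last.
  - by move=> x y /nz hx xy; rewrite (hcd x y hx xy) addr0.
  - apply: bd_lip; exact: lipbdM.
  rewrite mc_linS//; last exact: lip_cst.
  rewrite mc_zeroS// addr0 [X in _ = _ + X](@mc_local _ _ i c d)//; first last.
  - move=> x y /nz hx xy; rewrite updE; exact: hcd hx xy.
  - exact: lip_upd.
  - by apply: bd_lip; do 2 apply: lipbdM => //.
  rewrite addr0. have := @mc_lin0 c (fun x => phi q x * h x) (fun=> 0) (upd G i w') lq (lip_cst 0) (lip_upd i lG lw').
  rewrite mc_zero0 ?addr0; last exact: lip_upd. move=> <-; congr (T (tcons _ _)); apply/funext => x; rewrite addr0.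
  have [->|hx] := eqVneq (phi q x) 0; first by rewrite !mul0r mulr0. by rewrite (hcd x x hx) ?subrr ?normr0//; ring.
 have lU w : lip w -> lip_tuple (upd G i w) by move=> lw; exact: lip_upd.
 rewrite !(mc_stair_split _ _ bphi s1)//; try (by apply: lU); try (by apply: lipbdM).
 rewrite -big_split /=; apply: eq_bigr => q _. have [ha|hb] := hq q; first exact: key.
 rewrite [RHS]addrC -(key b a)//; congr (T (tcons _ (upd _ _ _))). by apply/funext => x; rewrite mulrC.
have lcG (f : nat -> V) : lcvg f g -> forall j, lcvg (fun k => upd G i (f k) j) (upd G i g j).
 move=> cf; apply: (@lcvg_upd _ _ _ _ _ (fun=> G)) => // j; exact: lcvg_cst.
have AB0 : 0 <= A + B by rewrite addr_ge0.
have A1 (t : R) : `|t| <= A -> `|t| <= A + B by move=> h1; rewrite (le_trans h1)// lerDl.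
have B1 x : `|h x| <= A + B by rewrite (le_trans (hB x))// lerDr.
have mh (f : nat -> V) : lcvg f g -> (forall k x, `|f k x| <= A) -> lcvg (fun k x => f k x * h x) (fun x => g x * h x).
 move=> cf fA; apply: (@lcvgM _ _ _ _ (fun=> h) _ (A + B)) => // [|k x|x]; [exact: lcvg_cst|exact/A1|].
 by apply: A1; case: (abA 0%N x).
have t1 : T (tcons h (upd G i (fun x => a k x * b k x))) @[k --> \oo] -->
  T (tcons h (upd G i (fun x => g x * g x))).
 apply: mc_lcvg; apply: (@lcvg_cons _ _ _ (fun=> h)); first exact: lcvg_cst.
 apply: (@lcvg_upd _ _ _ _ _ (fun=> G)) => [|j]; last exact: lcvg_cst.
 by apply: (lcvgM ca cb A0) => [k x|x|k x|x]; [case: (abA k x)|case: (abA 0%N x)|case: (abA k x)|case: (abA 0%N x)].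
have t2 := mc_lcvg (lcvg_cons (mh _ ca (fun k x => let: And3 h _ _ := abA k x in h)) (lcG _ cb)).
have t3 := mc_lcvg (lcvg_cons (mh _ cb (fun k x => let: And3 _ h _ := abA k x in h)) (lcG _ ca)).
move: t1; under eq_fun do rewrite hab.
by move/(cvg_unique _ (cvgD t2 t3)) => <-//; rewrite mulr_natl mulr2n.
Qed.

(** Polarisation of [mc_sq] with f + g. *)
Lemma mc_prod h f g G i : lipbd h -> lipbd f -> lipbd g -> lip_tuple G ->
 T (tcons h (upd G i (fun x => f x * g x))) =
 T (tcons (fun x => f x * h x) (upd G i g)) +
 T (tcons (fun x => g x * h x) (upd G i f)).
Proof.
move=> bh bf bg lG.
have lf := bd_lip bf; have lg := bd_lip bg; have lh := bd_lip bh.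
have bs : lipbd (fun x => 1 * f x + g x) by apply: lipbdD => //; apply: lipbdM => //; exact: lipbd_cst.
have s1 := mc_sq i bh bs lG; have s2 := mc_sq i bh bf lG; have s3 := mc_sq i bh bg lG.
have lff := bd_lip (lipbdM bf bf); have lgg := bd_lip (lipbdM bg bg); have lfg := bd_lip (lipbdM bf bg).
have lfh := bd_lip (lipbdM bf bh); have lgh := bd_lip (lipbdM bg bh).
have lU w : lip w -> lip_tuple (upd G i w) by move=> lw; exact: lip_upd.
move: s1.
rewrite (_ : (fun x => _ * _) = fun x => 2 * (f x * g x) + (fun x => 1 * (f x * f x) + g x * g x) x); last first.
 by apply/funext => x; ring.
have l1 : lip (fun x => 1 * (f x * f x) + g x * g x) by exact: lip_lin.
rewrite mc_linS// (mc_linS 1)// s2 s3.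
rewrite (_ : (fun x => (1 * f x + g x) * h x) = fun x => 1 * (f x * h x) + g x * h x); last first.
 by apply/funext => x; ring.
have ls : lip (fun x => 1 * f x + g x) by exact: lip_lin.
rewrite mc_lin0//; last exact: lU.
rewrite !mc_linS//; lra.
Qed.

End current.

(** * Reduction of a slot to the coordinate functions *)

Section slot.
Context {R n} {m : nat}.
Local Notation V := ('rV[R]_n -> R).
Implicit Types (f g h : V) (G : 'I_m -> V) (F : 'I_m.+1 -> V).
Definition cprj (l : 'I_n) : V := fun x => x ord0 l.

Lemma lip_cprj l : lip (cprj l).
Proof. by apply/lipP; exists 1 => //; exact: lipc_coord. Qed.

Lemma upd_comm G i j a b : i != j ->
 upd (upd G i a) j b = upd (upd G j b) i a.
Proof.
move=> ij; apply/funext => k; rewrite /tuple_upd; case: eqP => [->|//]; case: eqP => // ji.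
by move: ij; rewrite ji eqxx.
Qed.

Variable T : functional R n m.
Hypothesis hT : metric_current T.

Lemma mc_const h G i c : lip h -> lip_tuple G -> T (tcons h (upd G i (fun=> c))) = 0.
Proof.
move=> lh lG; apply: (@mc_local _ _ _ _ hT _ _ i c 1) => //.
 apply: lip_upd => //; exact: lip_cst.
by move=> x y _ _; rewrite updE.
Qed.

(** Expansion of [mc_alt] with the sum of the two functions in both slots. *)
Lemma mc_swap f G i j : lip f -> lip_tuple G -> i != j ->
 T (tcons f (G \o tperm i j)) = - T (tcons f G).
Proof.
move=> lf lG ij.
have lU k w : lip w -> lip_tuple (upd G k w) by move=> lw; exact: lip_upd.
pose H a b := upd (upd G i a) j b.
have lH a b : lip a -> lip b -> lip_tuple (H a b) by move=> la lb; do 2 apply: lip_upd => //.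
have alt a : lip a -> T (tcons f (H a a)) = 0.
 move=> la; apply: (mc_alt hT _ ij); first by apply: lip_cons => //; exact: lH.
 by rewrite !tconsS /H updE updN// updE.
pose a := G i; pose b := G j; pose s x := 1 * a x + b x.
have la : lip a by exact: lG. have lb : lip b by exact: lG.
have ls : lip s by exact: lip_lin.
have := alt s ls; rewrite /H (mc_linS hT 1)//; last exact: lU.
rewrite mul1r !(upd_comm G _ _ ij) !(mc_linS hT 1)//; try exact: lU.
rewrite !mul1r -!(upd_comm G _ _ ij) -!/(H _ _) !alt// add0r addr0.
have -> : H a b = G by apply/funext => k; rewrite /H /tuple_upd; case: eqP => [->//|_]; case: eqP => [->|].
have -> : H b a = G \o tperm i j.
 apply/funext => k; rewrite /H /tuple_upd /=; case: eqP => [->|kj]; first by rewrite tpermR.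
 by case: eqP => [->|ki]; [rewrite tpermL|rewrite tpermD//; apply/eqP => e; [apply: ki|apply: kj]].
by move/eqP; rewrite addr_eq0 => /eqP ->.
Qed.

Lemma lipbd_pp g : lipbd g -> lipbd (fun x => pp (g x)).
Proof.
move=> [L [A [L0 A0 gL gA]]]; exists (1 * L), A; split => //; first by rewrite mul1r.
 apply: (@lipc_comp1 _ _ pp) => //; exact: pp_lip.
move=> x; have h1 := pp_lip (g x) 0; rewrite mul1r subr0 (pp_pos (lexx 0)) subr0 in h1.
exact: le_trans h1 (gA x).
Qed.

(** Where [pp (g x)] is positive, the positive part and g agree. The first factor is replaced by
    [pp (g x - hk k)], which leaves a margin around its support on which g is still nonnegative;
    there locality applies to the difference. *)
Lemma mc_pp h g G i : lipbd h -> lipbd g -> lip_tuple G ->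
 T (tcons (fun x => pp (g x) * h x) (upd G i (fun x => pp (g x)))) =
 T (tcons (fun x => pp (g x) * h x) (upd G i g)).
Proof.
move=> bh bg lG; have [L [A [L0 A0 gL gA]]] := bg; have [Lh [Ah [Lh0 Ah0 hL hA]]] := bh.
have ppA c x : `|pp (g x - c)| <= A + `|c|.
 have h1 := pp_lip (g x - c) 0; rewrite mul1r subr0 (pp_pos (lexx 0)) subr0 in h1.
 by rewrite (le_trans h1)// le_normB// lerD2r.
have ppL c : lipc (1 * L) (fun x => pp (g x - c)).
 by apply: (@lipc_comp1 _ _ (fun t => pp (t - c))) => // s t; rewrite (le_trans (pp_lip _ _))// opprD addrACA opprK addNr addr0.
have bpp := lipbd_pp bg.
have lg := bd_lip bg; have lpp := bd_lip bpp; have lhp := bd_lip (lipbdM bpp bh).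
pose N x := -1 * g x + pp (g x).
have lN : lip N by exact: lip_lin.
suff e : T (tcons (fun x => pp (g x) * h x) (upd G i N)) = 0.
 by move: e; rewrite /N mc_linS// mulN1r addrC => /eqP; rewrite subr_eq0 => /eqP.
pose fk (k : nat) x := pp (g x - hk k) * h x.
have z k : T (tcons (fk k) (upd G i N)) = 0.
 have L1 : 0 < L + 1 by rewrite ltr_pwDr. apply: (@mc_local _ _ _ _ hT _ _ i 0 (hk k / (L + 1))).
 - apply: bd_lip; apply: lipbdM => //; exists (1 * L), (A + `|hk k|); split => //.
  + by rewrite mul1r.
  + by rewrite addr_ge0.
 - exact: lip_upd.
 - by rewrite divr_gt0// hk_gt0.
 move=> x y; rewrite mulf_eq0 negb_or => /andP[hx _]; rewrite ltr_pdivlMr// => hy.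
 have gx : hk k < g x by rewrite ltNge; apply/negP => h1; move: hx; rewrite pp_neg ?eqxx// subr_le0.
 have := gL y x; rewrite updE /N => h1.
 have h2 : `|g y - g x| < hk k by apply: le_lt_trans hy; rewrite (le_trans h1)// mulrC ler_wpM2l// lerDl.
 have gy : 0 <= g y by move: h2; rewrite ltr_norml => /andP[h3 _]; lra. by rewrite pp_pos// mulN1r addNr.
apply: (mc_lcvg0 hT) z; apply: (@lcvg_cons _ _ _ _ _ (fun=> upd G i N)) => [|j]; last exact/lcvg_cst/lip_upd.
have hk1 k : `|hk k| <= 1 by rewrite ger0_norm ?hk_le1// ltW// hk_gt0.
have bpp2 c : `|c| <= 1 -> lipc ((A + 1) * Lh + Ah * L) (fun x => pp (g x - c) * h x).
 move=> c1; apply: lipcM => //; first by rewrite addr_ge0.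
  by have := ppL c; rewrite mul1r.
 by move=> x; rewrite (le_trans (ppA c x))// lerD2l.
apply: (lcvg_le (L := (A + 1) * Lh + Ah * L) (c := Ah) _ _ _ _ (@hk_cvg R)) => [||k|k x].
- by rewrite addr_ge0// mulr_ge0// addr_ge0.
- by have := bpp2 0; rewrite normr0 ler01; under eq_fun do rewrite subr0; exact.
- apply: bpp2; exact: hk1.
- rewrite -mulrBl normrM mulrC ler_pM//.
 rewrite (le_trans (pp_lip _ _))// mul1r addrAC subrr add0r normrN ger0_norm//. by rewrite ltW// hk_gt0.
Qed.

(** Together with the cube below this is the chain rule for truncated powers; B-splines and their
    primitives are combinations of these ([bspE], [BspE]). *)
Lemma mc_pp_sq h g G i : lipbd h -> lipbd g -> lip_tuple G ->
 T (tcons h (upd G i (fun x => pp (g x) * pp (g x)))) =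
 2 * T (tcons (fun x => pp (g x) * h x) (upd G i g)).
Proof. by move=> bh bg lG; have bp := lipbd_pp bg; rewrite mc_sq// mc_pp. Qed.

Lemma mc_pp_cube h g G i : lipbd h -> lipbd g -> lip_tuple G ->
 T (tcons h (upd G i (fun x => pp (g x) * (pp (g x) * pp (g x))))) =
 3 * T (tcons (fun x => pp (g x) * (pp (g x) * h x)) (upd G i g)).
Proof.
move=> bh bg lG; have bp := lipbd_pp bg; have bph := lipbdM bp bh.
rewrite mc_prod//; last exact: lipbdM.
rewrite mc_pp_sq//.
rewrite (_ : (fun x => pp (g x) * pp (g x) * h x) = fun x => pp (g x) * (pp (g x) * h x)); last first.
 by apply/funext => x; rewrite mulrA.
by rewrite mc_pp//; ring.
Qed.

Lemma bspE (t : R) : bsp t = \sum_(k <- [:: (2^-1, 0); (- (3 / 2), 1); (3 / 2, 2); (- 2^-1, 3)])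
 k.1 * (pp (t - k.2) * pp (t - k.2)).
Proof.
rewrite !big_cons big_nil /= /bsp !thE /ramp2 subr0.
have -> : t - 1 - 1 = t - 2 by ring.
have -> : t - 2 - 1 = t - 3 by ring.
by field.
Qed.

Lemma bsp_crd_lip (r0 h c s t : R) : 0 < h ->
 `|bsp (crd r0 h s - c) - bsp (crd r0 h t - c)| <= 2 / h * `|s - t|.
Proof.
move=> h0; have := @sum_bsp_diff R 1 (crd r0 h s - c) (crd r0 h t - c).
rewrite big_ord1 !subr0 => /le_trans; apply.
have -> : crd r0 h s - c - (crd r0 h t - c) = h^-1 * (s - t) by rewrite /crd; ring.
by rewrite normrM gtr0_norm ?invr_gt0// mulrA.
Qed.

Lemma lipbd_bsp (r0 h c : R) g : 0 < h -> lip g -> lipbd (fun x => bsp (crd r0 h (g x) - c)).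
Proof.
move=> h0; apply: (@lipbd_comp _ _ (fun t => bsp (crd r0 h t - c)) (2 / h) 1).
- by rewrite divr_ge0 // ltW.
- move=> s t; exact: bsp_crd_lip.
- by move=> s; rewrite ger0_norm ?bsp_ge0// bsp_le1.
Qed.

Lemma mc_slot_ball G i : lip_tuple G -> exists r, forall f1 f2 g1 g2, lip f1 -> lip f2 -> lip g1 -> lip g2 ->
 (forall x, `|x| <= r -> f1 x = f2 x) -> (forall x, `|x| <= r -> g1 x = g2 x) ->
 T (tcons f1 (upd G i g1)) = T (tcons f2 (upd G i g2)).
Proof.
move=> lG; have [r [_ hr]] := mc_ball hT; exists r => f1 f2 g1 g2 l1 l2 l3 l4 e1 e2.
apply: hr; try (by apply: lip_cons => //; exact: lip_upd).
move=> j x xr; case: (unliftP ord0 j) => [k ->|->]; rewrite ?tcons0 ?e1// !tconsS /tuple_upd.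
case: eqP => // _; exact: e2.
Qed.

Lemma slot_bsp G i (r0 h c : R) l : 0 < h -> lip_tuple G ->
 (forall f, lip f -> T (tcons f (upd G i (cprj l))) = 0) ->
 forall f, lipbd f -> T (tcons f (upd G i (fun x => bsp (crd r0 h (cprj l x) - c)))) = 0.
Proof.
move=> h0 lG hz f bf; have [r hr] := mc_slot_ball i lG.
(* The product rule asks for bounded functions, so the coordinate is cut off outside the ball that T
   sees. *)
pose g x := cprj l x * cutoff r x.
have bg : lipbd g by apply: lipb_lipbd; apply: (lipb_cut (L := 1)); exact: lipc_coord.
have lg := bd_lip bg; have lf := bd_lip bf.
have gE x : `|x| <= r -> cprj l x = g x by move=> xr; rewrite /g cutoff1// mulr1.
have gz f' : lip f' -> T (tcons f' (upd G i g)) = 0.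
 by move=> lf'; rewrite -(hz f' lf'); apply: hr => //; [exact: lip_cprj|move=> x /gE].
have lU w : lip w -> lip_tuple (upd G i w) by exact: lip_upd.
rewrite (hr f f _ (fun x => bsp (crd r0 h (g x) - c)))//; first last.
- by move=> x xr; rewrite gE.
- exact/bd_lip/lipbd_bsp.
- apply/bd_lip/lipbd_bsp => //; exact: lip_cprj.
pose gc (e : R) x := h^-1 * g x + (fun=> r0 / h - c - e) x.
have gcE e x : crd r0 h (g x) - c - e = gc e x by rewrite /crd /gc; ring.
have bgc e : lipbd (gc e) by apply: lipbdD; [apply: lipbdM => //|]; exact: lipbd_cst.
have -> : (fun x => bsp (crd r0 h (g x) - c)) = fun x => \sum_(k <- [:: (2^-1, 0); (- (3 / 2), 1); (3 / 2, 2); (- 2^-1, 3)])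
 k.1 * (pp (gc k.2 x) * pp (gc k.2 x)). by apply/funext => x; rewrite bspE; apply: eq_bigr => k _; rewrite gcE.
rewrite (mc_sumS hT _ _ (f := fun k x => pp (gc k.2 x) * pp (gc k.2 x)))//; last first.
 move=> k; apply: bd_lip; apply: lipbdM; exact: lipbd_pp.
rewrite big1// => k _; rewrite mc_pp_sq// /gc.
have lpf : lip (fun x => pp (h^-1 * g x + (r0 / h - c - k.2)) * f x).
 apply: bd_lip; apply: lipbdM => //; exact: (lipbd_pp (bgc k.2)).
by rewrite mc_linS//; [rewrite gz// mc_const// !(mulr0, addr0)|exact: lip_cst].
Qed.

Lemma slot_om G i (r0 h : R) N (q : {ffun 'I_n -> 'I_N}) : 0 < h -> lip_tuple G ->
 (forall l f, lip f -> T (tcons f (upd G i (cprj l))) = 0) ->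
 forall f, lipbd f -> T (tcons f (upd G i (om r0 h q))) = 0.
Proof.
move=> h0 lG hz.
have [_] : lipbd (om r0 h q) /\ forall f, lipbd f -> T (tcons f (upd G i (om r0 h q))) = 0; last exact.
rewrite /om /tensor; elim: (index_enum _) => [|l s [IH1 IH2]].
 rewrite (_ : (fun x => _) = fun=> 1); last by apply/funext => x; rewrite big_nil.
 by split; [exact: lipbd_cst|move=> f bf; rewrite mc_const//; exact: bd_lip].
rewrite (_ : (fun x => _) = fun x => bsp (crd r0 h (cprj l x) - (q l)%:R) * \prod_(i <- s) bsp (crd r0 h (x ord0 i) - (q i)%:R)); last first.
 by apply/funext => x; rewrite big_cons.
have bb := lipbd_bsp r0 (q l)%:R h0 (lip_cprj l).
split; first exact: lipbdM.
move=> f bf; rewrite mc_prod// IH2 ?add0r; last exact: lipbdM.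
by apply: slot_bsp => //; [exact: hz|exact: lipbdM].
Qed.

(** The chain rule passes from coordinates to splines of one coordinate, the product rule to product
    splines, linearity to interpolations, and continuity to all Lipschitz functions. *)
Lemma slot_lip G i : lip_tuple G ->
 (forall l f, lip f -> T (tcons f (upd G i (cprj l))) = 0) ->
 forall f g, lip f -> lip g -> T (tcons f (upd G i g)) = 0.
Proof.
move=> lG hz f0 g0 lf0 lg0; have [r hr] := mc_slot_ball i lG.
pose f x := f0 x * cutoff r x; pose g x := g0 x * cutoff r x.
have bf : lipb f by have /lipP[L _ hL] := lf0; exact: lipb_cut hL.
have bg : lipb g by have /lipP[L _ hL] := lg0; exact: lipb_cut hL.
have lf := lipb_lip (bf); have lg := lipb_lip (bg).
rewrite (hr f0 f g0 g)//; try (by move=> x xr; rewrite /f /g cutoff1// mulr1).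
have [L [s [L0 gL gs]]] := bg.
pose fk k := Ih s (hk k) g.
have z k : T (tcons f (upd G i (fk k))) = 0.
 rewrite /fk /Ih /spl (mc_sumS hT _ _ (f := fun q => om (s + 6) (hk k) q))//; last first.
  by move=> q; apply/lipb_lip/om_lipb/hk_gt0.
 rewrite big1// => q _; rewrite slot_om ?mulr0//; first exact: hk_gt0. exact: lipb_lipbd.
apply: (mc_lcvg0 hT) z; apply: (@lcvg_cons _ _ _ (fun=> f)); first exact: lcvg_cst.
apply: (@lcvg_upd _ _ _ _ _ (fun=> G)) => [|j]; last exact: lcvg_cst.
have C0 : 0 <= (8 * n%:R + 7) * L by rewrite mulr_ge0.
apply: (lcvg_le (L := (8 * n%:R + 7) * L + L) (c := L * 3) _ _ _ _ (@hk_cvg R)) => [||k|k x].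
- by rewrite addr_ge0.
- by apply: lipcW gL; rewrite lerDr.
- have := Ih_lip (hk_gt0 k) (hk_le1 k) gs ltr01 (lexx 1) L0 ((lipc_hol L g).1 gL).
 by rewrite subrr powRr0 mulr1; apply: lipcW; rewrite lerDl.
- have := Ih_close (hk_gt0 k) (hk_le1 k) gs ltr01 (lexx 1) L0 ((lipc_hol L g).1 gL) x.
 by rewrite powRr1 ?mulrA// ltW// hk_gt0.
Qed.

End slot.

(** * Currents of top dimension are determined by their values on coordinates *)

Section uniqueness.
Context {R n}.
Local Notation V := ('rV[R]_n -> R).
Lemma mc_coords_repeat m (T : functional R n m) (l : 'I_m -> 'I_n) f : metric_current T ->
 ~ injective l -> lip f -> T (tcons f (cprj \o l)) = 0.
Proof.
move=> hT ninj lf; have [i1 [i2 [e i12]]] : exists i1 i2, l i1 = l i2 /\ i1 != i2.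
 apply/not_existsP => h; apply: ninj => i1 i2 e; apply/eqP/negPn/negP => i12. by apply: (h i1); exists i2.
apply: (mc_alt hT _ i12); last by rewrite !tconsS /= e.
apply: lip_cons => // k; exact: lip_cprj.
Qed.

(** Induction on the number of slots that need not hold coordinates, with [slot_lip] for the last of
    these. *)
Lemma mc_coords_all m (T : functional R n m) : metric_current T ->
 (forall (l : 'I_m -> 'I_n) f, lip f -> T (tcons f (cprj \o l)) = 0) ->
 forall F, lip_tuple F -> T F = 0.
Proof.
move=> hT all0.
suff S k : (k <= m)%N -> forall f (G : 'I_m -> V), lip f -> lip_tuple G ->
  (forall i : 'I_m, (k <= i)%N -> exists l, G i = cprj l) -> T (tcons f G) = 0.
 move=> F lF; rewrite -(tconsE F); apply: (S m) => //; first exact: lip_tl. by move=> i; rewrite leqNgt ltn_ord.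
elim: k => [|k IH] km f G lf lG hG.
 have /choice[l hl] := fun i => hG i isT. by rewrite (_ : G = cprj \o l); [exact: all0|apply/funext].
pose i := Ordinal km; rewrite -(upd_id G i).
apply: slot_lip => // l g lg; apply: IH => //; first exact: ltnW.
 apply: lip_upd => //; exact: lip_cprj.
move=> j kj; rewrite /tuple_upd; case: eqP => [_|/eqP ji]; first by exists l.
apply: hG; rewrite ltn_neqAle kj andbT; apply: contra ji => /eqP kE.
by apply/eqP/val_inj.
Qed.

(** Among n + 1 coordinate functions one is repeated. This removes the summands S_k of a fractal
    current of dimension n. *)
Lemma mc_top_zero (T : functional R n n.+1) : metric_current T ->
 forall F, lip_tuple F -> T F = 0.
Proof.
move=> hT; apply: mc_coords_all => // l f lf; apply: mc_coords_repeat => // inj.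
by have := leq_card l inj; rewrite !card_ord ltnn.
Qed.

(** A choice of coordinates for the slots either repeats one of them or is a permutation, that is a
    product of transpositions, each of which changes the sign. *)
Lemma mc_coords_zero (T : functional R n n) : metric_current T ->
 (forall f, lip f -> T (tcons f cprj) = 0) ->
 forall F, lip_tuple F -> T F = 0.
Proof.
move=> hT h0.
have perm0 (s : 'S_n) f : lip f -> T (tcons f (cprj \o s)) = 0.
 move=> lf; have [ts -> dts] := prod_tpermP s. elim: ts dts => [|[i j] ts IH] /=.
  move=> _; rewrite big_nil (_ : cprj \o _ = cprj) ?h0//. by apply/funext => k /=; rewrite perm1.
 move=> /andP[ij /IH e]; rewrite big_cons /=.
 rewrite (_ : cprj \o _ = (cprj \o (\prod_(t <- ts) tperm t.1 t.2)%g) \o tperm i j).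
  rewrite mc_swap// ?e ?oppr0//; move=> k; exact: lip_cprj.
 by apply/funext => k /=; rewrite permM.
apply: mc_coords_all => // l f lf; have [inj|ninj] := pselect (injective l).
 rewrite (_ : cprj \o l = cprj \o perm inj); first exact: perm0. by apply/funext => k /=; rewrite permE.
exact: mc_coords_repeat.
Qed.

Lemma hc_comb m (a : 'I_m.+1 -> R) c (T T' : functional R n m) : (forall i, 0 < a i) ->
 holder_current a T -> holder_current a T' -> holder_current a (fun F => c * T F + T' F).
Proof.
move=> a0 [h1 h2 h3 h4] [k1 k2 k3 k4]; split.
- move=> F i b f g hF hf hg; rewrite h1// k1//; ring.
- by move=> F hF h; rewrite h2// k2// mulr0 addr0.
- have [K [cK hK]] := h3; have [K' [cK' hK']] := k3; exists (K `|` K').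
 split; first exact: compactU. move=> F hF e; rewrite hK ?hK' ?mulr0 ?addr0//; apply/seteqP; split => x //= [p1 p2].
  by have : set0 x by rewrite -e; split => //; right.
 by have : set0 x by rewrite -e; split => //; left.
- move=> Fk F hFk hF hu hL; apply: cvgD; last exact: k4.
 by apply: cvgM; [exact: cvg_cst|exact: h4].
Qed.

Lemma mc_unique (T T' : functional R n n) : metric_current T -> metric_current T' ->
 (forall f, lip f -> T (tcons f cprj) = T' (tcons f cprj)) ->
 forall F, lip_tuple F -> T F = T' F.
Proof.
move=> hT hT' e F lF; have h := @hc_comb _ (fun=> 1) (-1) T' T (fun=> ltr01) hT' hT.
have := mc_coords_zero h _ lF; rewrite mulN1r addrC => h0.
apply/eqP; rewrite -subr_eq0; apply/eqP; apply: h0 => f lf.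
by rewrite mulN1r e// addNr.
Qed.

End uniqueness.

(** * Chain rule for primitives of splines *)

Section chain.
Context {R n} {m : nat}.
Local Notation V := ('rV[R]_n -> R).
Implicit Types (f g h : V) (G : 'I_m -> V) (F : 'I_m.+1 -> V).
Variable T : functional R n m.
Hypothesis hT : metric_current T.

Lemma BspE (t : R) : Bsp t = \sum_(k <- [:: (6^-1, 0); (- 2^-1, 1); (2^-1, 2); (- 6^-1, 3)])
 k.1 * (pp (t - k.2) * (pp (t - k.2) * pp (t - k.2))).
Proof.
rewrite !big_cons big_nil /= /Bsp /th3 subr0.
have -> : t - 1 - 1 = t - 2 by ring.
have -> : t - 1 - 2 = t - 3 by ring.
by field.
Qed.

Lemma Bsp_crd_lip (r0 h c s t : R) : 0 < h ->
 `|Bsp (crd r0 h s - c) - Bsp (crd r0 h t - c)| <= h^-1 * `|s - t|.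
Proof.
move=> h0; have := @sum_Bsp_diff R 1 (crd r0 h s - c) (crd r0 h t - c).
rewrite big_ord1 !subr0 => /le_trans; apply.
have -> : crd r0 h s - c - (crd r0 h t - c) = h^-1 * (s - t) by rewrite /crd; ring.
by rewrite normrM gtr0_norm ?invr_gt0.
Qed.

Lemma Bsp_ge0 (t : R) : 0 <= Bsp t.
Proof. by have [t0|/ltW t0] := leP t 0; [rewrite Bsp_0|rewrite -(Bsp_0 (lexx 0)) Bsp_mono]. Qed.

Lemma Bsp_le1 (t : R) : Bsp t <= 1.
Proof. by have [t0|/ltW t0] := leP 3 t; [rewrite Bsp_1|rewrite -(Bsp_1 (lexx 3)) Bsp_mono]. Qed.

Lemma lipbd_Bsp (r0 h c : R) g : 0 < h -> lip g -> lipbd (fun x => Bsp (crd r0 h (g x) - c)).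
Proof.
move=> h0; apply: (@lipbd_comp _ _ (fun t => Bsp (crd r0 h t - c)) h^-1 1).
- by rewrite invr_ge0 ltW.
- move=> s t; exact: Bsp_crd_lip.
- by move=> s; rewrite ger0_norm ?Bsp_ge0// Bsp_le1.
Qed.

(** The chain rule for [Bsp], whose derivative is [bsp]: the truncated cubes of [BspE] give 3 times
    the truncated squares of [bspE]. *)
Lemma slot_Bsp G i (r0 h c : R) l : 0 < h -> lip_tuple G -> forall f, lipbd f ->
 T (tcons f (upd G i (fun x => Bsp (crd r0 h (cprj l x) - c)))) =
 h^-1 * T (tcons (fun x => bsp (crd r0 h (cprj l x) - c) * f x) (upd G i (cprj l))).
Proof.
move=> h0 lG f bf; have [r hball] := mc_slot_ball hT i lG.
pose g x := cprj l x * cutoff r x.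
have bg : lipbd g by apply: lipb_lipbd; apply: (lipb_cut (L := 1)); exact: lipc_coord.
have lg := bd_lip bg; have lf := bd_lip bf.
have lU w : lip w -> lip_tuple (upd G i w) by exact: lip_upd.
have gE x : `|x| <= r -> cprj l x = g x by move=> xr; rewrite /g cutoff1// mulr1.
have bb w : lip w -> lipbd (fun x => bsp (crd r0 h (w x) - c)) by exact: lipbd_bsp.
have lc := @lip_cprj R n l.
rewrite (hball f f _ (fun x => Bsp (crd r0 h (g x) - c)))//; first last.
- by move=> x xr; rewrite gE.
- apply: bd_lip; exact: lipbd_Bsp.
- apply: bd_lip; exact: lipbd_Bsp.
rewrite (hball (fun x => bsp (crd r0 h (cprj l x) - c) * f x) (fun x => bsp (crd r0 h (g x) - c) * f x) _ g)//; first last.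
- by move=> x xr; rewrite gE.
- apply: bd_lip; apply: lipbdM => //; exact: bb.
- apply: bd_lip; apply: lipbdM => //; exact: bb.
pose gc (e : R) x := h^-1 * g x + (fun=> r0 / h - c - e) x.
have gcE e x : crd r0 h (g x) - c - e = gc e x by rewrite /crd /gc; ring.
have bgc e : lipbd (gc e) by apply: lipbdD; [apply: lipbdM => //|]; exact: lipbd_cst.
have bp e := lipbd_pp (bgc e).
have -> : (fun x => Bsp (crd r0 h (g x) - c)) = fun x => \sum_(k <- [:: (6^-1, 0); (- 2^-1, 1); (2^-1, 2); (- 6^-1, 3)])
 k.1 * (pp (gc k.2 x) * (pp (gc k.2 x) * pp (gc k.2 x))).
 by apply/funext => x; rewrite BspE; apply: eq_bigr => k _; rewrite gcE.
rewrite (mc_sumS hT _ _ (f := fun k x => pp (gc k.2 x) * (pp (gc k.2 x) * pp (gc k.2 x))))//; last first.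
 by move=> k; apply: bd_lip; do 2 apply: lipbdM => //.
have -> : (fun x => bsp (crd r0 h (g x) - c) * f x) = fun x => \sum_(k <- [:: (6^-1, 0); (- 2^-1, 1); (2^-1, 2); (- 6^-1, 3)])
  (3 * k.1) * (pp (gc k.2 x) * (pp (gc k.2 x) * f x)).
 by apply/funext => x; rewrite bspE !big_cons !big_nil /= !gcE; field.
rewrite (mc_sum0 hT _ _ (f := fun k x => pp (gc k.2 x) * (pp (gc k.2 x) * f x))); last first.
- exact: lU.
- by move=> k; apply: bd_lip; do 2 apply: lipbdM => //.
rewrite mulr_sumr; apply: eq_bigr => k _; rewrite mc_pp_cube// /gc.
have lpf : lip (fun x => pp (h^-1 * g x + (r0 / h - c - k.2)) * (pp (h^-1 * g x + (r0 / h - c - k.2)) * f x)).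
 exact: (bd_lip (lipbdM (bp k.2) (lipbdM (bp k.2) bf))).
by rewrite mc_linS//; [rewrite mc_const// addr0; ring|exact: lip_cst].
Qed.

End chain.

(** * Densities in divergence form *)

Section product.
Context {R n}.
Local Notation V := ('rV[R]_n -> R).
Variable T : functional R n n.
Hypothesis hT : metric_current T.
Variables (r0 : R) (cc hh kk : 'I_n -> R).
Hypothesis hh0 : forall l, 0 < hh l.

Definition fct l : V := fun x => cc l * bsp (crd r0 (hh l) (cprj l x) - kk l).

Lemma lipbd_fct l : lipbd (fct l).
Proof. by apply: lipbdM; [exact: lipbd_cst|apply: lipbd_bsp => //; exact: lip_cprj]. Qed.

Lemma lip_coords : lip_tuple (@cprj R n). Proof. by move=> l; exact: lip_cprj. Qed.

(** A function of another coordinate x_l in the slot m brings in x_l, which already stands in slot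
    l, so alternation gives 0. *)
Lemma slot_fct_zero (m : 'I_n) (s : seq 'I_n) : m \notin s ->
 lipbd (fun x => \prod_(l <- s) fct l x) /\
 forall f, lipbd f -> T (tcons f (upd cprj m (fun x => \prod_(l <- s) fct l x))) = 0.
Proof.
elim: s => [_|l s IH].
 rewrite (_ : (fun x => _) = fun=> 1); last by apply/funext => x; rewrite big_nil.
 by split; [exact: lipbd_cst|move=> f bf; rewrite mc_const//; [exact: bd_lip|exact: lip_coords]].
rewrite in_cons negb_or => /andP[ml /IH[IH1 IH2]].
rewrite (_ : (fun x => _) = fun x => fct l x * \prod_(j <- s) fct j x); last first.
 by apply/funext => x; rewrite big_cons.
have bl := lipbd_fct l; have lc := lip_coords.
split; first exact: lipbdM.
move=> f bf; have bpf := lipbdM IH1 bf; have lpf := bd_lip bpf.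
rewrite mc_prod// IH2 ?add0r; last exact: lipbdM.
rewrite /fct (_ : (fun x => cc l * _) = fun x => cc l * bsp (crd r0 (hh l) (cprj l x) - kk l) + (fun=> 0) x); last first.
 by apply/funext => x; rewrite addr0.
rewrite (mc_linS hT (cc l) m lpf)//; [|by apply/bd_lip/lipbd_bsp => //; exact: lip_cprj|exact: lip_cst].
rewrite mc_const// addr0 slot_bsp ?mulr0// => g lg.
apply: (mc_alt hT (i1 := m) (i2 := l)) => //.
 apply: lip_cons => //; apply: lip_upd => //; exact: lip_cprj.
by rewrite !tconsS updE updN// eq_sym.
Qed.

(** By the product rule and the previous lemma only H, a function of x_m, contributes, through its
    derivative H'. Thus a value of T on the density P H' becomes a value of the boundary of T. *)
Lemma slot_fct (m : 'I_n) (h1 h2 k1 k2 c1 c2 : R) : 0 < h1 -> 0 < h2 ->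
 let P x := \prod_(l | l != m) fct l x in
 let H x := c1 * Bsp (crd r0 h1 (cprj m x) - k1) - c2 * Bsp (crd r0 h2 (cprj m x) - k2) in
 let H' x := c1 / h1 * bsp (crd r0 h1 (cprj m x) - k1) - c2 / h2 * bsp (crd r0 h2 (cprj m x) - k2) in
 lipbd (fun x => P x * H x) /\ lipbd (fun x => P x * H' x) /\
 T (tcons (fun=> 1) (upd cprj m (fun x => P x * H x))) =
 T (tcons (fun x => P x * H' x) cprj).
Proof.
move=> h10 h20 P H H'.
have [bP PZ] : lipbd P /\ forall f, lipbd f -> T (tcons f (upd cprj m P)) = 0.
 rewrite /P (_ : (fun x => _) = fun x => \prod_(l <- [seq l <- index_enum 'I_n | l != m]) fct l x).
  by apply: slot_fct_zero; rewrite mem_filter eqxx.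
 by apply/funext => x; rewrite big_filter.
have bB h k : 0 < h -> lipbd (fun x => Bsp (crd r0 h (cprj m x) - k)).
 move=> h0; apply: lipbd_Bsp => //; exact: lip_cprj.
have bb h k : 0 < h -> lipbd (fun x => bsp (crd r0 h (cprj m x) - k)).
 move=> h0; apply: lipbd_bsp => //; exact: lip_cprj.
have bD c c' (f g : V) : lipbd f -> lipbd g -> lipbd (fun x => c * f x - c' * g x).
 move=> bf bg; rewrite (_ : (fun x => _) = fun x => c * f x + (- c') * g x); last by apply/funext => x; ring.
 apply: lipbdD; apply: lipbdM => //; exact: lipbd_cst.
have bH : lipbd H by exact: bD (bB _ _ h10) (bB _ _ h20).
have bH' : lipbd H' by exact: bD (bb _ _ h10) (bb _ _ h20).
split; first exact: lipbdM.
split; first exact: lipbdM.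
have lc := lip_coords; have b1 := @lipbd_cst R n 1.
rewrite mc_prod// PZ ?addr0; last exact: lipbdM.
have lP := bd_lip bP.
rewrite (_ : (fun x => P x * 1) = P); last by apply/funext => x; rewrite mulr1.
rewrite /H (_ : (fun x => c1 * _ - _) = fun x => c1 * Bsp (crd r0 h1 (cprj m x) - k1) + (fun x => - c2 * Bsp (crd r0 h2 (cprj m x) - k2) + (fun=> 0) x) x); last first.
 by apply/funext => x; rewrite addr0 mulNr.
have lB1 := bd_lip (bB _ k1 h10); have lB2 := bd_lip (bB _ k2 h20); have l0 := @lip_cst R n 0.
have lB3 : lip (fun x => - c2 * Bsp (crd r0 h2 (cprj m x) - k2) + (fun=> 0) x) by exact: lip_lin.
rewrite (mc_linS hT c1 m lP)// (mc_linS hT (- c2) m lP)// mc_const// addr0 !slot_Bsp//.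
have e : upd cprj m (cprj m) = @cprj R n by exact: upd_id.
rewrite !e (_ : (fun x => P x * H' x) = fun x => (c1 / h1) * (bsp (crd r0 h1 (cprj m x) - k1) * P x) + (fun x => - (c2 / h2) * (bsp (crd r0 h2 (cprj m x) - k2) * P x) + (fun=> 0) x) x); last first.
 by apply/funext => x; rewrite /H'; ring.
have l1 := bd_lip (lipbdM (bb _ k1 h10) bP); have l2 := bd_lip (lipbdM (bb _ k2 h20) bP).
have l3 : lip (fun x => - (c2 / h2) * (bsp (crd r0 h2 (cprj m x) - k2) * P x) + (fun=> 0) x) by exact: lip_lin.
by rewrite (mc_lin0 hT _ l1 l3)// (mc_lin0 hT _ l2)// mc_zero0//; ring.
Qed.

End product.

(** * Comparison of splines on two consecutive dyadic lattices *)

Section dyadic.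
Context {R}.
Lemma sum_half (N : nat) (F : nat -> R) : \sum_(j < N.*2) F j./2 = 2 * \sum_(j < N) F j.
Proof.
elim: N => [|N IH]; first by rewrite !big_ord0 mulr0.
rewrite doubleS !big_ord_recr /= IH uphalf_double doubleK; ring.
Qed.

Variables (r0 h : R).
Hypothesis h0 : 0 < h.

(** Primitive of a fine spline minus half of a coarse one. The factor 1/2 gives both the same
    integral, so the primitive has bounded support, and its size is h. *)
Definition Hsp (j : nat) t : R := h * Bsp (crd r0 h t - j%:R) - h * Bsp (crd r0 (2 * h) t - (j./2)%:R).

Lemma crd2 t : crd r0 (2 * h) t = crd r0 h t / 2.
Proof. by rewrite /crd; field; rewrite gt_eqF. Qed.

Lemma half_bounds (j : nat) : 2 * (j./2)%:R <= (j%:R : R) <= 2 * (j./2)%:R + 1.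
Proof. by rewrite -natrM natr1 !ler_nat; lia. Qed.

(** With s the coordinate of t only the indices with -1 < s - j < 7 contribute, each at most h. They
    are dominated by a difference of two clamps whose arguments lie 9 apart, and the sum over j
    telescopes to at most 9. *)
Lemma Hsp_sum N t : \sum_(j < N) `|Hsp j t| <= 9 * h.
Proof.
pose s := crd r0 h t.
apply: (via (\sum_(j < N) h * (clamp (s + 2 - j%:R) - clamp (s - 7 - j%:R)))).
 apply: ler_sum => j _; rewrite /Hsp -mulrBr normrM gtr0_norm// ler_wpM2l ?(ltW h0)// crd2 -/s.
 have /andP[b1 b2] := half_bounds j; set e := (j./2)%:R in b1 b2 *. have B0 := @Bsp_ge0 R; have B1 := @Bsp_le1 R.
 have c0 : clamp (s - 7 - j%:R) <= clamp (s + 2 - j%:R) by apply: clamp_nd; lra. have [a1|a1] := leP (s - j%:R) (-1).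
  by rewrite !Bsp_0; [rewrite subrr normr0 subr_ge0|lra|lra].
 have [a2|a2] := leP 7 (s - j%:R).
  by rewrite !Bsp_1; [rewrite subrr normr0 subr_ge0|lra|lra].
 rewrite clamp_1; last by lra. rewrite clamp_0; last by lra. rewrite subr0 ler_norml; apply/andP; split.
  by have := B0 (s - j%:R); have := B1 (s / 2 - e); lra.
 by have := B1 (s - j%:R); have := B0 (s / 2 - e); lra.
rewrite -mulr_sumr sumrB !sum_clamp mulrC ler_wpM2r ?(ltW h0)//.
have := @pp_mono1 R (s - 7) (s + 2); have := @pp_mono1 R (s - 7 - N%:R) (s + 2 - N%:R).
by move=> /(_ (ltac:(lra))) /andP[+ _] /(_ (ltac:(lra))) /andP[_]; lra.
Qed.

(** Every coarse term occurs for two indices j but varies half as fast, so fine and coarse terms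
    contribute |s - t| each. *)
Lemma Hsp_diff N s t : \sum_(j < N.*2) `|Hsp j s - Hsp j t| <= 2 * `|s - t|.
Proof.
apply: (via (\sum_(j < N.*2) h * `|Bsp (crd r0 h s - j%:R) - Bsp (crd r0 h t - j%:R)| +
  \sum_(j < N.*2) h * `|Bsp (crd r0 (2 * h) s - (j./2)%:R) - Bsp (crd r0 (2 * h) t - (j./2)%:R)|)).
 rewrite -big_split /=; apply: ler_sum => j _. rewrite -(ger0_norm (ltW h0)) -!normrM (ger0_norm (ltW h0)) /Hsp.
 rewrite (_ : _ - _ - _ = h * (Bsp (crd r0 h s - j%:R) - Bsp (crd r0 h t - j%:R)) -
  h * (Bsp (crd r0 (2 * h) s - (j./2)%:R) - Bsp (crd r0 (2 * h) t - (j./2)%:R))); last by ring.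
 exact: ler_normB.
rewrite (sum_half N (fun j => h * `|Bsp (crd r0 (2 * h) s - j%:R) - Bsp (crd r0 (2 * h) t - j%:R)|)) -!mulr_sumr.
have b1 := @sum_Bsp_diff R N.*2 (crd r0 h s) (crd r0 h t).
have b2 := @sum_Bsp_diff R N (crd r0 (2 * h) s) (crd r0 (2 * h) t).
have e1 : h * `|crd r0 h s - crd r0 h t| = `|s - t|.
 by rewrite crdB// normrM (gtr0_norm (x := h^-1)) ?invr_gt0// mulrC divfK// gt_eqF.
have e2 : 2 * (h * `|crd r0 (2 * h) s - crd r0 (2 * h) t|) = `|s - t|.
 by rewrite !crd2 -mulrBl normrM -e1 (gtr0_norm (x := 2^-1))//; field.
have := ler_wpM2l (ltW h0) b1; have := ler_wpM2l (ltW h0) b2; rewrite e1; lra.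
Qed.

Lemma fine_sum N t : \sum_(j < N) `|bsp (crd r0 h t - j%:R)| <= 1.
Proof. exact: sum_bsp_abs. Qed.

Lemma fine_diff N s t : \sum_(j < N) `|bsp (crd r0 h s - j%:R) - bsp (crd r0 h t - j%:R)| <= 2 / h * `|s - t|.
Proof.
apply: (le_trans (sum_bsp_diff _ _ _)).
by rewrite crdB// normrM (gtr0_norm (x := h^-1)) ?invr_gt0// mulrAC mulrA.
Qed.

Lemma coarse_sum N t : \sum_(j < N.*2) `|2^-1 * bsp (crd r0 (2 * h) t - (j./2)%:R)| <= 1.
Proof.
rewrite (sum_half N (fun j => `|2^-1 * bsp (crd r0 (2 * h) t - j%:R)|)).
under eq_bigr do rewrite normrM gtr0_norm//; rewrite -mulr_sumr mulrA divff// mul1r.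
exact: sum_bsp_abs.
Qed.

Lemma coarse_diff N s t : \sum_(j < N.*2) `|2^-1 * bsp (crd r0 (2 * h) s - (j./2)%:R) -
 2^-1 * bsp (crd r0 (2 * h) t - (j./2)%:R)| <= 2 / h * `|s - t|.
Proof.
rewrite (sum_half N (fun j => `|2^-1 * bsp (crd r0 (2 * h) s - j%:R) - 2^-1 * bsp (crd r0 (2 * h) t - j%:R)|)).
under eq_bigr do rewrite -mulrBr normrM gtr0_norm//; rewrite -mulr_sumr mulrA divff// mul1r.
apply: (le_trans (sum_bsp_diff _ _ _)).
rewrite !crd2 -mulrBl crdB// !normrM (gtr0_norm (x := h^-1)) ?invr_gt0// (gtr0_norm (x := 2^-1))//.
have := normr_ge0 (s - t); have : 0 < h^-1 by rewrite invr_gt0.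
set a := `|s - t|; move=> i0 a0; have := mulr_ge0 a0 (ltW i0); lra.
Qed.

End dyadic.

(** * The two-scale estimate for a current with a Hoelder bound on its boundary *)

Section key.
Context {R n}.
Local Notation V := ('rV[R]_n -> R).
Variable T : functional R n n.
Hypothesis hT : metric_current T.
Variables (al C : R).
Hypotheses (al0 : 0 < al) (al1 : al <= 1) (C0 : 0 <= C).
Hypothesis KH : forall i f A, lip f -> 0 <= A -> hol al A f ->
 `|T (tcons (fun=> 1) (upd cprj i f))| <= C * A.

Variables (r0 h : R) (N : nat).
Hypothesis h0 : 0 < h.
Local Notation idx := {ffun 'I_n -> 'I_N.*2}.
Definition coarse (q : idx) : V := tensor (fun l t => bsp (crd r0 (2 * h) t - ((q l)./2)%:R)).

(** A fine product spline minus 2^-n times the coarse one is changed one coordinate at a time: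
    before m the factors are coarse, after m fine, and at m stands a difference with integral 0
    ([dpsi]). Here that difference is replaced by its primitive [Hsp]. *)
Definition psif (m l : 'I_n) (j : nat) (t : R) : R :=
 if (l < m)%N then 2^-1 * bsp (crd r0 (2 * h) t - (j./2)%:R)
 else if l == m then Hsp r0 h j t else bsp (crd r0 h t - j%:R).

Definition psi (m : 'I_n) (q : idx) : V := fun x => \prod_l psif m l (q l) (x ord0 l).

Definition dpsi (m : 'I_n) (q : idx) : V := fun x => \prod_(l < n)
 (if (l < m)%N then 2^-1 * bsp (crd r0 (2 * h) (x ord0 l) - ((q l)./2)%:R)
  else if l == m then bsp (crd r0 h (x ord0 l) - (q l)%:R) - 2^-1 * bsp (crd r0 (2 * h) (x ord0 l) - ((q l)./2)%:R)
  else bsp (crd r0 h (x ord0 l) - (q l)%:R)).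

Lemma psi_spec (m : 'I_n) (q : idx) : lipbd (psi m q) /\
 lipbd (dpsi m q) /\ T (tcons (fun=> 1) (upd cprj m (psi m q))) = T (tcons (dpsi m q) cprj).
Proof.
pose cc (l : 'I_n) : R := if (l < m)%N then 2^-1 else 1.
pose hh (l : 'I_n) : R := if (l < m)%N then 2 * h else h.
pose kk (l : 'I_n) : R := if (l < m)%N then ((q l)./2)%:R else (q l)%:R.
have hh0 l : 0 < hh l by rewrite /hh; case: ifP => _ //; rewrite mulr_gt0.
have h20 : 0 < 2 * h by rewrite mulr_gt0.
have [b1 [b2 e]] := slot_fct hT r0 cc kk hh0 m (q m)%:R ((q m)./2)%:R h h h0 h20.
have fE l x : l != m -> fct r0 cc hh kk l x = psif m l (q l) (x ord0 l).
 by move=> /negbTE lm; rewrite /fct /psif /cc /hh /kk lm /cprj; case: ifP => _ //; rewrite mul1r.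
have E1 : psi m q = fun x => (\prod_(l | l != m) fct r0 cc hh kk l x) *
  (h * Bsp (crd r0 h (cprj m x) - (q m)%:R) - h * Bsp (crd r0 (2 * h) (cprj m x) - ((q m)./2)%:R)).
 apply/funext => x; rewrite /psi (bigD1 m)//= mulrC; congr (_ * _).
  by apply: eq_bigr => l lm; rewrite fE.
 by rewrite /psif ltnn eqxx.
have E2 : dpsi m q = fun x => (\prod_(l | l != m) fct r0 cc hh kk l x) *
  (h / h * bsp (crd r0 h (cprj m x) - (q m)%:R) - h / (2 * h) * bsp (crd r0 (2 * h) (cprj m x) - ((q m)./2)%:R)).
 apply/funext => x; rewrite /dpsi (bigD1 m)//= mulrC; congr (_ * _).
  by apply: eq_bigr => l lm; rewrite fE// /psif (negbTE lm).
 rewrite ltnn eqxx divff ?gt_eqF// mul1r; congr (_ - _ * _). by rewrite invfM mulrCA divff ?gt_eqF// mulr1.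
by rewrite /= E2 E1.
Qed.

Lemma T_two_scale (q : idx) :
 lipbd (fun x => om r0 h q x - 2^-1 ^+ n * coarse q x) /\
 T (tcons (fun x => om r0 h q x - 2^-1 ^+ n * coarse q x) cprj) =
 \sum_m T (tcons (fun=> 1) (upd cprj m (psi m q))).
Proof.
have -> : (fun x => om r0 h q x - 2^-1 ^+ n * coarse q x) = fun x => \sum_m 1 * dpsi m q x.
 apply/funext => x; under eq_bigr do rewrite mul1r; rewrite -prod_diff /om /coarse /tensor.
 by rewrite big_split /= prodr_const card_ord.
have bd m : lipbd (dpsi m q) by have [_ []] := psi_spec m q.
have ld m := bd_lip (bd m); split.
 apply: (lin_closed_sum _ (fun=> 1) lipbd_lin) => //; exact: lipbd_cst.
rewrite (mc_sum0 hT)//; last exact: lip_coords.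
by apply: eq_bigr => m _; rewrite mul1r; have [_ [_ ->]] := psi_spec m q.
Qed.

Section signed.
Variables (m : 'I_n) (eps : idx -> R).
Hypothesis eps1 : forall q, `|eps q| <= 1.

(** With the signs of the terms as coefficients eps, a sum of absolute values of T is a value of T
    on this one function. The bounds below hold for all signs because they are proved for sums of
    absolute values. *)
Definition psis : V := fun x => \sum_q eps q * psi m q x.

Lemma psis_lip : lip psis.
Proof.
by apply: (lin_closed_sum _ _ lip_lin (lip_cst 0)) => q; apply: bd_lip; have [] := psi_spec m q.
Qed.

Let A (l : 'I_n) : R := if l == m then 9 * h else 1.

Lemma psif_sum l t : \sum_(j < N.*2) `|psif m l j t| <= A l.
Proof.
rewrite /psif /A; case: ltngtP => [lm|lm|/val_inj ->].
- rewrite (negbTE (_ : l != m)) ?neq_ltn ?lm//; exact: coarse_sum.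
- rewrite (negbTE (_ : l != m)) ?neq_ltn ?lm ?orbT//; exact: fine_sum.
- rewrite eqxx; exact: Hsp_sum.
Qed.

Lemma psif_diff l s t : \sum_(j < N.*2) `|psif m l j s - psif m l j t| <=
 (if l == m then 2 else 2 / h) * `|s - t|.
Proof.
rewrite /psif; case: ltngtP => [lm|lm|/val_inj ->].
- rewrite (negbTE (_ : l != m)) ?neq_ltn ?lm//; exact: coarse_diff.
- rewrite (negbTE (_ : l != m)) ?neq_ltn ?lm ?orbT//; exact: fine_diff.
- rewrite eqxx; exact: Hsp_diff.
Qed.

Lemma prodA : \prod_l A l = 9 * h.
Proof. by rewrite (bigD1 m)//= /A eqxx big1 ?mulr1// => l /negbTE ->. Qed.

Lemma psis_bound x : `|psis x| <= 9 * h.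
Proof.
apply: le_norm_sum; rewrite -prodA.
apply: le_trans (@sum_tensor_bound R n N.*2 (fun l j => psif m l j (x ord0 l)) A _); last first.
 move=> l; exact: psif_sum.
by apply: ler_sum => q _; rewrite normrM ler_piMl// eps1.
Qed.

Lemma psis_lipc : lipc (18 * n%:R + 2) psis.
Proof.
move=> x y; rewrite /psis -sumrB; apply: le_norm_sum.
apply: (via (\sum_q `|psi m q x - psi m q y|)).
 by apply: ler_sum => q _; rewrite -mulrBr normrM ler_piMl// eps1.
pose D l : R := (if l == m then 2 else 2 / h) * `|x - y|.
apply: (le_trans (@sum_tensor_diff R n N.*2 (fun l j => psif m l j (x ord0 l))
  (fun l j => psif m l j (y ord0 l)) A D _ _ _)).
- move=> l; exact: psif_sum.
- move=> l; exact: psif_sum.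
- move=> l; apply: (le_trans (psif_diff _ _ _)); rewrite /D ler_wpM2l//.
  by case: ifP => // _; rewrite divr_ge0// ltW.
 by have := coord_le (x - y) l; rewrite !mxE.
apply: (via (\sum_(l < n) (18 + (l == m)%:R * 2) * `|x - y|)).
 apply: ler_sum => l _; rewrite /D; have [->|lm] := eqVneq l m.
  rewrite big1 ?mulr1 ?mul1r; last by move=> k /negbTE kl; rewrite /A kl. by rewrite ler_wpM2r//; lra.
 rewrite mul0r addr0 (bigD1 m) 1?eq_sym//= /A eqxx big1 ?mulr1; last first.
  by move=> k /andP[_ /negbTE ->].
 rewrite mulrAC ler_wpM2r// mulrCA divfK ?gt_eqF//; lra.
have e : \sum_(l < n) (18 + (l == m)%:R * 2) = 18 * n%:R + 2 :> R.
 rewrite big_split /= sumr_const card_ord; congr (_ + _); first by rewrite mulr_natr.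
 by rewrite -mulr_suml (bigD1 m)//= eqxx big1 ?addr0 ?mul1r// => k /negbTE ->.
by rewrite -mulr_suml e.
Qed.

(** Interpolation between the Lipschitz bound, used for |x - y| <= h, and twice the sup bound 9h,
    used beyond. *)
Lemma psis_hol : hol al ((18 * n%:R + 20) * h `^ (1 - al)) psis.
Proof.
move=> x y; have n0 : 0 <= 18 * n%:R :> R by rewrite mulr_ge0.
set a := `|x - y|; have [xh|hx] := leP a h.
 have [a0|a0] := eqVneq a 0.
  have /eqP -> : x == y by rewrite -subr_eq0 -normr_eq0 -/a a0.
  by rewrite subrr normr0 mulr_ge0 ?powR_ge0// mulr_ge0 ?powR_ge0// addr_ge0.
 have a1 : 0 < a by rewrite lt_neqAle eq_sym a0 normr_ge0. apply: (le_trans (psis_lipc x y)); rewrite -/a.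
 have e : (18 * n%:R + 2) * a = (18 * n%:R + 2) * a `^ (1 - al) * a `^ al.
  by rewrite -mulrA -powRD ?subrK ?powRr1 ?(ltW a1)// a0 implybT.
 rewrite e ler_wpM2r ?powR_ge0// ler_pM ?powR_ge0//; first by lra. by rewrite ge0_ler_powR ?nnegrE ?subr_ge0// ltW.
apply: (via (18 * h)).
 rewrite (_ : 18 * h = 9 * h + 9 * h); last by lra. by rewrite le_normB// lerD// psis_bound.
have -> : 18 * h = 18 * (h `^ (1 - al) * h `^ al) by rewrite -powRD ?subrK ?powRr1 ?(ltW h0)// (gt_eqF h0) implybT.
rewrite -mulrA ler_pM ?mulr_ge0 ?powR_ge0//; first by lra.
by rewrite ler_wpM2l ?powR_ge0// ge0_ler_powR ?nnegrE ?(ltW al0) ?(ltW h0) ?normr_ge0// ltW.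
Qed.

End signed.

Lemma key_estimate : \sum_(q : idx) `|T (tcons (fun x => om r0 h q x - 2^-1 ^+ n * coarse q x) cprj)| <=
 n%:R * (C * ((18 * n%:R + 20) * h `^ (1 - al))).
Proof.
pose t q := T (tcons (fun x => om r0 h q x - 2^-1 ^+ n * coarse q x) cprj).
pose eps q : R := Num.sg (t q).
have eps1 q : `|eps q| <= 1 by rewrite /eps normr_sg; case: (t q != 0).
have -> : \sum_q `|t q| = \sum_(m < n) T (tcons (fun=> 1) (upd cprj m (psis m eps))).
 transitivity (\sum_q eps q * \sum_m T (tcons (fun=> 1) (upd cprj m (psi m q)))).
  by apply: eq_bigr => q _; have [_ <-] := T_two_scale q; rewrite -/(t q) normrEsg.
 under eq_bigr do rewrite mulr_sumr; rewrite exchange_big /=; apply: eq_bigr => m _.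
 rewrite /psis (mc_sumS hT)//; [|exact: lip_cst|exact: lip_coords].
 by move=> q; apply: bd_lip; have [] := psi_spec m q.
rewrite (_ : n%:R * _ = \sum_(m < n) C * ((18 * n%:R + 20) * h `^ (1 - al))); last first.
 by rewrite sumr_const card_ord mulr_natl.
apply: ler_sum => m _; apply: (le_trans (ler_norm _)); apply: KH.
- exact: psis_lip.
- by rewrite mulr_ge0 ?powR_ge0// addr_ge0// mulr_ge0.
- exact: psis_hol.
Qed.

End key.

(** * Series in L^1 *)

Section L1_series_.
Context d (T : measurableType d) {R : realType} (mu : {measure set T -> \bar R}).
Local Notation I f := (\int[mu]_x f x).
(** The argument of Riesz and Fischer. The sum is defined pointwise where the series of absolute
    values is finite and is 0 elsewhere, so common zeros of the terms remain zeros; this keeps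
    supports bounded at every point. *)
Lemma L1_series (v : nat -> T -> R) (B : R) : (forall k, L1 mu (v k)) ->
 (forall N, \sum_(k < N) I (fun x => `|v k x|) <= B) ->
 exists u, [/\ L1 mu u, I (fun x => `|\sum_(k < N) v k x - u x|) @[N --> \oo] --> 0 &
  forall x, (forall k, v k x = 0) -> u x = 0].
Proof.
move=> lv hB.
pose g x : \bar R := (\sum_(0 <= k <oo) `|v k x|%:E)%E.
have mabs k : mfun (fun x => `|v k x|%:E).
 apply/measurable_EFinP; apply: measurableT_comp => //; exact: L1_mfun (lv k).
have mg : mfun g.
 by have := @ge0_emeasurable_sum _ T R setT (fun k x => `|v k x|%:E) xpredT
  (fun k x _ _ => normr_ge0 _) (fun k _ => mabs k).
have g0 x : (0 <= g x)%E by apply: nneseries_ge0 => k _ _; rewrite lee_fin.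
have lg : mu.-integrable setT g.
 apply/integrableP; split => //. under eq_integral do rewrite gee0_abs//. rewrite integral_nneseries//.
 apply: (@le_lt_trans _ _ B%:E); last exact: ltry.
 apply: lime_le; first by apply: is_cvg_nneseries => k _ _; apply: integral_ge0. apply: nearW => N; rewrite big_mkord.
 rewrite (eq_bigr (fun k : 'I_N => (I (fun x => `|v k x|))%:E)) => [|k _].
  rewrite sumEFin lee_fin; exact: hB.
 rewrite L1_EFin//; exact: L1_abs.
have gfin := integrable_ae measurableT lg.
have bound N x : g x \is a fin_num -> \sum_(k < N) `|v k x| <= fine (g x).
 move=> fx; rewrite -lee_fin fineK// -sumEFin.
 have := @nneseries_lim_ge R (fun k => `|v k x|%:E) xpredT 0 N (fun _ _ _ => normr_ge0 _). by rewrite big_mkord.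
pose w N x : R := if g x \is a fin_num then \sum_(k < N) v k x else 0.
pose u x : R := if g x \is a fin_num then limn (fun N => \sum_(k < N) v k x) else 0.
have wu x : w N x @[N --> \oo] --> u x.
 rewrite /w /u; case: ifP => fx; last exact: cvg_cst. have nc : cvgn [normed series (fun k => v k x : R^o)].
  apply: nondecreasing_is_cvgn.
   apply: nondecreasing_series => k _ _; exact: normr_ge0.
  by exists (fine (g x)) => _ [N _ <-]; have := bound N x fx; rewrite -(big_mkord xpredT (fun k => `|v k x|)).
 rewrite (_ : (fun N => _) = series (fun k => v k x : R^o)); first exact: (normed_cvg nc).
 by apply/funext => N; rewrite -(big_mkord xpredT (fun k => v k x)).
have mS N : mfun (fun x => \sum_(k < N) v k x).
 apply: measurable_sum => k; exact: L1_mfun (lv k).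
have mw N : mfun (w N).
 rewrite (_ : w N = fun x => (\sum_(k < N) v k x) * \1_[set x | g x \is a fin_num] x).
  apply: measurable_funM => //; apply: measurable_indic.
  by rewrite -[X in measurable X]setTI; exact: emeasurable_fin_num.
 apply/funext => x; rewrite /w indicE; case: ifP => fx.
  by rewrite mem_set ?mulr1.
 by rewrite memNset ?mulr0//= fx.
have mu' : mfun u by apply: (measurable_fun_cvg (h := w)) => // x _; exact: wu.
have mfg : L1 mu (fine \o g).
 apply: (@le_integrable _ _ _ mu setT _ _ g) => //.
  apply/measurable_EFinP; apply: measurableT_comp => //; exact: fine_measurable.
 move=> x _ /=; rewrite ger0_norm ?fine_ge0// gee0_abs//. by case: (g x) (g0 x) => //= *; rewrite leey.
have [//|//||//||lu c _] := @I_DCT _ _ _ mu w u (fine \o g).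
- apply: aeW => x; exact: wu.
- apply: aeW => x N; rewrite /w; case: ifP => fx /=; last by rewrite normr0 fine_ge0.
 apply: le_norm_sum; exact: bound.
exists u; split => //.
- apply: cvg_trans c; apply: near_eq_cvg; apply: nearW => N.
 apply: I_ae.
 + apply: measurableT_comp => //; exact: measurable_funB.
 + apply: measurableT_comp => //; exact: measurable_funB.
 + by apply: filterS gfin => x fx; rewrite /w fx.
- move=> x vx; rewrite /u; case: ifP => // _.
 rewrite (_ : (fun N => _) = fun=> 0) ?lim_cst//. apply/funext => N; rewrite big1// => k _; exact: vx.
Qed.

End L1_series_.

(** * Step functions on lattices *)

Section step.
Context {R n}.
Definition stepf (r0 h : R) N (a : {ffun 'I_n -> 'I_N} -> R) (x : 'rV[R]_n) : R :=
 \sum_q a q * \1_(cube h (node r0 h q)) x.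

Section lattice.
Variables (r0 h : R) (N : nat).
Hypothesis h0 : 0 < h.
Implicit Types a b : {ffun 'I_n -> 'I_N} -> R.
Lemma stepf_in a q x : cube h (node r0 h q) x -> stepf r0 h a x = a q.
Proof.
move=> qx; rewrite /stepf (bigD1 q)//= indicE mem_set// mulr1 big1 ?addr0// => q' q'q.
rewrite indicE memNset ?mulr0// => q'x; move/negP: q'q; apply; apply/eqP.
exact: (cube_disjoint h0 q'x qx).
Qed.

Lemma stepf_out a x : (forall q : {ffun 'I_n -> 'I_N}, ~ cube h (node r0 h q) x) -> stepf r0 h a x = 0.
Proof. by move=> hx; rewrite /stepf big1// => q _; rewrite indicE memNset ?mulr0. Qed.

Lemma stepf_cases x : (exists q : {ffun 'I_n -> 'I_N}, cube h (node r0 h q) x) \/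
 (forall q : {ffun 'I_n -> 'I_N}, ~ cube h (node r0 h q) x).
Proof.
have [hq|hq] := pselect (exists q : {ffun 'I_n -> 'I_N}, cube h (node r0 h q) x); first by left.
by right=> q qx; apply: hq; exists q.
Qed.

Lemma stepf_abs a x : `|stepf r0 h a x| = stepf r0 h (fun q => `|a q|) x.
Proof.
have [[q qx]|hx] := stepf_cases x; first by rewrite !(stepf_in _ qx).
by rewrite !(stepf_out _ hx) normr0.
Qed.

Lemma stepf_L1 a : L1 mu (stepf r0 h a).
Proof. by apply: L1_sum => q _; apply: L1Z; exact: L1_cube. Qed.

Lemma I_stepf a : I (stepf r0 h a) = \sum_q a q * h ^+ n.
Proof.
rewrite /stepf I_sum => [|q _]; last by apply: L1Z; exact: L1_cube.
apply: eq_bigr => q _; rewrite IZ ?I_cube ?(ltW h0)//; exact: L1_cube.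
Qed.

Lemma I_stepf_abs a : I (fun x => `|stepf r0 h a x|) = \sum_q `|a q| * h ^+ n.
Proof. by rewrite -I_stepf; congr Rintegral; apply/funext => x; exact: stepf_abs. Qed.

Lemma stepfB a b x : stepf r0 h a x - stepf r0 h b x = stepf r0 h (fun q => a q - b q) x.
Proof. by rewrite /stepf -sumrB; apply: eq_bigr => q _; rewrite mulrBl. Qed.

Lemma stepf_bsupp a r : h <= 1 -> (forall q, a q != 0 -> `|node r0 h q| <= r) ->
 bsupp (r + 1) (stepf r0 h a).
Proof.
move=> h1 ha x hx; have [[q qx]|] := stepf_cases x; last exact: stepf_out.
rewrite (stepf_in _ qx); apply/eqP; apply: contraTT hx => /ha hq; rewrite -leNgt.
have := cube_norm (ltW h0) qx; have := ler_normD (x - node r0 h q) (node r0 h q).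
by rewrite subrK; have := h1; lra.
Qed.

Lemma I_stepf_lip a f L : lipc L f -> lipb f -> 0 <= L ->
 `|I (fun x => stepf r0 h a x * f x) - \sum_q a q * h ^+ n * f (node r0 h q)| <=
 L * h * I (fun x => `|stepf r0 h a x|).
Proof.
move=> fL bf L0.
have [M [s [A [_ _ _ _ fA]]]] := lipbP bf.
have mf : mfun f by exact: lipc_mfun fL.
have l1 : L1 mu (fun x => stepf r0 h a x * f x) by exact: (L1M (stepf_L1 a) mf fA).
rewrite -(_ : I (stepf r0 h (fun q => a q * f (node r0 h q))) = \sum_q a q * h ^+ n * f (node r0 h q)); last first.
 by rewrite I_stepf; apply: eq_bigr => q _; rewrite mulrAC.
rewrite -IB//; last exact: stepf_L1.
rewrite -IZ; last by apply: L1_abs; exact: stepf_L1.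
apply: I_abs_le.
- apply: L1B => //; exact: stepf_L1.
- apply: L1Z; apply: L1_abs; exact: stepf_L1.
move=> x; have [[q qx]|hx] := stepf_cases x; last first.
 by rewrite !(stepf_out _ hx) mul0r subrr normr0 mulr0.
rewrite !(stepf_in _ qx) -mulrBr normrM mulrC ler_wpM2r//.
by rewrite (le_trans (fL _ _))// ler_wpM2l// cube_norm// ltW.
Qed.

End lattice.

Lemma half_ord_lt N (j : 'I_N.*2) : (j./2 < N)%N.
Proof. by have := ltn_ord j; lia. Qed.

(** Index of the parent: the cell q of mesh h lies in the cell [hidx q] of mesh 2h. *)
Definition hidx N (q : {ffun 'I_n -> 'I_N.*2}) : {ffun 'I_n -> 'I_N} :=
 [ffun l => Ordinal (half_ord_lt (q l))].

Lemma cube_hidx (r0 h : R) N (q : {ffun 'I_n -> 'I_N.*2}) (x : 'rV[R]_n) : 0 < h ->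
 cube h (node r0 h q) x -> cube (2 * h) (node r0 (2 * h) (hidx q)) x.
Proof.
move=> h0 /cubeP hx; apply/cubeP => l; have := hx l; rewrite !mxE ffunE /=.
have /andP[b1 b2] := half_bounds h0 (q l).
have := ler_wpM2l (ltW h0) b1; have := ler_wpM2l (ltW h0) b2.
by rewrite mulrDr mulr1 !mulrA [h * 2]mulrC => e1 e2 /andP[e3 e4]; apply/andP; split; lra.
Qed.

Lemma cube_refine (r0 h : R) N (q : {ffun 'I_n -> 'I_N}) (x : 'rV[R]_n) : 0 < h ->
 cube (2 * h) (node r0 (2 * h) q) x ->
 exists q' : {ffun 'I_n -> 'I_N.*2}, cube h (node r0 h q') x.
Proof.
move=> h0 /cubeP hx.
pose b l : bool := h < x ord0 l - node r0 (2 * h) q ord0 l.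
have hj l : ((q l).*2 + b l < N.*2)%N by have := ltn_ord (q l); case: (b l); lia.
exists [ffun l => Ordinal (hj l)]; apply/cubeP => l; have := hx l; move: (hj l).
rewrite /b !mxE ffunE /= !mxE => _ /andP[e1 e2]; rewrite natrD -muln2 natrM.
by have [e3|e3] := leP (x ord0 l - (2 * h * (q l)%:R - r0)) h; rewrite ?mulr1n ?mulr0n; lra.
Qed.

Lemma stepf_refine (r0 h : R) N (a : {ffun 'I_n -> 'I_N} -> R) x : 0 < h ->
 stepf r0 (2 * h) a x = stepf r0 h (fun q => a (hidx q)) x.
Proof.
move=> h0; have h20 : 0 < 2 * h by rewrite mulr_gt0.
have [[q qx]|hx] := stepf_cases r0 h N.*2 x.
 by rewrite (stepf_in h0 _ qx) (stepf_in h20 _ (cube_hidx h0 qx)).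
rewrite (stepf_out _ hx) stepf_out// => q /(cube_refine h0)[q' qx]; exact: hx qx.
Qed.

End step.

(** * Recovering the density of a current from dyadic step functions *)

Section dyadic.
Context {R} {p : nat}.
Local Notation n := p.+1.
Local Notation V := ('rV[R]_n -> R).
Variable T : functional R n n.
Hypothesis hT : metric_current T.
Variables (al C r : R).
Hypotheses (al0 : 0 < al) (al1 : al < 1) (C0 : 0 <= C) (r_ge0 : 0 <= r).
Hypothesis KH : forall i f A, lip f -> 0 <= A -> hol al A f ->
 `|T (tcons (fun=> 1) (upd cprj i f))| <= C * A.
Hypothesis hball : forall F F', lip_tuple F -> lip_tuple F' ->
 (forall i x, `|x| <= r -> F i x = F' i x) -> T F = T F'.

Definition hd (k : nat) : R := 2^-1 ^+ k.
Local Notation rho := (r + 6).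
Local Notation r0 := (rho + 6).

(** The number of nodes doubles when the mesh is halved, so that all lattices fill the same cube and
    are nested. *)
Fixpoint Nd (k : nat) : nat := if k is j.+1 then (Nd j).*2 else Nh rho 1.

Lemma hd_gt0 k : 0 < hd k. Proof. by rewrite exprn_gt0// invr_gt0. Qed.
Lemma hd_le1 k : hd k <= 1. Proof. by rewrite exprn_ile1// ?invr_ge0// invf_le1// ler1n. Qed.
Lemma hdS k : hd k = 2 * hd k.+1. Proof. by rewrite /hd exprS mulrA mulfV// mul1r. Qed.

Lemma Nd_ge k : 2 * rho + 10 <= (Nd k)%:R * hd k.
Proof.
elim: k => [|k IH]; first exact: Nh_ge.
by rewrite /= -muln2 natrM -mulrA -hdS.
Qed.

Local Notation idx k := {ffun 'I_n -> 'I_(Nd k)}.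
(** If T has a density, this is its weighted mean near the cell, since a product spline of mesh h
    has integral h^n. *)
Definition cd k (q : idx k) : R := (hd k) ^- n * T (tcons (om r0 (hd k) q) cprj).

Definition ad k : idx k -> R :=
 match k return idx k -> R with
 | 0 => @cd 0
 | j.+1 => fun q => @cd j.+1 q - @cd j (hidx q)
 end.

Definition Ud k : V := stepf r0 (hd k) (@cd k).
Definition vd k : V := stepf r0 (hd k) (@ad k).

Lemma vdS k x : vd k.+1 x = Ud k.+1 x - Ud k x.
Proof. by rewrite /Ud [hd k]hdS (stepf_refine _ _ _ (hd_gt0 _)) stepfB. Qed.

Lemma sum_vd k x : \sum_(j < k.+1) vd j x = Ud k x.
Proof.
elim: k => [|k IH]; first by rewrite big_ord_recl big_ord0 addr0.
by rewrite big_ord_recr /= IH vdS addrC subrK.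
Qed.

Lemma lip_om k (q : idx k) : lip (om r0 (hd k) q).
Proof. by apply: lipb_lip; apply: om_lipb; exact: hd_gt0. Qed.

Lemma cd_node k (q : idx k) : cd q != 0 -> `|node r0 (hd k) q| <= r + 3.
Proof.
move=> cq; have [[x [xr ox]]|ho] := pselect (exists x : 'rV[R]_n, `|x| <= r /\ om r0 (hd k) q x != 0).
 have h0 := hd_gt0 k; have h1 := hd_le1 k. have : `|x - node r0 (hd k) q| <= 3 * hd k.
  by apply: (om_dist h0 ox) => i; rewrite subrr lexx mulr_ge0// ltW.
 have := ler_normD (node r0 (hd k) q - x) x; rewrite subrK distrC; lra.
case/negP: cq; apply/eqP; rewrite /cd (_ : T _ = 0) ?mulr0//.
rewrite -(mc_zero0 hT lip_coords); apply: hball.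
- by apply: lip_cons; [exact: lip_om|exact: lip_coords].
- by apply: lip_cons; [exact: lip_cst|exact: lip_coords].
move=> i x xr; rewrite /tuple_cons; case: (unlift ord0 i) => //=.
by apply/eqP/negP => hx; apply: ho; exists x; split => //; exact/negP.
Qed.

Lemma Ud_bsupp k : bsupp (r + 4) (Ud k).
Proof.
have -> : r + 4 = r + 3 + 1 by ring.
exact: (stepf_bsupp (hd_gt0 k) (hd_le1 k) (@cd_node k)).
Qed.

Lemma vd_bsupp k : bsupp (r + 4) (vd k).
Proof.
case: k => [|k] x hx; first exact: (@Ud_bsupp 0).
by rewrite vdS !Ud_bsupp// subrr.
Qed.

Definition Ad : R := \sum_(q : idx 0) `|cd q| + n%:R * (C * (18 * n%:R + 20)).

Lemma Ad_ge0 : 0 <= Ad.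
Proof. by rewrite addr_ge0 ?sumr_ge0// !mulr_ge0// addr_ge0// mulr_ge0. Qed.

(** Multiplied by the volume of the cell, a coefficient of the difference of two levels is T on the
    fine spline minus 2^-n times the coarse one, so [key_estimate] applies. Level 0 is absorbed into
    the constant [Ad]. *)
Lemma ad_bound k : \sum_q `|@ad k q| * hd k ^+ n <= Ad * hd k `^ (1 - al).
Proof.
have K0 : 0 <= n%:R * (C * (18 * n%:R + 20)) by rewrite !mulr_ge0// addr_ge0// mulr_ge0.
have c0 : 0 <= \sum_(q : idx 0) `|cd q| by rewrite sumr_ge0.
case: k => [|k].
 rewrite /hd expr0 powR1 mulr1; under eq_bigr do rewrite expr1n mulr1. by rewrite lerDl.
have h0 := hd_gt0 k.+1; have hn : hd k.+1 ^+ n != 0 by rewrite expf_neq0// gt_eqF.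
have -> : \sum_(q : idx k.+1) `|ad q| * hd k.+1 ^+ n = \sum_(q : {ffun 'I_n -> 'I_(Nd k).*2})
  `|T (tcons (fun x => om r0 (hd k.+1) q x - 2^-1 ^+ n * coarse r0 (hd k.+1) q x) cprj)|.
 apply: eq_bigr => q _. rewrite -[X in _ * X](gtr0_norm (exprn_gt0 n h0)) -normrM; congr `|_|.
 have coE : coarse r0 (hd k.+1) q = om r0 (hd k) (hidx q).
  by apply/funext => x; apply: eq_bigr => l _; rewrite ffunE /= -hdS.
 have -> : (fun x => om r0 (hd k.+1) q x - 2^-1 ^+ n * coarse r0 (hd k.+1) q x) =
   fun x => - 2^-1 ^+ n * om r0 (hd k) (hidx q) x + om r0 (hd k.+1) (q : idx k.+1) x.
  by apply/funext => x; rewrite coE; ring.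
 rewrite (mc_lin0 hT); [|exact: lip_om|exact: lip_om|exact: lip_coords].
 rewrite /= /cd mulrBl mulrAC mulVf// mul1r addrC mulNr; congr (- _ + _).
 rewrite hdS exprMn invfM mulrAC -!mulrA; congr (_ * _); first by rewrite exprVn.
 by rewrite [X in _ * X]mulrC mulrCA mulVf ?mulr1.
have KE := key_estimate hT al0 (ltW al1) KH r0 (Nd k) h0.
refine (le_trans KE _).
have -> : n%:R * (C * ((18 * n%:R + 20) * hd k.+1 `^ (1 - al))) =
 n%:R * (C * (18 * n%:R + 20)) * hd k.+1 `^ (1 - al) by ring.
by rewrite ler_wpM2r ?powR_ge0// lerDr.
Qed.

Definition thd : R := 2^-1 `^ (1 - al).

Lemma thd_lt1 : 0 < thd < 1.
Proof.
rewrite powR_gt0 ?invr_gt0//=.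
have := @gt0_ltr_powR R (1 - al) _ 2^-1 1; rewrite subr_gt0 => /(_ al1).
by rewrite !nnegrE invr_ge0 ler0n ler01 powR1 => -> //; rewrite invf_lt1// ltr1n.
Qed.

Lemma hd_pow k : hd k `^ (1 - al) = thd ^+ k.
Proof. have -> : hd k = 2^-1 `^ k%:R by rewrite powR_mulrn ?invr_ge0.
by rewrite -powRrM mulrC powRrM powR_mulrn// powR_ge0. Qed.

Lemma sum_ad_bound N : \sum_(k < N) I (fun x => `|vd k x|) <= Ad / (1 - thd).
Proof.
have /andP[t0 t1] := thd_lt1.
apply: (via (\sum_(k < N) Ad * thd ^+ k)).
 by apply: ler_sum => k _; rewrite (I_stepf_abs r0 (hd_gt0 k)) -hd_pow ad_bound.
rewrite -mulr_sumr ler_wpM2l ?Ad_ge0//.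
rewrite -[leRHS]mul1r ler_pdivlMr ?subr_gt0//.
have -> : (\sum_(k < N) thd ^+ k) * (1 - thd) = 1 - thd ^+ N by rewrite -opprB mulrN mulrC -subrX1 opprB.
by rewrite gerBl exprn_ge0// ltW.
Qed.

Lemma Ud_norm k : I (fun x => `|Ud k x|) <= Ad / (1 - thd).
Proof.
apply: le_trans (sum_ad_bound k.+1).
have lv j : L1 mu (fun x => `|vd j x|) by apply: L1_abs; exact: stepf_L1.
rewrite -I_sum => [|j _]; last exact: lv.
apply: I_le; first by apply: L1_abs; exact: stepf_L1.
 apply: L1_sum => j _; exact: lv.
move=> x; rewrite -sum_vd; exact: ler_norm_sum.
Qed.

(** T on the spline interpolation of f is the Riemann sum of the step function times f over the
    nodes. It differs from the integral by at most L times the mesh times the L^1 norm of [Ud],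
    which is bounded in k. *)
Lemma T_spline f L : 0 <= L -> lipc L f -> bsupp rho f ->
 I (fun x => Ud k x * f x) @[k --> \oo] --> T (tcons f cprj).
Proof.
move=> L0 fL fr.
pose fk k := IhN rho (hd k) (Nd k) f.
have hdc : hd k @[k --> \oo] --> 0 by apply: cvg_expr; rewrite ger0_norm ?invr_ge0// invf_lt1// ltr1n.
have c1 : T (tcons (fk k) cprj) @[k --> \oo] --> T (tcons f cprj).
 apply: (mc_lcvg hT); apply: (@lcvg_cons _ _ _ _ _ (fun=> cprj)) => [|i]; last exact/lcvg_cst/lip_coords.
 apply: (lcvg_le (L := (8 * n%:R + 7) * L + L) (c := L * 3) _ _ _ _ hdc) => [||k|k x].
 - by rewrite addr_ge0// mulr_ge0// addr_ge0// mulr_ge0.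
 - by apply: lipcW fL; rewrite lerDr mulr_ge0// addr_ge0// mulr_ge0.
 - have := IhN_lip (hd_gt0 k) (hd_le1 k) (Nd_ge k) fr ltr01 (lexx 1) L0 ((lipc_hol L f).1 fL).
  by rewrite subrr powRr0 mulr1; apply: lipcW; rewrite lerDl.
 - have := IhN_close (hd_gt0 k) (hd_le1 k) (Nd_ge k) fr ltr01 (lexx 1) L0 ((lipc_hol L f).1 fL) x.
  by rewrite powRr1 ?mulrA// ltW// hd_gt0.
have E k : T (tcons (fk k) cprj) = \sum_q @cd k q * hd k ^+ n * f (node r0 (hd k) q).
 rewrite /fk /IhN /spl (mc_sum0 hT _ _ (f := fun q : idx k => om r0 (hd k) q)); last 2 first.
 - move=> q; exact: lip_om.
 - exact: lip_coords.
 apply: eq_bigr => q _; rewrite /cd mulrC; congr (_ * _).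
 by rewrite mulrAC mulVf ?mul1r// expf_neq0// gt_eqF// hd_gt0.
have bf : lipb f by exists L, rho; split.
have dk k : `|I (fun x => Ud k x * f x) - T (tcons (fk k) cprj)| <= L * (Ad / (1 - thd)) * hd k.
 rewrite E; apply: (le_trans (I_stepf_lip r0 (hd_gt0 k) (@cd k) fL bf L0)).
 by rewrite mulrAC ler_wpM2r ?(ltW (hd_gt0 k))// ler_wpM2l// Ud_norm.
have c2 : I (fun x => Ud k x * f x) - T (tcons (fk k) cprj) @[k --> \oo] --> 0.
 apply/cvgr0Pnorm_le => e e0. have : L * (Ad / (1 - thd)) * hd k @[k --> \oo] --> 0.
  by rewrite -[X in _ --> X](mulr0 (L * (Ad / (1 - thd)))); apply: cvgM; [exact: cvg_cst|exact: hdc].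
 move/cvgr0Pnorm_le => /(_ e e0); apply: filterS => k; apply: le_trans. by rewrite (le_trans (dk k))// ler_norm.
have -> : (fun k => I (fun x => Ud k x * f x)) =
  fun k => I (fun x => Ud k x * f x) - T (tcons (fk k) cprj) + T (tcons (fk k) cprj).
 by apply/funext => k; rewrite subrK.
by rewrite -[X in _ --> X]add0r; exact: cvgD c2 c1.
Qed.

Lemma detD_cprj x : detD (@cprj R n) x = 1.
Proof.
rewrite /detD (_ : (\matrix_(i, j) _) = 1%:M) ?det1//; apply/matrixP => i j; rewrite !mxE.
have E : dquot j (cprj i) ^~ x @ 0^' --> ((i == j)%:R : R).
 apply: (@cvg_trans _ ((fun=> (i == j)%:R) @ 0^')); last exact: cvg_cst. apply: near_eq_cvg; near=> t.
 have t0 : t != 0 by near: t; exact: nbhs_dnbhs_neq. by rewrite /dquot /cprj !mxE addrK mulrA mulVf// mul1r eqxx.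
rewrite partial_dquot; exact: cvg_lim E.
Unshelve. all: by end_near. Qed.

Theorem step_decomposition : exists u : V,
 [/\ L1 mu u /\ bsupp (r + 4) u, forall F, lip_tuple F -> T F = current_of u F &
  I (fun x => `|\sum_(k < N) vd k x - u x|) @[N --> \oo] --> 0].
Proof.
have [u [lu uc us]] := L1_series (fun k => stepf_L1 r0 (hd k) (@ad k) : L1 mu (vd k)) sum_ad_bound.
have ur : bsupp (r + 4) u by move=> x hx; apply: us => k; exact: vd_bsupp.
exists u; split => //.
(* Both sides are metric currents, so they are compared on coordinates only, where the determinant
   is 1. *)
apply: mc_unique => //; first exact: current_metric_bsupp lu ur.
move=> f lf; have [L L0 fL] := (lipP f).1 lf.
pose g x := f x * cutoff (r + 5) x.
have bg : lipb g by exact: lipb_cut fL.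
have [M [s [A [[M0 A0] _ gM _ gA]]]] := lipbP bg.
have gs : bsupp rho g by move=> x hx; rewrite /g cutoff0 ?mulr0// (_ : r + 5 + 1 = rho) 1?ltW//; ring.
have -> : T (tcons f cprj) = T (tcons g cprj).
 apply: hball.
 - apply: lip_cons => //; exact: lip_coords.
 - by apply: lip_cons; [apply: bd_lip; exact: lipb_lipbd|exact: lip_coords].
 move=> i x xr; rewrite /tuple_cons; case: (unlift ord0 i) => //=. by rewrite /g cutoff1 ?mulr1//; lra.
have -> : current_of u (tcons f cprj) = I (fun x => u x * g x).
 rewrite current_ofE; congr Rintegral; apply/funext => x. rewrite tl_cons tcons0 detD_cprj mulr1 /g.
 have [xr|xr] := leP `|x| (r + 5); first by rewrite cutoff1// mulr1. by rewrite ur ?mul0r//; lra.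
have mg : mfun g by exact: lipc_mfun gM.
have lU k : L1 mu (Ud k) by exact: stepf_L1.
suff c : I (fun x => Ud k x * g x) @[k --> \oo] --> I (fun x => u x * g x).
 exact: (cvg_unique _ (T_spline M0 gM gs) c).
apply/cvgrPdist_le => e e0.
have c' : A * I (fun x => `|\sum_(k < N.+1) vd k x - u x|) @[N --> \oo] --> 0.
 rewrite -[X in _ --> X](mulr0 A); apply: cvgM; first exact: cvg_cst. by move: uc; rewrite -(@cvg_shiftS _ _ _).
move/cvgr0Pnorm_le: c' => /(_ e e0); apply: filterS => k; apply: le_trans.
have ld : L1 mu (fun x => \sum_(j < k.+1) vd j x - u x) by apply: L1B => //; apply: L1_sum => j _; exact: stepf_L1.
rewrite distrC -IB; [|exact: (L1M (lU k) mg gA)|exact: (L1M lu mg gA)].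
apply: le_trans (ler_norm _); rewrite -IZ; last exact: L1_abs.
apply: I_abs_le.
- by apply: L1B; [exact: (L1M (lU k) mg gA)|exact: (L1M lu mg gA)].
- apply: L1Z; exact: L1_abs.
by move=> x; rewrite sum_vd -mulrBl normrM mulrC ler_wpM2r.
Qed.

End dyadic.

(** * Test fields and the variation of step functions *)

Section fields.
Context {R n}.
Implicit Types (f : 'rV[R]_n -> R) (phi : 'rV[R]_n -> 'rV[R]_n).
Local Notation e_ j := (delta_mx ord0 j : 'rV[R]_n).
Lemma differentiable_cprj phi x i v : differentiable phi x ->
 differentiable (fun y => phi y ord0 i) x /\
 'd (fun y => phi y ord0 i) x v = ('d phi x v) ord0 i.
Proof.
move=> dphi.
have @c : {linear 'rV[R]_n -> R}.
 by exists (fun N : 'rV[R]_n => N ord0 i); do 2![eexists]; do ?[constructor];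
   rewrite ?mxE// => ? *; rewrite ?mxE//; move=> ?; rewrite !mxE.
have cc : continuous c by exact: coord_continuous.
have dc y : differentiable c y by exact: linear_differentiable.
rewrite (_ : (fun y => phi y ord0 i) = c \o phi)//; split; first exact: differentiable_comp.
by rewrite diff_comp// (diff_lin _ cc).
Qed.

Lemma differentiable_MVT f (y v : 'rV[R]_n) (B : R) : (forall x, differentiable f x) ->
 (forall x, `|'d f x v| <= B) -> `|f (y + v) - f y| <= B.
Proof.
move=> df hB; pose g t := f (y + t *: v).
have dg t : is_derive t (1 : R) g ('d f (y + t *: v) v).
 have fD : derivable f (y + t *: v) v by exact: diff_derivable.
 have E : (fun h : R => h^-1 *: ((g \o shift t) (h *: 1) - g t)) =
   fun h : R => h^-1 *: ((f \o shift (y + t *: v)) (h *: v) - f (y + t *: v)).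
  apply/funext => h; rewrite /g /=; congr (_ *: (f _ - _)). by rewrite [h%:A]mulr1 scalerDl addrCA.
 split; first by rewrite /derivable E. by rewrite -(deriveE v (df _)) /derive E.
have gc : {within `[0, 1], continuous g}.
 apply: continuous_subspaceT => t; apply: differentiable_continuous. by apply/derivable1_diffP; have [] := dg t.
have [t _ ht] := MVT_segment (@ler01 R) (fun t _ => dg t) gc.
by move: ht; rewrite subr0 mulr1 /g scale1r scale0r addr0 => ->.
Qed.

(** The derivatives along the basis vectors are continuous with compact support, hence bounded, and
    the mean value theorem on segments applies. *)
Lemma test_field_lipb phi i : test_field phi -> lipb (fun x => phi x ord0 i).
Proof.
move=> [dphi cphi Kphi _].
have [r r0 Kr] := compact_rV Kphi.
have phi0 x : r < `|x| -> phi x = 0.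
 move=> hx; apply/eqP/negP => px; move: hx; apply/negP; rewrite -leNgt; apply: Kr.
 by apply: subset_closure; exact/negP.
have bj (j : 'I_n) : exists2 B : R, 0 <= B & forall x, `|'D_(e_ j) phi x| <= B.
 have : compact ((fun x => 'D_(e_ j) phi x) @` [set x : 'rV[R]_n | `|x| <= r]).
  by apply: continuous_compact; [exact: continuous_subspaceT|exact: compact_normle].
 move/compact_rV => [B B0 hB]; exists B; first exact: ltW.
 move=> x; have [xr|xr] := leP `|x| r; first by apply: hB; exists x. rewrite (_ : 'D_(e_ j) phi x = 0) ?normr0 ?ltW//.
 rewrite -(derive_cst 0 x (e_ j)). apply: near_eq_derive.
 by move: (open_nbhs_nbhs (conj (@open_normgt R n r) xr)); apply: filterS => y /phi0.
have /choice[B hB] : forall j, exists B : R, 0 <= B /\ forall x, `|'D_(e_ j) phi x| <= B.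
 by move=> j; have [B B0 hB] := bj j; exists B.
exists (\sum_j B j), r; split.
- by apply: sumr_ge0 => j _; have [] := hB j.
- move=> x y; rewrite -{1}(subrK y x) [x - y + y]addrC.
 apply: (differentiable_MVT (f := fun x => phi x ord0 i)) => z.
  exact: (differentiable_cprj i 0 (dphi z)).1.
 rewrite (differentiable_cprj i _ (dphi z)).2. apply: (le_trans (coord_le _ _)).
 rewrite {1}[x - y]row_sum_delta linear_sum mulr_suml. apply: le_norm_sum; apply: ler_sum => j _.
 rewrite linearZ normrZ mulrC -deriveE//. by apply: ler_pM => //; [exact: (hB j).2|exact: coord_le].
- by move=> x /phi0 ->; rewrite mxE.
Qed.

Lemma test_field_bound phi i x : test_field phi -> `|phi x ord0 i| <= 1.
Proof.
move=> [_ _ _ h]; apply: (le_trans (coord_le _ _)).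
by apply: (le_trans (norm_le_enorm _)).
Qed.

Lemma L1_partial_field u phi i : L1 mu u -> test_field phi ->
 L1 mu (fun x => u x * partial i (fun y => phi y ord0 i) x).
Proof.
move=> lu tphi; have [L [r [L0 fL fr]]] := test_field_lipb i tphi.
apply: (L1M (C := L)) => //.
 apply: partial_mf; exact: lipc_cont fL.
move=> x; exact: partial_bound.
Qed.

Lemma I_divergence u phi : L1 mu u -> test_field phi -> L1 mu (fun x => u x * divergence phi x) /\
 I (fun x => u x * divergence phi x) = \sum_i I (fun x => u x * partial i (fun y => phi y ord0 i) x).
Proof.
move=> lu tphi.
have -> : (fun x => u x * divergence phi x) = fun x => \sum_i u x * partial i (fun y => phi y ord0 i) x.
 by apply/funext => x; rewrite /divergence mulr_sumr.
by split; [apply: L1_sum => i _|rewrite I_sum// => i _]; exact: L1_partial_field.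
Qed.

Definition slab (i : 'I_n) (t h : R) (w : 'rV[R]_n) : set 'rV[R]_n :=
 hbox w (w + \row_l (if l == i then t else h)).

Lemma slabP i t h w (x : 'rV[R]_n) :
 slab i t h w x <-> forall l, 0 < x ord0 l - w ord0 l <= (if l == i then t else h).
Proof. by split => hx l; have := hx l; rewrite in_itv/= !mxE subr_gt0 lerBlDl. Qed.

Lemma I_slab i t h w : 0 <= t -> 0 <= h ->
 L1 mu (\1_(slab i t h w)) /\ I (\1_(slab i t h w)) = t * h ^+ n.-1.
Proof.
move=> t0 h0; have d0 l : 0 <= (if l == i then t else h) by case: ifP.
have le l : w ord0 l <= (w + \row_l (if l == i then t else h)) ord0 l by rewrite !mxE lerDl.
have volE : mu (slab i t h w) = (t * h ^+ n.-1)%:E.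
 rewrite /slab rV_hbox//; congr EFin.
 rewrite (eq_bigr (fun l => if l == i then t else h)) => [|l _]; last by rewrite !mxE [w _ _ + _]addrC addrK.
 rewrite (bigD1 i)//= eqxx (eq_bigr (fun=> h)) => [|l /negbTE ->//]. by rewrite prodr_const cardC1 card_ord.
split; last by rewrite I_indic ?volE//; exact: mf_hbox.
apply: (@L1_bounded _ _ _ 1 (`|w| + (t + h))).
- apply: measurable_indic; exact: mf_hbox.
- move=> x; exact: indic01.
- move=> x hx; rewrite indicE memNset// => /slabP hb.
 move: hx; apply/negP; rewrite -leNgt. apply: (norm_le (r := `|w| + (t + h))) => [|l]; first by rewrite !addr_ge0.
 have := hb l; have := coord_le w l; rewrite !ler_norml.
 by case: ifP => _ /andP[e1 e2] /andP[e3 e4]; apply/andP; split; lra.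
Qed.

(** The difference quotient is moved from f to the indicator of the cube. The cube and its translate
    by t differ only within two slabs of thickness t at the faces orthogonal to the direction i;
    dividing by t leaves the area of two faces. *)
Lemma cube_boundary (h : R) z i f : 0 < h -> lipb f -> (forall x, `|f x| <= 1) ->
 `|I (fun x => \1_(cube h z) x * partial i f x)| <= 2 * h ^+ n.-1.
Proof.
move=> h0 bf f1; have [L [r [L0 fL fr]]] := bf.
have lf := lipbL1 bf; have mQ := mf_cube h z; have lp := partial_L1 i bf.
(* The increments are at most h for the comparison with slabs and at most 1 for [dquot_L1_cvg]. *)
pose u k : R := hk k * Num.min h 1.
have m0 : 0 < Num.min h 1 by rewrite lt_min h0 ltr01.
have u0 k : 0 < u k by rewrite mulr_gt0// hk_gt0.
have u1 k : u k <= Num.min h 1 by rewrite ler_piMl ?hk_le1// ltW.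
have uc : u k @[k --> \oo] --> 0.
 by rewrite -[X in _ --> X](mul0r (Num.min h 1)); apply: cvgM; [exact: hk_cvg|exact: cvg_cst].
have un k : `|u k| <= 1 by rewrite gtr0_norm// (le_trans (u1 k))// ge_min lexx orbT.
have dc := dquot_L1_cvg i bf (fun k => lt0r_neq0 (u0 k)) un uc.
have step t : 0 < t -> t <= h -> L1 mu (dquot i f t) /\
  `|I (fun x => \1_(cube h z) x * dquot i f t x)| <= 2 * h ^+ n.-1.
 move=> t0 th; have [ls _] := L1_shift (t *: e_ i) lf.
 have ls' : L1 mu (fun x => f (t *: e_ i + x)) by under eq_fun do rewrite addrC.
 have ld : L1 mu (dquot i f t) by apply: L1Z; exact: L1B. split => //. have lQ := L1_indic lf mQ.
 have [lQs IQs] := L1_shift (- (t *: e_ i)) (L1_indic ls' mQ). have E : I (fun x => \1_(cube h z) x * dquot i f t x) =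
   t^-1 * I (fun x => (\1_(cube h z) (x - t *: e_ i) - \1_(cube h z) x) * f x).
  rewrite (_ : (fun x => \1_(cube h z) x * dquot i f t x) = fun x =>
   t^-1 * (f (t *: e_ i + x) * \1_(cube h z) x - f x * \1_(cube h z) x)); last first.
   by apply/funext => x; rewrite /dquot; ring.
  have l1 : L1 mu (fun x => f (t *: e_ i + x) * \1_(cube h z) x) by exact: L1_indic. rewrite IZ; last exact: L1B.
  congr (_ * _); rewrite IB// -IQs -IB//; congr Rintegral; apply/funext => x.
  by rewrite [t *: _ + _]addrC subrK; ring.
 have [l1 v1] := I_slab i z (ltW t0) (ltW h0). have [l2 v2] := I_slab i (z + h *: e_ i) (ltW t0) (ltW h0).
 rewrite E normrM gtr0_norm ?invr_gt0// ler_pdivrMl//.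
 have -> : t * (2 * h ^+ n.-1) = I (fun x => \1_(slab i t h z) x + \1_(slab i t h (z + h *: e_ i)) x).
  by rewrite ID// v1 v2; ring.
 apply: I_abs_le; last first.
 - move=> x; rewrite normrM; apply: (via `|\1_(cube h z) (x - t *: e_ i) - \1_(cube h z) x|).
   by rewrite ler_piMr.
  rewrite !indicE. have sl (w : 'rV[R]_n) : 0 <= ((x \in slab i t h w)%:R : R) by [].
  have [q1|q1] := boolP (x - t *: e_ i \in cube h z); have [q2|q2] := boolP (x \in cube h z).
  + by rewrite subrr normr0 addr_ge0.
  + rewrite subr0 normr1 [X in _ <= _ + X](_ : _ = 1) ?lerDr// (_ : x \in _ = true)//.
   move/set_mem/cubeP: q1 => q1; apply/mem_set/slabP => l. case: (eqVneq l i) => [->|li]; last first.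
    by have := q1 l; rewrite !mxE (negbTE li) /= !mulr0 subr0 addr0.
   have := q1 i; rewrite !mxE !eqxx !mulr1 /= => hx; apply/andP; split; last lra.
   rewrite ltNge; apply/negP => h1; move/negP: q2; apply; apply/mem_set/cubeP => k.
   have := q1 k; rewrite !mxE /=; case: (eqVneq k i) => [->|_]; rewrite ?mulr1 ?mulr0 ?subr0//; lra.
  + rewrite sub0r normrN normr1 [X in _ <= X + _](_ : _ = 1) ?lerDl// (_ : x \in _ = true)//.
   move/set_mem/cubeP: q2 => q2; apply/mem_set/slabP => l; have := q2 l.
   case: (eqVneq l i) => [-> hx|//]; apply/andP; split; first lra.
   rewrite leNgt; apply/negP => h1; move/negP: q1; apply; apply/mem_set/cubeP => k.
   have := q2 k; rewrite !mxE /=; case: (eqVneq k i) => [->|_]; rewrite ?mulr1 ?mulr0 ?subr0//; lra.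
  + by rewrite subrr normr0 addr_ge0.
 - exact: L1D.
 - rewrite (_ : (fun x => _) = fun x => f (t *: e_ i + (x - t *: e_ i)) * \1_(cube h z) (x - t *: e_ i) - f x * \1_(cube h z) x).
   exact: L1B.
  by apply/funext => x; rewrite [t *: _ + _]addrC subrK; ring.
have uh k : u k <= h by rewrite (le_trans (u1 k))// ge_min lexx.
apply/ler_addgt0Pr => e e0.
have /cvgr0Pnorm_le /(_ e e0)[N _ /(_ N (leqnn N))] := dc => hN.
have [lN bN] := step _ (u0 N) (uh N).
rewrite -[X in `|X|](subrK (I (fun x => \1_(cube h z) x * dquot i f (u N) x))) addrC.
apply: le_normD; apply: lerD => //.
have lw g : L1 mu g -> L1 mu (fun x => \1_(cube h z) x * g x).
 move=> lg; under eq_fun do rewrite mulrC; exact: L1_indic.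
rewrite -IB; [|exact: lw|exact: lw]; apply: le_trans hN; apply: le_trans (ler_norm _).
apply: I_abs_le; [by apply: L1B; exact: lw|by apply: L1_abs; exact: L1B|].
move=> x; rewrite -mulrBr normrM distrC ler_piMl//.
by rewrite indicE; case: (_ \in _); rewrite ?normr0 ?normr1.
Qed.

Lemma cube_divergence (h : R) z phi : 0 < h -> test_field phi ->
 `|I (fun x => \1_(cube h z) x * divergence phi x)| <= 2 * n%:R * h ^+ n.-1.
Proof.
move=> h0 tphi; rewrite (I_divergence (L1_cube h z) tphi).2.
apply: le_norm_sum.
apply: (via (\sum_(i < n) 2 * h ^+ n.-1)).
 apply: ler_sum => i _; apply: cube_boundary => //; first exact: test_field_lipb. move=> x; exact: test_field_bound.
by rewrite sumr_const card_ord -[leLHS]mulr_natl mulrA [n%:R * 2]mulrC.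
Qed.

(** Every cell is charged the area 2n h^(n-1) of its whole boundary. Cancellation between neighbours
    is given away, which does not affect the rate in h. *)
Lemma div_variation_stepf (r0 h : R) N (a : {ffun 'I_n -> 'I_N} -> R) : 0 < h ->
 (div_variation (stepf r0 h a) <= (2 * n%:R * (\sum_q `|a q|) * h ^+ n.-1)%:E)%E.
Proof.
move=> h0; apply: ub_ereal_sup => _ [phi [tphi ->]]; rewrite lee_fin.
have lc q : L1 mu (fun x => \1_(cube h (node r0 h q)) x * divergence phi x).
 exact: (I_divergence (L1_cube h (node r0 h q)) tphi).1.
rewrite (_ : (fun x => _) = fun x => \sum_q a q * (\1_(cube h (node r0 h q)) x * divergence phi x)); last first.
 by apply/funext => x; rewrite /stepf mulr_suml; apply: eq_bigr => q _; rewrite mulrA.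
rewrite I_sum => [|q _]; last exact: L1Z.
apply: (le_trans (ler_norm _)); apply: le_norm_sum.
rewrite mulrAC mulr_sumr; apply: ler_sum => q _.
by rewrite IZ// normrM mulrC ler_wpM2r// cube_divergence.
Qed.

End fields.

(** * Quantitative continuity of Hoelder currents and of boundaries *)

Section holder_bounds.
Context {R n}.
Local Notation V := ('rV[R]_n -> R).
Lemma mlin_scale m (P : 'I_m -> V -> Prop) T F (c : 'I_m -> R) : (forall i, lin_closed (P i)) ->
 (forall i, P i (fun=> 0)) -> mlin P T -> (forall i, P i (F i)) ->
 T (fun i x => c i * F i x) = (\prod_i c i) * T F.
Proof.
move=> Pl P0 mT PF; pose A i : V := fun x => c i * F i x.
have PA i : P i (A i) by rewrite (_ : A i = fun x => c i * F i x + 0); [exact: Pl|apply/funext => x; rewrite addr0].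
suff H k : (k <= m)%N -> T (hyb A F k) = (\prod_(i < m | (i < k)%N) c i) * T F.
 have := H m (leqnn m); rewrite (_ : hyb A F m = A).
  by move=> ->; congr (_ * _); apply: eq_bigl => i; rewrite ltn_ord.
 by apply/funext => i; rewrite /hyb ltn_ord.
elim: k => [_|k IH km].
 by rewrite big_pred0_eq mul1r; congr T; apply/funext => i.
pose o := Ordinal km.
have e1 : hyb A F k.+1 = upd (hyb A F k) o (A o).
 apply/funext => i; rewrite /hyb /tuple_upd ltnS leq_eqVlt.
 by case: (eqVneq i o) => [->|io]; rewrite ?eqxx//= (_ : (i == k :> nat) = false)//; apply/negbTE.
have e2 : hyb A F k = upd (hyb A F k) o (F o).
 by apply/funext => i; rewrite /tuple_upd; case: (eqVneq i o) => // ->; rewrite /hyb ltnn.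
rewrite e1 (mlinZ (c o) mT)//; [|exact: hyb_P].
rewrite -e2 (IH (ltnW km)) [in RHS](bigD1 o) /=; last exact: ltnSn.
rewrite -[RHS]mulrA; congr (_ * (_ * _)).
apply: eq_bigl => i; rewrite ltnS andbC; case: (eqVneq i o) => [->|io] /=; first by rewrite ltnn.
have ik : (nat_of_ord i == k) = false by apply/negbTE.
by rewrite [in RHS]leq_eqVlt ik.
Qed.

(* Otherwise a sequence of tuples tending to 0 would have values larger than 1. *)
Lemma holder_current_bound m (a : 'I_m.+1 -> R) (T : functional R n m) : (forall i, 0 < a i) ->
 holder_current a T -> exists C, 0 <= C /\ forall F A, (forall i, hol (a i) (A i) (F i)) ->
  (forall i, 0 <= A i) -> (forall i x, `|F i x| <= A i) -> `|T F| <= C * \prod_i A i.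
Proof.
move=> a0 hT; apply: contrapT => hN.
have mT := hc_mlin hT.
have hk' (k : nat) : exists FA : ('I_m.+1 -> V) * ('I_m.+1 -> R),
  [/\ forall i, hol (a i) (FA.2 i) (FA.1 i), forall i, 0 <= FA.2 i,
   forall i x, `|FA.1 i x| <= FA.2 i & k.+1%:R ^+ m.+1 * \prod_i FA.2 i < `|T FA.1|].
 apply: contrapT => hk; apply: hN; exists (k.+1%:R ^+ m.+1); split; first exact: exprn_ge0.
 move=> F A h1 h2 h3; rewrite leNgt; apply/negP => h4; apply: hk. by exists (F, A).
have /choice[FA hFA] := hk'.
pose G k i : V := fun x => (k.+1%:R * (FA k).2 i)^-1 * (FA k).1 i x.
have Apos k i : 0 < (FA k).2 i.
 have [h1 h2 h3 h4] := hFA k; rewrite lt_neqAle h2 andbT; apply/eqP => A0.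
 have Fi0 : (FA k).1 i = fun=> 0 by apply/funext => x; apply/eqP; rewrite -normr_le0; have := h3 i x; rewrite -A0.
 move: h4; rewrite -(upd_id (FA k).1 i) Fi0 (mlin0 mT).
 - by rewrite normr0 ltNge mulr_ge0 ?exprn_ge0// prodr_ge0.
 - by move=> j; apply/holderP => //; exists ((FA k).2 j).
 - exact: holder_cst.
have kA k i : 0 < k.+1%:R * (FA k).2 i by rewrite mulr_gt0.
have TG k : 1 < `|T (G k)|.
 have [h1 h2 h3 h4] := hFA k.
 rewrite /G (mlin_scale (P := fun i => holder (a i)) (F := (FA k).1) (fun i => (k.+1%:R * (FA k).2 i)^-1))//.
 - have P0 : 0 < \prod_i (k.+1%:R * (FA k).2 i) by apply: prodr_gt0 => i _.
  rewrite normrM prodfV normfV (gtr0_norm P0) mulrC ltr_pdivlMr// mul1r. by rewrite big_split /= prodr_const card_ord.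
 - move=> i; exact: holder_lin.
 - move=> i; exact: holder_cst.
 - by move=> i; apply/holderP => //; exists ((FA k).2 i).
have Gb k i x : `|G k i x| <= hk k.
 have [h1 h2 h3 h4] := hFA k. rewrite /G normrM gtr0_norm ?invr_gt0// ler_pdivrMl// mulrAC mulfV ?mul1r//.
have GL k i : hol (a i) 1 (G k i).
 have [h1 h2 h3 h4] := hFA k; move=> x y. rewrite /G -mulrBr normrM gtr0_norm ?invr_gt0// ler_pdivrMl// mul1r.
 apply: (le_trans (h1 i x y)); by rewrite ler_wpM2r ?powR_ge0// ler_peMl// ler1n.
have c : T (G k) @[k --> \oo] --> T (fun _ _ => 0).
 apply: (hc_cvg a0 hT ler01 GL).
 - by move=> i x y; rewrite subrr normr0 mul1r powR_ge0.
 - move=> i; apply: (ucvg_le (ek := hk)); last exact: hk_cvg.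
  by move=> k x; rewrite subr0.
have T0 : T (fun _ _ => 0) = 0.
 rewrite -(upd_id (fun _ _ => 0) ord0); apply: (mlin0 mT) => //.
 - move=> j; exact: holder_cst.
 - exact: holder_cst.
move: c; rewrite T0 => /cvgr0Pnorm_lt /(_ 1 ltr01)[N _ /(_ N (leqnn N))] /=.
by rewrite ltNge (ltW (TG N)).
Qed.

(** Subtracting the value at 0 bounds the function on the ball by a multiple of its Hoelder constant
    alone. *)
Lemma cutoff_hol (r a A : R) (f : V) : 0 <= r -> 0 < a -> a <= 1 -> 0 <= A -> hol a A f ->
 let g x := (f x - f 0) * cutoff r x in
 hol a (A * (2 * r + 5)) g /\ forall x, `|g x| <= A * (2 * r + 5).
Proof.
move=> r0 a0 a1 A0 fA g.
have pw (s : R) : 1 <= s -> s `^ a <= s by move=> s1; rewrite -[leRHS]powRr1 ?(le_trans ler01)// ler_powR.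
have fb x s : `|x| <= s -> 1 <= s -> `|f x - f 0| <= A * s.
 move=> xs s1; apply: (le_trans (fA x 0)); rewrite subr0 ler_wpM2l//.
 by apply: le_trans (pw _ s1); rewrite ge0_ler_powR ?nnegrE ?(ltW a0)// (le_trans ler01).
have g0 x : r + 1 < `|x| -> g x = 0 by move=> hx; rewrite /g cutoff0 ?mulr0// ltW.
have gb x : `|g x| <= A * (r + 1).
 have [hx|hx] := leP `|x| (r + 1); last by rewrite g0// normr0 mulr_ge0//; lra. rewrite /g normrM.
 by apply: (le_trans (ler_piMr _ (cutoff_norm _ _))) => //; apply: fb => //; lra.
split; last first.
 by move=> x; apply: (le_trans (gb x)); rewrite ler_wpM2l//; lra.
move=> x y; have [xy|xy] := leP `|x - y| 1; last first.
 have p1 : 1 <= `|x - y| `^ a.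
  by have := @ge0_ler_powR R a (ltW a0) 1 `|x - y|; rewrite powR1; apply; rewrite ?nnegrE// ltW.
 apply: le_normB; apply: (via (A * (2 * r + 5) * 1)).
  by have := lerD (gb x) (gb y); move/le_trans; apply; rewrite mulr1 -mulrDr ler_wpM2l//; lra.
 by rewrite ler_wpM2l// mulr_ge0//; lra.
have [hy|hy] := leP `|y| (r + 2); last first.
 have hx : r + 1 < `|x| by have := ler_normD (y - x) x; rewrite subrK distrC; lra.
 rewrite !g0//; first by rewrite subrr normr0 mulr_ge0 ?powR_ge0// mulr_ge0//; lra. lra.
have -> : g x - g y = (f x - f y) * cutoff r x + (f y - f 0) * (cutoff r x - cutoff r y) by rewrite /g; ring.
have dle : `|x - y| <= `|x - y| `^ a.
 have [->|xy0] := eqVneq `|x - y| 0; first exact: powR_ge0. rewrite -[leLHS]powRr1//.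
 have d0 : 0 < `|x - y| by rewrite lt_neqAle eq_sym xy0/=. by rewrite ger_powR// d0.
apply: le_normD; rewrite !normrM.
apply: (via (A * `|x - y| `^ a * 1 + A * (r + 2) * `|x - y| `^ a)).
 apply: lerD; apply: ler_pM => //; [exact: cutoff_norm|by apply: fb => //; lra|].
 by apply: (le_trans (cutoff_lip _ _ _)); rewrite mul1r.
have -> : A * `|x - y| `^ a * 1 + A * (r + 2) * `|x - y| `^ a = A * (r + 3) * `|x - y| `^ a by ring.
by rewrite ler_wpM2r ?powR_ge0// ler_wpM2l//; lra.
Qed.

Section boundary.
Variables (m : nat) (T : functional R n m.+1).
Hypothesis hT : metric_current T.

Lemma boundary_mlin : mlin (fun=> lip) (boundary T).
Proof.
move=> G i c h1 h2 lG l1 l2; rewrite /boundary; apply: (mc_linS hT) => //; exact: lip_cst.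
Qed.

Lemma boundary_sub_cst (G : 'I_m.+1 -> V) c : lip_tuple G ->
 boundary T (fun i x => G i x - c i) = boundary T G.
Proof.
move=> lG; have lc i : lip (fun x => G i x - c i) by apply: lip_sub => //; exact: lip_cst.
apply/eqP; rewrite -subr_eq0 (mlin_telescope boundary_mlin lc lG) big1// => i _.
rewrite (_ : (fun x => _) = fun=> - c i); last by apply/funext => x; ring.
by apply: (mc_const hT); [exact: lip_cst|exact: (@hyb_P _ _ _ (fun=> lip))].
Qed.

(** The bound for a Hoelder current involves sup norms as well. For a boundary, constants in any
    slot contribute 0, so the value at 0 may be subtracted from each function; after a cutoff
    outside the ball that T sees, the sup norms are bounded by the Hoelder constants. *)
Lemma boundary_bound (a : 'I_m.+1 -> R) : (forall i, 0 < a i <= 1) ->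
 holder_extension a (boundary T) -> exists C, 0 <= C /\ forall G A, lip_tuple G ->
  (forall i, 0 <= A i) -> (forall i, hol (a i) (A i) (G i)) -> `|boundary T G| <= C * \prod_i A i.
Proof.
move=> ha [T' [K [hT' _ _ _ ext]]].
have a0 i : 0 < a i by case/andP: (ha i).
have a1 i : a i <= 1 by case/andP: (ha i).
have [C [C0 hC]] := holder_current_bound a0 hT'.
have [r [r0 hr]] := mc_ball hT.
exists (C * (2 * r + 5) ^+ m.+1); split; first by rewrite mulr_ge0// exprn_ge0//; lra.
move=> G A lG A0 hG.
pose H i : V := fun x => (G i x - G i 0) * cutoff r x.
have hH i := cutoff_hol r0 (a0 i) (a1 i) (A0 i) (hG i).
have A5 i : 0 <= A i * (2 * r + 5) by rewrite mulr_ge0//; lra.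
have lc i : lip (fun x => G i x - G i 0) by apply: lip_sub => //; exact: lip_cst.
have lH : lip_tuple H.
 move=> i; have [L L0 GL] := (lipP _).1 (lc i). apply: lipb_lip; exact: lipb_cut GL.
have E : boundary T G = T' H.
 rewrite (ext H H)//; last by move=> i; apply/holderP => //; exists (A i * (2 * r + 5)) => //; exact: (hH i).1.
 rewrite -(boundary_sub_cst (fun i => G i 0) lG); apply: hr.
 - apply: lip_cons => //; exact: lip_cst.
 - apply: lip_cons => //; exact: lip_cst.
 move=> i x xr; rewrite /tuple_cons; case: (unlift ord0 i) => //= j. by rewrite /H cutoff1// mulr1.
rewrite E; have := hC H (fun i => A i * (2 * r + 5)) (fun i => (hH i).1) A5 (fun i => (hH i).2).
by rewrite big_split /= prodr_const card_ord mulrCA mulrA [X in _ <= X](_ : _ = C * (2 * r + 5) ^+ m.+1 * \prod_i A i)//; ring.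
Qed.

End boundary.
End holder_bounds.

(** * From bounds on the boundary to dyadic series and fractional variation *)

Section key.
Context {R} {p : nat}.
Local Notation n := p.+1.
Local Notation V := ('rV[R]_n -> R).
Lemma represents_boundary (u : V) (T : functional R n n) G : represents u T -> lip_tuple G ->
 boundary T G = I (fun x => u x * detD G x).
Proof.
move=> uT lG; rewrite /boundary uT; last by apply: lip_cons => //; exact: lip_cst.
by rewrite current_ofE; congr Rintegral; apply/funext => x; rewrite tl_cons tcons0 mul1r.
Qed.

Definition dyadic_series (a b : R) (u : V) := exists (C : R) (uk : nat -> V),
 [/\ 0 < C, forall k, BVc (uk k),
  L1norm (fun x => u x - \sum_(0 <= k < N) uk k x) @[N --> \oo] --> 0%E,
  bounded_set (\bigcup_k ess_spt (uk k)) &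
  forall k, (L1norm (uk k) <= (C * 2 `^ (k%:R * a))%:E)%E /\
   (div_variation (uk k) <= (C * 2 `^ (k%:R * b))%:E)%E].

Section bounds.
Variable T : functional R n n.
Hypothesis hT : metric_current T.
Variables (al : R).
Hypotheses (al0 : 0 < al) (al1 : al < 1).

Definition slot1_bound C := forall G A, lip_tuple G -> 0 <= A -> hol al A (G ord0) ->
 (forall i, lipc 1 (G (sc i))) -> `|boundary T G| <= C * A.

(** Alternation exchanges the slots, so the Hoelder function may stand in any of them. *)
Lemma slot1_bound_all C : slot1_bound C -> forall i f A, lip f -> 0 <= A -> hol al A f ->
 `|T (tcons (fun=> 1) (upd cprj i f))| <= C * A.
Proof.
move=> hC i f A lf A0 fA.
have lG : lip_tuple (upd cprj i f) by apply: lip_upd => //; exact: lip_coords.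
have c1 l : lipc 1 (@cprj R n l) by exact: lipc_coord.
have [->|i0] := eqVneq i ord0.
 apply: hC => //; first by apply: lip_upd => //; exact: lip_coords. by move=> j; rewrite updN// eq_sym neq_lift.
rewrite -normrN -(mc_swap hT (i := ord0) (j := i))//; [|exact: lip_cst|by rewrite eq_sym].
apply: hC => //.
- move=> j; exact: lG.
- by rewrite /= tpermL updE.
- move=> j; rewrite /=; case: tpermP => [/eqP|ji|/eqP ji /eqP ji'].
 + by rewrite eq_sym (negbTE (neq_lift _ _)).
 + by rewrite updN// eq_sym.
 + by rewrite updN//; apply/eqP => h; apply: ji'.
Qed.

Lemma hd2 (b : R) k : hd k `^ b = 2 `^ (k%:R * - b).
Proof.
have -> : @hd R k = 2 `^ (- k%:R) by rewrite powR_invn// /hd exprVn.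
by rewrite -powRrM mulNr mulrN.
Qed.

Lemma slot1_decomposition C : 0 <= C -> slot1_bound C -> exists u,
 [/\ L1c u, represents u T & dyadic_series (al - 1) al u].
Proof.
move=> C0 hC; have KH := slot1_bound_all hC.
have [r [r0 hball]] := mc_ball hT.
have [u [[lu ur] uT uc]] := step_decomposition hT al0 al1 C0 KH hball.
pose vk := vd T r.
have lv k : L1 mu (vk k) by exact: stepf_L1.
have vr k : bsupp (r + 4) (vk k) by exact: vd_bsupp hball k.
exists u; split => //; first by apply: (aesupp_L1c lu) => //; exact: aeW ur.
pose B := Ad T C r; have B0 : 0 <= B by exact: Ad_ge0.
have ab k := ad_bound hT r al0 al1 C0 KH k.
(* B bounds the L^1 norms, 2n B the variations, and 1 makes the constant positive. *)
exists (2 * n%:R * B + B + 1), vk.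
have dv k : (div_variation (vk k) <= ((2 * n%:R * B + B + 1) * 2 `^ (k%:R * al))%:E)%E.
 apply: (le_trans (div_variation_stepf _ _ (hd_gt0 _))); rewrite lee_fin. have h0 : 0 < @hd R k by exact: hd_gt0.
 have an0 : 0 <= @hd R k `^ (- al) by exact: powR_ge0.
 have pE : hd k `^ (1 - al) = hd k * hd k `^ - al by rewrite powRD ?powRr1// ?ltW// (gt_eqF h0) implybT.
 have := ab k; rewrite pE -mulr_suml -/B exprS => abk.
 have abk' : (\sum_q `|@ad R p T r k q|) * hd k ^+ p <= B * hd k `^ - al.
  by move: abk; rewrite mulrCA [X in _ <= X]mulrCA ler_pM2l.
 have -> : 2 `^ (k%:R * al) = hd k `^ - al by rewrite hd2 opprK.
 have e1 : 2 * n%:R * ((\sum_q `|@ad R p T r k q|) * hd k ^+ p) <= 2 * n%:R * (B * hd k `^ - al).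
  by rewrite ler_wpM2l// mulr_ge0.
 rewrite -mulrA; apply: (le_trans e1). have := mulr_ge0 B0 an0; set X := hd k `^ - al in an0 *; nra.
split.
- by rewrite ltr_wpDl// addr_ge0// !mulr_ge0.
- move=> k; split; first by apply: (aesupp_L1c (lv k)); exact: aeW (vr k).
 by apply: (le_lt_trans (dv k)); rewrite ltry.
- have -> : (fun N => L1norm (fun x => u x - \sum_(0 <= k < N) vk k x)) =
  EFin \o (fun N => I (fun x => `|\sum_(k < N) vk k x - u x|)).
  apply/funext => N /=; rewrite /L1norm L1_EFin; last first.
   apply: L1_abs; apply: L1B => //; under eq_fun do rewrite big_mkord. by apply: L1_sum.
  by congr (_%:E); congr Rintegral; apply/funext => x; rewrite distrC big_mkord.
 by apply: cvg_EFin; [exact: nearW|exact: uc].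
- exists (r + 4); split; first exact: num_real.
 move=> M rM x [k _ kx]; apply: ltW; apply: le_lt_trans rM. apply: (ess_spt_sub _ kx); exact: aeW (vr k).
- move=> k; split => //; rewrite /L1norm L1_EFin; last exact: L1_abs.
 rewrite lee_fin I_stepf_abs ?hd_gt0//. apply: (le_trans (ab k)); rewrite hd2 opprB ler_wpM2r ?powR_ge0//.
 by rewrite -/B addrAC lerDr addr_ge0// !mulr_ge0.
Qed.

Lemma hsemi_ge0 a (f : V) : (0 <= holder_seminorm a f)%E.
Proof.
apply: (via (`|f (const_mx 1) - f 0| / enorm (const_mx 1 - 0) `^ a)%:E).
 rewrite lee_fin; exact: divr_ge0 (normr_ge0 _) (powR_ge0 _ _).
apply: ereal_sup_ubound; exists (const_mx 1), 0; split; last reflexivity.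
by apply/eqP => /rowP /(_ ord0); rewrite !mxE => /eqP; rewrite oner_eq0.
Qed.

Lemma fracvar_slot1 u : represents u T -> (fracvar al u < +oo)%E ->
 exists2 C, 0 <= C & slot1_bound C.
Proof.
move=> uT /ereal_inf_lt[[c| |] [c0 hc] //] _; rewrite lee_fin in c0.
exists c => // G A lG A0 hA hG; rewrite (represents_boundary uT lG) -lee_fin.
apply: (le_trans (hc G lG)).
have h1 : (\big[mule/1]_(i < p) holder_seminorm 1 (G (sc i)) <= 1)%E.
 apply: (@proj2 (0 <= \big[mule/1]_(i < p) holder_seminorm 1 (G (sc i)))%E).
 elim/big_ind: _ => [|x y [x0 x1] [y0 y1]|i _] //; split.
 - exact: mule_ge0.
 - by rewrite -[leRHS]mule1; exact: lee_pmul.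
 - exact: hsemi_ge0.
 - by apply: hol_seminorm => //; apply/lipc_hol.
have h2 : (holder_seminorm al (G ord0) <= A%:E)%E by apply: hol_seminorm => //; exact: ltW.
rewrite EFinM -[leRHS]mule1; apply: lee_pmul => //.
- by apply: mule_ge0; [rewrite lee_fin|exact: hsemi_ge0].
- apply: prode_ge0 => i _; exact: hsemi_ge0.
- apply: lee_pmul => //; exact: hsemi_ge0.
Qed.

Local Notation ai := (fun i : 'I_n => if i == ord0 then al else 1).
Lemma boundary_bound_slot1 C :
 (forall G A, lip_tuple G -> (forall i, 0 <= A i) -> (forall i, hol (ai i) (A i) (G i)) ->
  `|boundary T G| <= C * \prod_i A i) -> slot1_bound C.
Proof.
move=> hC G A lG A0 hA hG.
have := hC G (fun i => if i == ord0 then A else 1) lG.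
rewrite big_ord_recl eqxx big1 ?mulr1 => [|i _]; last by [].
apply=> i; first by case: ifP.
case: (unliftP ord0 i) => [j ->|->]; last by rewrite eqxx.
by rewrite eq_sym (negbTE (neq_lift _ _)); apply/lipc_hol.
Qed.

(** If one of the last functions has seminorm 0 it is constant and the left side is 0; otherwise an
    infinite Hoelder seminorm makes the right side infinite. In the remaining case the factors of K
    turn Euclidean seminorms into constants for the sup norm. *)
Lemma boundary_bound_fracvar u C : represents u T -> 0 <= C ->
 (forall G A, lip_tuple G -> (forall i, 0 <= A i) -> (forall i, hol (ai i) (A i) (G i)) ->
  `|boundary T G| <= C * \prod_i A i) -> (fracvar al u < +oo)%E.
Proof.
move=> uT C0 hC.
pose K : R := \prod_(i < n) n%:R `^ ai i.
have K0 : 0 <= K by apply: prodr_ge0 => i _; exact: powR_ge0.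
(* The summand 1 makes the constant positive, so that its product with an infinite seminorm is
   infinite. *)
apply: (@le_lt_trans _ _ (C * K + 1)%:E); last exact: ltry.
apply: ereal_inf_lbound; split.
 by rewrite lee_fin addr_ge0// mulr_ge0.
move=> F lF; rewrite -(represents_boundary uT lF).
pose s i := holder_seminorm (ai i) (F i).
have s0 i : (0 <= s i)%E by exact: hsemi_ge0.
have sl i : s (sc i) = holder_seminorm 1 (F (sc i)) by rewrite /s eq_sym (negbTE (neq_lift _ _)).
rewrite (_ : holder_seminorm al (F ord0) = s ord0); last by rewrite /s eqxx.
under eq_bigr do rewrite -sl.
have sfin i : s (sc i) \is a fin_num by rewrite ge0_fin_numE// sl; exact: lF.
have [[i si0]|sN] := pselect (exists i : 'I_p, s (sc i) = 0%E).
 have Fc : F (sc i) = fun=> F (sc i) 0.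
  apply/funext => x; apply/eqP; rewrite -subr_eq0 -normr_le0.
  have := @seminorm_hol R n 1 0 (F (sc i)) ltr01; rewrite -sl si0 lexx => /(_ isT x 0). by rewrite !mul0r.
 have e : F = upd F (sc i) (fun=> F (sc i) 0) by rewrite -Fc upd_id.
 have -> : boundary T F = 0 by rewrite e; apply: (mc_const hT) => //; exact: lip_cst.
 rewrite normr0; apply: mule_ge0; last by apply: prode_ge0.
 by apply: mule_ge0 => //; rewrite lee_fin addr_ge0// mulr_ge0.
have sp i : 0 < fine (s (sc i)).
 rewrite lt_neqAle fine_ge0// andbT eq_sym; apply/eqP => h; apply: sN; exists i. by rewrite -[LHS]fineK// h.
have -> : (\big[mule/1]_(i < p) s (sc i) = (\prod_(i < p) fine (s (sc i)))%:E)%E.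
 by rewrite -prodEFin; apply: eq_bigr => i _; rewrite fineK.
have P0 : 0 < \prod_(i < p) fine (s (sc i)) by apply: prodr_gt0.
have C1 : 0 < C * K + 1 by rewrite ltr_wpDl// mulr_ge0.
case E : (s ord0) (s0 ord0) => [a| |] // a0; last first.
 by rewrite gt0_muley ?lte_fin// gt0_mulye ?lte_fin// leey.
rewrite lee_fin in a0; rewrite -!EFinM lee_fin.
have hb := hC F (fun i => fine (s i) * n%:R `^ ai i) lF.
apply: (le_trans (hb _ _)).
- by move=> i; rewrite mulr_ge0 ?powR_ge0// fine_ge0.
- move=> i; apply: seminorm_hol; first by case: ifP.
 rewrite fineK//; case: (unliftP ord0 i) => [j ->|->]; first exact: sfin. by rewrite E.
rewrite big_split /= -/K big_ord_recl E /= -subr_ge0.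
set P := \prod_(i < p) _.
have -> : (C * K + 1) * a * P - C * (a * P * K) = a * P by ring.
by rewrite mulr_ge0// ltW.
Qed.

End bounds.
End key.

(** * Mollification by splines *)

Section spline.
Context {R n}.
Implicit Types (u v : 'rV[R]_n -> R) (z : 'rV[R]_n).
Lemma bsp_ge_half (t : R) : 1 < t <= 2 -> 2^-1 <= bsp t.
Proof.
move=> /andP[t1 t2]; rewrite bspE !big_cons big_nil /=.
rewrite subr0 (pp_pos (_ : 0 <= t)) ?(pp_pos (_ : 0 <= t - 1)) ?(pp_neg (_ : t - 2 <= 0)) ?(pp_neg (_ : t - 3 <= 0)); try lra.
by have := mulr_ge0 (_ : 0 <= t - 1) (_ : 0 <= 2 - t); nra.
Qed.

Section scale_.
Variable h : R.
Hypotheses (h0 : 0 < h) (h1 : 3 * h <= 1).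

Definition bker z : 'rV[R]_n -> R := tensor (fun l t => bsp ((t - z ord0 l) / h)).
Definition bmass : R := I (bker 0).
(** Mean weighted by the spline kernel. At a node the weight is the spline [om] used in the
    interpolation ([bker_node]), so that normalisation and integral cancel and [moll] does not
    increase the L^1 norm. *)
Definition bavg u z : R := bmass^-1 * I (fun x => u x * bker z x).

Lemma bker_node r0 N (q : {ffun 'I_n -> 'I_N}) : bker (node r0 h q) = om r0 h q.
Proof.
apply/funext => x; apply: eq_bigr => l _; congr bsp; rewrite /crd !mxE.
by field; rewrite gt_eqF.
Qed.

Lemma bker_ge0 z x : 0 <= bker z x.
Proof. by apply: prodr_ge0 => l _; exact: bsp_ge0. Qed.

Lemma bker_le1 z x : bker z x <= 1.
Proof. by apply: prodr_ile1 => l _; rewrite bsp_ge0 bsp_le1. Qed.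

Lemma bker_supp z x : bker z x != 0 -> forall l, 0 <= x ord0 l - z ord0 l <= 3 * h.
Proof.
move=> hx l; have hb : bsp ((x ord0 l - z ord0 l) / h) != 0.
 by apply: contraNneq hx => e; rewrite /bker /tensor (bigD1 l)//= e mul0r.
rewrite leNgt [_ <= 3 * h]leNgt -negb_or; apply: contraNN hb => /orP[e|e]; apply/eqP/bsp_0.
 by rewrite ler_pdivrMr// mul0r ltW.
by rewrite [3 <= _]ler_pdivlMr// (ltW e) orbT.
Qed.

Lemma bker_dist z x y : bker z x != 0 -> bker z y != 0 -> `|x - y| <= 3 * h.
Proof.
move=> /bker_supp hx /bker_supp hy; apply: norm_le => [|l]; first by rewrite mulr_ge0// ltW.
by rewrite !mxE ler_norml; have := hx l; have := hy l; lra.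
Qed.

Lemma bker_norm z x : bker z x != 0 -> `|x - z| <= 3 * h.
Proof.
move=> /bker_supp hx; apply: norm_le => [|l]; first by rewrite mulr_ge0// ltW.
by rewrite !mxE ler_norml; have := hx l; have := h0; lra.
Qed.

Lemma bker_measurable z : mfun (bker z).
Proof.
rewrite (_ : bker z = tensor (fun l t => bsp (crd (- z ord0 l) h t - 0))).
 apply: tensor_measurable => l; exact: (@testfun_bsp R (- z ord0 l) h 0 h0).1.1.
by apply/funext => x; apply: eq_bigr => l _; rewrite subr0.
Qed.

Lemma bker_L1 z : L1 mu (bker z) /\ I (bker z) = bmass.
Proof.
have l0 : L1 mu (bker 0).
 apply: (@L1_bounded _ _ _ 1 (3 * h)); first exact: bker_measurable.
  by move=> x; rewrite ger0_norm ?bker_ge0 ?bker_le1.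
 move=> x hx; apply/eqP/negPn/negP => /bker_norm; rewrite subr0. by apply/negP; rewrite -ltNge.
have E : bker z = fun x => bker 0 (x + - z) by apply/funext => x; apply: eq_bigr => l _; rewrite !mxE subr0.
rewrite E; exact: L1_shift.
Qed.

(** On the middle cube of side h of the support every factor of the kernel is at least 1/2. *)
Lemma bmass_gt0 : (h / 2) ^+ n <= bmass.
Proof.
have [l0 _] := bker_L1 0.
apply: (via (I (fun x => 2^-1 ^+ n * \1_(cube h (const_mx h)) x))).
 rewrite IZ ?I_cube ?(ltW h0)// ?exprMn 1?mulrC//; exact: L1_cube.
apply: I_le => //; first by apply: L1Z; exact: L1_cube.
move=> x; rewrite indicE; case: (boolP (x \in _)) => [/set_mem/cubeP hx|_]; last by rewrite mulr0 bker_ge0.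
rewrite mulr1 /bker /tensor -[X in _ ^+ X]card_ord -prodr_const.
apply: ler_prod => l _; rewrite mxE subr0 invr_ge0 ler0n /=; apply: bsp_ge_half.
have := hx l; rewrite mxE => /andP[e1 e2].
by rewrite ltr_pdivlMr// ler_pdivrMr// mul1r; apply/andP; split; lra.
Qed.

Let m0 : 0 < bmass.
Proof. by apply: lt_le_trans bmass_gt0; rewrite exprn_gt0// divr_gt0. Qed.

Lemma L1_bker u z : L1 mu u -> L1 mu (fun x => u x * bker z x).
Proof.
move=> lu; apply: (L1M (C := 1) lu); first exact: bker_measurable.
by move=> x; rewrite ger0_norm ?bker_ge0 ?bker_le1.
Qed.

Lemma bavg_bsupp u r : bsupp r u -> bsupp (r + 1) (bavg u).
Proof.
move=> ur z hz; rewrite /bavg (_ : (fun x => _) = fun=> 0) ?I0 ?mulr0//.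
apply/funext => x; have [->|/bker_norm hx] := eqVneq (bker z x) 0; first by rewrite mulr0.
by rewrite ur ?mul0r//; have := ler_normD (z - x) x; rewrite subrK distrC; have := h1; lra.
Qed.

Lemma bavg_dist u z c E : L1 mu u -> (forall x, bker z x != 0 -> `|u x - c| <= E) ->
 `|bavg u z - c| <= E.
Proof.
move=> lu hE; have [lk Ik] := bker_L1 z; have lu' := L1_bker z lu.
have -> : bavg u z - c = bmass^-1 * I (fun x => (u x - c) * bker z x).
 rewrite (_ : (fun x => (u x - c) * _) = fun x => u x * bker z x - c * bker z x).
  by rewrite IB ?IZ ?Ik//; [rewrite /bavg; field; rewrite gt_eqF|exact: L1Z].
 by apply/funext => x; ring.
rewrite normrM gtr0_norm ?invr_gt0// ler_pdivrMl// mulrC -Ik -IZ//.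
apply: I_abs_le; [|exact: L1Z|].
 rewrite (_ : (fun x => _) = fun x => u x * bker z x - c * bker z x).
  apply: L1B => //; exact: L1Z.
 by apply/funext => x; ring.
move=> x; rewrite normrM (ger0_norm (bker_ge0 _ _)).
have [->|/hE hx] := eqVneq (bker z x) 0; first by rewrite !mulr0.
by rewrite ler_wpM2r// bker_ge0.
Qed.

Variable r : R.
Local Notation r0 := (r + 1 + 6).
Local Notation N := (Nh (r + 1) h).
Local Notation idx := {ffun 'I_n -> 'I_N}.
Definition moll u : 'rV[R]_n -> R := Ih (r + 1) h (bavg u).
Lemma moll_lipb u : lipb (moll u). Proof. exact: Ih_lipb. Qed.

Lemma mollL c u v x : L1 mu u -> L1 mu v ->
 moll (fun y => c * u y + v y) x = c * moll u x + moll v x.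
Proof.
move=> lu lv; rewrite /moll -IhL; congr (Ih _ _ _ x); apply/funext => z.
have lu' := L1_bker z lu; have lv' := L1_bker z lv.
rewrite /bavg (_ : (fun x => _) = fun x => c * (u x * bker z x) + v x * bker z x).
 by rewrite ID ?IZ//; [ring|exact: L1Z].
by apply/funext => y; ring.
Qed.

Lemma moll_norm u : L1 mu u -> I (fun x => `|moll u x|) <= I (fun x => `|u x|).
Proof.
move=> lu; have lm := lipbL1 (moll_lipb u).
have lo (q : idx) : L1 mu (om r0 h q) /\ I (om r0 h q) = bmass by rewrite -bker_node; exact: bker_L1.
have la (q : idx) : L1 mu (fun x => `|u x| * om r0 h q x) by rewrite -bker_node; apply: L1_bker; exact: L1_abs.
apply: (via (I (fun x => \sum_(q : idx) `|bavg u (node r0 h q)| * om r0 h q x))).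
 apply: I_le; [exact: L1_abs| |].
  apply: L1_sum => q _; apply: L1Z; exact: (lo q).1.
 move=> x; apply: le_norm_sum; apply: ler_sum => q _. by rewrite normrM (ger0_norm (om_ge0 _ _ _ _)).
rewrite I_sum => [|q _]; last by apply: L1Z; exact: (lo q).1.
apply: (via (\sum_(q : idx) I (fun x => `|u x| * om r0 h q x))).
 apply: ler_sum => q _; have [lq Iq] := lo q; rewrite IZ// Iq /bavg bker_node.
 rewrite normrM gtr0_norm ?invr_gt0// mulrAC mulVf ?gt_eqF// mul1r.
 apply: I_abs_le => //; first by rewrite -bker_node; exact: L1_bker.
 by move=> x; rewrite normrM (ger0_norm (om_ge0 _ _ _ _)).
rewrite -I_sum => [|q _]; last exact: la.
apply: I_le; [by apply: L1_sum => q _; exact: la|exact: L1_abs|].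
move=> x; rewrite -mulr_sumr ler_piMr//.
apply: le_trans (sum_om_abs r0 h N x); apply: ler_sum => q _; exact: ler_norm.
Qed.

Lemma moll_close v M x : lipb v -> 0 <= M -> lipc M v -> bsupp (r + 2) v ->
 (forall z, r + 1 < `|z| -> bavg v z = 0) -> `|moll v x - v x| <= M * (3 * h).
Proof.
move=> bv M0 vM vr c0; have lv := lipbL1 bv; have h01 : h <= 1 by have := h1; have := h0; lra.
have NE := Nh_ge (r + 1) h0.
apply: (spl_close h0 (r := r + 2)) => //.
- lra.
- lra.
- move=> q y; rewrite -bker_node => /bker_norm hq hy; apply: c0.
 have := ler_normD (y - node r0 h q) (node r0 h q); rewrite subrK; have := h1; lra.
- move=> q y; rewrite -bker_node => hq; apply: bavg_dist => // t ht.
 by apply: (le_trans (vM _ _)); rewrite ler_wpM2l// (bker_dist ht hq).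
- by rewrite !mulr_ge0// ltW.
Qed.

End scale_.

Lemma moll_cvg u r : L1 mu u -> bsupp r u ->
 I (fun x => `|moll (hk k / 3) (r + 1) u x - u x|) @[k --> \oo] --> 0.
Proof.
move=> lu ur; apply/cvgr0Pnorm_le => e e0.
have e3 : 0 < e / 3 by rewrite divr_gt0.
have [v [bv vr /ltW hv]] := lipb_dense_supp lu ur e3; have lv := lipbL1 bv.
have [M [s [M0 vM _]]] := bv.
pose K := M * I (fun x : 'rV[R]_n => cutoff (r + 5) x).
have K0 : 0 <= K by rewrite mulr_ge0// I_ge0// => x; exact: clamp_ge0.
have e20 : 0 < e / 3 / (K + 1) by rewrite !divr_gt0// ltr_pwDr.
have /cvgr0Pnorm_lt /(_ _ e20) := @hk_cvg R; apply: filterS => k hhk.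
have h0 : 0 < hk k / 3 :> R by rewrite divr_gt0// hk_gt0.
have h1 : 3 * (hk k / 3) <= 1 :> R by rewrite mulrC divfK// hk_le1.
have cvz z : r + 1 + 1 < `|z| -> bavg (hk k / 3) v z = 0 by exact: (bavg_bsupp h0 h1 vr).
pose m := moll (hk k / 3) (r + 1).
have ml w : L1 mu (m w) by apply: lipbL1; exact: moll_lipb.
have lw : L1 mu (fun x => -1 * v x + u x) by apply: L1D => //; exact: L1Z.
have lc : L1 mu (fun x : 'rV[R]_n => M * (3 * (hk k / 3)) * cutoff (r + 5) x) by apply/L1Z/lipbL1/lipb_cutoff.
rewrite ger0_norm ?I_ge0//.
have close x : `|m v x - v x| <= M * (3 * (hk k / 3)) * cutoff (r + 5) x.
 have [hx|hx] := leP `|x| (r + 5).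
  rewrite cutoff1// mulr1; apply: (@moll_close (hk k / 3) h0 h1 (r + 1) v M x bv M0 vM) => //.
  by apply: bsuppW vr; lra.
 have -> : m v x = 0.
  have h01 : hk k / 3 <= 1 :> R by lra.
  have := Ih_bsupp h0 h01 (bavg_bsupp h0 h1 vr : bsupp (r + 1 + 1) _); apply; lra.
 by rewrite vr ?subrr ?normr0 ?mulr_ge0 ?clamp_ge0 ?(ltW h0)//; lra.
apply: (via (I (fun x => `|m (fun y => -1 * v y + u y) x| +
  M * (3 * (hk k / 3)) * cutoff (r + 5) x + `|u x - v x|))).
 apply: I_le.
 - by apply/L1_abs/L1B.
 - by apply: L1D; [apply: L1D => //; exact: L1_abs|apply/L1_abs/L1B].
 move=> x; have -> : m u x - u x = (m (fun y => -1 * v y + u y) x + (m v x - v x)) - (u x - v x).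
  by rewrite /m mollL//; ring.
 apply: le_normB; rewrite lerD2r. by apply: le_normD; rewrite lerD2l.
rewrite ID; [|by apply: L1D => //; exact: L1_abs|by apply/L1_abs/L1B].
rewrite ID//; last exact: L1_abs.
have t1 : I (fun x => `|m (fun y => -1 * v y + u y) x|) <= e / 3.
 apply: (le_trans (moll_norm h0 _ lw)); apply: le_trans hv.
 by apply: I_le => [||x]; [exact: L1_abs|apply/L1_abs/L1B|rewrite addrC mulN1r].
have t2 : I (fun x : 'rV[R]_n => M * (3 * (hk k / 3)) * cutoff (r + 5) x) <= e / 3.
 rewrite IZ; last exact/lipbL1/lipb_cutoff.
 have -> : M * (3 * (hk k / 3)) * I (@cutoff R n (r + 5)) = hk k * K by rewrite /K; field.
 move: hhk; rewrite gtr0_norm ?hk_gt0// ltr_pdivlMr ?ltr_pwDr// mulrDr mulr1 => /ltW.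
 by apply: le_trans; rewrite lerDl ltW// hk_gt0.
lra.
Qed.

End spline.

(** * Test fields built from products of functions of one variable *)

Section tensor_fields.
Context {R n}.
Implicit Types (g : 'I_n -> R -> R).
Local Notation e_ j := (delta_mx ord0 j : 'rV[R]_n).
Lemma continuous_bigprod (J : Type) (s : seq J) (P : pred J) (f : J -> 'rV[R]_n -> R) :
 (forall k, continuous (f k)) -> continuous (fun x => \prod_(k <- s | P k) f k x).
Proof.
move=> cf; elim: s => [|k s IH].
 under eq_fun do rewrite big_nil; exact: cst_continuous.
have ck : continuous (if P k then f k else fun=> 1) by case: (P k); [exact: cf|exact: cst_continuous].
rewrite (_ : (fun x => _) = fun x => (if P k then f k else fun=> 1) x * \prod_(k <- s | P k) f k x).
 move=> x; exact: (continuousM (ck x) (IH x)).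
by apply/funext => x; rewrite big_cons; case: ifP; rewrite ?mul1r.
Qed.

Lemma continuous_bigsum (J : Type) (s : seq J) (f : J -> 'rV[R]_n -> R) :
 (forall k, continuous (f k)) -> continuous (fun x => \sum_(k <- s) f k x).
Proof.
move=> cf; elim: s => [|k s IH].
 under eq_fun do rewrite big_nil; exact: cst_continuous.
under eq_fun do rewrite big_cons; move=> x.
exact: (continuousD (cf k x) (IH x)).
Qed.

Lemma differentiable_bigprod (J : Type) (s : seq J) (f : J -> 'rV[R]_n -> R) x :
 (forall k, differentiable (f k) x) -> differentiable (fun x => \prod_(k <- s) f k x) x.
Proof.
move=> df; elim: s => [|k s IH].
 under eq_fun do rewrite big_nil; exact: differentiable_cst.
by under eq_fun do rewrite big_cons; apply: differentiableM.
Qed.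

Lemma differentiable_bigsum (J : Type) (s : seq J) (f : J -> 'rV[R]_n -> R) x :
 (forall k, differentiable (f k) x) -> differentiable (fun x => \sum_(k <- s) f k x) x.
Proof.
move=> df; elim: s => [|k s IH].
 under eq_fun do rewrite big_nil; exact: differentiable_cst.
by under eq_fun do rewrite big_cons; apply: differentiableD.
Qed.

Lemma continuous_coordf (f : R -> R) (i : 'I_n) : continuous f ->
 continuous (fun x : 'rV[R]_n => f (x ord0 i)).
Proof.
by move=> cf x; apply: (continuous_comp (f := fun x : 'rV[R]_n => x ord0 i)); [exact: coord_continuous|exact: cf].
Qed.

Variables (J : Type) (s : seq J) (ep : J -> R) (g g' : J -> 'I_n -> R -> R).
Hypothesis gd : forall k i t, is_derive t (1 : R) (g k i) (g' k i t).
Hypothesis cg' : forall k i, continuous (g' k i).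

(** Times a basis vector this is a test field as soon as it is bounded by 1 with bounded support,
    and its divergence is a single partial derivative. *)
Definition tfield x : R := \sum_(k <- s) ep k * tensor (g k) x.

Lemma differentiable_tfield x : differentiable tfield x.
Proof.
apply: differentiable_bigsum => k; apply: differentiableM; first exact: differentiable_cst.
apply: differentiable_bigprod => i.
apply: (differentiable_comp (f := fun x : 'rV[R]_n => x ord0 i)); first exact: differentiable_coord.
by apply/derivable1_diffP; have [] := gd k i (x ord0 i).
Qed.

Lemma partial_tfield i x : partial i tfield x =
 \sum_(k <- s) ep k * (g' k i (x ord0 i) * \prod_(l | l != i) g k l (x ord0 l)).
Proof.
have h k := partial_tensor (gd k i (x ord0 i)).
have [_ ->] := partial_sum s ep (fun k => (h k).1).
by apply: eq_bigr => k _; rewrite (h k).2.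
Qed.

Lemma continuous_partial_tfield i : continuous (partial i tfield).
Proof.
rewrite (_ : partial i tfield = fun x =>
 \sum_(k <- s) ep k * (g' k i (x ord0 i) * \prod_(l | l != i) g k l (x ord0 l))); last first.
 apply/funext => x; exact: partial_tfield.
apply: continuous_bigsum => k.
have c0 : continuous (fun _ : 'rV[R]_n => ep k) by exact: cst_continuous.
have c1 : continuous (fun x : 'rV[R]_n => g' k i (x ord0 i)) by exact: continuous_coordf.
have c2 : continuous (fun x : 'rV[R]_n => \prod_(l | l != i) g k l (x ord0 l)).
 apply: continuous_bigprod => l; apply: continuous_coordf => t.
 by apply: differentiable_continuous; apply/derivable1_diffP; have [] := gd k l t.
move=> x; exact: (continuousM (c0 x) (continuousM (c1 x) (c2 x))).
Qed.

Lemma tfield_test_field j r : bsupp r tfield -> (forall x, `|tfield x| <= 1) ->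
 test_field (fun x => tfield x *: e_ j) /\
 forall x, divergence (fun x => tfield x *: e_ j) x = partial j tfield x.
Proof.
move=> tr t1; have dt := differentiable_tfield.
have dphi x : differentiable (fun x => tfield x *: e_ j) x by exact: differentiableZl.
have Dphi i x : 'D_(e_ i) (fun x => tfield x *: e_ j) x = partial i tfield x *: e_ j.
 by rewrite deriveE// diffZl//= -deriveE.
split; first split => //.
- move=> i; rewrite (_ : 'D_(e_ i) (fun x => tfield x *: e_ j) = fun x => partial i tfield x *: e_ j); last first.
  apply/funext => x; exact: Dphi.
 move=> x; apply: (continuous_comp (f := partial i tfield) (g := fun t => t *: e_ j)).
  exact: continuous_partial_tfield.
 exact: scalel_continuous.
- apply: (@subclosed_compact _ _ [set x : 'rV[R]_n | `|x| <= r]); [exact: closed_closure|exact: compact_normle|].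
 rewrite (closure_id [set x : 'rV[R]_n | `|x| <= r]).1; last exact: closed_normle.
 apply: closureS => x /=; apply: contraNT; rewrite -ltNge => hx. by rewrite tr// scale0r.
- move=> x; rewrite /enorm (bigD1 j)//= big1 ?addr0 => [|i ij]; last first.
  by rewrite !mxE (negbTE ij) andbF mulr0 expr0n.
 by rewrite !mxE !eqxx mulr1 sqrtr_sqr.
move=> x; rewrite /divergence (bigD1 j)//= big1 ?addr0 => [|i ij].
 by congr partial; apply/funext => y; rewrite !mxE !eqxx mulr1.
apply: (@partial_local _ _ _ _ setT 0) => //; first exact: openT.
by move=> y _; rewrite !mxE (negbTE ij) andbF mulr0.
Qed.

End tensor_fields.

Section derivative.
Context {R}.
Lemma is_derive_Bsp_crd (r0 h c t : R) : 0 < h ->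
 is_derive t (1 : R) (fun t => Bsp (crd r0 h t - c)) (h^-1 * bsp (crd r0 h t - c)).
Proof.
move=> h0.
have dB s : is_derive s (1 : R) (fun t => Bsp (t - c)) (bsp (s - c)).
 apply: (derive_congr (is_deriveB (is_derive_th3 c s) (is_derive_th3 (c + 1) s))) => [y|].
  by rewrite /Bsp /= (_ : y - c - 1 = y - (c + 1)); last ring.
 by rewrite /bsp (_ : s - c - 1 = s - (c + 1)); last ring.
exact: (is_derive_crd (f := fun t => Bsp (t - c))).
Qed.

Lemma crd_shift (r0 h t : R) : 0 < h -> crd r0 h t + 1 = crd (r0 + h) h t.
Proof. by move=> h0; rewrite /crd; field; rewrite gt_eqF. Qed.

End derivative.

(** * The gradient of a mollified function is bounded by the variation *)

Section smoothed.
Context {R n}.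
Local Notation e_ j := (delta_mx ord0 j : 'rV[R]_n).
Variables (u : 'rV[R]_n -> R) (r h V : R) (j : 'I_n).
Hypotheses (h0 : 0 < h) (h1 : 3 * h <= 1) (lu : L1 mu u) (ur : bsupp r u).
Hypothesis uV : (div_variation u <= V%:E)%E.
Local Notation r0 := (r + 1 + 6).
Local Notation N := (Nh (r + 1) h).
Local Notation idx := {ffun 'I_n -> 'I_N}.
Local Notation cr := (crd r0 h).
Local Notation nd := (node r0 h).

(** The factor in x_j is a primitive, chosen so that h times the derivative in direction j of the
    product is the difference of two neighbouring kernels ([kdE]). *)
Let g (q : idx) (l : 'I_n) (t : R) : R :=
 if l == j then Bsp (cr t - (q l)%:R) - Bsp (cr t + 1 - (q l)%:R) else bsp (cr t - (q l)%:R).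
Let g' (q : idx) (l : 'I_n) (t : R) : R :=
 if l == j then h^-1 * (bsp (cr t - (q l)%:R) - bsp (cr t + 1 - (q l)%:R)) else h^-1 * dbsp (cr t - (q l)%:R).

Let g_derive q l t : is_derive t (1 : R) (g q l) (g' q l t).
Proof.
rewrite /g /g'; case: (l == j); last first.
 by have [_ [_ h2]] := @testfun_bsp R r0 h (q l)%:R h0.
have d1 := @is_derive_Bsp_crd R r0 h (q l)%:R t h0.
have d2 := @is_derive_Bsp_crd R (r0 + h) h (q l)%:R t h0.
by apply: (derive_congr (is_deriveB d1 d2)) => [y|]; rewrite ?mulrBr crd_shift.
Qed.

Let g'_continuous q l : continuous (g' q l).
Proof.
rewrite /g'; case: (l == j); last by have [_ [[c _] _]] := @testfun_bsp R r0 h (q l)%:R h0.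
have [[c1 _] _] := @testfun_bsp R r0 h (q l)%:R h0.
have [[c2 _] _] := @testfun_bsp R (r0 + h) h (q l)%:R h0.
have c0 : continuous (fun _ : R => h^-1) by exact: cst_continuous.
rewrite (_ : (fun t => _) = fun t => h^-1 * (bsp (crd r0 h t - (q l)%:R) - bsp (crd (r0 + h) h t - (q l)%:R))).
 move=> t; exact: (continuousM (c0 t) (continuousB (c1 t) (c2 t))).
by apply/funext => t; rewrite crd_shift.
Qed.

Let kd (q : idx) x : R := bker h (nd q) x - bker h (nd q - h *: e_ j) x.

Let kdE q (x : 'rV[R]_n) : h * (g' q j (x ord0 j) * \prod_(l | l != j) g q l (x ord0 l)) = kd q x.
Proof.
have bE z : bker h z x = bsp ((x ord0 j - z ord0 j) / h) * \prod_(l | l != j) bsp ((x ord0 l - z ord0 l) / h).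
 by rewrite /bker /tensor (bigD1 j).
rewrite /kd !bE /g' eqxx mulrA mulrA mulfV ?gt_eqF// mul1r.
have e1 l : (x ord0 l - nd q ord0 l) / h = cr (x ord0 l) - (q l)%:R by rewrite /crd !mxE; field; rewrite gt_eqF.
rewrite e1 (_ : (x ord0 j - (nd q - h *: e_ j) ord0 j) / h = cr (x ord0 j) + 1 - (q j)%:R); last first.
 by rewrite /crd !mxE !eqxx mulr1; field; rewrite gt_eqF.
rewrite mulrBl; congr (_ * _ - _ * _).
 by apply: eq_bigr => l /negbTE lj; rewrite e1 /g lj.
apply: eq_bigr => l /negbTE lj; rewrite /g lj -e1; congr (bsp (_ / _)).
by rewrite !mxE lj andbF mulr0 subr0.
Qed.

Let L1_kd q : L1 mu (fun x => u x * kd q x).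
Proof.
under eq_fun do rewrite mulrBr.
apply: L1B; exact: L1_bker.
Qed.

Let diff_bavg (q : idx) : bavg h u (nd q) - bavg h u (nd q - h *: e_ j) =
 (@bmass R n h)^-1 * I (fun x => u x * kd q x).
Proof.
rewrite /bavg -mulrBr -IB; [|exact: L1_bker|exact: L1_bker].
by congr (_ * _); congr Rintegral; apply/funext => x; rewrite -mulrBr.
Qed.

Let field_le1 (ep : idx -> R) x : (forall q, `|ep q| <= 1) -> `|tfield (index_enum idx) ep g x| <= 1.
Proof.
move=> ep1; rewrite /tfield; apply: le_norm_sum.
apply: (via (\sum_(q : idx) `|\prod_l g q l (x ord0 l)|)).
 by apply: ler_sum => q _; rewrite normrM ler_piMl.
have := @sum_tensor_bound R n N (fun l k => if l == j then Bsp (cr (x ord0 l) - k%:R) - Bsp (cr (x ord0 l) + 1 - k%:R)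
 else bsp (cr (x ord0 l) - k%:R)) (fun=> 1).
rewrite big1_eq => hb; apply: hb => l; case: (l == j).
 by apply: (le_trans (sum_Bsp_diff _ _ _)); rewrite opprD addrA subrr sub0r normrN normr1.
exact: sum_bsp_abs.
Qed.

Let field_bsupp ep : bsupp (`|r0| + `|N%:R * h| + 4) (tfield (index_enum idx) ep g).
Proof.
move=> x hx; rewrite /tfield big1// => q _.
have [l hl] : exists l, `|r0| + `|N%:R * h| + 4 < `|x ord0 l|.
 apply: contrapT => hN; move: hx; apply/negP; rewrite -leNgt. apply: norm_le; first by rewrite !addr_ge0.
 by move=> l; rewrite leNgt; apply/negP => hl; apply: hN; exists l.
rewrite /tensor (bigD1 l)//= (_ : g q l _ = 0) ?mul0r ?mulr0//.
have qN : (q l)%:R * h <= N%:R * h by rewrite ler_wpM2r ?(ltW h0)// ler_nat ltnW.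
have q0 : 0 <= (q l)%:R * h by rewrite mulr_ge0// ltW.
have b1 := ler_norm (N%:R * h); have b2 := ler_norm r0; have b3 := ler_norm (- r0).
rewrite normrN in b3.
have [x0|x0] := leP 0 (x ord0 l).
 have hc : 3 <= cr (x ord0 l) - (q l)%:R.
  rewrite lerBrDr /crd ler_pdivlMr// mulrDl; move: hl; rewrite ger0_norm//; have := h1; lra.
 rewrite /g; case: (l == j); last by rewrite bsp_0// hc orbT. by rewrite !Bsp_1 ?subrr//; lra.
have hc : cr (x ord0 l) + 1 - (q l)%:R <= 0.
 rewrite subr_le0 -lerBrDr /crd ler_pdivrMr// mulrBl; move: hl; rewrite ltr0_norm//. have := h1; have := h0; lra.
rewrite /g; case: (l == j); last by rewrite bsp_0//; apply/orP; left; lra.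
by rewrite !Bsp_0 ?subrr//; lra.
Qed.

(** The zero field, written as an empty sum, is a test field. *)
Let var_ge0 : 0 <= V.
Proof.
have t0 x : tfield [::] (fun=> 0) g x = 0 by rewrite /tfield big_nil.
have [||tf dE] := @tfield_test_field R n idx [::] (fun=> 0) g g' g_derive g'_continuous j 0.
- move=> x _; exact: t0.
- by move=> x; rewrite t0 normr0.
rewrite -lee_fin; apply: le_trans uV; apply: ereal_sup_ubound.
eexists; split; first exact: tf.
rewrite (_ : (fun x => _) = fun=> 0) ?I0//; apply/funext => x.
by rewrite dE (partial_tfield _ _ g_derive) big_nil mulr0.
Qed.

(** The L^1 norm of the derivative is controlled by the sum of the absolute differences d q of
    neighbouring means. With the signs of the d q as coefficients, that sum is the pairing of u with
    the divergence of one field of norm at most 1. The constant is (3h)^n from the kernels [omj]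
    over (h/2)^n from [bmass_gt0]. *)
Lemma moll_partial : I (fun x => `|partial j (moll h r u) x|) <= 6 ^+ n * V.
Proof.
have h01 : h <= 1 by have := h1; have := h0; lra.
pose d (q : idx) := bavg h u (nd q) - bavg h u (nd q - h *: e_ j).
have bur : bsupp (r + 1) (bavg h u) by exact: bavg_bsupp.
have E x : partial j (moll h r u) x = \sum_(q : idx) h^-1 * d q * omj j q x by rewrite /moll partial_Ih.
have lo (q : idx) := L1_omj j h0 q.
apply: (via (I (fun x => \sum_(q : idx) h^-1 * `|d q| * omj j q x))).
 apply: I_le; [apply: L1_abs| |].
 - apply: partial_L1; exact: moll_lipb.
 - apply: L1_sum => q _; apply: L1Z; exact: (lo q).1.
 move=> x; rewrite E; apply: le_norm_sum; apply: ler_sum => q _.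
 by rewrite !normrM gtr0_norm ?invr_gt0// (ger0_norm (omj_ge0 _ _ _)).
rewrite I_sum => [|q _]; last by apply: L1Z; exact: (lo q).1.
apply: (via (h^-1 * (3 * h) ^+ n * \sum_(q : idx) `|d q|)).
 rewrite mulr_sumr; apply: ler_sum => q _; have [l1 l2] := lo q. rewrite IZ// [X in _ <= X]mulrAC.
 by apply: ler_wpM2l => //; rewrite mulr_ge0// invr_ge0 ltW.
pose ep q : R := Num.sg (d q).
have ep1 q : `|ep q| <= 1 by rewrite normr_sg; case: (_ != _).
have [tf divE] := tfield_test_field g_derive g'_continuous j (@field_bsupp ep) (fun x => field_le1 x ep1).
have m0 := @bmass_gt0 R n h h0.
have m1 : 0 < @bmass R n h by apply: lt_le_trans m0; rewrite exprn_gt0// divr_gt0.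
have hS : \sum_(q : idx) `|d q| <= (@bmass R n h)^-1 * (h * V).
 have -> : \sum_(q : idx) `|d q| = (@bmass R n h)^-1 * (h * I (fun x => u x * divergence (fun x => tfield (index_enum idx) ep g x *: e_ j) x)).
  have l1 (q : idx) : L1 mu (fun x => ep q * (u x * kd q x)) by exact: L1Z.
  have l2 : L1 mu (fun x => h^-1 * \sum_(q : idx) ep q * (u x * kd q x)) by apply: L1Z; exact: L1_sum.
  rewrite (_ : (fun x => u x * _) = fun x => h^-1 * \sum_(q : idx) ep q * (u x * kd q x)); last first.
   apply/funext => x; rewrite divE (partial_tfield _ _ g_derive) mulr_sumr mulr_sumr.
   apply: eq_bigr => q _; rewrite -kdE; field; rewrite gt_eqF//.
  rewrite IZ; last exact: L1_sum. rewrite mulrA mulfV ?gt_eqF// mul1r I_sum// mulr_sumr; apply: eq_bigr => q _.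
  by rewrite IZ// mulrCA -diff_bavg normrEsg.
 apply: ler_wpM2l; first by rewrite invr_ge0 ltW. apply: ler_wpM2l; first exact: ltW.
 rewrite -lee_fin; apply: le_trans uV; apply: ereal_sup_ubound.
 by exists (fun x => tfield (index_enum idx) ep g x *: e_ j); split.
apply: (via (h^-1 * (3 * h) ^+ n * (((h / 2) ^+ n)^-1 * (h * V)))).
 apply: ler_wpM2l; first by rewrite mulr_ge0 ?invr_ge0 ?exprn_ge0 ?mulr_ge0// ltW.
 apply: (le_trans hS); apply: ler_wpM2r; first by rewrite mulr_ge0// ltW.
 by rewrite lef_pV2 ?posrE// exprn_gt0// divr_gt0.
have -> : h^-1 * (3 * h) ^+ n * (((h / 2) ^+ n)^-1 * (h * V)) = ((3 * h) ^+ n * ((h / 2)^-1) ^+ n) * V.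
 by rewrite exprVn; field; rewrite expf_neq0 ?mulf_neq0 ?invr_neq0 ?gt_eqF.
rewrite -exprMn (_ : 3 * h * (h / 2)^-1 = 6)//; field; rewrite gt_eqF//.
Qed.

End smoothed.

(** * Mass and boundary mass of the current of a density *)

Section mass.
Context {R} {p : nat}.
Local Notation n := p.+1.
Local Notation V := ('rV[R]_n -> R).
Implicit Types (u w : V).
Lemma seminorm1_lipc (f : V) : (holder_seminorm 1 f <= 1%:E)%E -> lipc n%:R f.
Proof. by move/(seminorm_hol ltr01); rewrite mul1r powRr1//; move/lipc_hol. Qed.

Lemma mass_current_of u r : L1 mu u -> bsupp r u ->
 (mass (current_of u) <= (n`!%:R * n%:R ^+ n * I (fun x => `|u x|))%:E)%E.
Proof.
move=> lu ur; apply: ub_ereal_sup => _ [N [F [lF F1 FL ->]]]; rewrite lee_fin.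
have lt l := current_L1 lu ur (lF l).
rewrite (eq_bigr (fun l => I (fun x => u x * (F l ord0 x * detD (tl (F l)) x)))) => [|l _]; last exact: current_ofE.
rewrite -I_sum => [|l _]; last exact: lt.
apply: (le_trans (ler_norm _)); rewrite -IZ; last exact: L1_abs.
apply: I_abs_le; [by apply: L1_sum => l _; exact: lt|by apply/L1Z/L1_abs|].
move=> x; rewrite -mulr_sumr normrM mulrC ler_wpM2r//.
apply: le_norm_sum.
apply: (via (\sum_l `|F l ord0 x| * (n`!%:R * n%:R ^+ n))); last first.
 by rewrite -mulr_suml ler_piMl// mulr_ge0// exprn_ge0.
apply: ler_sum => l _; rewrite normrM ler_wpM2l//.
have := @detD_bound R n (tl (F l)) (fun=> n%:R) x; rewrite prodr_const card_ord; apply => // i.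
apply: seminorm1_lipc; exact: FL.
Qed.

(** Functions with Euclidean Lipschitz constant 1 have partial derivatives at most n, so n! n^p
    bounds a determinant with p such rows, the remaining row being a gradient. The factor n 6^n is
    the bound [moll_partial] for the n entries of that gradient. *)
Definition Kbd : R := n`!%:R * n%:R ^+ p * (n%:R * 6 ^+ n).

Lemma boundary_current_of u G : lip_tuple G -> boundary (current_of u) G = I (fun x => u x * detD G x).
Proof. by apply: represents_boundary. Qed.

(** For a mollified density integration by parts puts its gradient into one row of the determinants,
    and the condition on the first functions bounds the whole family under one integral. The bound
    passes to u by convergence in L^1, as the finitely many determinants are bounded. *)
Lemma mass_boundary_current_of u r W : L1 mu u -> bsupp r u -> (div_variation u <= W%:E)%E ->
 (mass (boundary (current_of u)) <= (Kbd * W)%:E)%E.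
Proof.
move=> lu ur uW; apply: ub_ereal_sup => _ [N [F [lF F1 FL ->]]]; rewrite lee_fin.
rewrite (eq_bigr (fun l => I (fun x => u x * detD (F l) x))) => [|l _]; last exact: boundary_current_of.
have /choice[L hL] : forall l, exists L, 0 <= L /\ forall i, lipc L (F l i) by move=> l; exact: lip_tuple_max.
pose K l : R := n`!%:R * \prod_(i < n) L l.
have K0 l : 0 <= K l by rewrite mulr_ge0// prodr_ge0// => i _; exact: (hL l).1.
have dK l x : `|detD (F l) x| <= K l by apply: detD_bound => i; [exact: (hL l).1|exact: (hL l).2].
have md l : mfun (detD (F l)) by apply: detD_mf => i; exact: lipc_cont ((hL l).2 i).
have lud w l : L1 mu w -> L1 mu (fun x => w x * detD (F l) x) by move=> lw; exact: (L1M lw (md l) (dK l)).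
pose m k := moll (hk k / 3) (r + 1) u.
have h0 k : 0 < hk k / 3 :> R by rewrite divr_gt0// hk_gt0.
have h1 k : 3 * (hk k / 3) <= 1 :> R by rewrite mulrC divfK// hk_le1.
have bm k : lipb (m k) by exact: moll_lipb.
have ur1 : bsupp (r + 1) u by apply: bsuppW ur; rewrite lerDl.
have mb k : \sum_l I (fun x => m k x * detD (F l) x) <= Kbd * W.
 have lg j : L1 mu (partial j (m k)) by exact: partial_L1.
 have Ll l i : exists L, 0 <= L /\ lipc L (F l i) by exists (L l); split; [exact: (hL l).1|exact: (hL l).2].
 have Gl l : L1 mu (fun x => F l ord0 x * detD (upd (F l) ord0 (m k)) x).
  have ld : L1 mu (detD (upd (F l) ord0 (m k))).
   apply: (@L1_detD _ _ _ ord0) => [i|]; last by rewrite updE. rewrite /tuple_upd; case: ifP => _ //.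
   by have [M [s [M0 mM _]]] := bm k; exists M.
  under eq_fun do rewrite mulrC. apply: (L1M (C := 1) ld); first exact: lipc_mfun ((hL l).2 ord0).
  move=> x; apply: le_trans (F1 x); rewrite (bigD1 l)//= lerDl sumr_ge0//.
 rewrite (eq_bigr (fun l => - I (fun x => F l ord0 x * detD (upd (F l) ord0 (m k)) x))); last first.
  move=> l _; rewrite -(I_detD_parts ord0 (Ll l) (bm k) (Ll l ord0)). by rewrite upd_id.
 rewrite sumrN -I_sum => [|l _]; last exact: Gl. apply: (le_trans (ler_norm _)); rewrite normrN.
 apply: (via (I (fun x => n`!%:R * n%:R ^+ p * \sum_j `|partial j (m k) x|))).
  apply: I_abs_le; [by apply: L1_sum => l _; exact: Gl|by apply/L1Z/L1_sum => j _; exact: L1_abs|].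
  move=> x; apply: le_norm_sum.
  apply: (via (\sum_l `|F l ord0 x| * (n`!%:R * n%:R ^+ p * \sum_j `|partial j (m k) x|))); last first.
   by rewrite -mulr_suml ler_piMl// !mulr_ge0 ?exprn_ge0// sumr_ge0.
  apply: ler_sum => l _; rewrite normrM ler_wpM2l//.
  have := @det_bound R n (\matrix_(i < n, j < n) partial j (upd (F l) ord0 (m k) i) x)
   (fun i => if i == ord0 then \sum_j `|partial j (m k) x| else n%:R).
  rewrite (_ : \prod_(i < n) (if i == ord0 then _ else _) = n%:R ^+ p * \sum_j `|partial j (m k) x|); last first.
   by rewrite big_ord_recl [X in X * _]/= mulrC prodr_const card_ord.
  rewrite mulrA. apply => i j; rewrite mxE /tuple_upd; case: (unliftP ord0 i) => [i' ->|->].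
   rewrite eq_sym (negbTE (neq_lift _ _)); apply: partial_bound => //. apply: seminorm1_lipc; exact: FL.
  by rewrite eqxx (bigD1 j)//= lerDl sumr_ge0.
 rewrite IZ; last by apply: L1_sum => j _; exact: L1_abs. rewrite /Kbd -!mulrA ler_wpM2l// ler_wpM2l ?exprn_ge0//.
 rewrite I_sum => [|j _]; last exact: L1_abs. apply: (via (\sum_(j < n) 6 ^+ n * W)).
  apply: ler_sum => j _; exact: moll_partial (h0 k) (h1 k) lu ur1 uW.
 by rewrite sumr_const card_ord -[leLHS]mulr_natl.
apply/ler_addgt0Pr => e e0.
pose S := \sum_l K l; have S0 : 0 <= S by rewrite sumr_ge0.
have e1 : 0 < e / (S + 1) by rewrite divr_gt0// ltr_wpDl.
have := moll_cvg lu ur => /cvgr0Pnorm_le /(_ _ e1)[k _ /(_ k (leqnn k))] hk.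
rewrite -[leLHS](subrK (\sum_l I (fun x => m k x * detD (F l) x))) addrC; apply: lerD (mb k) _.
rewrite -sumrB; apply: (via (\sum_l K l * I (fun x => `|m k x - u x|))).
 apply: ler_sum => l _; have lm := lipbL1 (bm k). rewrite -IB; [|exact: lud|exact: lud].
 rewrite -IZ; last by apply/L1_abs/L1B.
 apply: (le_trans (ler_norm _)); apply: I_abs_le; [by apply: L1B; exact: lud|by apply/L1Z/L1_abs/L1B|].
 by move=> x; rewrite -mulrBl normrM distrC mulrC ler_wpM2r.
rewrite -mulr_suml -/S; apply: (via (S * (e / (S + 1)))).
 apply: ler_wpM2l => //; apply: le_trans hk; exact: ler_norm.
rewrite mulrCA ler_piMr ?(ltW e0)// ler_pdivrMr ?ltr_wpDl// mul1r lerDl//.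
Qed.

End mass.

(** * Series of functions of bounded variation give fractal currents *)

Section fractal.
Context {R} {p : nat}.
Local Notation n := p.+1.
Local Notation V := ('rV[R]_n -> R).
Implicit Types (u w : V).
Lemma geometric_series_lty (a : nat -> \bar R) (c q : R) : (forall k, (0 <= a k)%E) ->
 0 <= c -> 0 <= q -> q < 1 -> (forall k, (a k <= (c * q ^+ k)%:E)%E) ->
 (\sum_(0 <= k <oo) a k < +oo)%E.
Proof.
move=> a0 c0 q0 q1 ha; apply: (@le_lt_trans _ _ (c / (1 - q))%:E); last exact: ltry.
apply: lime_le; first by apply: is_cvg_nneseries => k _ _.
apply: nearW => N; rewrite big_mkord.
apply: (via (\sum_(k < N) (c * q ^+ k)%:E)%E); first exact: lee_sum.
rewrite sumEFin lee_fin -mulr_sumr ler_wpM2l//.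
rewrite -[leRHS]mul1r ler_pdivlMr ?subr_gt0//.
have -> : (\sum_(k < N) q ^+ k) * (1 - q) = 1 - q ^+ N by rewrite -opprB mulrN mulrC -subrX1 opprB.
by rewrite gerBl exprn_ge0.
Qed.

Lemma ess_spt_aesupp u r : L1c u -> ess_spt u `<=` [set x | `|x| <= r] -> aesupp (r + 1) u.
Proof.
move=> lu ur; have [s [s0 us]] := L1c_aesupp lu.
pose A := [set x : 'rV[R]_n | r + 1 <= `|x|] `&` [set x | `|x| <= s].
have cA : compact A by exact: compact_annulus.
have A0 : A `&` ess_spt u = set0.
 apply/seteqP; split => // x [[/= x1 _] /ur /= x2]; lra.
have := negligible_compact cA A0; apply: filterS2 us => x u1 u2 xr.
by have [xs|xs] := leP `|x| s; [apply: u2; split => //=; exact: ltW|exact: u1].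
Qed.

Lemma zero_metric_current m : metric_current ((fun _ => 0) : functional R n m).
Proof.
apply: (@hc_build _ _ _ _ _ _ 0) => //.
by move=> F i c h1 h2 _ _ _; rewrite mulr0 addr0.
move=> Fk F L _ _ _ _; exact: cvg_cst.
Qed.

Lemma mass_ge0 m (T : functional R n m) : (0 <= mass T)%E.
Proof.
apply: ereal_sup_ubound; exists 0%N, (fun _ _ _ => 0).
by split; [case|move=> x; rewrite big_ord0|case|rewrite big_ord0].
Qed.

Lemma mass_zero m : mass ((fun _ => 0) : functional R n m) = 0%E.
Proof.
apply/eqP; rewrite eq_le mass_ge0 andbT.
by apply: ub_ereal_sup => _ [N [F [_ _ _ ->]]]; rewrite big1.
Qed.

Lemma represents_metric u (T : functional R n n) : L1c u -> represents u T -> metric_current T.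
Proof. by move=> lu uT; apply: (hc_ext (fun _ => ltr01) uT); exact: current_metric. Qed.

(** The decomposition has R_k = [[u_k]], S_k = 0 and both bases equal to 2. Two of the series
    vanish; the other two are dominated by geometric series of ratio 2^(d - delta), which is less
    than 1 because d < delta. *)
Lemma fractal_of_series (T : functional R n n) (d delta C : R) u (uk : nat -> V) :
 d < delta -> 0 <= C -> L1c u -> represents u T -> (forall k, BVc (uk k)) ->
 L1norm (fun x => u x - \sum_(0 <= k < N) uk k x) @[N --> \oo] --> 0%E ->
 bounded_set (\bigcup_k ess_spt (uk k)) ->
 (forall k, (L1norm (uk k) <= (C * 2 `^ (k%:R * (d - n%:R)))%:E)%E /\
   (div_variation (uk k) <= (C * 2 `^ (k%:R * (d - p%:R)))%:E)%E) ->
 fractal n%:R delta T.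
Proof.
move=> dd C0 lcu uT bv ucvg [M0 [_ hM]] ub; split; first exact: represents_metric lcu uT.
have [s [s0 us]] := L1c_aesupp lcu.
(* The first 1 comes from the strict inequality in boundedness, the second from [ess_spt_aesupp]. *)
pose r := Num.max s (M0 + 1 + 1).
have us' : aesupp r u by move: us; apply: filterS => x h xr; apply: h; apply: le_lt_trans xr; rewrite le_max lexx.
have ks k : aesupp r (uk k).
 have : aesupp (M0 + 1 + 1) (uk k).
  apply: ess_spt_aesupp; first exact: (bv k).1. by move=> x hx /=; apply: (hM (M0 + 1)); [rewrite ltrDl|exists k].
 by apply: filterS => x h xr; apply: h; apply: le_lt_trans xr; rewrite le_max lexx orbT.
have lu : L1 mu u by exact: lcu.1.
have lk k : L1 mu (uk k) by exact: (bv k).1.1.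
(* Representatives that vanish at every point outside one common ball. *)
pose u' := bcut r u; pose v k := bcut r (uk k).
have lu' : L1 mu u' by exact: cut_L1.
have lv k : L1 mu (v k) by exact: cut_L1.
have u'r : bsupp r u' by exact: cut_bsupp.
have vr k : bsupp r (v k) by exact: cut_bsupp.
have uu : {ae mu, forall x, u x = u' x} by exact: cut_ae.
have kv k : {ae mu, forall x, uk k x = v k x} by exact: cut_ae.
have vn k : I (fun x => `|v k x|) <= C * 2 `^ (k%:R * (d - n%:R)).
 rewrite -lee_fin -L1_EFin; last exact: L1_abs. apply: le_trans (ub k).1; rewrite /L1norm L1_EFin; last exact: L1_abs.
 rewrite L1_EFin; last exact: L1_abs. rewrite lee_fin (@I_ae _ _ _ _ (fun x => `|v k x|) (fun x => `|uk k x|))//.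
 - apply: L1_mfun; exact: (L1_abs (lv k)).
 - apply: L1_mfun; exact: (L1_abs (lk k)).
 - by apply: filterS (kv k) => x ->.
have vV k : (div_variation (v k) <= (C * 2 `^ (k%:R * (d - p%:R)))%:E)%E.
 apply: le_trans (ub k).2; apply: ub_ereal_sup => _ [phi [tphi ->]].
 apply: ereal_sup_ubound; exists phi; split => //; congr EFin; apply: I_ae.
 - apply: L1_mfun; exact: (I_divergence (lv k) tphi).1.
 - apply: L1_mfun; exact: (I_divergence (lk k) tphi).1.
 - by apply: filterS (kv k) => x ->.
have mk k := mass_current_of (lv k) (vr k).
have bk k := mass_boundary_current_of (lv k) (vr k) (vV k).
have K0 : 0 <= n`!%:R * n%:R ^+ n :> R by rewrite mulr_ge0// exprn_ge0.
have B0 : 0 <= @Kbd R p by rewrite !mulr_ge0 ?exprn_ge0.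
have q1 : 2 `^ (d - delta) < 1 :> R.
 rewrite -[d - delta]opprB powRN invf_lt1 ?powR_gt0//. have d0 : 0 < delta - d by rewrite subr_gt0.
 by have := gt0_ltr_powR d0 (x := 1) (y := 2); rewrite powR1; apply; rewrite ?nnegrE// ltr1n.
have sptin (f : V) : bsupp r f -> spt (current_of f) `<=` [set x | `|x| <= r].
 move=> fr; apply: hspt_sub; first exact: closed_normle. move=> F _ F0; exact: current_off fr F0.
pose Z m : functional R n m := fun _ => 0.
have bZ m : boundary (Z m.+1) = Z m by [].
have sZ m : spt (Z m) `<=` [set x | `|x| <= r] by apply: hspt_sub => //; exact: closed_normle.
exists [set x | `|x| <= r], (fun k => current_of (v k)), (fun k => Z p.+2), 2, 2.
split.
- exact: compact_normle.
- move=> k; split => //.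
 + split; first exact: current_metric_bsupp (lv k) (vr k).
  apply: (@le_lt_trans _ _ (_ + _)%:E); last exact: ltry. by rewrite EFinD; apply: leeD; [exact: mk|exact: bk].
 + split; first exact: zero_metric_current.
  by rewrite bZ /Z !mass_zero adde0 ltry.
 + exact: sptin.
- by rewrite ltr1n.
- split.
  exists [set x | `|x| <= r]; split; first exact: compact_normle.
   rewrite /spt (@holder_spt_ext _ _ _ _ (current_of u')).
   - exact: sptin.
   - move=> F lF; rewrite uT// (current_of_ae _ _ uu)//; [exact: (L1_mfun lu)|exact: (L1_mfun lu')].
  move=> k; apply: hspt_sub; first exact: closed_normle.
  by move=> F _ F0; rewrite big1// => j _; rewrite (current_off (vr j) F0) addr0.
 move=> F lF; have [L [L0 FL]] := lip_tuple_max lF. pose A := `|F ord0 0| + L * `|r|.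
 pose c := A * (@cD R p * \prod_(i < n) L).
 have lS N : L1 mu (fun x => \sum_(k < N) v k x - u' x) by apply: L1B => //; apply: L1_sum.
 have E N : \sum_(0 <= k < N) (current_of (v k) F + boundary (Z p.+2) F) - T F =
   current_of (fun x => \sum_(k < N) v k x - u' x) F.
  rewrite uT// (current_of_ae (L1_mfun lu) (L1_mfun lu') uu lF) big_mkord.
  rewrite (eq_bigr (fun k : 'I_N => I (fun x => v k x * (F ord0 x * detD (tl F) x)))); last first.
   by move=> k _; rewrite addr0 current_ofE.
  have lvW k := current_L1 (lv k) (vr k) lF. have lW := current_L1 lu' u'r lF.
  rewrite !current_ofE -I_sum// -IB//; last exact: L1_sum.
  by congr Rintegral; apply/funext => x; rewrite mulrBl mulr_suml.
 have cS : c * I (fun x => `|\sum_(k < N) v k x - u' x|) @[N --> \oo] --> 0.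
  rewrite -[X in _ --> X](mulr0 c); apply: cvgM; first exact: cvg_cst.
  have [_ h] := (fine_cvgP _ _).1 ucvg; apply: cvg_trans h; apply: near_eq_cvg; apply: nearW => N /=.
  have luk : L1 mu (fun x => u x - \sum_(0 <= k < N) uk k x) by apply: L1B => //; apply: L1_sum.
  rewrite /L1norm L1_EFin /=; last exact: L1_abs. apply: I_ae.
  - exact: L1_mfun (L1_abs luk).
  - exact: L1_mfun (L1_abs (lS N)).
  have /ae_foralln kv' := kv.
  by move: uu kv'; apply: filterS2 => x -> hx; rewrite distrC big_mkord; congr (`|_ - _|); apply: eq_bigr.
 apply/cvgrPdist_le => e e0; move/cvgr0Pnorm_le: cS => /(_ e e0); apply: filterS => N; apply: le_trans.
 rewrite distrC E; apply: le_trans (ler_norm _). have sr : bsupp r (fun x => \sum_(k < N) v k x - u' x).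
  move=> x hx; rewrite u'r// big1 ?subr0// => k _; exact: vr.
 apply: (current_bound (lS N) sr lF) => //.
 - by rewrite addr_ge0// mulr_ge0.
 - move=> x xr; exact: (lip_bound_ball L0 (FL ord0)).
 - move=> i; exact: FL.
have geo c e (F : nat -> \bar R) : 0 <= c -> (forall k, 0 <= F k)%E ->
  (forall k, F k <= (c * (C * 2 `^ (k%:R * (d - e))))%:E)%E ->
  (\sum_(0 <= k <oo) F k * (2 `^ (k%:R * (e - delta)))%:E < +oo)%E.
 move=> c0 F0 hF; apply: (@geometric_series_lty _ (c * C) (2 `^ (d - delta))) => //.
 - by move=> k; apply: mule_ge0; rewrite ?lee_fin ?powR_ge0.
 - by rewrite mulr_ge0.
 move=> k; apply: (via ((c * (C * 2 `^ (k%:R * (d - e))))%:E * (2 `^ (k%:R * (e - delta)))%:E)%E).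
  by apply: lee_wpmul2r; rewrite ?lee_fin ?powR_ge0.
 rewrite -EFinM lee_fin -!mulrA -powRD ?pnatr_eq0 ?implybT//.
 rewrite -mulrDr (_ : d - e + (e - delta) = d - delta); last by ring.
 by rewrite [k%:R * _]mulrC powRrM powR_mulrn ?powR_ge0.
split.
- by rewrite eseries0 ?ltry// => k _ _; rewrite mass_zero mul0e.
- by rewrite eseries0 ?ltry// => k _ _; rewrite bZ mass_zero mul0e.
- apply: (geo (n`!%:R * n%:R ^+ n)) => // k; first exact: mass_ge0.
 by apply: (le_trans (mk k)); rewrite lee_fin ler_wpM2l.
- apply: (geo (@Kbd R p)) => // k; exact: mass_ge0.
Qed.

End fractal.

(** * Values of currents in terms of mass and boundary mass *)

Section mass_bounds.
Context {R} {p : nat}.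
Local Notation n := p.+1.
Local Notation V := ('rV[R]_n -> R).
(** Scaling every slot gives a normalised tuple, which is an admissible family with one member. The
    extra factor e in the first slot supplies the sign of T F. *)
Lemma mass_bound m (T : functional R n m) (M : R) F (A : R) (L : 'I_m -> R) :
 mlin (fun=> lip) T -> (mass T <= M%:E)%E -> lip_tuple F -> 0 < A -> (forall x, `|F ord0 x| <= A) ->
 (forall i, 0 < L i) -> (forall i, lipc (L i) (tl F i)) -> `|T F| <= M * (A * \prod_i L i).
Proof.
move=> mT hM lF A0 FA L0 FL.
pose c (i : 'I_m.+1) : R := oapp (fun j => (L j)^-1) A^-1 (unlift ord0 i).
pose G (e : R) (i : 'I_m.+1) : V := fun x => (if i == ord0 then e else 1) * (c i * F i x).
have c0 : c ord0 = A^-1 by rewrite /c unlift_none.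
have cS j : c (sc j) = (L j)^-1 by rewrite /c liftK.
have lipZ a f : lip f -> lip (fun x => a * f x).
 by move=> lf; rewrite (_ : (fun x => _) = fun x => a * f x + 0);
  [apply: lip_lin => //; exact: lip_cst|apply/funext => x; rewrite addr0].
have lcF i : lip (fun x => c i * F i x) by exact: lipZ.
have TG e : T (G e) = e * ((A * \prod_i L i)^-1 * T F).
 rewrite /G (mlin_scale (P := fun=> lip) (F := fun i x => c i * F i x) (fun i => if i == ord0 then e else 1))//.
 - rewrite (mlin_scale (P := fun=> lip) c)//.
  + rewrite !big_ord_recl eqxx c0 big1 ?mulr1; last by [].
   by rewrite (eq_bigr (fun j => (L j)^-1)) ?prodfV ?invfM// => j _; rewrite cS.
  + move=> i; exact: lip_lin.
  + move=> i; exact: lip_cst.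
 - move=> i; exact: lip_lin.
 - move=> i; exact: lip_cst.
have P0 : 0 < A * \prod_i L i by rewrite mulr_gt0// prodr_gt0.
have key e : `|e| <= 1 -> e * ((A * \prod_i L i)^-1 * T F) <= M.
 move=> e1; rewrite -TG -lee_fin; apply: le_trans hM; apply: ereal_sup_ubound. exists 1%N, (fun=> G e); split.
 - move=> _ i; exact: lipZ.
 - move=> x; rewrite big_ord_recl big_ord0 addr0 /G eqxx c0 normrM.
  rewrite -[leRHS]mul1r; apply: ler_pM => //.
  by rewrite normrM (gtr0_norm (x := A^-1)) ?invr_gt0// ler_pdivrMl// mulr1.
 - move=> _ i; apply: hol_seminorm => //; rewrite ?ler01//.
  move=> x y; rewrite /G eq_sym (negbTE (neq_lift _ _)) !mul1r cS -mulrBr normrM gtr0_norm ?invr_gt0//.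
  rewrite powRr1// ler_pdivrMl//; exact: FL.
 - by rewrite big_ord_recl big_ord0 addr0.
have := key (Num.sg (T F)); rewrite normr_sg.
have -> : Num.sg (T F) * ((A * \prod_i L i)^-1 * T F) = (A * \prod_i L i)^-1 * `|T F| by rewrite normrEsg mulrCA.
rewrite ler_pdivrMl// mulrC; apply.
by case: (_ != _).
Qed.

Variable N : functional R n n.
Hypothesis hN : metric_current N.
Variables (M B : R).
Hypotheses (NM : (mass N <= M%:E)%E) (NB : (mass (boundary N) <= B%:E)%E).
Hypotheses (M0 : 0 <= M) (B0 : 0 <= B).

(* N(f; D@i) = N(1; fD@i) - N(D; f@i) *)
Lemma normal_slot_bound f D G (i : 'I_n) (sf sD Lf : R) (L : 'I_n -> R) :
 lipbd f -> lipbd D -> lip_tuple G -> 0 < sf -> 0 < sD -> 0 < Lf -> (forall l, 0 < L l) ->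
 (forall x, `|f x| <= sf) -> (forall x, `|D x| <= sD) -> lipc Lf f -> (forall l, lipc (L l) (G l)) ->
 `|N (tcons f (upd G i D))| <=
 B * (sf * sD * \prod_(l | l != i) L l) + M * (sD * (Lf * \prod_(l | l != i) L l)).
Proof.
move=> bf bD lG sf0 sD0 Lf0 L0 fs Ds fL GL.
have lf := bd_lip bf; have lD := bd_lip bD; have lfD := bd_lip (lipbdM bf bD).
have e1 : N (tcons f (upd G i D)) =
  N (tcons (fun=> 1) (upd G i (fun x => f x * D x))) - N (tcons D (upd G i f)).
 rewrite (mc_prod hN (h := fun=> 1))//; last exact: lipbd_cst.
 have -> : (fun x => f x * 1) = f by apply/funext => x; rewrite mulr1.
 have -> : (fun x => D x * 1) = D by apply/funext => x; rewrite mulr1. by rewrite addrK.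
rewrite e1; apply: le_normB; apply: lerD.
 pose G' := upd G i (fun x => f x * D x). have lG' : lip_tuple G' by exact: lip_upd.
 have -> : `|N (tcons (fun=> 1) G')| = `|boundary N (G' \o tperm ord0 i)|.
  have [->|i0] := eqVneq i ord0.
   by rewrite /boundary (_ : _ \o _ = G')//; apply/funext => j /=; rewrite tperm1 perm1.
  by rewrite /boundary (mc_swap hN)// ?normrN//; [exact: lip_cst|rewrite eq_sym].
 pose L' (l : 'I_p) := L (tperm ord0 i (sc l)). have -> : \prod_(l | l != i) L l = \prod_l L' l.
  rewrite (reindex_inj (@perm_inj _ (tperm ord0 i))) /=. rewrite (eq_bigl (fun l => l != ord0)) => [|l]; last first.
   by rewrite -{2}(tpermL ord0 i) (inj_eq perm_inj).
  by rewrite big_mkcond big_ord_recl /= mul1r.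
 apply: mass_bound => //.
 - exact: boundary_mlin hN.
 - move=> j; exact: lG'.
 - exact: mulr_gt0.
 - move=> x; rewrite /= tpermL /G' updE normrM; exact: ler_pM.
 - move=> l; exact: L0.
 - move=> l; rewrite /tl /= /G' updN; first exact: GL.
  by rewrite -[X in _ != X](tpermL ord0 i) (inj_eq perm_inj) eq_sym neq_lift.
have := @mass_bound n N M (tcons D (upd G i f)) sD (fun l => if l == i then Lf else L l) (mc_mlin hN) NM.
rewrite (bigD1 i)//= eqxx (eq_bigr L) => [|l /negbTE ->//]; apply => //.
- apply: lip_cons => //; exact: lip_upd.
- by move=> x; rewrite tcons0.
- by move=> l; case: ifP.
- by move=> l; rewrite tl_cons /tuple_upd; case: ifP.
Qed.

End mass_bounds.

(** * Normal currents on interpolations at consecutive scales *)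

Section approximation_scale.
Context {R} {p : nat}.
Local Notation n := p.+1.
Local Notation V := ('rV[R]_n -> R).
Variables (a : 'I_n.+1 -> R) (d q r B : R).
Hypotheses (a01 : forall i, 0 < a i <= 1) (q1 : 1 < q) (B0 : 0 < B).
Hypotheses (hd : p%:R < d < n%:R) (asum : n%:R < \sum_i a i) (dsum : d <= \sum_(i < n) a (sc i)).

Let a0 i : 0 < a i. Proof. by case/andP: (a01 i). Qed.
Let a1 i : a i <= 1. Proof. by case/andP: (a01 i). Qed.
Let q0 : 0 < q. Proof. exact: lt_trans q1. Qed.
Definition hj (j : nat) : R := q^-1 ^+ j.
Definition appr j (F : 'I_n.+1 -> V) : 'I_n.+1 -> V := fun i => Ih r (hj j) (F i).

Definition hclass (F : 'I_n.+1 -> V) := forall i,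
 [/\ bsupp r (F i), hol (a i) B (F i) & forall x, `|F i x| <= B].

Lemma hj_gt0 j : 0 < hj j. Proof. by rewrite exprn_gt0// invr_gt0. Qed.
Lemma hj_le j k : (j <= k)%N -> hj k <= hj j.
Proof.
by move=> jk; rewrite /hj ler_wiXn2l// ?invr_ge0 ?(ltW q0)// invf_le1// ltW.
Qed.
Lemma hj_le1 j : hj j <= 1. Proof. by have := hj_le (leq0n j); rewrite {2}/hj expr0. Qed.
Lemma hj_pow j (b : R) : hj j `^ b = (q `^ - b) ^+ j.
Proof.
have e : q^-1 = q `^ (-1) by rewrite powR_inv1// ltW.
rewrite /hj e -(powR_mulrn j (powR_ge0 q (-1))) -(powR_mulrn j (powR_ge0 q (- b))) -!powRrM.
by congr (_ `^ _); ring.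
Qed.
Lemma hj_cvg : hj j @[j --> \oo] --> 0.
Proof. by apply: cvg_expr; rewrite ger0_norm ?invr_ge0 ?(ltW q0)// invf_lt1. Qed.

(** One constant for three bounds: the Lipschitz constants at two consecutive scales, whose ratio
    costs q; the step between them, 6 = 3 + 3 interpolation errors; and the sup norms, for which it
    is at least 1. *)
Definition cQ : R := (8 * n%:R + 7) * q + 6.
Local Notation Q := (cQ * B).

Let cQ0 : 0 < cQ.
Proof. by rewrite ltr_wpDl// mulr_ge0 ?(ltW q0)// addr_ge0// mulr_ge0. Qed.
Let Q0 : 0 < Q. Proof. by rewrite mulr_gt0. Qed.

Lemma appr_close F j i x : hclass F -> `|appr j F i x - F i x| <= B * (3 * hj j `^ a i).
Proof.
by move=> /(_ i)[fr fL _]; exact: (Ih_close (hj_gt0 j) (hj_le1 j) fr (a0 i) (a1 i) (ltW B0) fL).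
Qed.

Lemma appr_lip F j i : hclass F -> lipc ((8 * n%:R + 7) * B * hj j `^ (a i - 1)) (appr j F i).
Proof.
by move=> /(_ i)[fr fL _]; exact: (Ih_lip (hj_gt0 j) (hj_le1 j) fr (a0 i) (a1 i) (ltW B0) fL).
Qed.

Lemma appr_bound F j i x : hclass F -> `|appr j F i x| <= Q.
Proof.
move=> /(_ i)[_ _ fB]; apply: (via B); last first.
 rewrite ler_peMl ?(ltW B0)// /cQ. have : 0 <= (8 * n%:R + 7) * q by rewrite mulr_ge0 ?(ltW q0)// addr_ge0// mulr_ge0.
 lra.
apply: le_norm_sum.
apply: (via (\sum_q0 B * `|om (r + 6) (hj j) q0 x|)).
 by apply: ler_sum => k _; rewrite normrM ler_wpM2r.
rewrite -mulr_sumr ler_piMr ?(ltW B0)//; exact: sum_om_abs.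
Qed.

Lemma lipb_appr F j i : lipb (appr j F i). Proof. exact: Ih_lipb (hj_gt0 j). Qed.
Lemma lip_appr F j : lip_tuple (appr j F).
Proof. by move=> i; apply: lipb_lip; exact: lipb_appr. Qed.

Lemma appr_lipQ F j k i : hclass F -> (j <= k <= j.+1)%N -> lipc (Q * hj j `^ (a i - 1)) (appr k F i).
Proof.
move=> hF jk; apply: lipcW (appr_lip k i hF).
have hp : hj k `^ (a i - 1) <= q * hj j `^ (a i - 1).
 move: jk => /andP[jk kj]; have [<-|jk'] := eqVneq j k.
  by rewrite ler_peMl ?powR_ge0// ltW.
 have -> : k = j.+1 by lia. rewrite !hj_pow exprS ler_wpM2r ?exprn_ge0 ?powR_ge0//.
 by rewrite -[leRHS]powRr1 ?(ltW q0)// ler_powR ?(ltW q1)//; have := a0 i; lra.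
have c0 : 0 <= (8 * n%:R + 7) * B by rewrite mulr_ge0 ?(ltW B0)// addr_ge0// mulr_ge0.
apply: (le_trans (ler_wpM2l c0 hp)).
have -> : (8 * n%:R + 7) * B * (q * hj j `^ (a i - 1)) = (8 * n%:R + 7) * q * B * hj j `^ (a i - 1) by ring.
by rewrite ler_wpM2r ?powR_ge0// ler_wpM2r ?(ltW B0)// /cQ lerDl.
Qed.

Lemma appr_step F j i x : hclass F -> `|appr j.+1 F i x - appr j F i x| <= Q * hj j `^ a i.
Proof.
move=> hF; have c1 := appr_close j i x hF; have c2 := appr_close j.+1 i x hF.
have h1 : hj j.+1 `^ a i <= hj j `^ a i by rewrite ge0_ler_powR ?nnegrE ?(ltW (a0 i)) ?(ltW (hj_gt0 _))// hj_le.
have hp : 0 <= hj j `^ a i by exact: powR_ge0.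
have -> : appr j.+1 F i x - appr j F i x = (appr j.+1 F i x - F i x) - (appr j F i x - F i x) by ring.
apply: le_normB.
have e1 : B * (3 * hj j.+1 `^ a i) <= B * (3 * hj j `^ a i) by rewrite ler_wpM2l ?(ltW B0)// ler_wpM2l.
apply: (via (6 * (B * hj j `^ a i))); first by lra.
rewrite -mulrA; apply: ler_wpM2r; first by rewrite mulr_ge0// ltW.
by rewrite /cQ lerDr mulr_ge0 ?(ltW q0)// addr_ge0// mulr_ge0.
Qed.

(** The gains in one step of scale: the power [eps] of the mesh accompanies the mass, the power
    [theta] the boundary mass. They are positive by the condition on the sum of all exponents and by
    d > n - 1. *)
Definition eps : R := \sum_i a i - n%:R.
Definition theta : R := d - p%:R.
Let eps0 : 0 < eps. Proof. by rewrite subr_gt0. Qed.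
Let theta0 : 0 < theta. Proof. by rewrite subr_gt0; case/andP: hd. Qed.

Lemma prod_pow m (P : pred 'I_m) (b : 'I_m -> R) (h : R) : 0 < h ->
 \prod_(i | P i) (Q * h `^ b i) = Q ^+ #|P| * h `^ (\sum_(i | P i) b i).
Proof.
move=> h0; rewrite big_split /= prodr_const; congr (_ * _).
apply: (big_rec2 (fun x y => x = h `^ y)); first by rewrite powRr0.
by move=> i x y _ ->; rewrite -powRD// (gt_eqF h0) implybT.
Qed.

Section normal.
Variable N : functional R n n.
Hypothesis hN : metric_current N.
Variables (M Bd : R).
Hypotheses (NM : (mass N <= M%:E)%E) (NB : (mass (boundary N) <= Bd%:E)%E).
Hypotheses (M0 : 0 <= M) (Bd0 : 0 <= Bd).

Let sumS : \sum_i a i = a ord0 + \sum_(i < n) a (sc i). Proof. exact: big_ord_recl. Qed.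
Let sum1 : \sum_(l < n) (a (sc l) - 1) = \sum_(i < n) a (sc i) - n%:R.
Proof. by rewrite sumrB sumr_const card_ord. Qed.

(** The step in slot i is D, of size h^(a i), while every other function has Lipschitz constant of
    order h^(a k - 1). In the first slot the mass alone gives h^eps. In another slot
    [normal_slot_bound] takes D out of the determinant: the boundary term has the exponent of a
    (lift ord0 k) summed over k, minus p, which is at least [theta], and the mass term has the
    exponent [eps]. *)
Lemma normal_step F j : hclass F -> `|N (appr j.+1 F) - N (appr j F)| <=
 n.+1%:R * Q ^+ n.+1 * (Bd * hj j `^ theta + M * hj j `^ eps).
Proof.
move=> hF; have h0 := hj_gt0 j; have h1 := hj_le1 j.
have lA := lip_appr F j.+1; have lB := lip_appr F j.
rewrite (mlin_telescope (mc_mlin hN) lA lB).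
apply: le_norm_sum.
have tE : (n.+1%:R * Q ^+ n.+1 * (Bd * hj j `^ theta + M * hj j `^ eps) : R) =
  \sum_(i < n.+1) Q ^+ n.+1 * (Bd * hj j `^ theta + M * hj j `^ eps).
 by rewrite sumr_const card_ord -[RHS]mulr_natl mulrA.
rewrite tE; apply: ler_sum => i _.
pose D x := appr j.+1 F i x - appr j F i x.
have bD : lipbd D.
 rewrite /D (_ : (fun x => _) = fun x => appr j.+1 F i x + -1 * appr j F i x); last first.
  by apply/funext => x; rewrite mulN1r.
 by apply: lipb_lipbd; apply: lipbD; [exact: lipb_appr|apply: lipbZ; exact: lipb_appr].
pose H := hyb (appr j.+1 F) (appr j F) i.
have lH : lip_tuple H by apply: (@hyb_P _ _ _ (fun=> lip)).
have HQ k : lipc (Q * hj j `^ (a k - 1)) (H k).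
 by rewrite /H /hyb; case: ifP => _; apply: appr_lipQ => //; rewrite leqnn leqnSn.
have Hb k x : `|H k x| <= Q by rewrite /H /hyb; case: ifP => _; exact: appr_bound.
have Db x : `|D x| <= Q * hj j `^ a i by exact: appr_step.
have Qh b : 0 < Q * hj j `^ b by rewrite mulr_gt0// powR_gt0.
have hth : hj j `^ (\sum_(k < n) a (sc k) - p%:R) <= hj j `^ theta by rewrite ger_powR ?h0// /theta lerD2r.
have hp b : 0 <= hj j `^ b by exact: powR_ge0.
have Qn : 0 <= Q ^+ n.+1 by rewrite exprn_ge0// ltW.
rewrite -/D -/H; case: (unliftP ord0 i) => [l il|i0].
 have -> : upd H i D = tcons (H ord0) (upd (tl H) l D) by rewrite il tcons_upd tconsE.
 have bH : lipbd (H ord0) by rewrite /H /hyb; case: ifP => _; apply: lipb_lipbd; exact: lipb_appr.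
 have := normal_slot_bound hN NM NB l bH bD (lip_tl lH) Q0 (Qh (a i)) (Qh (a ord0 - 1))
  (fun k => Qh (a (sc k) - 1)) (Hb ord0) Db (HQ ord0) (fun k => HQ (sc k)).
 move/le_trans; apply; rewrite prod_pow//. have card : #|[pred k : 'I_n | k != l]| = p by rewrite cardC1 card_ord.
 have sE : \sum_(k < n | k != l) (a (sc k) - 1) = \sum_(k < n) a (sc k) - a i - p%:R.
  by have := sum1; rewrite il (bigD1 l)//= -natr1 => e; lra.
 rewrite sE (_ : Q ^+ #|_| = Q ^+ p); last by rewrite -[in RHS]card. have h0' : (hj j == 0) = false by rewrite gt_eqF.
 have e1 : Q * (Q * hj j `^ a i) * (Q ^+ p * hj j `^ (\sum_(k < n) a (sc k) - a i - p%:R)) =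
   Q ^+ n.+1 * hj j `^ (\sum_(k < n) a (sc k) - p%:R).
  have -> : \sum_(k < n) a (sc k) - p%:R = a i + (\sum_(k < n) a (sc k) - a i - p%:R) by ring.
  by rewrite [in RHS]powRD ?h0' ?implybT// !exprS; ring.
 have e2 : Q * hj j `^ a i * (Q * hj j `^ (a ord0 - 1) * (Q ^+ p * hj j `^ (\sum_(k < n) a (sc k) - a i - p%:R))) =
   Q ^+ n.+1 * hj j `^ eps.
  have -> : eps = a i + (a ord0 - 1 + (\sum_(k < n) a (sc k) - a i - p%:R)).
   by rewrite /eps sumS -natr1; ring.
  by rewrite [in RHS]powRD ?h0' ?implybT// [in RHS]powRD ?h0' ?implybT// !exprS; ring.
 rewrite e1 e2 mulrDr; apply: lerD; last by rewrite mulrCA. by rewrite mulrCA ler_wpM2l// ler_wpM2l.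
have := @mass_bound R p n N M (upd H i D) (Q * hj j `^ a i) (fun k => Q * hj j `^ (a (sc k) - 1)) (mc_mlin hN) NM.
rewrite prod_pow// sum1 i0 => hb.
apply: (via (Q ^+ n.+1 * (M * hj j `^ eps))); last first.
 by rewrite ler_wpM2l// lerDr mulr_ge0.
apply: (le_trans (hb _ _ _ _ _)) => //.
- apply: lip_upd => //; exact: bd_lip.
- by move=> x; rewrite updE -i0.
have -> : eps = a ord0 + (\sum_(k < n) a (sc k) - n%:R) by rewrite /eps sumS; ring.
rewrite powRD ?(gt_eqF h0) ?implybT// (_ : Q ^+ #|_| = Q ^+ n); last by rewrite card_ord.
by rewrite [in X in _ <= X]exprS le_eqVlt; apply/orP; left; apply/eqP; ring.
Qed.

Lemma normal_value F j : hclass F -> `|N (appr j F)| <= Q ^+ n.+1 * (M * hj j `^ (d - n%:R)).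
Proof.
move=> hF; have h0 := hj_gt0 j; have h1 := hj_le1 j.
have Qh b : 0 < Q * hj j `^ b by rewrite mulr_gt0// powR_gt0.
have := @mass_bound R p n N M (appr j F) Q (fun k => Q * hj j `^ (a (sc k) - 1)) (mc_mlin hN) NM.
rewrite prod_pow// sum1 => hb; apply: (le_trans (hb _ _ _ _ _)) => //.
- exact: lip_appr.
- move=> x; exact: appr_bound.
- by move=> k; apply: appr_lipQ => //; rewrite leqnn leqnSn.
rewrite (_ : Q ^+ #|_| = Q ^+ n); last by rewrite card_ord.
rewrite [Q * _]mulrA -exprS mulrCA; apply: ler_wpM2l; first by rewrite exprn_ge0// ltW.
by apply: ler_wpM2l => //; rewrite ger_powR ?h0// lerD2r.
Qed.

Definition geo (b : R) : R := (1 - q `^ - b)^-1.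

Lemma geo_sum (b : R) J m : 0 < b -> 0 < geo b /\ \sum_(i < m) hj (J + i) `^ b <= geo b * hj J `^ b.
Proof.
move=> b0; have k1 : q `^ (- b) < 1.
 rewrite powRN invf_lt1 ?powR_gt0//.
 by have := gt0_ltr_powR b0 (x := 1) (y := q); rewrite powR1; apply; rewrite ?nnegrE// ltW.
have g0 : 0 < 1 - q `^ (- b) by rewrite subr_gt0.
split; first by rewrite invr_gt0.
have -> : \sum_(i < m) hj (J + i) `^ b = hj J `^ b * \sum_(i < m) (q `^ - b) ^+ i.
 by rewrite mulr_sumr; apply: eq_bigr => i _; rewrite !hj_pow exprD.
rewrite mulrC; apply: ler_wpM2r; first exact: powR_ge0.
rewrite /geo -[leRHS]mul1r ler_pdivlMr//.
have -> : (\sum_(i < m) (q `^ - b) ^+ i) * (1 - q `^ - b) = 1 - (q `^ - b) ^+ m.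
 by rewrite -opprB mulrN mulrC -subrX1 opprB.
by rewrite gerBl exprn_ge0// powR_ge0.
Qed.

Definition cS : R := n.+1%:R * Q ^+ n.+1 * (geo theta + geo eps) + 2 * Q ^+ n.+1.

(** Bound for the k-th summand of a fractal series between scale J and any later one. For k < J the
    steps from J on are summed. For k >= J the scales up to k are estimated by the values
    themselves, and steps are summed only from k on. The powers of [hj k] are the weights in the
    definition of fractal currents with base q. *)
Definition slev (J k : nat) : R := if (J <= k)%N then Bd * hj k `^ theta + M * hj k `^ (d - n%:R)
 else Bd * hj J `^ theta + M * hj J `^ eps.

Lemma normal_tail F J m : hclass F -> `|N (appr (J + m) F) - N (appr J F)| <=
 n.+1%:R * Q ^+ n.+1 * (geo theta + geo eps) * (Bd * hj J `^ theta + M * hj J `^ eps).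
Proof.
move=> hF.
have C0 : 0 <= n.+1%:R * Q ^+ n.+1 by rewrite mulr_ge0// exprn_ge0// ltW.
apply: (via (n.+1%:R * Q ^+ n.+1 * (Bd * \sum_(i < m) hj (J + i) `^ theta + M * \sum_(i < m) hj (J + i) `^ eps))).
 elim: m => [|m IH]; first by rewrite addn0 subrr normr0 !big_ord0 !mulr0 addr0 mulr0.
 have -> : N (appr (J + m.+1) F) - N (appr J F) =
  (N (appr (J + m).+1 F) - N (appr (J + m) F)) + (N (appr (J + m) F) - N (appr J F)).
  by rewrite addnS; ring.
 apply: le_normD; rewrite !big_ord_recr /=.
 by have := lerD (normal_step (J + m) hF) IH; move/le_trans; apply; rewrite le_eqVlt; apply/orP; left; apply/eqP; ring.
have [g1 s1] := geo_sum J m theta0; have [g2 s2] := geo_sum J m eps0.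
have t0 : 0 <= hj J `^ theta by exact: powR_ge0.
have t1 : 0 <= hj J `^ eps by exact: powR_ge0.
rewrite -[leRHS]mulrA; apply: ler_wpM2l => //.
have u1 := ler_wpM2l Bd0 s1; have u2 := ler_wpM2l M0 s2.
apply: (le_trans (lerD u1 u2)); rewrite mulrDr; apply: lerD.
 by rewrite mulrCA ler_wpM2r ?mulr_ge0// lerDl ltW.
by rewrite mulrCA ler_wpM2r ?mulr_ge0// lerDr ltW.
Qed.

(** For J <= k the value at a scale l <= k is at most of order M times the power d - n of the mesh
    at k, since this exponent is negative and the meshes decrease. The same power dominates the mass
    term of the tail from k on. *)
Lemma normal_cauchy F J J' k : hclass F -> (J <= J')%N ->
 `|N (appr J' F) - N (appr J F)| <= cS * slev J k.
Proof.
move=> hF JJ; have Qn : 0 <= Q ^+ n.+1 by rewrite exprn_ge0// ltW.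
have [g1 _] := geo_sum 0 0 theta0; have [g2 _] := geo_sum 0 0 eps0.
have G0 : 0 <= n.+1%:R * Q ^+ n.+1 * (geo theta + geo eps).
 by apply: mulr_ge0; [exact: mulr_ge0|apply: addr_ge0; exact: ltW].
have w0 l b : 0 <= hj l `^ b by exact: powR_ge0.
have tail l m : `|N (appr (l + m) F) - N (appr l F)| <= cS * (Bd * hj l `^ theta + M * hj l `^ eps).
 apply: (le_trans (normal_tail l m hF)); apply: ler_wpM2r.
  apply: addr_ge0; exact: mulr_ge0.
 by rewrite /cS lerDl mulr_ge0.
rewrite /slev; case: leqP => Jk; last by rewrite -(subnKC JJ); exact: tail.
have he : hj k `^ eps <= hj k `^ (d - n%:R).
 rewrite ger_powR ?hj_gt0 ?hj_le1//; case/andP: hd => _ dn; apply: (via 0); last exact: ltW. by rewrite subr_le0 ltW.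
have val l : (l <= k)%N -> `|N (appr l F)| <= Q ^+ n.+1 * (M * hj k `^ (d - n%:R)).
 move=> lk; apply: (le_trans (normal_value l hF)); apply: ler_wpM2l => //; apply: ler_wpM2l => //.
 rewrite !hj_pow; apply: ler_weXn2l => //; rewrite opprB. rewrite -[leLHS](powRr0 q) ler_powR ?(ltW q1)// subr_ge0.
 by case/andP: hd => _ /ltW.
have X0 : 0 <= Bd * hj k `^ theta by exact: mulr_ge0.
have Y0 : 0 <= M * hj k `^ (d - n%:R) by exact: mulr_ge0.
have [J'k|kJ'] := leqP J' k.
 apply: le_normB; apply: (le_trans (lerD (val _ J'k) (val _ Jk))).
 rewrite /cS; set X := Bd * _ in X0 *; set Y := M * _ in Y0 *.
 have := mulr_ge0 G0 (addr_ge0 X0 Y0); have := mulr_ge0 Qn X0; set G := n.+1%:R * _ * _; lra.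
have -> : N (appr J' F) - N (appr J F) = (N (appr (k + (J' - k)) F) - N (appr k F)) + (N (appr k F) - N (appr J F)).
 by rewrite (subnKC (ltnW kJ')); ring.
apply: le_normD.
have t1 := normal_tail k (J' - k) hF.
have t2 : n.+1%:R * Q ^+ n.+1 * (geo theta + geo eps) * (Bd * hj k `^ theta + M * hj k `^ eps) <=
 n.+1%:R * Q ^+ n.+1 * (geo theta + geo eps) * (Bd * hj k `^ theta + M * hj k `^ (d - n%:R)).
 by apply: ler_wpM2l => //; rewrite lerD2l ler_wpM2l.
apply: (le_trans (lerD (le_trans t1 t2) (ler_normB _ _))).
apply: (le_trans (lerD (lexx _) (lerD (val k (leqnn k)) (val J Jk)))).
rewrite /cS; set X := Bd * _ in X0 *; set Y := M * hj k `^ (d - n%:R) in Y0 *.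
have := mulr_ge0 Qn X0; set G := n.+1%:R * _ * _; lra.
Qed.

End normal.
End approximation_scale.

(** * Uniform smallness of the sum over all summands *)

Section uniform.
Context {R} {p : nat}.
Local Notation n := p.+1.
Local Notation V := ('rV[R]_n -> R).
Lemma cvg_dist_le (u v : nat -> R) x y e : u k @[k --> \oo] --> x -> v k @[k --> \oo] --> y ->
 (forall k, `|u k - v k| <= e) -> `|x - y| <= e.
Proof.
move=> hu hv uv; have hc : `|u k - v k| @[k --> \oo] --> `|x - y| by apply: cvg_norm; exact: cvgB.
rewrite -(cvg_lim _ hc)//; apply: limr_le; last exact: nearW.
apply/cvg_ex; eexists; exact: hc.
Qed.

Lemma bounded_partial_sums (b : nat -> R) (S : R) : (forall k, 0 <= b k) ->
 (forall N, \sum_(k < N) b k <= S) -> forall e : R, 0 < e ->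
 exists K, forall N, \sum_(i < N) b (K + i)%N <= e.
Proof.
move=> b0 hS e e0; pose A := [set \sum_(k < N) b k | N in [set: nat]].
have sA : has_sup A by split; [exists (\sum_(k < 0) b k); exists 0%N|exists S => _ [N _ <-]].
have [_ [K _ <-] hK] := sup_adherent e0 sA; exists K => N.
have : \sum_(k < K + N) b k <= sup A by apply: ub_le_sup; [case: sA|exists (K + N)%N].
by rewrite big_split_ord /=; lra.
Qed.

Lemma nneseries_bound (b : nat -> \bar R) (c : nat -> R) : (forall k, (c k)%:E = b k) ->
 (forall k, 0 <= c k) -> (\sum_(0 <= k <oo) b k < +oo)%E -> exists S, forall N, \sum_(k < N) c k <= S.
Proof.
move=> cb c0 h; exists (fine (\sum_(0 <= k <oo) b k)) => N.
have b0 k : (0 <= b k)%E by rewrite -cb lee_fin.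
rewrite -lee_fin fineK ?ge0_fin_numE//; last by apply: nneseries_ge0.
rewrite -sumEFin (eq_bigr (fun k : 'I_N => b k)) => [|k _]; last exact: cb.
rewrite -(big_mkord xpredT); exact: nneseries_lim_ge.
Qed.

Variable d : R.
Hypothesis hd : p%:R < d < n%:R.
Variables (M Bd : nat -> R) (S q : R).
Hypotheses (q1 : 1 < q) (M0 : forall k, 0 <= M k) (Bd0 : forall k, 0 <= Bd k).
Hypothesis hS : forall N, \sum_(k < N) (Bd k * hj q k `^ @theta R p d + M k * hj q k `^ (d - n%:R)) <= S.
Variable a : 'I_n.+1 -> R.
Hypothesis asum : n%:R < \sum_i a i.

(** Beyond an index K the bounds are dominated by the tail of a convergent series, whatever J >= K
    is. The finitely many k < K carry powers of the mesh at J with positive exponents, which tend to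
    0. *)
Lemma slev_sum (e : R) : 0 < e -> exists J0, forall J N, (J0 <= J)%N ->
 \sum_(k < N) slev a d q (M k) (Bd k) J k <= e.
Proof.
move=> e0; have th0 : 0 < @theta R p d by rewrite subr_gt0; case/andP: hd.
have ep0 : 0 < eps a by rewrite subr_gt0.
have w0 k b : 0 <= hj q k `^ b by exact: powR_ge0.
have [K hK] := bounded_partial_sums (fun k => addr_ge0 (mulr_ge0 (Bd0 k) (w0 k _)) (mulr_ge0 (M0 k) (w0 k _)))
 hS (divr_gt0 e0 (ltr0n R 2)).
have pow0 (b : R) : 0 < b -> hj q J `^ b @[J --> \oo] --> 0.
 move=> b0; rewrite (_ : (fun J => _) = fun J => (q `^ (- b)) ^+ J); last by apply/funext => J; rewrite hj_pow//.
 apply: cvg_expr; rewrite ger0_norm ?powR_ge0// powRN invf_lt1 ?powR_gt0 ?(lt_trans ltr01)//.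
 have := gt0_ltr_powR b0 (x := 1) (y := q); rewrite powR1; apply; rewrite ?nnegrE// ltW//. exact: lt_trans q1.
have lo : (\sum_(k < K) Bd k) * hj q J `^ @theta R p d + (\sum_(k < K) M k) * hj q J `^ eps a @[J --> \oo] -->
  (\sum_(k < K) Bd k) * 0 + (\sum_(k < K) M k) * 0.
 by apply: cvgD; (apply: cvgM; [exact: cvg_cst|exact: pow0]).
rewrite !mulr0 addr0 in lo.
have [J1 _ hJ1] := cvgr0_norm_le _ lo _ (divr_gt0 e0 (ltr0n R 2)).
exists (maxn J1 K) => J N; rewrite geq_max => /andP[J1J KJ].
have sl0 k : 0 <= slev a d q (M k) (Bd k) J k by rewrite /slev; case: ifP => _; apply: addr_ge0; exact: mulr_ge0.
apply: (via (\sum_(k < K + N) slev a d q (M k) (Bd k) J k)).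
 rewrite addnC big_split_ord /= lerDl; exact: sumr_ge0.
rewrite big_split_ord /= [leRHS]splitr; apply: lerD.
 apply: le_trans (hJ1 J J1J); apply: le_trans (ler_norm _). rewrite !mulr_suml -big_split /=; apply: ler_sum => k _.
 by rewrite /slev leqNgt (leq_trans (ltn_ord k) KJ).
apply: le_trans (hK N); apply: ler_sum => i _; rewrite /slev.
(* For an index k between K and J the convergent series still dominates, since the power [eps] of
   the mesh at J is at most 1 and the power d - n of the mesh at k at least 1. *)
case: leqP => // kJ; apply: lerD; apply: ler_wpM2l => //.
 have := hj_le q1 (ltnW kJ); have := hj_gt0 q1 J; have := hj_gt0 q1 (K + i) => h1 h2 h3.
 by rewrite ge0_ler_powR ?nnegrE// ltW.
have le1 (b : R) : 0 <= b -> hj q J `^ b <= 1.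
 move=> b0; have := ge0_ler_powR b0 (x := hj q J) (y := 1); rewrite powR1; apply; rewrite ?nnegrE//.
  exact/ltW/hj_gt0.
 exact: hj_le1.
apply: (le_trans (le1 _ (ltW ep0))).
rewrite hj_pow// -[leLHS](expr1n _ (K + i)) lerXn2r ?nnegrE ?powR_ge0// opprB.
rewrite -[leLHS](powRr0 q) ler_powR ?(ltW q1)// subr_ge0.
by case/andP: hd => _ /ltW.
Qed.

End uniform.

(** * Fractal currents converge along interpolations *)

Section fractal_cvg.
Context {R} {p : nat}.
Local Notation n := p.+1.
Variable d : R.
Hypothesis hd : p%:R < d < n%:R.

Lemma normal_mass_fin m (N : functional R n m.+1) : normal_current N ->
 [/\ 0 <= fine (mass N), 0 <= fine (mass (boundary N)), (fine (mass N))%:E = mass N &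
  (fine (mass (boundary N)))%:E = mass (boundary N)].
Proof.
move=> [_ fN]; have g0 := mass_ge0 N; have g1 := mass_ge0 (boundary N).
have f0 : mass N \is a fin_num by rewrite ge0_fin_numE//; apply: le_lt_trans fN; rewrite leeDl.
have f1 : mass (boundary N) \is a fin_num by rewrite ge0_fin_numE//; apply: le_lt_trans fN; rewrite leeDr.
by split; rewrite ?fine_ge0 ?fineK.
Qed.

(** The ratio q of the interpolation scales is the base rho of the decomposition, which matches the
    bounds of the R_k with its two series. The boundaries of the S_k vanish by [mc_top_zero]. The
    threshold J0 depends on the class of tuples only. *)
Lemma fractal_cauchy (T : functional R n n) : fractal n%:R d T ->
 exists q, 1 < q /\ forall (a : 'I_n.+1 -> R) r B e, (forall i, 0 < a i <= 1) -> n%:R < \sum_i a i ->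
  d <= \sum_(i < n) a (sc i) -> 0 < B -> 0 < e ->
  exists J0, forall J J' F, (J0 <= J <= J')%N -> hclass a r B F ->
   `|T (appr q r J' F) - T (appr q r J F)| <= e.
Proof.
move=> [hT [K [Rk [Sk [sigma [q [cK hk [_ q1] [_ hw] [_ _ s1 s2]]]]]]]].
exists q; split => // a r B e a01 asum dsum B0 e0.
have nR k : normal_current (Rk k) by case: (hk k).
pose M k := fine (mass (Rk k)); pose Bd k := fine (mass (boundary (Rk k))).
have hM k := normal_mass_fin (nR k).
have M0 k : 0 <= M k by case: (hM k).
have Bd0 k : 0 <= Bd k by case: (hM k).
have ME k : (M k)%:E = mass (Rk k) by case: (hM k).
have BE k : (Bd k)%:E = mass (boundary (Rk k)) by case: (hM k).
have powE k (b : R) : q `^ (k%:R * b) = hj q k `^ (- b) by rewrite hj_pow// opprK mulrC powRrM powR_mulrn// powR_ge0.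
have [S1 hS1] : exists S, forall N, \sum_(k < N) M k * hj q k `^ (d - n%:R) <= S.
 refine (nneseries_bound (c := fun k => M k * hj q k `^ (d - n%:R)) _ _ s1) => k; last by rewrite mulr_ge0// powR_ge0.
 by rewrite powE opprB EFinM ME.
have [S2 hS2] : exists S, forall N, \sum_(k < N) Bd k * hj q k `^ @theta R p d <= S.
 refine (nneseries_bound (c := fun k => Bd k * hj q k `^ theta d) _ _ s2) => k; last by rewrite mulr_ge0// powR_ge0.
 by rewrite powE opprB EFinM BE.
have hS N : \sum_(k < N) (Bd k * hj q k `^ @theta R p d + M k * hj q k `^ (d - n%:R)) <= S2 + S1.
 rewrite big_split; exact: lerD.
have c0 : 0 < cS a d q B + 1.
 have := geo_sum q1 0 0 (b := eps a). rewrite subr_gt0 asum => /(_ isT)[g1 _].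
 have := geo_sum q1 0 0 (b := @theta R p d). rewrite subr_gt0 => /(_ (proj1 (andP hd)))[g2 _].
 have Q0 : 0 <= @cQ R p q * B.
  by rewrite mulr_ge0 ?(ltW B0)// /cQ !addr_ge0// mulr_ge0 ?(le_trans ler01 (ltW q1))// addr_ge0// mulr_ge0.
 rewrite ltr_wpDl// /cS; apply: addr_ge0; apply: mulr_ge0; rewrite ?exprn_ge0//.
  by rewrite mulr_ge0// exprn_ge0.
 by rewrite addr_ge0// ltW.
have [J0 hJ0] := slev_sum hd q1 M0 Bd0 hS asum (divr_gt0 e0 c0).
exists J0 => J J' F /andP[J0J JJ'] hF.
have lA j : lip_tuple (appr q r j F) by apply: lip_appr => //.
apply: (cvg_dist_le (hw _ (lA J')) (hw _ (lA J))) => N.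
rewrite !big_mkord -sumrB.
apply: le_norm_sum.
apply: (via (\sum_(k < N) (cS a d q B + 1) * slev a d q (M k) (Bd k) J k)); last first.
 rewrite -mulr_sumr mulrC -ler_pdivlMr//; exact: hJ0.
apply: ler_sum => k _.
have S0 j : boundary (Sk k) (appr q r j F) = 0.
 by apply: mc_top_zero; [case: (hk k) => _ []|apply: lip_cons => //; exact: lip_cst].
rewrite !S0 !addr0.
have := @normal_cauchy R p a d q r B a01 q1 B0 hd asum dsum (Rk k) (proj1 (nR k)) (M k) (Bd k).
rewrite ME BE => /(_ (lexx _) (lexx _) (M0 k) (Bd0 k) F J J' k hF JJ') /le_trans; apply.
rewrite [leRHS]mulrDl lerDl mul1r /slev; case: ifP => _; by rewrite addr_ge0// mulr_ge0// powR_ge0.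
Qed.

End fractal_cvg.

(** * Construction of the Hoelder extension *)

Section hoelder.
Context {R} {p : nat}.
Local Notation n := p.+1.
Local Notation V := ('rV[R]_n -> R).
Implicit Types F : 'I_n.+1 -> V.
Lemma cutoff_mul_hol (r a A : R) (f : V) : 0 <= r -> 0 < a -> a <= 1 -> 0 <= A -> hol a A f ->
 let g x := f x * cutoff r x in
 hol a (A * (2 * r + 5) + `|f 0|) g /\ forall x, `|g x| <= A * (2 * r + 5) + `|f 0|.
Proof.
move=> r0 a0 a1 A0 fA g; have [h1 h2] := cutoff_hol r0 a0 a1 A0 fA.
have gE x : g x = (f x - f 0) * cutoff r x + f 0 * cutoff r x by rewrite /g; ring.
split => [x y|x]; last first.
 rewrite gE; apply: le_normD; apply: lerD; first exact: h2. by rewrite normrM ler_piMr// cutoff_norm.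
have -> : g x - g y = ((f x - f 0) * cutoff r x - (f y - f 0) * cutoff r y) + f 0 * (cutoff r x - cutoff r y).
 by rewrite !gE; ring.
rewrite [leRHS]mulrDl; apply: le_normD; apply: lerD; first exact: h1.
rewrite normrM ler_wpM2l//; have c1 := @cutoff_lip R n r x y; rewrite mul1r in c1.
have [xy|xy] := leP `|x - y| 1.
 apply: (le_trans c1); have [->|xy0] := eqVneq `|x - y| 0; first exact: powR_ge0.
 have xy1 : 0 < `|x - y| by rewrite lt_neqAle eq_sym xy0 /=. by rewrite -[leLHS]powRr1// ger_powR// xy1.
apply: (via 1).
 rewrite ler_norml; have := @clamp_ge0 R (r + 1 - `|x|); have := @clamp_ge0 R (r + 1 - `|y|).
 have := @clamp_le1 R (r + 1 - `|x|); have := @clamp_le1 R (r + 1 - `|y|).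
 by rewrite /cutoff => *; apply/andP; split; lra.
by rewrite -[leLHS](powRr0 `|x - y|) ler_powR// ltW.
Qed.

Lemma compact_margin (K U : set 'rV[R]_n) : compact K -> open U -> K `<=` U ->
 exists2 e : R, 0 < e & forall z y, K z -> `|z - y| <= e -> U y.
Proof.
move=> /compact_near_coveringP cov oU KU.
have [j _ hj] : \forall j \near \oo, K `<=` (fun z => forall y, `|z - y| <= j.+1%:R^-1 -> U y).
 apply: (cov _ \oo (fun j z => forall y, `|z - y| <= j.+1%:R^-1 -> U y)) => z /KU Uz.
 have [e e0 he] := (open_rVP _).1 oU z Uz.
 have [J _ hJ] := cvgr0_norm_lt _ (@cvg_harmonic R) _ (divr_gt0 e0 (ltr0n R 2)).
 exists ([set z' | `|z - z'| < e / 2], [set j | (J <= j)%N]) => /=.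
  split; last by exists J. by apply/nbhs_rVP; exists (e / 2) => //; rewrite divr_gt0.
 move=> [z' j] /= [zz /hJ]; rewrite /= ger0_norm// => hh y z'y; apply: he.
 have := ler_normD (z - z') (z' - y); rewrite addrA subrK => h1; apply: (le_lt_trans h1).
 by rewrite [ltRHS]splitr; apply: ltrD => //; exact: le_lt_trans hh.
by exists j.+1%:R^-1 => // z y Kz; apply: (hj j) => /=.
Qed.

Lemma Ih_dist r h (f g : V) e : 0 < h -> 0 <= e -> (forall x, `|f x - g x| <= e) ->
 forall x, `|Ih r h f x - Ih r h g x| <= e.
Proof.
move=> h0 e0 fg x; rewrite /Ih /spl -sumrB.
apply: le_norm_sum.
apply: (via (\sum_(k : {ffun 'I_n -> 'I_(Nh r h)}) e * `|om (r + 6) h k x|)).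
 by apply: ler_sum => k _; rewrite -mulrBl normrM ler_wpM2r.
rewrite -mulr_sumr ler_piMr//; exact: sum_om_abs.
Qed.

Lemma Ih_eq r h (f g : V) x : 0 < h -> (forall y, `|x - y| <= 3 * h -> f y = g y) -> Ih r h f x = Ih r h g x.
Proof.
move=> h0 fg; rewrite /Ih /spl; apply: eq_bigr => k _.
have [->|k0] := eqVneq (om (r + 6) h k x) 0; first by rewrite !mulr0.
by rewrite (fg _ (node_dist h0 k0)).
Qed.

Lemma Ih_zero (r h : R) (f : V) x : 0 < h -> (forall y, `|x - y| <= 3 * h -> f y = 0) -> Ih r h f x = 0.
Proof. by move=> h0 f0; rewrite (Ih_eq _ h0 f0) /Ih /spl big1// => k _; rewrite mul0r. Qed.

Lemma Ih_cst_in (r h c : R) (f : V) x : 0 < h -> h <= 1 -> 0 <= r -> `|x| <= r + 1 ->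
 (forall y, `|x - y| <= 3 * h -> f y = c) -> Ih r h f x = c.
Proof.
move=> h0 h1 r0 xr fc; rewrite (Ih_eq _ h0 fc) /Ih /spl -mulr_sumr sum_om1 ?mulr1// => i.
have := coord_le x i; rewrite ler_norml => /andP[x1 x2]; have N := Nh_ge r h0.
by apply/andP; split; lra.
Qed.

Variables (T : functional R n n) (a : 'I_n.+1 -> R) (q : R).
Hypotheses (hT : metric_current T) (a01 : forall i, 0 < a i <= 1) (q1 : 1 < q).
Hypothesis hUC : forall r B e, 0 < B -> 0 < e -> exists J0, forall J J' F,
 (J0 <= J <= J')%N -> hclass a r B F -> `|T (appr q r J' F) - T (appr q r J F)| <= e.
Variable r : R.
Hypothesis r0 : 0 <= r.
Hypothesis hr : forall F F', lip_tuple F -> lip_tuple F' ->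
 (forall i x, `|x| <= r -> F i x = F' i x) -> T F = T F'.

Let a0 i : 0 < a i. Proof. by case/andP: (a01 i). Qed.
Let a1 i : a i <= 1. Proof. by case/andP: (a01 i). Qed.
Let s0 : 0 <= r + 10. Proof. by rewrite addr_ge0. Qed.
(** T sees only the ball of radius r and an interpolation reaches at most 3 further, so the cutoff
    at r + 10 changes no value of T on interpolations, while it places the tuple in a class with
    bounded functions and supports, as the uniform Cauchy condition [hUC] asks. *)
Definition cut_tuple F : 'I_n.+1 -> V := fun i x => F i x * cutoff (r + 10) x.
Definition apprT F j : R := T (appr q (r + 11) j (cut_tuple F)).
Definition extT : functional R n n := fun F => limn (apprT F).
Let lipA F j : lip_tuple (appr q (r + 11) j (cut_tuple F)). Proof. exact: lip_appr. Qed.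

Lemma cutoff_tuple_class F (b : 'I_n.+1 -> R) L A : (forall i, 0 < b i) -> (forall i, b i <= 1) ->
 0 <= L -> (forall i, hol (b i) L (F i)) -> (forall i, `|F i 0| <= A) ->
 hclass b (r + 11) (L * (2 * (r + 10) + 5) + A) (cut_tuple F).
Proof.
move=> b0 b1 L0 FL FA i; have [h1 h2] := cutoff_mul_hol s0 (b0 i) (b1 i) L0 (FL i).
split.
- have -> : r + 11 = r + 10 + 1 by ring.
 by move=> x hx; rewrite /cut_tuple cutoff_bsupp// mulr0.
- by move=> x y; apply: (le_trans (h1 x y)); rewrite ler_wpM2r ?powR_ge0// lerD2l.
- by move=> x; apply: (le_trans (h2 x)); rewrite lerD2l.
Qed.

Lemma cutoff_tuple_ex F : holder_tuple a F -> exists2 B, 0 < B & hclass a (r + 11) B (cut_tuple F).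
Proof.
move=> /(holder_tupleP a0)/(_ _)/cid2-/(_ _)/= hF.
have /choice[C hC] : forall i, exists C, 0 <= C /\ hol (a i) C (F i) by move=> i; have [C C0 FC] := hF i; exists C.
have C0 i : 0 <= C i by case: (hC i).
pose L := \sum_i C i; pose A := \sum_i `|F i 0|.
have L0 : 0 <= L by exact: sumr_ge0.
have A0 : 0 <= A by exact: sumr_ge0.
have FL i : hol (a i) L (F i).
 move=> x y; apply: (le_trans ((hC i).2 x y)); rewrite ler_wpM2r ?powR_ge0//.
 by rewrite /L (bigD1 i)//= lerDl sumr_ge0.
have FA i : `|F i 0| <= A by rewrite /A (bigD1 i)//= lerDl sumr_ge0.
have h := cutoff_tuple_class a0 a1 L0 FL FA.
exists (L * (2 * (r + 10) + 5) + A + 1).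
 by rewrite ltr_wpDl// addr_ge0// mulr_ge0// addr_ge0// mulr_ge0.
move=> i; have [h1 h2 h3] := h i; split => // [x y|x].
 by apply: (le_trans (h2 x y)); rewrite ler_wpM2r ?powR_ge0// lerDl.
by apply: (le_trans (h3 x)); rewrite lerDl.
Qed.

Lemma extT_cvg F : holder_tuple a F -> apprT F j @[j --> \oo] --> extT F.
Proof.
move=> hF; have [B B0 hB] := cutoff_tuple_ex hF.
apply: cauchy_cvg; apply/cauchy_exP => e e0.
have [J0 hJ0] := hUC (r + 11) B0 (divr_gt0 e0 (ltr0n R 2)).
exists (apprT F J0); exists J0 => // j /= Jj; rewrite /ball /= distrC.
have := hJ0 J0 j _ _ hB; rewrite leqnn Jj => /(_ isT); rewrite /apprT; lra.
Qed.

Lemma extT_val F v : (\forall j \near \oo, apprT F j = v) -> extT F = v.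
Proof. by move=> h; apply: cvg_lim => //; exact: cvg_near_cst. Qed.

Lemma appr_upd F i h j : appr q (r + 11) j (cut_tuple (upd F i h)) =
 upd (appr q (r + 11) j (cut_tuple F)) i (Ih (r + 11) (hj q j) (fun x => h x * cutoff (r + 10) x)).
Proof. by apply/funext => k; rewrite /tuple_upd /appr /cut_tuple; case: eqP. Qed.

Lemma extT_mlin : mlin (fun i => holder (a i)) extT.
Proof.
move=> F i c h1 h2 hF p1 p2.
have hu h : holder (a i) h -> holder_tuple a (upd F i h).
 by move=> hh; apply: (upd_P (P := fun i => holder (a i))).
have c1 := extT_cvg (hu _ p1); have c2 := extT_cvg (hu _ p2).
apply: cvg_lim => //.
rewrite (_ : apprT _ = fun j => c * apprT (upd F i h1) j + apprT (upd F i h2) j); last first.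
 apply/funext => j; rewrite /apprT !appr_upd. rewrite (_ : (fun x => (c * h1 x + h2 x) * cutoff (r + 10) x) =
   fun x => c * (h1 x * cutoff (r + 10) x) + h2 x * cutoff (r + 10) x); last by apply/funext => x; ring.
 rewrite (_ : Ih _ _ (fun x => c * _ + _) = fun x => c * Ih (r + 11) (hj q j) (fun x => h1 x * cutoff (r + 10) x) x
   + Ih (r + 11) (hj q j) (fun x => h2 x * cutoff (r + 10) x) x); last by apply/funext => x; exact: IhL.
 have li h : lip (Ih (r + 11) (hj q j) h) by apply: lipb_lip; apply: Ih_lipb; exact: hj_gt0.
 by apply: (mc_mlin hT); [exact: lipA|exact: li|exact: li].
apply: cvgD => //; apply: cvgM => //; exact: cvg_cst.
Qed.

Lemma extT_ball F : holder_tuple a F -> (forall x, `|x| <= r + 3 -> F ord0 x = 0) -> extT F = 0.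
Proof.
move=> hF F0; apply: extT_val; apply: nearW => j.
have e i x : `|x| <= r -> appr q (r + 11) j (cut_tuple F) i x =
  upd (appr q (r + 11) j (cut_tuple F)) ord0 (fun=> 0) i x.
 move=> xr; rewrite /tuple_upd; case: eqP => // ->. apply: Ih_zero => [|y xy]; first exact: hj_gt0.
  rewrite /cut_tuple F0 ?mul0r//; have := hj_le1 q1 j.
 by have := ler_normD (y - x) x; rewrite subrK distrC; lra.
rewrite /apprT (hr _ _ e)//; last by apply: lip_upd => //; exact: lip_cst.
by apply: (mlin0 (mc_mlin hT)); [exact: lipA|exact: lip_cst].
Qed.

(** Interpolation enlarges supports by 3h only. The part of the support of the first function that
    matters is compact, so for small h its neighbourhood of width 7h lies in U, and the
    interpolation of the i-th function is constant near the interpolated support. *)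
Lemma extT_local F : holder_tuple a F -> (exists (i : 'I_n) (U : set 'rV[R]_n) (c : R),
 [/\ open U, fun_spt (F ord0) `<=` U & forall x, U x -> F (sc i) x = c]) -> extT F = 0.
Proof.
move=> hF [i [U [c [oU FU Fc]]]]; apply: extT_val.
pose K := fun_spt (F ord0) `&` [set x | `|x| <= r + 4].
have cK : compact K by apply: compact_cap_ball; exact: closed_closure.
(* 7 = 3 + 1 + 3: the reach of the interpolation in both slots and the margin h used for
   locality. *)
have near1 : \forall j \near \oo, K `<=` (fun z => forall y, `|z - y| <= 7 * hj q j -> U y).
 have [e e0 he] := compact_margin cK oU (fun z zK => FU z zK.1).
 have [J _ hJ] := cvgr0_norm_lt _ (hj_cvg q1) _ (divr_gt0 e0 (ltr0n R 7)).
 exists J => // j /hJ /=; rewrite gtr0_norm ?hj_gt0// => hh z Kz y zy; apply: (he z y Kz). by move: zy; lra.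
apply: filterS near1 => j hj_.
set G := appr q (r + 11) j (cut_tuple F).
have lG : lip_tuple G by exact: lipA.
have h0 := hj_gt0 q1 j; have h1 := hj_le1 q1 j.
have lc : lip (fun x => G ord0 x * cutoff r x).
 have [L L0 GL] := (lipP _).1 (lG ord0). apply: lipb_lip; exact: lipb_cut GL.
rewrite /apprT -/G (@hr G (tcons (fun x => G ord0 x * cutoff r x) (tl G)))//; last 2 first.
- apply: lip_cons => //; exact: lip_tl.
- move=> k x xr; rewrite -{1}(tconsE G) /tuple_cons; case: (unlift ord0 k) => //=.
 by rewrite cutoff1// mulr1.
apply: (mc_local hT (i := i) (c := c) (d := hj q j)) => //; first exact: lip_tl.
move=> x y hx xy.
have xr : `|x| <= r + 1 by rewrite leNgt; apply/negP => /ltW xr; move/eqP: hx; apply; rewrite cutoff0 ?mulr0.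
have [z xz Fz] : exists2 z, `|x - z| <= 3 * hj q j & F ord0 z != 0.
 apply: contrapT => hz; move/eqP: hx; apply.
 rewrite /G /appr Ih_zero ?mul0r// => z xz; rewrite /cut_tuple; have [->|Fz] := eqVneq (F ord0 z) 0; first by rewrite mul0r.
 by case: hz; exists z.
have Kz : K z.
 split; first exact: fun_spt_neq0. by have := ler_normD (z - x) x; rewrite subrK distrC /=; lra.
apply: Ih_cst_in; rewrite ?addr_ge0//; first by have := ler_normD (y - x) x; rewrite subrK; lra.
move=> w yw; rewrite /cut_tuple Fc; last first.
 apply: (hj_ _ Kz); have := ler_normD (z - x) (x - w); rewrite addrA subrK.
 have := ler_normD (x - y) (y - w); rewrite addrA subrK distrC => t1 t2.
 by move: t1 t2 xz yw xy; rewrite (distrC z x) (distrC x y); lra.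
rewrite cutoff1 ?mulr1//; have := ler_normD (w - y) (y - x + x); rewrite addrA addrA !subrK.
by have := ler_normD (y - x) x; rewrite subrK (distrC w y); lra.
Qed.

Lemma extT_continuous Fk F L : 0 <= L -> (forall k i, hol (a i) L (Fk k i)) ->
 (forall i, hol (a i) L (F i)) -> (forall i, ucvg (fun k => Fk k i) (F i)) ->
 extT (Fk k) @[k --> \oo] --> extT F.
Proof.
move=> L0 FkL FL hu.
pose A := \sum_i `|F i 0| + 1.
have FA i : `|F i 0| <= A by rewrite /A (bigD1 i)//= -addrA lerDl addr_ge0// sumr_ge0.
(* The tuples with values at 0 that are too large, which cannot occur from some index on, are
   replaced by F, so that one constant B serves for all k. *)
pose Gk k := if pselect (forall i, `|Fk k i 0| <= A) then Fk k else F.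
have GkE : \forall k \near \oo, Gk k = Fk k.
 have : \forall k \near \oo, forall i, forall x, `|Fk k i x - F i x| <= 1.
  apply: filter_forall => i; exact: (hu i).
 apply: filterS => k hk; rewrite /Gk; case: pselect => // -[] i.
 have := hk i 0; have := ler_normD (Fk k i 0 - F i 0) (F i 0); rewrite subrK /A (bigD1 i)//=.
 have : 0 <= \sum_(i0 < n.+1 | i0 != i) `|F i0 0| by exact: sumr_ge0. by lra.
have GL k i : hol (a i) L (Gk k i) by rewrite /Gk; case: pselect => h /=; [exact: FkL|exact: FL].
have GA k i : `|Gk k i 0| <= A by rewrite /Gk; case: pselect.
have Gu i : ucvg (fun k => Gk k i) (F i) by move=> e e0; apply: filterS2 GkE (hu i e e0) => k -> .
suff: extT (Gk k) @[k --> \oo] --> extT F.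
 by move=> hc; apply: cvg_trans hc; apply: near_eq_cvg; apply: filterS GkE => k ->.
pose B := L * (2 * (r + 10) + 5) + A.
have B0 : 0 < B by rewrite /B /A addrA ltr_wpDl// addr_ge0 ?sumr_ge0// mulr_ge0// addr_ge0// mulr_ge0.
have hG k : hclass a (r + 11) B (cut_tuple (Gk k)) by exact: cutoff_tuple_class.
have hF : hclass a (r + 11) B (cut_tuple F) by exact: cutoff_tuple_class.
have hol_tuple G : (forall i, hol (a i) L (G i)) -> holder_tuple a G by move=> h i; apply/holderP => //; exists L.
apply/cvgrPdist_le => e e0; have e3 : 0 < e / 3 by rewrite divr_gt0.
have [J hJ] := hUC (r + 11) B0 e3.
have lim G : (forall i, hol (a i) L (G i)) -> hclass a (r + 11) B (cut_tuple G) ->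
  `|extT G - apprT G J| <= e / 3.
 move=> gL hg; have c1 : apprT G (k + J)%N @[k --> \oo] --> extT G by rewrite cvg_shiftn; exact/extT_cvg/hol_tuple.
 apply: (cvg_dist_le c1 (cvg_cst (apprT G J))) => k. by apply: hJ => //; rewrite leqnn leq_addl.
have mid : apprT (Gk k) J @[k --> \oo] --> apprT F J.
 pose M := \sum_i (8 * n%:R + 7) * B * hj q J `^ (a i - 1). have c0 i : 0 <= (8 * n%:R + 7) * B * hj q J `^ (a i - 1).
  by rewrite mulr_ge0 ?powR_ge0// mulr_ge0 ?(ltW B0)// addr_ge0// mulr_ge0.
 have lM G : hclass a (r + 11) B (cut_tuple G) -> forall i, lipc M (appr q (r + 11) J (cut_tuple G) i).
  move=> hg i; apply: (lipcW _ (appr_lip a01 q1 B0 J i hg)). by rewrite /M (bigD1 i)//= lerDl sumr_ge0.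
 apply: (mc_cvg hT (L := M)) => [|k|i|i]; first exact: sumr_ge0.
 - exact: lM.
 - exact: lM.
 - move=> s sp; apply: filterS (Gu i s sp) => k hk.
  apply: Ih_dist => [||x]; [exact: hj_gt0|exact: ltW|]. rewrite /cut_tuple -mulrBl normrM; apply: le_trans (hk x).
  by rewrite ler_piMr// cutoff_norm.
have /cvgrPdist_le /(_ _ e3) := mid; apply: filterS => k hk.
have l1 := lim _ FL hF; have l2 := lim _ (GL k) (hG k).
have -> : extT F - extT (Gk k) = (extT F - apprT F J) + (apprT F J - apprT (Gk k) J) - (extT (Gk k) - apprT (Gk k) J).
 by ring.
apply: le_normB; have := ler_normD (extT F - apprT F J) (apprT F J - apprT (Gk k) J).
by lra.
Qed.

(** On a Lipschitz tuple the interpolations converge with bounded Lipschitz constants, so the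
    continuity of T itself identifies the limit. *)
Lemma extT_extends F F' : lip_tuple F -> holder_tuple a F' ->
 (forall i x, `|x| <= r + 10 -> F i x = F' i x) -> extT F' = T F.
Proof.
move=> lF hF' e; apply: cvg_lim => //.
have -> : apprT F' = fun j => T (appr q (r + 11) j (cut_tuple F)).
 apply/funext => j; apply: hr => // i x xr; apply: Ih_eq; first exact: hj_gt0.
 move=> y xy; rewrite /cut_tuple e//; have := hj_le1 q1 j. by have := ler_normD (y - x) x; rewrite subrK distrC; lra.
have [L [L0 FL]] := lip_tuple_max lF.
pose A := \sum_i `|F i 0| + 1.
have FA i : `|F i 0| <= A by rewrite /A (bigD1 i)//= -addrA lerDl addr_ge0// sumr_ge0.
pose B := L * (2 * (r + 10) + 5) + A.
have B0 : 0 < B by rewrite /B /A addrA ltr_wpDl// addr_ge0 ?sumr_ge0// mulr_ge0// addr_ge0// mulr_ge0.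
have hB : hclass (fun=> 1) (r + 11) B (cut_tuple F) by apply: cutoff_tuple_class => // i; exact/lipc_hol.
have b01 : forall i : 'I_n.+1, 0 < (1 : R) <= 1 by move=> i; rewrite ltr01 lexx.
have TE : T F = T (cut_tuple F).
 apply: hr => // [i|i x xr]; last by rewrite /cut_tuple cutoff1 ?mulr1// (le_trans xr)// lerDl.
 apply: lipb_lip; exact: lipb_cut (FL i).
rewrite TE; apply: (mc_cvg hT (L := (8 * n%:R + 7) * B)) => [|k i|i|i].
- by rewrite mulr_ge0 ?(ltW B0)// addr_ge0// mulr_ge0.
- by have := appr_lip b01 q1 B0 k i hB; rewrite subrr powRr0 mulr1.
- have [_ h _] := hB i; move/lipc_hol : h; apply: lipcW.
 rewrite ler_peMl ?(ltW B0)//; have : 0 <= 8 * n%:R :> R by rewrite mulr_ge0. by clear b01; lra.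
- apply: (@ucvg_le _ _ _ _ (fun k => B * (3 * hj q k `^ 1))) => [k x|]; first exact: (appr_close b01).
 rewrite -[X in _ --> X](mulr0 (B * 3)) (_ : (fun k => _) = fun k => B * 3 * hj q k); last first.
  by apply/funext => k; rewrite powRr1 ?mulrA// ltW// hj_gt0.
 by apply: cvgM; [exact: cvg_cst|exact: hj_cvg].
Qed.

Lemma holder_extension_extT : holder_extension a T.
Proof.
have cl (s : R) := @closed_normle R n s.
exists extT, [set x | `|x| <= r + 10]; split.
- by apply: (@hc_build _ _ _ _ _ _ (r + 3)) => //; [exact: extT_mlin|exact: extT_local|exact: extT_ball|exact: extT_continuous].
- exact: compact_normle.
- apply: hspt_sub => // F hF F0.
 have lF : lip_tuple F by []. rewrite (hr (F' := upd F ord0 (fun=> 0)))//.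
 + apply: (mlin0 (mc_mlin hT)) => //; exact: lip_cst.
 + apply: lip_upd => //; exact: lip_cst.
 + by move=> i x xr; rewrite /tuple_upd; case: eqP => // ->; apply: F0 => /=; lra.
- by apply: hspt_sub => // F hF F0; apply: extT_ball => // x xr; apply: F0 => /=; lra.
- move=> F F' lF hF' e; apply: extT_extends => // i x xr; apply: e; exact: mem_set.
Qed.

End hoelder.

Lemma fractal_holder_extension {R : realType} {p : nat} (d : R) (T : functional R p.+1 p.+1) a :
 p%:R < d < p.+1%:R -> fractal p.+1%:R d T -> (forall i, 0 < a i <= 1) ->
 p.+1%:R < \sum_i a i -> d <= \sum_(i < p.+1) a (sc i) -> holder_extension a T.
Proof.
move=> hd fT a01 asum dsum; have hT := fT.1.
have [q [q1 hq]] := fractal_cauchy hd fT; have [r [r0 hr]] := mc_ball hT.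
apply: (holder_extension_extT hT a01 q1 _ r0 hr) => s B e B0 e0; exact: hq.
Qed.

(** * From extensions of T to extensions of its boundary *)

Section boundary_ext.
Context {R} {p : nat}.
Local Notation n := p.+1.
Local Notation V := ('rV[R]_n -> R).
Implicit Types G : 'I_n -> V.
Definition exps_cons (b : 'I_n -> R) : 'I_n.+1 -> R := fun i => oapp b 1 (unlift ord0 i).
Lemma exps_cons0 b : exps_cons b ord0 = 1. Proof. by rewrite /exps_cons unlift_none. Qed.
Lemma exps_consS b i : exps_cons b (sc i) = b i. Proof. by rewrite /exps_cons liftK. Qed.

Lemma exps_cons_bounds b : (forall i, 0 < b i <= 1) -> forall i, 0 < exps_cons b i <= 1.
Proof.
move=> b01 i; case: (unliftP ord0 i) => [j ->|->]; first by rewrite exps_consS.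
by rewrite exps_cons0 ltr01 lexx.
Qed.

Lemma exps_cons_sum b : \sum_i exps_cons b i = 1 + \sum_i b i.
Proof. by rewrite big_ord_recl exps_cons0; congr (_ + _); apply: eq_bigr => i _; exact: exps_consS. Qed.

Lemma holder_extension_metric (T : functional R n n) : holder_extension (fun=> 1) T -> metric_current T.
Proof. by move=> [T' [K [hT' _ _ _ ext]]]; apply: (hc_ext _ _ hT') => // F lF; rewrite -(ext F F). Qed.

Variables (T : functional R n n) (b : 'I_n -> R).
Hypotheses (hT : metric_current T) (b01 : forall i, 0 < b i <= 1).

Let b0 i : 0 < b i. Proof. by case/andP: (b01 i). Qed.
Let c0 i : 0 < exps_cons b i. Proof. by case/andP: (exps_cons_bounds b01 i). Qed.

Lemma holder_cons f G : lip f -> holder_tuple b G -> holder_tuple (exps_cons b) (tcons f G).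
Proof.
move=> lf hG i; rewrite /exps_cons /tuple_cons; case: (unlift ord0 i) => //= j; exact: hG.
Qed.

Lemma cst_one : @Defs.lipschitz R n (fun=> 1). Proof. exact: lip_cst. Qed.

Section localisation.
Variable T' : functional R n n.
Hypothesis hT' : holder_current (exps_cons b) T'.

Lemma extension_split f g G : lip f -> lip g -> holder_tuple b G ->
 T' (tcons (fun x => f x + g x) G) = T' (tcons f G) + T' (tcons g G).
Proof.
move=> lf lg hG; have h := holder_cons lf hG.
have := mlinD (hc_mlin hT') h (i := ord0) (h1 := f) (h2 := g).
rewrite !tcons_upd0; apply; rewrite exps_cons0//.
Qed.

Lemma extension_ball : exists2 r, 0 <= r & forall f G, lip f -> holder_tuple b G ->
 (forall x, `|x| <= r -> f x = 0) -> T' (tcons f G) = 0.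
Proof.
have [K [cK hK]] := hc_compact hT'; have [r r0 hr] := compact_rV cK.
exists (r + 1); first by rewrite ltW// addr_gt0.
move=> f G lf hG f0; apply: hK; first exact: holder_cons.
rewrite tcons0; apply/seteqP; split => x //= [+ /hr /= xr].
move=> /closure_rVP /(_ 1 ltr01)[y fy xy]; move/eqP: fy; apply; apply: f0.
by have := ler_normD (y - x) x; rewrite subrK distrC; lra.
Qed.

Lemma extension_one r G : (forall f G, lip f -> holder_tuple b G ->
 (forall x, `|x| <= r -> f x = 0) -> T' (tcons f G) = 0) -> holder_tuple b G ->
 T' (tcons (fun=> 1) G) = T' (tcons (cutoff r) G).
Proof.
move=> hr hG; pose f : V := fun x => 1 - cutoff r x.
have lchi : lip (@cutoff R n r) by apply: lipb_lip; exact: lipb_cutoff.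
have lf : lip f by apply: lip_sub => //; exact: cst_one.
have -> : (fun=> 1) = (fun x : 'rV[R]_n => cutoff r x + f x) by apply/funext => x; rewrite /f; ring.
by rewrite extension_split// (hr f) ?addr0// => x xr; rewrite /f cutoff1 ?subrr.
Qed.

(** The first slot now holds 1, so locality has to be recovered. On a large ball 1 is split by a
    Lipschitz phi with support in U that is 1 near the support of [G ord0]: with phi in the first
    slot the i-th function is constant there, and with the rest [G ord0] is the constant 0. *)
Lemma extension_boundary_local G : holder_tuple b G ->
 (exists (i : 'I_p) (U : set 'rV[R]_n) (c : R),
  [/\ open U, fun_spt (G ord0) `<=` U & forall x, U x -> G (sc i) x = c]) ->
 T' (tcons (fun=> 1) G) = 0.
Proof.
move=> hG [i [U [c [oU GU Gc]]]]; have [r r0 hr] := extension_ball.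
pose K := fun_spt (G ord0) `&` [set x | `|x| <= r + 2].
have cK : compact K by apply: compact_cap_ball; exact: closed_closure.
have [e e0 he] := compact_margin cK oU (fun z zK => GU z zK.1).
(* phi will be the interpolation of the indicator of the neighbourhood of K of width e/2.
   Interpolation reaches 3h <= e/4, which leaves room on both sides: phi is 1 near K and its support
   stays within e of K. *)
pose h := Num.min 1 (e / 12).
have h0 : 0 < h by rewrite lt_min ltr01 divr_gt0.
have h1 : h <= 1 by rewrite ge_min lexx.
have he12 : h <= e / 12 by rewrite ge_min lexx orbT.
pose A := [set x : 'rV[R]_n | exists2 z, K z & `|z - x| <= e / 2].
pose phi : V := Ih (r + 2) h (\1_A).
have lphi : lipb phi by exact: Ih_lipb.
have lchi := @lipb_cutoff R n r.
have [L [s [L0 phiL _]]] := lphi.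
have lf1 : lip (fun x => phi x * cutoff r x) by apply: lipb_lip; exact: lipb_cut phiL.
have lf2 : lip (fun x => cutoff r x - phi x * cutoff r x).
 apply: lip_sub => //; apply: bd_lip; exact: lipb_lipbd.
rewrite (extension_one hr hG).
have -> : cutoff r = (fun x : 'rV[R]_n => phi x * cutoff r x + (cutoff r x - phi x * cutoff r x)).
 by apply/funext => x; ring.
rewrite extension_split// [X in X + _](hc_local hT') ?add0r; first last.
- exists (sc i), U, c; rewrite tcons0; split => // [x|x Ux]; last by rewrite tconsS Gc.
 move=> /closure_rVP /(_ (e / 8))[]; first by rewrite divr_gt0.
 move=> y /=; rewrite mulf_eq0 negb_or => /andP[py _] xy. have [z Az yz] : exists2 z, A z & `|y - z| <= 3 * h.
  apply: contrapT => hz; move/eqP: py; apply; apply: Ih_zero => // z yz.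
  by rewrite indicE memNset// => Az; apply: hz; exists z.
 case: Az => w Kw wz; apply: (he w) => //.
 have := ler_normD (w - z) (z - y); have := ler_normD (w - y) (y - x); rewrite !addrA !subrK.
 by rewrite (distrC z y) (distrC y x); lra.
- exact: holder_cons.
apply: (hc_local hT'); first exact: holder_cons.
exists ord0, (~` fun_spt (G ord0)), 0; rewrite tcons0; split.
- apply: closed_openC; exact: closed_closure.
- move=> x /closure_rVP hx Gx; have [xr|xr] := leP `|x| (r + 3 / 2); last first.
  have [|y] := hx (1 / 4); first by rewrite divr_gt0.
  move=> /eqP + xy; apply; have := ler_normD (x - y) y; rewrite subrK => yr. by rewrite cutoff0 ?mulr0 ?subrr//; lra.
 have [|y] := hx (Num.min (e / 4) (1 / 4)); first by rewrite lt_min !divr_gt0.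
 rewrite lt_min => /eqP + /andP[xy1 xy2]; apply.
 rewrite /phi (@Ih_cst_in _ _ _ _ 1) ?mul1r ?subrr//; first by rewrite addr_ge0.
  by have := ler_normD (y - x) x; rewrite subrK distrC; lra.
 move=> w yw; rewrite indicE mem_set//; exists x; first by split => //=; lra.
 by have := ler_normD (x - y) (y - w); rewrite addrA subrK; lra.
- move=> x Gx; rewrite tconsS; exact: fun_sptN.
Qed.

End localisation.

(** The extension is that of T with 1 in the first slot. Its support is bounded by locality: 1 may
    be replaced by [cutoff r], and a function [G ord0] that vanishes on the ball of radius r + 2 is
    constant near the support of the cutoff. *)
Lemma holder_extension_boundary : holder_extension (exps_cons b) T -> holder_extension b (boundary T).
Proof.
move=> [T' [K [hT' cK _ _ ext]]].
have [r r0 hr] := extension_ball hT'; have [s s0 hs] := compact_rV cK.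
have [t [t0 ht]] := mc_ball hT.
pose B := r + s + t + 2.
have bd G : holder_tuple b G -> (forall x, `|x| <= r + 2 -> G ord0 x = 0) -> T' (tcons (fun=> 1) G) = 0.
 move=> hG G0; have lchi : lip (@cutoff R n r) by apply: lipb_lip; exact: lipb_cutoff.
 rewrite (extension_one hT' hr hG); apply: (hc_local hT'); first exact: holder_cons.
 exists ord0, [set x | `|x| < r + 2], 0; rewrite tcons0; split.
 - apply/open_rVP => x /= xr; exists (r + 2 - `|x|); first by rewrite subr_gt0.
  by move=> y xy; have := ler_normD (y - x) x; rewrite subrK distrC; lra.
 - move=> x /closure_rVP /(_ 1 ltr01)[y /eqP cy xy] /=; rewrite ltNge; apply/negP => xr; apply: cy.
  by apply: cutoff0; have := ler_normD (x - y) y; rewrite subrK; lra.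
 - move=> x /= /ltW; rewrite tconsS; exact: G0.
exists (fun G => T' (tcons (fun=> 1) G)), [set x | `|x| <= B]; split.
- apply: (@hc_build _ _ _ _ _ _ (r + 2)) => //.
 + move=> G i c h1 h2 hG p1 p2; rewrite !tcons_upd.
  apply: (hc_mlin hT'); rewrite ?exps_consS//; exact: holder_cons cst_one hG.
 + exact: extension_boundary_local.
 + move=> Gk G L L0 GkL GL Gu.
  have hc' (H : 'I_n -> V) : (forall i, hol (b i) L (H i)) -> forall i, hol (exps_cons b i) L (tcons (fun=> 1) H i).
   move=> HL i; rewrite /exps_cons /tuple_cons; case: (unlift ord0 i) => [j|] /=; first exact: HL.
   by move=> x y; rewrite subrr normr0 mulr_ge0// powR_ge0.
  apply: (hc_cvg c0 hT' L0) => [k||i]; [exact: hc'|exact: hc'|].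
  rewrite /tuple_cons; case: (unlift ord0 i) => [j|] /=; [exact: Gu|exact: ucvg_cst].
- exact: compact_normle.
- apply: hspt_sub; first exact: closed_normle.
 move=> G lG G0; rewrite /boundary (ht _ (tcons (fun=> 1) (upd G ord0 (fun=> 0)))).
 + apply: mc_zeroS => //; exact: cst_one.
 + apply: lip_cons => //; exact: cst_one.
 + by apply: lip_cons; [exact: cst_one|apply: lip_upd => //; exact: lip_cst].
 + move=> i x xt; rewrite /tuple_cons; case: (unlift ord0 i) => //= j.
  by rewrite /tuple_upd; case: eqP => // ->; apply: G0 => /=; rewrite /B; lra.
- apply: hspt_sub; first exact: closed_normle.
 by move=> G hG G0; apply: bd => // x xr; apply: G0 => /=; rewrite /B; lra.
- move=> G G' lG hG' e; apply: ext.
 + apply: lip_cons => //; exact: cst_one.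
 + exact: holder_cons cst_one hG'.
 + move=> i x /set_mem /hs /= xs; rewrite /tuple_cons; case: (unlift ord0 i) => //= j.
  by apply: e; apply: mem_set => /=; rewrite /B; lra.
Qed.

End boundary_ext.

(** * Flat chains of top dimension are metric currents *)

Section flat.
Context {R} {p : nat}.
Local Notation n := p.+1.
Local Notation V := ('rV[R]_n -> R).
(** Composition with a Lipschitz map keeps Lipschitz bounds and locality; the support stays bounded
    because T sees only a ball, whose image is bounded. *)
Lemma metric_current_pushforward m (T : functional R n m) (g : 'rV[R]_n -> 'rV[R]_n) (L : R) :
 metric_current T -> 0 <= L -> (forall x y, `|g x - g y| <= L * `|x - y|) ->
 metric_current (fun F => T (fun i => F i \o g)).
Proof.
move=> hT L0 gL.
have lg (f : V) : lip f -> lip (f \o g).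
 move=> /lipP[M M0 fM]; apply/lipP; exists (M * L); first exact: mulr_ge0.
 by move=> x y; apply: (le_trans (fM _ _)); rewrite -mulrA ler_wpM2l.
have cg x (e : R) : 0 < e -> exists2 d : R, 0 < d & forall y, `|x - y| < d -> `|g x - g y| < e.
 move=> e0; exists (e / (L + 1)); first by rewrite divr_gt0// ltr_wpDl.
 move=> y; rewrite ltr_pdivlMr ?ltr_wpDl// => xy; apply: (le_lt_trans (gL x y)); apply: le_lt_trans xy.
 by rewrite mulrC ler_wpM2l// lerDl.
have updg F i h : (fun j => upd F i h j \o g) = upd (fun j => F j \o g) i (h \o g).
 by apply/funext => j; rewrite /tuple_upd; case: eqP.
have [r [r0 hr]] := mc_ball hT.
apply: (@hc_build _ _ _ _ _ _ (`|g 0| + L * r)) => //.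
- move=> F i c f h lF lf lh; rewrite !updg.
 by apply: (mc_mlin hT); [move=> j; exact/lg/lF|exact: lg|exact: lg].
- move=> F lF [i [U [c [oU FU Fc]]]]; apply: (hc_local hT); first by move=> j; exact/lg/lF.
 exists i, (g @^-1` U), c; split => [|x hx|x Ux /=]; last exact: Fc.
  by apply/open_rVP => x /= /((open_rVP _).1 oU)[e e0 he]; have [d d0 hd] := cg x e e0; exists d => // y /hd/he.
 apply: FU; apply/closure_rVP => e e0; have [d d0 hd] := cg x e e0.
 by have [y /= Fy /hd xy] := (closure_rVP _ _).1 hx d d0; exists (g y).
- move=> F lF F0; have lFg : lip_tuple (fun j => F j \o g) by move=> j; exact/lg/lF.
 rewrite (hr _ (upd (fun j => F j \o g) ord0 (fun=> 0)))//.
 + apply: (mlin0 (mc_mlin hT)) => //; exact: lip_cst.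
 + apply: lip_upd => //; exact: lip_cst.
 + move=> i x xr; rewrite /tuple_upd; case: eqP => // -> /=; apply: F0.
  have := gL x 0; rewrite subr0 => h1; have := ler_normD (g x - g 0) (g 0); rewrite subrK => h2.
  by apply: (le_trans h2); rewrite addrC lerD2l (le_trans h1)// ler_wpM2l.
- move=> Fk F M M0 FkM FM Fu; apply: (mc_cvg hT (L := M * L)) => [|k i|i|i]; first exact: mulr_ge0.
 + move=> x y; have /lipc_hol/(_ (g x) (g y)) := FkM k i => h1.
  by apply: (le_trans h1); rewrite -mulrA ler_wpM2l.
 + move=> x y; have /lipc_hol/(_ (g x) (g y)) := FM i => h1.
  by apply: (le_trans h1); rewrite -mulrA ler_wpM2l.
 + move=> e e0; apply: filterS (Fu i e e0) => k hk x; exact: hk.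
Qed.

Lemma closed_std_simplex : closed (@std_simplex R n).
Proof.
have lsum : lipc n%:R (fun y : 'rV[R]_n => \sum_i y ord0 i).
 have := @lipc_sum R n _ (index_enum 'I_n) xpredT (fun=> 1) (fun i (y : 'rV[R]_n) => y ord0 i).
 rewrite sumr_const card_ord; apply => i _; exact: lipc_coord.
move=> y hy; have hy' e (e0 : 0 < e) := (closure_rVP _ _).1 hy e e0.
split => [i|]; apply/ler_addgt0Pl => e e0.
 have [z [z0 _] yz] := hy' e e0; have := lipc_coord i y z; rewrite mul1r => /(le_lt_trans)/(_ yz).
 by rewrite ltr_norml => /andP[h _]; have := z0 i; lra.
have en : 0 < e / n%:R by rewrite divr_gt0.
have [z [_ z1] yz] := hy' _ en; have := lsum y z; have : n%:R * `|y - z| < e by rewrite mulrC -ltr_pdivlMr.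
by move=> h1 /le_lt_trans/(_ h1); rewrite ltr_norml => /andP[_]; lra.
Qed.

(** The current of a simplex is the push-forward, under an affine map, of the current whose density
    is the indicator of the standard simplex. *)
Lemma simplex_current_metric (s : 'rV[R]_n * 'M[R]_(n, n)) : metric_current (simplex_current s).
Proof.
have mS : measurable (@std_simplex R n).
 rewrite -[X in measurable X]setCK; apply: measurableC; apply: open_mf. exact/closed_openC/closed_std_simplex.
have S1 (x : 'rV[R]_n) : std_simplex x -> `|x| <= 1.
 move=> [y0 y1] /=; apply: norm_le => // i; rewrite ger0_norm//.
 by apply: le_trans y1; rewrite (bigD1 i)//= lerDl sumr_ge0.
pose w : V := \1_(@std_simplex R n).
have w0 x : 1 < `|x| -> w x = 0 by move=> xr; rewrite /w indicE memNset// => /S1; rewrite leNgt xr.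
have lw : L1c w.
 apply: (@aesupp_L1c _ _ 1).
  apply: (@L1_bounded _ _ _ 1 1) => [|x|x]; [exact: measurable_indic| |exact: w0].
  by rewrite /w indicE; case: (_ \in _); rewrite ?normr0 ?normr1.
 apply: nearW => x; exact: w0.
pose L := \sum_i \sum_j `|s.2 j i|.
have gL x y : `|simplex_map s x - simplex_map s y| <= L * `|x - y|.
 rewrite /simplex_map opprD addrACA subrr add0r -mulmxBl; set z := x - y.
 apply: norm_le => [|i]; first by rewrite mulr_ge0// sumr_ge0// => i _; exact: sumr_ge0.
 rewrite mxE; apply: le_norm_sum. apply: (via ((\sum_j `|s.2 j i|) * `|z|)); last first.
  by rewrite ler_wpM2r// /L [leRHS](bigD1 i)//= lerDl sumr_ge0// => k _; exact: sumr_ge0.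
 rewrite mulr_suml; apply: ler_sum => j _; rewrite normrM mulrC ler_wpM2l//; exact: coord_le.
have L0 : 0 <= L by apply: sumr_ge0 => i _; exact: sumr_ge0.
apply: (hc_ext _ _ (metric_current_pushforward (current_metric lw) L0 gL)) => // F lF.
rewrite /simplex_current /current_of /Rintegral; congr fine.
rewrite integral_mkcond; apply: eq_integral => x _.
rewrite /restrict /w indicE; case: (x \in _) => /=; first by rewrite mul1r.
by rewrite !mul0r.
Qed.

Lemma chain_current_metric (P : @poly_chain R n n) : metric_current (chain_current P).
Proof.
elim: P => [|s P IH]; rewrite /chain_current.
 by apply: (hc_ext _ _ (zero_metric_current n)) => // F _; rewrite big_nil.
apply: (hc_ext _ _ (hc_comb s.1 (fun=> ltr01) (simplex_current_metric s.2) IH)) => // F _.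
by rewrite big_cons.
Qed.

(** There is no nondegenerate simplex of dimension n + 1 in R^n, so the only chain over which the
    infimum extends is the empty one. *)
Lemma flat_norm_top (S : functional R n n) : flat_norm S = mass S.
Proof.
have E (D : @poly_chain R n n.+1) : Defs.nondegenerate D -> D = [::].
 case: D => // s D /= /andP[]; rewrite /row_free => /eqP h. by have := rank_leq_col s.2.2; rewrite h ltnn.
have c0 : @chain_current R n n.+1 [::] = fun=> 0 by apply/funext => F; rewrite /chain_current big_nil.
have m0 : (mass (fun F => (S F - boundary (chain_current ([::] : @poly_chain R n n.+1)) F)%R) +
  mass (chain_current ([::] : @poly_chain R n n.+1)))%E = mass S.
 rewrite c0 mass_zero adde0; congr mass; apply/funext => F; by rewrite /boundary subr0.
apply/eqP; rewrite eq_le; apply/andP; split.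
 by apply: ereal_inf_lbound; exists [::].
by apply: le_ereal_inf_tmp => _ [D [/E -> ->]]; rewrite m0.
Qed.

(** By the Cauchy property in mass the convergence is uniform over tuples with a common Lipschitz
    constant and a common bound of the first function at 0, so continuity passes to the limit; the
    other axioms pass pointwise. *)
Lemma mass_limit_metric (S : nat -> functional R n n) (T : functional R n n) (r : R) : 0 <= r ->
 (forall k, metric_current (S k)) ->
 (forall k F F', lip_tuple F -> lip_tuple F' -> (forall x, `|x| <= r -> F ord0 x = F' ord0 x) ->
  (forall i, F (sc i) = F' (sc i)) -> S k F = S k F') ->
 (forall e : R, 0 < e -> exists N : nat, forall k l, (N <= k)%N -> (N <= l)%N ->
  (mass (fun F => (S k F - S l F)%R) <= e%:E)%E) ->
 (forall F, lip_tuple F -> S k F @[k --> \oo] --> T F) -> metric_current T.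
Proof.
move=> r0 hS Sr Sm ST.
have zeroF F : lip_tuple F -> (forall k, S k F = 0) -> T F = 0.
 move=> lF S0; rewrite -(cvg_lim _ (ST F lF))//; apply: lim_near_cst => //; exact: nearW.
have lupd (F : 'I_n.+1 -> V) i h : lip_tuple F -> lip h -> lip_tuple (upd F i h) by exact: lip_upd.
apply: (@hc_build _ _ _ _ _ _ r) => //.
- move=> F i c h1 h2 lF l1 l2.
 have l12 : lip (fun x => c * h1 x + h2 x) by exact: lip_lin.
 rewrite -(cvg_lim _ (ST _ (lupd F i _ lF l12)))//; apply: cvg_lim => //.
 rewrite (_ : (fun k => _) = fun k => c * S k (upd F i h1) + S k (upd F i h2)); last first.
  apply/funext => k; exact: (mc_mlin (hS k)).
 by apply: cvgD; [apply: cvgM; [exact: cvg_cst|exact/ST/lupd]|exact/ST/lupd].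
- move=> F lF hF; apply: zeroF => // k; exact: (hc_local (hS k)).
- move=> F lF F0; apply: zeroF => // k; rewrite (Sr k _ (upd F ord0 (fun=> 0)))//.
 + apply: (mlin0 (mc_mlin (hS k))) => //; exact: lip_cst.
 + apply: lupd => //; exact: lip_cst.
- move=> Fk F L L0 FkL FL Fu.
 (* The mass controls bounded first functions; cutting the first function off outside the ball of
    radius r changes no value of [S k]. *)
 pose cF (G : 'I_n.+1 -> V) := upd G ord0 (fun x => G ord0 x * cutoff r x).
 pose A := L * (2 * r + 5) + (`|F ord0 0| + 1) + 1.
 have A0 : 0 < A by rewrite /A ltr_wpDl// addr_ge0 ?addr_ge0// mulr_ge0// addr_ge0// mulr_ge0.
 have lipL (G : 'I_n.+1 -> V) : (forall i, hol 1 L (G i)) -> lip_tuple G.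
  by move=> h i; apply/lipP; exists L => //; exact/lipc_hol.
 have lcF (G : 'I_n.+1 -> V) : lip_tuple G -> lip_tuple (cF G).
  move=> lG; apply: lupd => //; have [M _ GM] := (lipP _).1 (lG ord0). apply: lipb_lip; exact: lipb_cut GM.
 have ScF k (G : 'I_n.+1 -> V) : lip_tuple G -> S k G = S k (cF G).
  move=> lG; apply: Sr => // [|x xr]; first exact: lcF. by rewrite /cF updE cutoff1 ?mulr1.
 have bound k l e (G : 'I_n.+1 -> V) : (mass (fun F => (S k F - S l F)%R) <= e%:E)%E ->
   (forall i, hol 1 L (G i)) -> `|G ord0 0| <= `|F ord0 0| + 1 ->
   `|S k G - S l G| <= e * (A * (L + 1) ^+ n).
  move=> me GL G0; have lG := lipL _ GL; rewrite !(ScF _ _ lG).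
  have [_ hb] := cutoff_mul_hol r0 ltr01 (lexx _) L0 (GL ord0). have mS : mlin (fun=> lip) (fun F => S k F - S l F).
   by move=> F' i c h1 h2 lF l1 l2; rewrite !(mc_mlin (hS _))//; ring.
  have := @mass_bound R p n (fun F => S k F - S l F) e (cF G) A (fun=> L + 1) mS me (lcF _ lG) A0.
  rewrite prodr_const card_ord; apply.
  + move=> x; rewrite /cF updE; apply: (le_trans (hb x)); rewrite /A.
   by move: G0; set u := L * _; lra.
  + by move=> _; rewrite ltr_wpDl.
  + move=> i; rewrite /tl /cF updN//; apply: (@lipcW _ _ L); first by rewrite lerDl.
   exact/lipc_hol.
 apply/cvgrPdist_le => e e0. have K0 : 0 < A * (L + 1) ^+ n by rewrite mulr_gt0// exprn_gt0// ltr_wpDl.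
 have e3 : 0 < e / 3 by rewrite divr_gt0. have [N hN] := Sm _ (divr_gt0 e3 K0).
 have lim (G : 'I_n.+1 -> V) : (forall i, hol 1 L (G i)) -> `|G ord0 0| <= `|F ord0 0| + 1 ->
   `|T G - S N G| <= e / 3.
  move=> GL G0; have c1 : S (k + N)%N G @[k --> \oo] --> T G by have := ST G (lipL _ GL); rewrite -(cvg_shiftn N).
  apply: (cvg_dist_le c1 (cvg_cst (S N G))) => k.
  have := bound (k + N)%N N _ _ (hN _ _ (leq_addl k N) (leqnn N)) GL G0. by rewrite divfK ?gt_eqF.
 have mid : S N (Fk k) @[k --> \oo] --> S N F.
  by apply: (mc_cvg (hS N) L0) => [k i|i|i]; [exact/lipc_hol|exact/lipc_hol|exact: Fu].
 have /cvgrPdist_le /(_ _ e3) := mid; apply: filterS2 (Fu ord0 1 ltr01) => k k1 k2.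
 have F0 : `|Fk k ord0 0| <= `|F ord0 0| + 1.
  by have := ler_normD (Fk k ord0 0 - F ord0 0) (F ord0 0); rewrite subrK; have := k1 0; lra.
 have l1 := lim _ FL; have l2 := lim _ (FkL k) F0. have {}l1 : `|T F - S N F| <= e / 3 by apply: l1; rewrite lerDl.
 have -> : T F - T (Fk k) = (T F - S N F) + (S N F - S N (Fk k)) - (T (Fk k) - S N (Fk k)) by ring.
 apply: le_normB; have := ler_normD (T F - S N F) (S N F - S N (Fk k)). by lra.
Qed.

Lemma chain_current_within (K : set 'rV[R]_n) (P : @poly_chain R n n) (F F' : 'I_n.+1 -> V) :
 chain_within K P -> (forall x, K x -> F ord0 x = F' ord0 x) ->
 (forall i, F (sc i) = F' (sc i)) -> chain_current P F = chain_current P F'.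
Proof.
move=> PK F0 FS; have cE t Q G : chain_current (t :: Q) G = t.1 * simplex_current t.2 G + chain_current Q G.
 exact: big_cons.
elim: P PK => [|s P IH] PK.
 have c0 G : chain_current ([::] : @poly_chain R n n) G = 0 by exact: big_nil. by rewrite !c0.
have sK := PK s (mem_head s P).
have eT : (fun i => F (sc i) \o simplex_map s.2) = (fun i => F' (sc i) \o simplex_map s.2).
 by apply/funext => i; rewrite FS.
have e1 : simplex_current s.2 F = simplex_current s.2 F'.
 rewrite /simplex_current eT; apply: eq_Rintegral => y yS.
 have Ky : K (simplex_map s.2 y) by apply: sK; exists y; [exact: set_mem yS|].
 exact: (congr1 (fun t => t * _) (F0 _ Ky)).
have e2 : chain_current P F = chain_current P F' by apply: IH => t tP; apply: PK; rewrite in_cons tP orbT.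
by rewrite !cE e1 e2.
Qed.

Lemma flat_chain_metric (T : functional R n n) : flat_chain T -> metric_current T.
Proof.
move=> [K [P [cK hP Pm PT]]]; have [r r0 hr] := compact_rV cK.
apply: (mass_limit_metric (ltW r0) _ _ _ PT).
- move=> k; exact: chain_current_metric.
- move=> k F F' _ _ F0 FS; apply: (chain_current_within (hP k).2) => // x /hr; exact: F0.
- move=> e e0; have [N hN] := Pm e e0; exists N => k l Nk Nl; have := hN k l Nk Nl.
 by rewrite flat_norm_top => /ltW.
Qed.

End flat.

(** * The implications between the statements *)

Section implications.
Context {R} {p : nat}.
Local Notation n := p.+1.
Variable d : R.
Hypothesis hd : p%:R < d < n%:R.
Let al0 : 0 < d - p%:R. Proof. by rewrite subr_gt0; case/andP: hd. Qed.
Let al1 : d - p%:R < 1. Proof. by rewrite ltrBlDr addrC natr1; case/andP: hd. Qed.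
Definition slot1_exps : 'I_n -> R := fun i => if i == ord0 then d - p%:R else 1.

Lemma slot1_exps01 i : 0 < slot1_exps i <= 1.
Proof. by rewrite /slot1_exps; case: ifP => _; rewrite ?ltr01 ?lexx// al0 ltW. Qed.

Lemma slot1_exps_sum : \sum_i slot1_exps i = d.
Proof.
rewrite big_ord_recl /slot1_exps eqxx big1_eq || rewrite big_ord_recl /slot1_exps eqxx.
rewrite (eq_bigr (fun=> 1)) => [|i _]; last by [].
by rewrite sumr_const card_ord subrK.
Qed.

Definition all_ext (T : functional R n n) := forall a : 'I_n.+1 -> R, (forall i, 0 < a i <= 1) ->
 n%:R < \sum_i a i -> d <= \sum_(i < n) a (sc i) -> holder_extension a T.

Lemma all_ext_metric (T : functional R n n) : all_ext T -> metric_current T.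
Proof.
move=> hT; apply: holder_extension_metric; apply: hT => [_||]; first by rewrite ltr01 lexx.
 by rewrite sumr_const card_ord ltr_nat.
by rewrite sumr_const card_ord; case/andP: hd => _ /ltW.
Qed.

Lemma all_ext_boundary (T : functional R n n) (b : 'I_n -> R) : all_ext T ->
 (forall i, 0 < b i <= 1) -> p%:R < \sum_i b i -> d <= \sum_i b i -> holder_extension b (boundary T).
Proof.
move=> hT b01 bp bd; apply: (holder_extension_boundary (all_ext_metric hT) b01).
apply: hT; first exact: exps_cons_bounds.
 by rewrite exps_cons_sum -natr1 [1 + _]addrC ltrD2r.
rewrite (eq_bigr b)// => i _; exact: exps_consS.
Qed.

Lemma all_ext_slot1 (T : functional R n n) : all_ext T ->
 holder_extension slot1_exps (boundary T).
Proof.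
move=> hT; apply: all_ext_boundary => //; first exact: slot1_exps01.
 by rewrite slot1_exps_sum; case/andP: hd.
by rewrite slot1_exps_sum.
Qed.

Lemma all_ext_uniform (T : functional R n n) : all_ext T ->
 exists a : R, 0 < a < 1 /\ holder_extension (fun _ : 'I_n => a) (boundary T).
Proof.
move=> hT; case/andP: hd => pd dn; have n0 : 0 < n%:R :> R by [].
have d0 : 0 < d by exact: le_lt_trans pd.
have e1 : 0 < d / n%:R by rewrite divr_gt0.
have e2 : d / n%:R < 1 by rewrite ltr_pdivrMr// mul1r.
have sE : \sum_(i < n) ((d / n%:R + 1) / 2) = (d + n%:R) / 2.
 have n1 : n%:R != 0 :> R by rewrite pnatr_eq0.
 by rewrite sumr_const card_ord -[LHS]mulr_natr; move: (n%:R : R) n1 => N n1; field.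
move: e1 e2 sE; set t := d / n%:R => e1 e2 sE.
(* The mean of d/n and 1: n such exponents add up to (d + n)/2, which exceeds d and hence n - 1. *)
exists ((t + 1) / 2); split; first by apply/andP; split; lra.
apply: all_ext_boundary => // [_||]; first by apply/andP; split; lra.
 by rewrite sE; move: dn pd; rewrite -natr1; lra.
by rewrite sE; lra.
Qed.

(** The second bound serves to construct a density of T, the first one then applies to that
    density. *)
Lemma slot1_extension_bound (T : functional R n n) : metric_current T ->
 holder_extension slot1_exps (boundary T) -> exists2 C, 0 <= C &
 (forall u, represents u T -> (fracvar (d - p%:R) u < +oo)%E) /\ slot1_bound T (d - p%:R) C.
Proof.
move=> hT hE; have [C [C0 hC]] := boundary_bound hT slot1_exps01 hE.
exists C => //; split; last exact: boundary_bound_slot1 hC.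
move=> u uT; exact: (boundary_bound_fracvar _ _ uT C0 hC).
Qed.

Lemma series_of_bound (T : functional R n n) C : metric_current T -> 0 <= C ->
 slot1_bound T (d - p%:R) C -> exists u,
 [/\ L1c u, represents u T & dyadic_series (d - n%:R) (d - p%:R) u].
Proof.
move=> hT C0 hC; have := slot1_decomposition hT al0 al1 C0 hC.
by rewrite -addrA -opprD natr1.
Qed.

End implications.

Lemma BVfrac_series {R : realType} {p : nat} (d : R) (T : functional R p.+1 p.+1) u : p%:R < d < p.+1%:R ->
 BVfrac (d - p%:R) u -> represents u T -> exists2 C, 0 <= C & metric_current T /\ slot1_bound T (d - p%:R) C.
Proof.
move=> hd [lu fu] uT; have al0 : 0 < d - p%:R by rewrite subr_gt0; case/andP: hd.
have al1 : d - p%:R < 1 by rewrite ltrBlDr addrC natr1; case/andP: hd.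
by have [C C0 hC] := fracvar_slot1 al0 uT fu; exists C => //; split => //; exact: represents_metric uT.
Qed.

(* The dimension is n = p.+1, so that n >= 1 and n - 1 = p. *)
Theorem theorem4p12 (R : realType) (p : nat) (d : R)
    (hd : p%:R < d < p.+1%:R) :
  (forall T : functional R p.+1 p.+1, metric_current T \/ flat_chain T ->
    let stmt1 := fractal p.+1%:R d T in
    let stmt2 := forall a : 'I_p.+2 -> R, (forall i, 0 < a i <= 1) ->
      p.+1%:R < \sum_i a i ->
      d <= \sum_(i < p.+1) a (lift ord0 i) ->
      holder_extension a T in
    let stmt3 :=
      (exists a : R, 0 < a < 1 /\
        holder_extension (fun _ : 'I_p.+1 => a) (boundary T)) /\
      holder_extension
        (fun i : 'I_p.+1 => if i == ord0 then d - p%:R else 1) (boundary T) in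
    let stmt4 := exists u : 'rV[R]_p.+1 -> R,
      BVfrac (d - p%:R) u /\ represents u T in
    let stmt5 := exists u : 'rV[R]_p.+1 -> R,
      [/\ L1c u, represents u T &
        exists (C : R) (uk : nat -> 'rV[R]_p.+1 -> R),
        [/\ 0 < C, forall k, BVc (uk k),
          L1norm (fun x => u x - \sum_(0 <= k < N) uk k x) @[N --> \oo]
            --> 0%E,
          bounded_set (\bigcup_k ess_spt (uk k)) &
          forall k,
            (L1norm (uk k) <= (C * 2 `^ (k%:R * (d - p.+1%:R)))%:E)%E /\
            (div_variation (uk k) <= (C * 2 `^ (k%:R * (d - p%:R)))%:E)%E]] in
    [/\ stmt1 -> stmt2, stmt2 -> stmt3, stmt3 -> stmt4, stmt4 -> stmt5 &
      stmt5 -> forall delta : R, d < delta < p.+1%:R ->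
        fractal p.+1%:R delta T]) /\
  (forall T : functional R p.+1 p.+1,
    (exists u : 'rV[R]_p.+1 -> R,
      (forall delta : R, d < delta < p.+1%:R -> BVfrac (delta - p%:R) u) /\
      represents u T) <->
    (forall delta : R, d < delta < p.+1%:R -> fractal p.+1%:R delta T)).
Proof.
split=> [T hT|T]; cbv zeta.
 have {}hT : metric_current T by case: hT => //; exact: flat_chain_metric. split.
 - move=> fT a a01 asum dsum; exact: (fractal_holder_extension hd fT).
 - by move=> h2; split; [exact: (all_ext_uniform hd h2)|exact: (all_ext_slot1 hd h2)].
 - move=> [_ h3]; have [C C0 [hu hC]] := slot1_extension_bound hd hT h3.
  by have [u [lu uT _]] := series_of_bound hd hT C0 hC; exists u; split => //; split => //; exact: hu.
 - move=> [u [bu uT]]; have [C C0 [_ hC]] := BVfrac_series hd bu uT.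
  exact: (series_of_bound hd hT C0 hC).
 - move=> [u [lu uT [C [uk [C0 bv uc bs ub]]]]] delta /andP[dd _].
  exact: (fractal_of_series dd (ltW C0) lu uT bv uc bs ub).
have hdelta (delta : R) : d < delta < p.+1%:R -> p%:R < delta < p.+1%:R.
 by case/andP: hd => pd _ /andP[dd ->]; rewrite (lt_trans pd dd).
split=> [[u [bu uT]] delta hde|h].
 (* The series is built at an exponent strictly between d and delta, since passing from a series to
    a fractal current loses an arbitrarily small amount. *)
 pose d' := (d + delta) / 2; case/andP: (hde) => dd dn.
 have hd' : d < d' < p.+1%:R by apply/andP; split; rewrite /d'; lra.
 have [C C0 [hT hC]] := BVfrac_series (hdelta _ hd') (bu _ hd') uT.
 have [v [lv vT [D [vk [D0 bv vc bs vb]]]]] := series_of_bound (hdelta _ hd') hT C0 hC.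
 have dd' : d' < delta by rewrite /d'; lra. exact: (fractal_of_series dd' (ltW D0) lv vT bv vc bs vb).
have bnd delta (hde : d < delta < p.+1%:R) := slot1_extension_bound (hdelta _ hde) (h delta hde).1
 (all_ext_slot1 (hdelta _ hde) (fun a => fractal_holder_extension (hdelta _ hde) (h delta hde))).
(* A density is constructed at one exponent. As it represents T, the bounds on the boundary of T at
   all the other exponents apply to the same function. *)
pose d0 := (d + p.+1%:R) / 2.
have hd0 : d < d0 < p.+1%:R by case/andP: hd => _ dn; apply/andP; split; rewrite /d0; lra.
have [C C0 [_ hC]] := bnd _ hd0.
have [u [lu uT _]] := series_of_bound (hdelta _ hd0) (h d0 hd0).1 C0 hC.
exists u; split => // delta hde; split => //.
by have [D _ [hu _]] := bnd _ hde; exact: hu.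
Qed.
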